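(* Assume that $\mathbb{F}=\mathbb{F}_{p^r}$ is finite. Let $G$ be a finite index subgroup of $\Gamma=\mathcal{G}(A)$ without $p'$-torsion. Let $\mathrm{St}$ be the Steinberg module, i.e. the $\mathbb{Z}[G]$-module defined as the kernel of the augmentation morphism $\epsilon:\mathbb{Z}[H(\ell,k)\cup\{\infty\}]\to\mathbb{Z}$, $\epsilon(z)=1$ for all $z\in H(\ell,k)\cup\{\infty\}$. Then $\mathrm{St}$ is a finitely generated projective $\mathbb{Z}[G]$-module whose stably free rank is $-\chi(G)$, i.e. there exist two finitely generated free $\mathbb{Z}[G]$-modules $L_0$ and $L_1$, of ranks $l_0$ and $l_1$ respectively, such that $$\mathrm{St}\oplus L_0\cong L_1 \quad\text{and}\quad \chi(G)=l_0-l_1 .$$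
   Context: Setting. $\mathbb{F}$ is a field of characteristic $\neq 2$; $\mathcal{C}$ is a smooth, projective, geometrically integral curve over $\mathbb{F}$ with function field $k$; $\ell/k$ is a quadratic field extension such that $\mathbb{F}$ is algebraically closed in $\ell$ ($\ell$ is the function field of a geometrically integral curve $\mathcal{D}$ with a $2:1$ morphism $\mathcal{D}\to\mathcal{C}$); $x\mapsto\overline{x}$ is the nontrivial element of $\mathrm{Gal}(\ell/k)$, $N(x)=x\overline{x}$, $T(x)=x+\overline{x}$. $P$ is a closed point of $\mathcal{C}$ with a unique point $Q$ of $\mathcal{D}$ above it; $A\subset k$ is the ring of functions regular outside $P$; $B$ is the integral closure of $A$ in $\ell$. On $\ell^3$ consider the hermitian form $h(x,y)=x_{-1}\overline{y_1}+x_0\overline{y_0}+x_1\overline{y_{-1}}$, coordinates ordered $(x_{-1},x_0,x_1)$. $\mathcal{G}=\mathrm{SU}(h)$, so $\mathcal{G}(k)=\{g\in\mathrm{SL}_3(\ell): h(gx,gy)=h(x,y)\}$ and $\Gamma=\mathcal{G}(A)=\mathcal{G}(k)\cap\mathrm{SL}_3(B)$. $H(\ell,k)=\{(u,v)\in\ell^2: N(u)+T(v)=0\}$; for $(u,v)\in H(\ell,k)$, $\mathrm{u}_a(u,v)=\begin{pmatrix}1&-\overline{u}&v\\0&1&u\\0&0&1\end{pmatrix}$. $\mathcal{B}(k)$ is the group of upper triangular matrices in $\mathcal{G}(k)$. $\mathrm{s}$ is the $3\times3$ matrix with $-1$ on the antidiagonal and $0$ elsewhere. $g_{u,v}=\mathrm{s}\,\mathrm{u}_a(u,v)$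 and $g_\infty=\mathrm{id}$. The map $z\mapsto g_z^{-1}\mathcal{B}(k)$ is a bijection $H(\ell,k)\cup\{\infty\}\to\mathcal{G}(k)/\mathcal{B}(k)$, and $\mathcal{G}(k)$ (hence $G$) acts on $H(\ell,k)\cup\{\infty\}$ through this bijection by left translation. Tree. $\nu$ is the normalized discrete valuation of $k$ at $P$ and also its unique extension to $\ell$. The standard apartment is the line $\mathbb{A}_0=\mathbb{R}a^\vee$, with the linear form $a(ra^\vee)=2r$; its vertices are the $x$ with $a(x)\in\frac12\nu(\ell^* )$. $\mathcal{S}$ is the torus of matrices $\mathrm{diag}(s,1,s^{-1})$; the group $\mathcal{N}(k)$ of $k$-points of its normalizer in $\mathcal{G}$ is generated by $\mathrm{s}$ and the $\tilde a(t)=\mathrm{diag}(t,\overline{t}t^{-1},\overline{t}^{-1})$, $t\in\ell^*$, and acts on $\mathbb{A}_0$ by $\tilde a(t)\cdot x=x-\frac12\nu(t)a^\vee$, $\mathrm{s}\cdot x=-x$. Put $\mathrm{u}_{-a}=\mathrm{s}\,\mathrm{u}_a\,\mathrm{s}$, $\mathcal{U}_{b,x}(k)=\{\mathrm{u}_b(u,v):(u,v)\in H(\ell,k),\ \nu(v)\ge-2b(x)\}$ for $b=\pm a$, and $\mathcal{U}_x(k)=\langle\mathcal{U}_{a,x}(k),\mathcal{U}_{-a,x}(k)\rangle$. The Bruhat-Tits tree is $X=\mathcal{G}(k)\times\mathbb{A}_0/\sim$, where $(g,x)\sim(h,y)$ iff there is $n\in\mathcal{N}(k)$ with $y=n\cdot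 x$ and $g^{-1}hn\in\mathcal{U}_x(k)$; $\mathcal{G}(k)$ acts on it by left multiplication, without inversions. A group is without $p'$-torsion if every element of finite order has $p$-power order. The Euler-Poincaré characteristic of a finite index subgroup $G$ of $\Gamma$ is $\chi(G)=\sum_v 1/\sharp\mathrm{Stab}_G(v)-\sum_e 1/\sharp\mathrm{Stab}_G(e)$, where $v$ (resp. $e$) runs through representatives of the $G$-orbits of vertices (resp. geometrical, i.e. unoriented, edges) of $X$; both series converge. *)

(* Defs.v *)
From HB Require Import structures.
From mathcomp Require Import all_boot all_order all_algebra all_field.
From mathcomp Require Import perm finmap monalg.
From mathcomp Require Import boolp classical_sets functions cardinality.
From mathcomp Require Import reals ereal esum.
From mathcomp Require Import ring.

Set Implicit Arguments.
Unset Strict Implicit.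
Unset Printing Implicit Defensive.

Import Order.TTheory GRing.Theory Num.Theory.

Local Open Scope classical_set_scope.
Local Open Scope ring_scope.

Section FreeAbelian.
Variable K : choiceType.
Implicit Types (x : {malg int[K]}) (k : K).

(* The additive extension Z[K] -> M of a map K -> M. *)
Definition zlift (M : zmodType) (f : K -> M) x : M :=
  \sum_(k <- msupp x) f k *~ x@_k.

Lemma zliftEw (M : zmodType) (f : K -> M) x (d : {fset K}) :
  (msupp x `<=` d)%fset -> zlift f x = \sum_(k <- d) f k *~ x@_k.
Proof.
move=> le_xd; rewrite /zlift (big_fset_incl _ le_xd) //= => k _ kNx.
by rewrite mcoeff_outdom ?mulr0z.
Qed.

Fact zlift_is_additive (M : zmodType) (f : K -> M) :
  GRing.zmod_morphism (zlift f).
Proof.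
move=> x y; pose d := (msupp x `|` msupp y)%fset.
rewrite (@zliftEw _ _ _ d) ?msuppB_le // (@zliftEw _ _ x d) ?fsubsetUl //.
rewrite (@zliftEw _ _ y d) ?fsubsetUr // -sumrB.
by apply: eq_bigr => k _; rewrite mcoeffB mulrzBr.
Qed.

HB.instance Definition _ (M : zmodType) (f : K -> M) :=
  GRing.isZmodMorphism.Build {malg int[K]} M (zlift f) (zlift_is_additive f).

Lemma zliftU (M : zmodType) (f : K -> M) k : zlift f << k >> = f k.
Proof.
by rewrite (@zliftEw _ _ _ [fset k]%fset) ?msuppU_le // big_seq_fset1 mcoeffUU.
Qed.

Lemma malg_span x : x = \sum_(k <- msupp x) << k >> *~ x@_k.
Proof.
rewrite [LHS]monalgE; apply: eq_bigr => k _.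
by rewrite -(raddfMz (mkmalgU k)) intz.
Qed.

Lemma malg_zind (P : {malg int[K]} -> Prop) :
    P 0 -> (forall x y, P x -> P y -> P (x - y)) -> (forall k, P << k >>) ->
  forall x, P x.
Proof.
move=> P0 PB PU x.
have PN y : P y -> P (- y) by move=> Py; rewrite -sub0r; apply: PB.
have PD y z : P y -> P z -> P (y + z).
  by move=> Py Pz; rewrite -[z]opprK; apply/PB/PN.
have PMn y n : P y -> P (y *+ n).
  by move=> Py; elim: n => // n IHn; rewrite mulrS; apply: PD.
rewrite (malg_span x); elim/big_ind: _ => // k _; case: x@_k => n.
  exact: PMn.
by rewrite NegzE mulrNz; apply/PN/PMn.
Qed.

End FreeAbelian.

Section Convolution.
Variables (A B C : choiceType) (op : A -> B -> C).

(* The biadditive extension Z[A] x Z[B] -> Z[C] of [op]. *)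
Definition conv (a : {malg int[A]}) (b : {malg int[B]}) : {malg int[C]} :=
  zlift (fun i => zlift (fun j => << op i j >>) b) a.

Fact conv_is_additive_r a : GRing.zmod_morphism (conv a).
Proof.
move=> x y; rewrite /conv /zlift -sumrB; apply: eq_bigr => k _.
by rewrite -/(zlift _ _) (raddfB (zlift _)) mulrzBl.
Qed.

HB.instance Definition _ a :=
  GRing.isZmodMorphism.Build _ _ (conv a) (conv_is_additive_r a).

Lemma convDl b : {morph conv^~ b : x y / x + y}.
Proof. by move=> x y; rewrite /conv raddfD. Qed.

Lemma convBl b : {morph conv^~ b : x y / x - y}.
Proof. by move=> x y; rewrite /conv raddfB. Qed.

Lemma conv0l b : conv 0 b = 0.
Proof. by rewrite /conv raddf0. Qed.

Lemma convUU i j : conv << i >> << j >> = << op i j >>.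
Proof. by rewrite /conv !zliftU. Qed.
End Convolution.

Lemma convA (A B C D E F : choiceType) (f : A -> D -> F) (g : B -> C -> D)
    (f' : E -> C -> F) (g' : A -> B -> E) :
    (forall a b c, f a (g b c) = f' (g' a b) c) ->
  forall a b c, conv f a (conv g b c) = conv f' (conv g' a b) c.
Proof.
move=> fg a b c; elim/malg_zind: a => [|a1 a2 IH1 IH2|a].
- by rewrite !conv0l.
- by rewrite !convBl IH1 IH2.
elim/malg_zind: b => [|b1 b2 IH1 IH2|b].
- by rewrite conv0l !raddf0 conv0l.
- by rewrite convBl !raddfB /= convBl IH1 IH2.
elim/malg_zind: c => [|c1 c2 IH1 IH2|c].
- by rewrite !raddf0.
- by rewrite !raddfB /= IH1 IH2.
by rewrite !convUU fg.
Qed.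

Lemma conv1l (A B : choiceType) (f : A -> B -> B) e :
  (forall b, f e b = b) -> forall x, conv f << e >> x = x.
Proof.
move=> fe; elim/malg_zind => [|x y IHx IHy|b]; first by rewrite raddf0.
  by rewrite raddfB /= IHx IHy.
by rewrite convUU fe.
Qed.

Section GroupRing.
Variable T : groupType.

(* The group ring Z[T]. The ring structure that the library puts on
   [{malg int[K]}] requires that only 1 be invertible in K, so it never applies
   to a non-trivial group. *)
Definition gring : Type := {malg int[T]}.

HB.instance Definition _ := GRing.Zmodule.on gring.

Definition gring_mul (a b : gring) : gring := conv *%g a b.
Definition gring_one : gring := << 1%g >>.

Fact gring_mulA : associative gring_mul.
Proof. exact: convA mulgA. Qed.

Fact gring_mul1r : left_id gring_one gring_mul.
Proof. exact: conv1l mul1g. Qed.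

Fact gring_mulr1 : right_id gring_one gring_mul.
Proof.
rewrite /gring_mul; elim/malg_zind => [|x y IHx IHy|g].
- by rewrite conv0l.
- by rewrite convBl IHx IHy.
by rewrite convUU mulg1.
Qed.

Fact gring_mulDl : left_distributive gring_mul +%R.
Proof. by move=> a b c; apply: convDl. Qed.

Fact gring_mulDr : right_distributive gring_mul +%R.
Proof. by move=> a b c; rewrite /gring_mul raddfD. Qed.

Fact gring_one_neq0 : gring_one != 0.
Proof. by rewrite monalgU_eq0. Qed.

HB.instance Definition _ := GRing.Zmodule_isNzRing.Build gring
  gring_mulA gring_mul1r gring_mulr1 gring_mulDl gring_mulDr gring_one_neq0.

Record laction (Y : choiceType) := LAction {
  lact :> T -> Y -> Y;
  lact1 : forall y, lact 1%g y = y;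
  lactM : forall g h y, lact g (lact h y) = lact (g * h)%g y
}.

Section PermModule.
Variables (Y : choiceType) (to : laction Y).

(* Z[Y] as a left Z[T]-module. *)
Definition permmod of laction Y : Type := {malg int[Y]}.

Local Notation ZY := (permmod to).

HB.instance Definition _ := GRing.Zmodule.on ZY.

Definition permmod_scale (a : gring) (x : ZY) : ZY := conv to a x.

Fact permmod_scaleA a b x :
  permmod_scale a (permmod_scale b x) = permmod_scale (a * b) x.
Proof. exact: convA (lactM to) a b x. Qed.

Fact permmod_scale1 : left_id 1 permmod_scale.
Proof. exact: conv1l (lact1 to). Qed.

Fact permmod_scaleDr : right_distributive permmod_scale +%R.
Proof. by move=> a x y; rewrite /permmod_scale raddfD. Qed.

Fact permmod_scaleDl x : {morph permmod_scale^~ x : a b / a + b}.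
Proof. by move=> a b; apply: convDl. Qed.

HB.instance Definition _ := GRing.Zmodule_isLmodule.Build gring ZY
  permmod_scaleA permmod_scale1 permmod_scaleDr permmod_scaleDl.

Definition augmentation (x : ZY) : int := zlift (fun=> 1 : int) x.

Definition aug_ker : {pred ZY} := fun x => augmentation x == 0.

Fact aug_ker_submod : submod_closed aug_ker.
Proof.
split=> [|a x y]; rewrite !unfold_in /augmentation; first by rewrite raddf0.
move=> /eqP x0 /eqP y0; apply/eqP.
rewrite raddfD /= y0 addr0 {y y0} -[a *: x]/(conv to a x).
elim/malg_zind: a => [|a b IHa IHb|g]; first by rewrite conv0l raddf0.
  by rewrite convBl raddfB /= IHa IHb subr0.
rewrite -[RHS]x0 {x0}; elim/malg_zind: x => [|x y IHx IHy|z].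
- by rewrite !raddf0.
- by rewrite !raddfB /= IHx IHy.
by rewrite convUU !zliftU.
Qed.

HB.instance Definition _ := GRing.isSubmodClosed.Build gring ZY aug_ker
  aug_ker_submod.

Record aug_kernel := AugKernel { akval : ZY; _ : akval \in aug_ker }.

HB.instance Definition _ := [isSub for akval].
HB.instance Definition _ := [Choice of aug_kernel by <:].
HB.instance Definition _ := [SubChoice_isSubLmodule of aug_kernel by <:].

End PermModule.
End GroupRing.

Record quad_ext (k : fieldType) := QuadExt {
  qe_ext :> fieldExtType k;
  qconj : 'AEnd(qe_ext);
  quad_ext_dim : (\dim {:qe_ext} = 2)%N;
  qconj_neq1 : qconj != \1%AF
}.

Arguments qconj {k L} : rename.

Section Unitary.
Variables (k : fieldType) (L : quad_ext k).
Implicit Types (u v t : L) (g : 'M[L]_3).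

Definition qnorm u : L := u * qconj u.
Definition qtrace u : L := u + qconj u.

(* The coordinates x_{-1}, x_0, x_1 have indices 0, 1, 2. *)
Definition herm (x y : 'cV[L]_3) : L :=
  x 0 0 * qconj (y 2 0) + x 1 0 * qconj (y 1 0) + x 2 0 * qconj (y 0 0).

Definition is_su g : Prop :=
  \det g = 1 /\ forall x y, herm (g *m x) (g *m y) = herm x y.

Definition mx3 (s : seq (seq L)) : 'M[L]_3 :=
  \matrix_(i, j) nth 0 (nth [::] s i) j.

Definition ua_mx u v := mx3 [:: [:: 1; - qconj u; v];
                                [:: 0; 1;        u];
                                [:: 0; 0;        1]].

Definition s_mx := mx3 [:: [::  0;  0; -1];
                           [::  0; -1;  0];
                           [:: -1;  0;  0]].

Definition a_mx t := mx3 [:: [:: t; 0;              0];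
                             [:: 0; qconj t * t^-1;  0];
                             [:: 0; 0; (qconj t)^-1]].

Definition is_upper g := forall i j : 'I_3, (j < i)%N -> g i j = 0.

Lemma qconjK : involutive (qconj : L -> L).
Proof.
move=> x; pose X := [tuple 1; x; x ^+ 2].
have /freeP nfX : ~~ free X.
  apply/negP => fX; have := dimvS (subvf <<X>>%VS).
  by rewrite (eqnP fX) quad_ext_dim size_tuple.
have [c [c0 [i cn0]]] : exists c : 'I_3 -> k,
    \sum_(i < 3) c i *: X`_i = 0 /\ exists i, c i != 0.
  apply: contrapT => /forallNP H; apply: nfX => c c0 i.
  by apply/eqP/negP => /negP cn0; case: (H c); split=> //; exists i.
have qconjA (z : k) : qconj (z%:A : L) = z%:A by rewrite linearZ /= rmorph1.
pose a : L := (c 0)%:A; pose b : L := (c 1)%:A; pose d : L := (c 2)%:A.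
have Ex : a + b * x + d * x ^+ 2 = 0.
  move: c0; rewrite !big_ord_recl big_ord0 /= addr0 addrA /a /b /d !mulr_algl.
  by move=> <-; congr (_ + c _ *: _ + c _ *: _); apply: val_inj.
have Ey : a + b * qconj x + d * qconj x ^+ 2 = 0.
  have := congr1 qconj Ex.
  by rewrite !rmorphD !rmorphM /= rmorph0 /a /b /d !qconjA.
have [xy|nxy] := eqVneq (qconj x) x; first by rewrite !xy.
have bd : b + d * (x + qconj x) = 0.
  apply/eqP; have : (qconj x - x) * (b + d * (x + qconj x)) == 0.
    apply/eqP; rewrite -[RHS](subrr 0) -{1}Ey -Ex; ring.
  by rewrite mulf_eq0 subr_eq0 (negPf nxy).
have dn0 : d != 0.
  apply: contraNneq cn0 => d0; move: bd Ex; rewrite d0 !mul0r !addr0 => b0.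
  rewrite b0 mul0r addr0 => a0.
  have inj (z : k) : (z%:A : L) = 0 -> z = 0.
    by move=> /eqP; rewrite scaler_eq0 oner_eq0 orbF => /eqP.
  have [c0' c1' c2'] : [/\ c 0 = 0, c 1 = 0 & c 2 = 0] by split; apply: inj.
  case: i => -[|[|[|//]]] lti; apply/eqP.
  - by rewrite -[RHS]c0'; congr c; apply: val_inj.
  - by rewrite -[RHS]c1'; congr c; apply: val_inj.
  - by rewrite -[RHS]c2'; congr c; apply: val_inj.
have := congr1 qconj bd; rewrite rmorphD rmorphM rmorphD /= rmorph0 /b /d !qconjA.
rewrite -/b -/d -bd => /addrI /(mulfI dn0).
by rewrite addrC => /addIr.
Qed.

Lemma big_ord3 (F : 'I_3 -> L) : \sum_i F i = F 0 + F 1 + F 2.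
Proof.
rewrite !big_ord_recl big_ord0 addr0 addrA.
by congr (_ + F _ + F _); apply: val_inj.
Qed.

Lemma mul3 (g : 'M[L]_3) n (x : 'M[L]_(3, n)) i j :
  (g *m x) i j = g i 0 * x 0 j + g i 1 * x 1 j + g i 2 * x 2 j.
Proof. by rewrite mxE big_ord3. Qed.

Lemma ord3P (P : 'I_3 -> Prop) : P 0 -> P 1 -> P 2 -> forall i, P i.
Proof.
move=> P0 P1 P2 [[|[|[|//]]] lti]; rewrite (bool_irrelevance lti isT).
- by rewrite (_ : Ordinal _ = 0) //; apply: val_inj.
- by rewrite (_ : Ordinal _ = 1) //; apply: val_inj.
- by rewrite (_ : Ordinal _ = 2) //; apply: val_inj.
Qed.

Lemma ua_mx_su u v : qnorm u + qtrace v = 0 -> is_su (ua_mx u v).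
Proof.
move=> Huv; split=> [|x y].
  rewrite -det_tr det_trig; first by rewrite !big_ord_recl big_ord0 !mxE /= !mulr1.
  by apply/is_trig_mxP; do 2!elim/ord3P=> //; rewrite !mxE.
rewrite /herm !mul3 !mxE /= !(rmorphD, rmorphM, rmorphN, rmorph0, rmorph1) /=.
rewrite qconjK (_ : qconj v = - v - u * qconj u); first ring.
by apply/eqP; rewrite -subr_eq0 -[X in _ == X]Huv /qnorm /qtrace; apply/eqP; ring.
Qed.

Lemma s_mx_su : is_su s_mx.
Proof.
split=> [|x y]; last first.
  by rewrite /herm !mul3 !mxE /= !(rmorphD, rmorphM, rmorphN, rmorph0, rmorph1) /=; ring.
have -> : s_mx = - 1 *: perm_mx (tperm 0 2).
  apply/matrixP; do 2!elim/ord3P; rewrite !mxE ?tpermL ?tpermR ?tpermD //=.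
  all: rewrite ?mulr0 ?mulr1 ?mulN1r ?oppr0 //.
rewrite detZ det_perm odd_tperm /=; ring.
Qed.

Fact is_su_mul g h : is_su g -> is_su h -> is_su (g *m h).
Proof.
move=> [dg hg] [dh hh]; split=> [|x y]; first by rewrite det_mulmx dg dh mulr1.
by rewrite -!mulmxA hg hh.
Qed.

Fact is_su_unit g : is_su g -> g \in unitmx.
Proof. by case=> dg _; rewrite unitmxE dg unitr1. Qed.

Fact is_su_inv g : is_su g -> is_su (invmx g).
Proof.
move=> Sg; have Ug := is_su_unit Sg; case: Sg => dg hg.
split=> [|x y]; first by rewrite det_inv dg invr1.
by rewrite -hg !mulmxA mulmxV // !mul1mx.
Qed.

Fact is_su1 : is_su 1%:M.
Proof. by split=> [|x y]; rewrite ?det1 // !mul1mx. Qed.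

(* The group of k-points of the special unitary group of [herm]. *)
Record SU := MkSU { suval :> 'M[L]_3; _ : `[< is_su suval >] }.

HB.instance Definition _ := [isSub for suval].
HB.instance Definition _ := [Choice of SU by <:].

Lemma suP (g : SU) : is_su g.
Proof. by case: g => g /= /asboolP. Qed.

Definition mkSU g (Sg : is_su g) : SU := MkSU (asboolT Sg).
Definition su_one : SU := mkSU is_su1.
Definition su_mul (g h : SU) : SU := mkSU (is_su_mul (suP g) (suP h)).
Definition su_inv (g : SU) : SU := mkSU (is_su_inv (suP g)).

Fact su_mulA : associative su_mul.
Proof. by move=> g h i; apply/val_inj/mulmxA. Qed.
Fact su_mul1 : left_id su_one su_mul.
Proof. by move=> g; apply/val_inj/mul1mx. Qed.
Fact su_mulr1 : right_id su_one su_mul.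
Proof. by move=> g; apply/val_inj/mulmx1. Qed.
Fact su_mulV : left_inverse su_one su_inv su_mul.
Proof. by move=> g; apply/val_inj/mulVmx/is_su_unit/suP. Qed.
Fact su_mulrV : right_inverse su_one su_inv su_mul.
Proof. by move=> g; apply/val_inj/mulmxV/is_su_unit/suP. Qed.

HB.instance Definition _ :=
  isGroup.Build SU su_mulA su_mul1 su_mulr1 su_mulV su_mulrV.

Definition in_H : pred (L * L) := fun w => qnorm w.1 + qtrace w.2 == 0.

(* The disjoint union of H(L,k) and {infinity}; infinity is [None]. *)
Definition boundary := option {w | in_H w}.

Fact g_mx_su (w : {w | in_H w}) : is_su (s_mx *m ua_mx (val w).1 (val w).2).
Proof. exact/is_su_mul/ua_mx_su/eqP/(valP w)/s_mx_su. Qed.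

Definition g_ (z : boundary) : SU :=
  if z is Some w then mkSU (g_mx_su w) else 1%g.

Definition borel (g : SU) : Prop := is_upper g.

(* Left translation by g maps the coset of (g_ z)^-1 modulo the Borel subgroup
   to that of (g_ z')^-1. For given g and z there is exactly one such z' (lemmas
   [borel_g_ex] and [borel_g_inj]), so [boundary_fun] is the action on the
   boundary and the default value [None] of [xget] plays no role. *)
Definition boundary_rel (g : SU) (z z' : boundary) : Prop :=
  borel (g_ z' * (g * (g_ z)^-1))%g.

Definition boundary_fun (g : SU) (z : boundary) : boundary :=
  xget None [set z' | boundary_rel g z z'].

Lemma borelE (g : SU) : borel g <-> suval g 1 0 = 0 /\ suval g 2 0 = 0.
Proof.
split=> [Bg|[g10 g20]]; first by split; apply: Bg.
have Ug : suval g \in unitmx by apply/is_su_unit/suP.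
have g00 : suval g 0 0 != 0.
  apply/eqP => g00; have : invmx g *m suval g = 1%:M by apply: mulVmx.
  move=> /matrixP/(_ 0 0); rewrite mul3 g00 g10 g20 !mulr0 !addr0 !mxE /= => /eqP.
  by rewrite eq_sym oner_eq0.
have [_ /(_ (delta_mx 0 0) (delta_mx 1 0))] := suP g.
rewrite -!colE /herm !mxE /= !(g10, g20, rmorph0, mul0r, mulr0, addr0).
move/eqP; rewrite mulf_eq0 (negPf g00) /= fmorph_eq0 => /eqP g21.
by do 2!elim/ord3P => //.
Qed.

Lemma col0_neq0 (g : SU) :
  suval g 0 0 = 0 -> suval g 1 0 = 0 -> suval g 2 0 = 0 -> False.
Proof.
move=> g00 g10 g20; have Ug : suval g \in unitmx by apply/is_su_unit/suP.
have /matrixP/(_ 0 0) : invmx g *m suval g = 1%:M by apply: mulVmx.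
rewrite mul3 g00 g10 g20 !mulr0 !addr0 !mxE /= => /eqP.
by rewrite eq_sym oner_eq0.
Qed.

Lemma borel_gP (z : boundary) (g : SU) : borel (g_ z * g)%g <->
  if z is Some w then
    suval g 1 0 + (val w).1 * suval g 2 0 = 0 /\
    suval g 0 0 - qconj (val w).1 * suval g 1 0 + (val w).2 * suval g 2 0 = 0
  else suval g 1 0 = 0 /\ suval g 2 0 = 0.
Proof.
rewrite borelE; case: z => [w|] /=; last by rewrite !mul1mx.
set m := _ *m suval g.
have m10 : m 1 0 = - (suval g 1 0 + (val w).1 * suval g 2 0).
  by rewrite /m !mul3 !mxE /=; ring.
have m20 : m 2 0 =
    - (suval g 0 0 - qconj (val w).1 * suval g 1 0 + (val w).2 * suval g 2 0).
  by rewrite /m !mul3 !mxE /=; ring.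
rewrite m10 m20; split=> -[e1 e2]; split; apply/eqP; move: e1 e2.
all: by rewrite ?oppr_eq0 => /eqP; rewrite ?oppr_eq0 => e1 /eqP; rewrite ?oppr_eq0 => e2.
Qed.

Lemma borel_g_ex (g : SU) : exists z, borel (g_ z * g)%g.
Proof.
pose a := suval g 0 0; pose b := suval g 1 0; pose c := suval g 2 0.
have iso : a * qconj c + b * qconj b + c * qconj a = 0.
  have [_ /(_ (delta_mx 0 0) (delta_mx 0 0))] := suP g.
  by rewrite -!colE /herm !mxE /= !(rmorph0, mul0r, mulr0, addr0).
have [c0|cn0] := eqVneq c 0.
  exists None; apply/borel_gP; split=> //; apply/eqP.
  move: iso; rewrite c0 rmorph0 mulr0 mul0r add0r addr0 => /eqP.
  by rewrite mulf_eq0 fmorph_eq0 orbb.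
have ccn0 : qconj c != 0 by rewrite fmorph_eq0.
pose u := - b / c; pose v := (qconj u * b - a) / c.
have Huv : in_H (u, v).
  apply/eqP; rewrite /qnorm /qtrace /v /u /=.
  rewrite !(rmorphB, rmorphM, rmorphN, fmorphV) /=.
  rewrite !qconjK.
  have -> : qconj a = - (a * qconj c + b * qconj b) / c.
    by apply: (canRL (mulfK cn0)); rewrite mulrC; apply/eqP; rewrite -addr_eq0 addrC iso.
  by field; rewrite cn0 ccn0.
exists (Some (exist _ (u, v) Huv)); apply/borel_gP => /=.
by rewrite -/a -/b -/c -/u /v; split; first rewrite /u; field.
Qed.

Lemma borel_g_inj (g : SU) z z' :
  borel (g_ z * g)%g -> borel (g_ z' * g)%g -> z = z'.
Proof.
wlog [w ->] : z z' / exists w, z = Some w.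
  move=> wl; case: z => [w|]; first by apply: wl; exists w.
  by case: z' => // w' B B'; symmetry; apply: (wl (Some w') None) => //; exists w'.
move=> /borel_gP[e1 e2] /borel_gP e'.
have gn0 : suval g 2 0 != 0.
  apply/eqP => g20; move: e1 e2; rewrite g20 !mulr0 !addr0 => g10.
  by rewrite g10 mulr0 subr0 => g00; apply: (@col0_neq0 g).
case: z' e' => [w' [e1' e2']|[_ g20]]; last by rewrite g20 eqxx in gn0.
have eu : (val w).1 = (val w').1.
  by apply: (mulIf gn0); apply: (addrI (suval g 1 0)); rewrite e1 e1'.
have ev : (val w).2 = (val w').2.
  apply: (mulIf gn0); apply: (addrI (suval g 0 0 - qconj (val w).1 * suval g 1 0)).
  by rewrite e2 eu e2'.
congr Some; apply/val_inj; move: eu ev.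
by case: (val w) (val w') => ? ? [? ?] /= -> ->.
Qed.

Lemma borelM (g h : SU) : borel g -> borel h -> borel (g * h)%g.
Proof.
move=> /borelE[g10 g20] Bh; have /borelE[h10 h20] := Bh.
by apply/borelE; rewrite !mul3 g10 g20 h10 h20; split; ring.
Qed.

Lemma boundary_funP (g : SU) z z' : boundary_rel g z z' <-> boundary_fun g z = z'.
Proof.
rewrite /boundary_fun; case: xgetP => [z1 -> /= B1|H].
  by split=> [|<- //]; apply: borel_g_inj.
by have [z1 B1] := borel_g_ex (g * (g_ z)^-1)%g; case: (H z1).
Qed.

Fact boundary_fun1 z : boundary_fun 1%g z = z.
Proof.
apply/boundary_funP; rewrite /boundary_rel mul1g mulgV.
by apply/borelE; rewrite !mxE.
Qed.

Fact boundary_funM (g h : SU) z :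
  boundary_fun g (boundary_fun h z) = boundary_fun (g * h)%g z.
Proof.
have /boundary_funP Bh := erefl (boundary_fun h z).
have /boundary_funP Bg := erefl (boundary_fun g (boundary_fun h z)).
symmetry; apply/boundary_funP; have := borelM Bg Bh.
by rewrite /boundary_rel -!mulgA mulKg.
Qed.

Definition boundary_act := LAction boundary_fun1 boundary_funM.

End Unitary.

Section Subgroup.
Variables (T : groupType) (G : groupClosed T).

Definition subgroup_elt : Type := {g : T | g \in G}.

HB.instance Definition _ := SubChoice.on subgroup_elt.

Fact subgroup_elt_closed : group_closed G.
Proof. by split; [exact: gpred1 | exact: gpredF]. Qed.

HB.instance Definition _ :=
  SubChoice_isSubGroup.Build T _ subgroup_elt subgroup_elt_closed.

Variables (Y : choiceType) (to : laction T Y).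

Fact lact_res1 y : to (val (1%g : subgroup_elt)) y = y.
Proof. exact: lact1. Qed.

Fact lact_resM (g h : subgroup_elt) y :
  to (val g) (to (val h) y) = to (val (g * h)%g) y.
Proof. exact: lactM. Qed.

Definition lact_res : laction subgroup_elt Y :=
  @LAction subgroup_elt Y (fun g => to (val g)) lact_res1 lact_resM.

Definition finite_index_subgroup (Gamma : set T) : Prop :=
  [set` G] `<=` Gamma /\
  finite_set [set [set (g * x)%g | x in [set` G]] | g in Gamma].

Definition has_order (g : T) (n : nat) : Prop :=
  [/\ (0 < n)%N, (g ^+ n = 1)%g &
      forall m, (0 < m < n)%N -> (g ^+ m <> 1)%g].

Definition no_p'_torsion (p : nat) : Prop :=
  forall (g : T) (n : nat), g \in G -> has_order g n ->
  exists m, n = (p ^ m)%N.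

(* The sum of 1/#Stab_G(z) over the G-orbits in S, where z is a representative
   of its orbit chosen by [get]. [fset_set] sends infinite sets to the empty
   set, so an infinite stabilizer would contribute 0. *)
Definition inv_stab_sum (R : realType) (Z : pointedType) (act : T -> Z -> Z)
    (S : set Z) : \bar R :=
  let orbit z := [set act g z | g in [set` G]] in
  let stab z := [set g | g \in G /\ act g z = z] in
  \esum_(O in orbit @` S) ((#|` fset_set (stab (get O))|)%:R^-1)%:E.

End Subgroup.

(* The Steinberg module, over the group ring of the subgroup G. *)
Definition Steinberg (k : fieldType) (L : quad_ext k) (G : groupClosed (SU L)) :
    lmodType (gring (subgroup_elt G)) :=
  aug_kernel (lact_res G (boundary_act L)).

Definition fg_module (R : nzRingType) (M : lmodType R) : Prop :=
  exists (n : nat) (f : {linear 'rV[R]_n -> M}), forall x, exists r, f r = x.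

Definition projective_module (R : nzRingType) (M : lmodType R) : Prop :=
  forall (U V : lmodType R) (q : {linear U -> V}) (f : {linear M -> V}),
    (forall v, exists u, q u = v) ->
  exists h : {linear M -> U}, forall x, q (h x) = f x.

Section FunctionField.
Variables (F K : fieldType) (iota : F -> K).

(* y belongs to iota(F)(t). *)
Definition in_ratfun (t y : K) : Prop :=
  exists p q : {poly F},
    q != 0 /\ y = (map_poly iota p).[t] / (map_poly iota q).[t].

(* K is a finite extension of a purely transcendental extension F(t). *)
Definition is_function_field : Prop :=
  exists t : K, ~ algebraicOver iota t /\
    exists (n : nat) (b : 'I_n -> K), forall x : K, exists c : 'I_n -> K,
      (forall i, in_ratfun t (c i)) /\ x = \sum_i c i * b i.

Definition algebraically_closed_in : Prop :=
  forall x : K, algebraicOver iota x -> exists c : F, x = iota c.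

(* For F perfect, the closed points of the smooth projective curve over F with
   function field K, given by their normalized discrete valuations. The value at 0, which should
   be +oo, is fixed to the junk value 0: thus two places are equal as soon as
   they agree on the non-zero elements, but 0 must be treated apart in lower
   bounds on valuations. *)
Record is_place (w : K -> int) : Prop := IsPlace {
  place0 : w 0 = 0;
  placeM : forall x y, x != 0 -> y != 0 -> w (x * y) = w x + w y;
  placeD : forall x y, x != 0 -> y != 0 -> x + y != 0 ->
    Num.min (w x) (w y) <= w (x + y);
  place_const : forall c : F, c != 0 -> w (iota c) = 0;
  place_normalized : exists2 x, x != 0 & w x = 1
}.

Definition regular_outside (P : K -> int) : set K :=
  [set x | forall w, is_place w -> w <> P -> x = 0 \/ 0 <= w x].

End FunctionField.

Section Extension.
Variables (k : fieldType) (L : fieldExtType k).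

Definition integral_closure (A : set k) : set L :=
  [set x | exists p : {poly k},
     [/\ p \is monic, forall i, A p`_i & root (map_poly (in_alg L) p) x]].

(* Q lies over P with ramification index e. *)
Definition lies_over (e : nat) (Q : L -> int) (P : k -> int) : Prop :=
  (0 < e)%N /\ forall c : k, Q c%:A = e%:Z * P c.

(* When [lies_over e Q P], the extension of the valuation P to L. *)
Definition nu_ext (R : realType) (e : nat) (Q : L -> int) (x : L) : R :=
  (Q x)%:~R / e%:R.

End Extension.

Arguments integral_closure {k} L A.

Definition arith_group (k : fieldType) (L : quad_ext k) (B : set L) :
    set (SU L) :=
  [set g | forall i j, B (suval g i j)].

Definition generated (T : groupType) (S : set T) : set T :=
  [set g | forall H : groupClosed T, S `<=` [set` H] -> g \in H].

(* The point r a^\vee of the standard apartment is represented by r : R. *)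
Section Tree.
Variables (R : realType) (k : fieldType) (L : quad_ext k) (nu : L -> R).

Definition a_form (r : R) : R := 2 * r.

Definition apt_vertex (x : R) : Prop :=
  exists2 t : L, t != 0 & a_form x = 1 / 2 * nu t.

(* [apt_act n f]: n belongs to N(k) and acts on the apartment by f. No
   constructor is needed for inverses, as s^-1 = s and a(t)^-1 = a(t^-1). *)
Inductive apt_act : SU L -> (R -> R) -> Prop :=
| apt_act_s (n : SU L) : suval n = s_mx L -> apt_act n (fun x => - x)
| apt_act_a (n : SU L) (t : L) : t != 0 -> suval n = a_mx t ->
    apt_act n (fun x => x - 1 / 2 * nu t)
| apt_act_mul (m n : SU L) (f g : R -> R) :
    apt_act m f -> apt_act n g -> apt_act (m * n)%g (f \o g).

Definition uma_mx (u v : L) : 'M[L]_3 := s_mx L *m ua_mx u v *m s_mx L.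

(* U_{b,x}, for the root group b given by its parametrization [ub] and its
   linear form [b]. The case v = 0 is that of infinite valuation. *)
Definition root_subgroup (ub : L -> L -> 'M[L]_3) (b : R -> R) (x : R) :
    set (SU L) :=
  [set g | exists u v : L, [/\ in_H (u, v),
     v = 0 \/ - 2 * b x <= nu v & suval g = ub u v]].

Definition parahoric (x : R) : set (SU L) :=
  generated (root_subgroup (@ua_mx k L) a_form x
             `|` root_subgroup uma_mx (fun y => - a_form y) x).

Definition tree_rel (p q : SU L * R) : Prop :=
  exists n f, [/\ apt_act n f, q.2 = f p.2 &
                  parahoric p.2 (p.1^-1 * q.1 * n)%g].

(* Points of the tree are classes for [tree_rel], viewed as sets of pairs;
   [tree_point g x] is the class of (g, x). *)
Definition tree_point (g : SU L) (x : R) : set (SU L * R) :=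
  [set q | tree_rel (g, x) q].

Definition tree_act (g : SU L) (C : set (SU L * R)) : set (SU L * R) :=
  [set ((g * q.1)%g, q.2) | q in C].

Definition tree_vertices : set (set (SU L * R)) :=
  [set C | exists g x, apt_vertex x /\ C = tree_point g x].

Definition consecutive (x y : R) : Prop :=
  [/\ apt_vertex x, apt_vertex y, x < y &
      forall z, apt_vertex z -> ~~ (x < z < y)].

(* Geometrical edges are the translates of the segments joining consecutive
   vertices of the apartment, as sets of points of the tree. *)
Definition tree_edges : set (set (set (SU L * R))) :=
  [set e | exists g x y, consecutive x y /\
     e = [set tree_point g z | z in [set z | x <= z <= y]]].

Variable G : groupClosed (SU L).

Definition vertex_sum : \bar R := inv_stab_sum G R tree_act tree_vertices.

Definition edge_sum : \bar R :=
  inv_stab_sum G R (fun g e => tree_act g @` e) tree_edges.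

(* Meaningful only when both sums are finite: [fine] is 0 at +oo. *)
Definition euler_char : R := fine vertex_sum - fine edge_sum.

End Tree.

(* Main.v *)
(* A stable vertex or edge of the tree X is one with trivial stabilizer in G. A finite
   subgroup of G is a p-group of unipotent elements, so the stabilizer of an unstable
   vertex v fixes a unique end z(v), and it fixes the ray from v to z(v). Send a stable
   vertex g v_j (v_j in a set of representatives of the l_0 stable orbits) to
   (g oo, g e_j), and an unstable vertex v to (z(v), 0), in Z[ends] + Z[G]^l_0. The
   boundaries of stable edges then map to St + Z[G]^l_0; this gives an isomorphism from
   the free module on the l_1 orbits of stable edges. It is onto since X is connected,
   unstable edges have boundary 0, and every end is z(v) for some v. It is one to one since
   cutting X along a stable edge separates the ends and the vertices compatibly with
   v |-> z(v).

   The unstable terms of chi(G) cancel: v |-> {v, next vertex towards z(v)} matches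
   unstable vertices with unstable edges and preserves stabilizers. The sums converge
   because all but finitely many unstable orbits have at least two neighbours pointing to
   them, which halves the mass at each step.

   The finiteness statements come from reduction theory: there are finitely many orbits of
   vertices v whose stabilizer has at most M elements. Transvections show that B^3 has no
   short vector for the norm v; by Riemann's inequality and a pigeonhole argument
   (Minkowski), B^3 contains a basis of L^3 of bounded norm, and such bases are classified up
   to the arithmetic group by their Gram matrix, determinant d and residue modulo d. *)

From HB Require Import structures.
Require Import Defs.
From mathcomp Require Import all_boot all_order all_algebra all_field.
From mathcomp Require Import fingroup cyclic pgroup center sylow finmap monalg.
From mathcomp Require Import boolp classical_sets cardinality.
From mathcomp Require Import reals fsbigop ereal esum ring lra zify.

Set Implicit Arguments.
Unset Strict Implicit.
Unset Printing Implicit Defensive.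

Import Order.TTheory GRing.Theory Num.Theory.
Local Open Scope classical_set_scope.
Local Open Scope ring_scope.

(** * Indices of additive subgroups *)

Definition subgrp (V : zmodType) (X : set V) : Prop :=
  X 0 /\ forall x y, X x -> X y -> X (x - y).

Definition indexp (V : zmodType) (X Y : set V) (m : nat) : Prop :=
  exists f : 'I_m -> V, [/\ forall i, X (f i),
    forall i j, Y (f i - f j) -> i = j &
    forall x, X x -> exists i, Y (x - f i)].

Definition card_ge (V : eqType) (S : set V) (m : nat) : Prop :=
  exists s : seq V, [/\ uniq s, size s = m & {in s, forall x, S x}].

Section SubgrpTheory.
Variables (V : zmodType) (X : set V).
Hypothesis sX : subgrp X.

Lemma subgrp0 : X 0. Proof. by case: sX. Qed.
Lemma subgrpB x y : X x -> X y -> X (x - y). Proof. by case: sX => _; apply. Qed.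
Lemma subgrpN x : X x -> X (- x).
Proof. by move=> Xx; rewrite -sub0r; apply: subgrpB => //; apply: subgrp0. Qed.
Lemma subgrpD x y : X x -> X y -> X (x + y).
Proof. by move=> Xx Xy; rewrite -[y]opprK; apply/subgrpB/subgrpN. Qed.
Lemma subgrpBC x y : X (x - y) -> X (y - x).
Proof. by move/subgrpN; rewrite opprB. Qed.
Lemma subgrp_trans y x z : X (x - y) -> X (y - z) -> X (x - z).
Proof. by move=> xy yz; rewrite -(subrKA y); apply: subgrpD. Qed.
Lemma subgrp_sum (I : Type) (r : seq I) (P : pred I) (F : I -> V) :
  (forall i, P i -> X (F i)) -> X (\sum_(i <- r | P i) F i).
Proof.
by move=> XF; elim/big_ind: _ => //; [exact: subgrp0 | exact: subgrpD].
Qed.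
End SubgrpTheory.

Lemma subgrpI (V : zmodType) (X Y : set V) : subgrp X -> subgrp Y -> subgrp (X `&` Y).
Proof.
move=> sX sY; split=> [|x y [Xx Yx] [Xy Yy]]; first by split; apply: subgrp0.
by split; apply: subgrpB.
Qed.

Lemma subgrp_set0 (V : zmodType) : subgrp [set 0 : V].
Proof. by split=> // x y -> ->; rewrite /= subr0. Qed.

Section Index.
Variable V : zmodType.
Implicit Types X Y Z S : set V.

Lemma fin_collision (I J : finType) (h : I -> J) :
  (#|J| < #|I|)%N -> exists i j, i != j /\ h i = h j.
Proof.
move=> ltJI; have /injectivePn[i [j nij hij]] : ~~ injectiveb h.
  by apply/injectiveP => /leq_card; rewrite leqNgt ltJI.
by exists i, j.
Qed.

Lemma index_collision X Y m (I : finType) (g : I -> V) : subgrp Y ->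
    indexp X Y m -> (m < #|I|)%N -> (forall i, X (g i)) ->
  exists i j, i != j /\ Y (g i - g j).
Proof.
move=> sY [f [_ _ cov]] ltmI Xg; have /choice[h hP] i := cov _ (Xg i).
have [i [j [nij hij]]] : exists i j, i != j /\ h i = h j.
  by apply: fin_collision; rewrite card_ord.
exists i, j; split=> //.
by apply: (subgrp_trans sY (hP i)); rewrite hij; apply: subgrpBC.
Qed.

Lemma indexp_ub X Y m (I : finType) (g : I -> V) : subgrp Y ->
    indexp X Y m -> (forall i, X (g i)) ->
    (forall i j, Y (g i - g j) -> i = j) -> (#|I| <= m)%N.
Proof.
move=> sY XYm Xg g_inj; rewrite leqNgt; apply/negP => lt.
by have [i [j [/eqP nij /g_inj]]] := index_collision sY XYm lt Xg.
Qed.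

Lemma indexp_unique X Y m n :
  subgrp Y -> indexp X Y m -> indexp X Y n -> m = n.
Proof.
move=> sY XYm XYn; have [f [Xf fi _]] := XYm; have [g [Xg gi _]] := XYn.
apply/eqP; rewrite eqn_leq -{1}(card_ord m) -{2}(card_ord n).
by rewrite (indexp_ub sY XYn Xf fi) (indexp_ub sY XYm Xg gi).
Qed.

Lemma indexp_fin X Y (I : finType) (f : I -> V) : (forall i, X (f i)) ->
    (forall i j, Y (f i - f j) -> i = j) ->
    (forall x, X x -> exists i, Y (x - f i)) ->
  indexp X Y #|I|.
Proof.
move=> Xf fi cov; exists (fun i => f (enum_val i)); split=> // [i j|x /cov[i Yi]].
  by move/fi/enum_val_inj.
by exists (enum_rank i); rewrite enum_rankK.
Qed.

Lemma indexp_gt0 X Y m : subgrp X -> indexp X Y m -> (0 < m)%N.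
Proof.
by move=> sX [f [_ _ /(_ _ (subgrp0 sX))[i _]]]; apply: leq_trans (ltn_ord i).
Qed.

Lemma indexpM X Y Z a b : subgrp X -> subgrp Y -> subgrp Z -> Y `<=` X ->
  Z `<=` Y -> indexp X Y a -> indexp Y Z b -> indexp X Z (a * b).
Proof.
move=> sX sY sZ YX ZY [f [Xf fi fc]] [g [Yg gi gc]].
have -> : (a * b = #|{: 'I_a * 'I_b}|)%N by rewrite card_prod !card_ord.
apply: (@indexp_fin _ _ _ (fun ij : 'I_a * 'I_b => f ij.1 + g ij.2)).
- by move=> ij; apply: subgrpD => //; apply: YX.
- move=> [i j] [i' j'] /= H.
  have ii' : i = i'.
    apply: fi; rewrite (_ : _ - _ = (f i + g j - (f i' + g j')) - (g j - g j')).
      by apply: subgrpB => //; [apply: ZY | apply: subgrpB].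
    by rewrite opprD addrACA addrK.
  rewrite ii' in H *; congr (_, _); apply: gi.
  by move: H; rewrite opprD addrACA subrr add0r.
- move=> x /fc[i Yi]; have [j Zj] := gc _ Yi.
  by exists (i, j); rewrite /= opprD addrA.
Qed.

Lemma indexp_ex X Y m : subgrp Y ->
    (forall g : 'I_m.+1 -> V, (forall i, X (g i)) ->
       exists i j, i != j /\ Y (g i - g j)) ->
  exists2 c, (c <= m)%N & indexp X Y c.
Proof.
move=> sY H.
pose P c := `[< exists f : 'I_c -> V, (forall i, X (f i)) /\
                   forall i j, Y (f i - f j) -> i = j >].
have P0 : exists c, P c.
  by exists 0; apply/asboolP; exists (fun=> 0); split=> -[].
have Pm c : P c -> (c <= m)%N.
  move=> /asboolP[f [Xf fi]]; rewrite leqNgt; apply/negP => ltmc.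
  have [i [j [/eqP nij /fi/(congr1 val) /= /val_inj]]] :=
    H (fun i => f (widen_ord ltmc i)) (fun i => Xf _).
  exact: nij.
case: (ex_maxnP P0 Pm) => c Pc cmax; exists c; first exact: Pm.
move: Pc => /asboolP[f [Xf fi]]; exists f; split=> // x Xx.
apply: contrapT => /forallNP nY; suff /cmax : P c.+1 by rewrite ltnn.
apply/asboolP; exists (fun i => if unlift ord_max i is Some j then f j else x); split=> [i|i j].
  by case: unliftP.
case: unliftP => [i' ->|->]; case: unliftP => [j' ->|->] //.
- by move/fi ->.
- by move/(subgrpBC sY)/nY.
- by move/nY.
Qed.

Lemma indexp1 X Y : subgrp X -> X `<=` Y -> indexp X Y 1.
Proof.
move=> sX XY; exists (fun=> 0); split=> [i|i j _|x Xx]; first exact: subgrp0.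
  by rewrite !ord1.
by exists 0; rewrite subr0; apply: XY.
Qed.

End Index.

Lemma indexp_iso (V W : zmodType) (f : {additive V -> W}) (X Y : set V)
    (X' Y' : set W) c : subgrp Y' ->
    (forall x, X x -> X' (f x)) -> (forall x, X x -> Y' (f x) <-> Y x) ->
    subgrp X -> (forall x', X' x' -> exists2 x, X x & Y' (x' - f x)) ->
  indexp X Y c <-> indexp X' Y' c.
Proof.
move=> sY' XX' YY' sX surj; split=> -[g [Xg gi gc]].
  exists (f \o g); split=> [i|i j|x' /surj[x Xx Yx']] /=; first exact: XX'.
    by rewrite -raddfB => /YY'; move/(_ (subgrpB sX (Xg _) (Xg _)))/gi.
  have [i Yi] := gc _ Xx; exists i.
  by apply: (subgrp_trans sY' Yx'); rewrite -raddfB; apply/YY' => //; apply: subgrpB.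
have /choice[h hP] i : exists x, X x /\ Y' (g i - f x).
  by have [x] := surj _ (Xg i); exists x.
exists h; split=> [i|i j|x Xx]; first by case: (hP i).
  move=> Yij; apply: gi; have [Xi Yi] := hP i; have [Xj Yj] := hP j.
  apply: (subgrp_trans sY' Yi); rewrite -[f _](subrK (f (h j))) -raddfB -addrA.
  apply: subgrpD => //; last exact: subgrpBC.
  by apply/YY' => //; apply: subgrpB.
have [i Yi] := gc _ (XX' _ Xx); exists i; have [Xi Yhi] := hP i.
apply/YY'; first exact: subgrpB.
by rewrite raddfB; apply: (subgrp_trans sY' Yi).
Qed.

Lemma indexpX (V W : zmodType) (X Y : set V) (X' Y' : set W) c d :
  indexp X Y c -> indexp X' Y' d ->
  indexp [set x : V * W | X x.1 /\ X' x.2] [set x : V * W | Y x.1 /\ Y' x.2] (c * d).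
Proof.
move=> [f [Xf fi fc]] [g [Yg gi gc]].
have -> : (c * d = #|{: 'I_c * 'I_d}|)%N by rewrite card_prod !card_ord.
apply: (@indexp_fin _ _ _ _ (fun ij : 'I_c * 'I_d => (f ij.1, g ij.2))).
- by move=> ij /=; split; [exact: Xf | exact: Yg].
- by move=> [i j] [i' j'] [/= /fi -> /gi ->].
- by move=> [x y] [/= /fc[i Yi] /gc[j Yj]]; exists (i, j).
Qed.

Section Cardinality.

Lemma card_ge_mono (V : eqType) (S S' : set V) m m' : (m' <= m)%N -> S `<=` S' ->
  card_ge S m -> card_ge S' m'.
Proof.
move=> le SS' [s [us ss Ss]]; exists (take m' s); split.
- exact: take_uniq.
- by rewrite size_takel // ss.
- by move=> x /mem_take/Ss/SS'.
Qed.

Lemma card_ge_inj (I : finType) (V : eqType) (S : set V) (f : I -> V) :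
  injective f -> (forall i, S (f i)) -> card_ge S #|I|.
Proof.
move=> fi Sf; exists [seq f i | i : I]; split.
- by rewrite map_inj_uniq ?enum_uniq.
- by rewrite size_map -cardE.
- by move=> _ /mapP[i _ ->].
Qed.

Lemma card_geP (V : eqType) (S : set V) m :
  card_ge S m -> exists f : 'I_m -> V, injective f /\ forall i, S (f i).
Proof.
case=> s [us <- Ss]; exists (tnth (in_tuple s)); split.
  exact/tuple_uniqP.
by move=> i; apply/Ss/mem_tnth.
Qed.

Lemma card_ge_pigeonhole (V W : zmodType) (f : {additive V -> W}) (S : set V)
    (X Y : set W) c m m' : subgrp S -> subgrp Y -> (forall x, S x -> X (f x)) ->
    indexp X Y c -> (c * m' <= m)%N -> card_ge S m ->
  card_ge (S `&` f @^-1` Y) m'.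
Proof.
move=> sS sY SX [r [Xr ri rc]] le [s [us ss Ss]].
case: m' le => [|m'] le; first by exists [::].
have /choice[h hP] x : exists i, S x -> Y (f x - r i).
  have [Sx|nSx] := pselect (S x); first by have [i] := rc _ (SX _ Sx); exists i.
  by have [i _] := rc _ (SX _ (subgrp0 sS)); exists i.
pose cl i := [seq x <- s | h x == i].
have [i ltmi] : exists i, (m' < size (cl i))%N.
  apply: contrapT => /forallNP H.
  have : (size s <= \sum_(i < c) m')%N.
    rewrite -sum1_size (partition_big h predT) //=; apply: leq_sum => i _.
    by rewrite sum1_count -size_filter leqNgt; apply/negP/H.
  have [i _] := rc _ (SX _ (subgrp0 sS)); have := ltn_ord i; rewrite sum_nat_const card_ord ss.
  by move: le; nia.
have cls x : x \in cl i -> [/\ x \in s & h x = i].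
  by rewrite mem_filter => /andP[/eqP].
have x0cl : head 0 (cl i) \in cl i by case: (cl i) ltmi => // ? ? _; rewrite mem_head.
apply: (card_ge_mono ltmi (fun _ H => H)).
exists [seq x - head 0 (cl i) | x <- cl i]; split.
- by rewrite map_inj_uniq ?filter_uniq //; apply: addIr.
- by rewrite size_map.
move=> _ /mapP[x /cls[xs hx] ->]; have [x0s hx0] := cls _ x0cl; split.
  by apply: subgrpB => //; apply: Ss.
rewrite /preimage /= raddfB; apply: (subgrp_trans sY (y := r i)).
  by rewrite -hx; apply/hP/Ss.
by apply: subgrpBC => //; have := hP _ (Ss _ x0s); rewrite hx0.
Qed.
End Cardinality.

Section Dependence.
Variables (K : fieldType) (V : lmodType K) (S M : set K) (X Y : set V) (c n : nat).
Hypotheses (sS : subgrp S) (sM : subgrp M).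
Hypothesis SM : forall a b, S a -> S b -> S (a * b).
Hypothesis SV : forall a, S a -> ~ M a -> S a^-1.
Hypothesis SMc : indexp S M c.
Hypotheses (sX : subgrp X) (sY : subgrp Y).
Hypothesis SX : forall a x, S a -> X x -> X (a *: x).
Hypothesis SY : forall a x, S a -> Y x -> Y (a *: x).
Hypothesis MX : forall a x, M a -> X x -> Y (a *: x).
Hypothesis dep : forall x : 'I_n.+1 -> V, (forall i, X (x i)) ->
  exists a : 'I_n.+1 -> K, [/\ forall i, S (a i), exists i, ~ M (a i) &
     Y (\sum_i a i *: x i)].

(* If the residue ring S/M is a field with c elements, then X/Y is a vector
   space of dimension at most n over it. *)
Lemma index_dependence : exists2 m, (m <= n)%N & indexp X Y (c ^ m).
Proof.
pose indep m (x : 'I_m -> V) := (forall i, X (x i)) /\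
  forall a : 'I_m -> K, (forall i, S (a i)) -> Y (\sum_i a i *: x i) ->
    forall i, M (a i).
pose P m := `[< exists x : 'I_m -> V, indep m x >].
have P0 : exists m, P m.
  by exists 0; apply/asboolP; exists (fun=> 0); split=> [[]|a _ _ []].
have Pub m : P m -> (m <= n)%N.
  move=> /asboolP[x [Xx indx]]; rewrite leqNgt; apply/negP => ltnm.
  have [a [Sa [i nMai] Ya]] := dep (fun i => Xx (widen_ord ltnm i)).
  pose b (j : 'I_m) : K := if insub (val j) is Some i then a i else 0.
  apply: nMai; have -> : a i = b (widen_ord ltnm i) by rewrite /b /= valK.
  apply: indx => [j|].
    by rewrite /b; case: insub => // ; apply: (subgrp0 sS).
  congr (Y _): Ya.
  rewrite [RHS](bigID (fun j : 'I_m => (j < n.+1)%N)) /= [X in _ + X]big1 ?addr0.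
    rewrite (big_ord_narrow ltnm); apply: eq_bigr => j _.
    by rewrite /b /= valK.
  by move=> j /negPf nj; rewrite /b insubF ?scale0r.
case: (ex_maxnP P0 Pub) => m Pm mmax; exists m; first exact: Pub.
move: Pm => /asboolP[x [Xx indx]].
have [r [Sr ri rc]] := SMc.
have -> : (c ^ m = #|{ffun 'I_m -> 'I_c}|)%N by rewrite card_ffun !card_ord.
apply: (@indexp_fin _ _ _ _ (fun h : {ffun 'I_m -> 'I_c} => \sum_i r (h i) *: x i)).
- by move=> h; apply: subgrp_sum => // i _; apply: SX.
- move=> h h'; rewrite -sumrB => Yh; apply/ffunP => i; apply: ri.
  apply: (indx (fun i => r (h i) - r (h' i))) => [j|]; first exact: subgrpB.
  by congr (Y _): Yh; apply: eq_bigr => j _; rewrite scalerBl.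
move=> y Xy.
have : ~ indep m.+1 (fun i => if unlift ord0 i is Some j then x j else y).
  move=> ind; have /mmax : P m.+1 by apply/asboolP; eexists; exact: ind.
  by rewrite ltnn.
move=> /not_andP[/existsNP[i []]|]; first by case: unliftP.
move=> /existsNP[a /not_implyP[Sa /not_implyP[]]].
rewrite big_ord_recl unlift_none.
under eq_bigr => i _ do rewrite liftK.
move=> Ya /existsNP[i0 nMi0].
have nM0 : ~ M (a ord0).
  move=> M0; apply: nMi0; case: (unliftP ord0 i0) => [j ->|-> //].
  apply: (indx (fun j => a (lift ord0 j))) => //.
  by rewrite -[X in Y X](addKr (a ord0 *: y)) addrC; apply: subgrpB => //; apply: MX.
have a0 : a ord0 != 0 by apply/eqP => a0; apply: nM0; rewrite a0; apply: (subgrp0 sM).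
have /choice[h hP] j : exists i, M (- ((a ord0)^-1 * a (lift ord0 j)) - r i).
  by apply/rc/(subgrpN sS)/SM => //; apply: SV.
exists [ffun j => h j].
have /(subgrpB sY) : Y ((a ord0)^-1 *: (a ord0 *: y + \sum_i a (lift ord0 i) *: x i)).
  by apply: SY => //; apply: SV.
rewrite scalerDr scalerA mulVf // scale1r scaler_sumr.
have YM : Y (\sum_i (- ((a ord0)^-1 * a (lift ord0 i)) - r (h i)) *: x i).
  by apply: subgrp_sum => // i _; apply: MX.
move=> /(_ (- \sum_i (- ((a ord0)^-1 * a (lift ord0 i)) - r (h i)) *: x i)).
move=> /(_ (subgrpN sY YM)); rewrite opprK -addrA -big_split /= => H.
congr (Y _): H; congr (_ + _); rewrite -sumrN; apply: eq_bigr => i _.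
by rewrite ffunE !scalerA -!scalerDl addrA subrr sub0r scaleNr.
Qed.
End Dependence.

(** * Places of function fields *)

Section FunctionFieldRank.
Variables (F : finFieldType) (k : fieldType) (iota : {rmorphism F -> k}).

Definition pev (y : k) (p : {poly F}) : k := (map_poly iota p).[y].

Lemma pevE y p : pev y p = \sum_(i < size p) iota p`_i * y ^+ i.
Proof. by rewrite /pev horner_poly. Qed.

Lemma pev_is_zmod_morphism y : GRing.zmod_morphism (pev y).
Proof. by move=> p q; rewrite /pev rmorphB hornerD hornerN. Qed.

Lemma pev_is_monoid_morphism y : GRing.monoid_morphism (pev y).
Proof. by split=> [|p q]; rewrite /pev ?rmorph1 ?hornerC // rmorphM hornerM. Qed.

HB.instance Definition _ y := GRing.isZmodMorphism.Build _ _ (pev y) (pev_is_zmod_morphism y).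
HB.instance Definition _ y := GRing.isMonoidMorphism.Build _ _ (pev y) (pev_is_monoid_morphism y).

Lemma pevC y c : pev y c%:P = iota c.
Proof. by rewrite /pev map_polyC hornerC. Qed.

Lemma pevX y : pev y 'X = y.
Proof. by rewrite /pev map_polyX hornerX. Qed.

Lemma pevZ y c p : pev y (c *: p) = iota c * pev y p.
Proof. by rewrite -mul_polyC rmorphM /= pevC. Qed.

Lemma pev_alg y p : p != 0 -> pev y p = 0 -> algebraicOver iota y.
Proof. by move=> p0 py; exists p => //; apply/rootP. Qed.

Lemma nonalg_pev y p : ~ algebraicOver iota y -> p != 0 -> pev y p != 0.
Proof. by move=> ny p0; apply/eqP => /(pev_alg p0). Qed.

Section Rank.
Variables (t : k) (n : nat) (b : 'I_n -> k).
Hypothesis nalg_t : ~ algebraicOver iota t.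
Hypothesis gen : forall x : k, exists c : 'I_n -> k,
  (forall i, in_ratfun iota t (c i)) /\ x = \sum_i c i * b i.

Lemma ff_clear_denom (I : finType) (z : I -> k) :
  exists (D : {poly F}) (X : I -> 'I_n -> {poly F}), D != 0 /\
    forall s, pev t D * z s = \sum_l pev t (X s l) * b l.
Proof.
have /choice[c hc] s : exists c : 'I_n -> k,
  (forall i, in_ratfun iota t (c i)) /\ z s = \sum_i c i * b i by apply: gen.
have /choice[pq hpq] (sl : I * 'I_n) : exists pq : {poly F} * {poly F},
    pq.2 != 0 /\ c sl.1 sl.2 = pev t pq.1 / pev t pq.2.
  by have [/(_ sl.2)[p [q [q0 e]]] _] := hc sl.1; exists (p, q).
exists (\prod_sl (pq sl).2).
exists (fun s l => (pq (s, l)).1 * \prod_(sl | sl != (s, l)) (pq sl).2).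
split=> [|s]; first by apply/prodf_neq0 => sl _; case: (hpq sl).
have [_ ->] := hc s; rewrite mulr_sumr; apply: eq_bigr => l _.
rewrite (bigD1 (s, l)) //= !rmorphM /=.
have [q0 /= ->] := hpq (s, l).
have := nonalg_pev nalg_t q0; move: (pev t _) (pev t (pq _).1) (pev t (\prod_(_ | _) _)).
by move=> u v w u0; field.
Qed.

Lemma rank_lt_dep (m1 m2 : nat) (A : 'M[F]_(m1, m2)) : (m2 < m1)%N ->
  exists2 v : 'rV_m1, v != 0 & v *m A = 0.
Proof.
move=> lt; have nz : kermx A != 0.
  rewrite -mxrank_eq0 mxrank_ker subn_eq0 -ltnNge.
  exact: leq_ltn_trans (rank_leq_col A) lt.
exists (nz_row (kermx A)); first by rewrite nz_row_eq0.
by apply/sub_kermxP; rewrite nz_row_sub.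
Qed.

Lemma ff_rank_aux (y : k) : exists N, forall x : 'I_N.+1 -> k,
  exists c : 'I_N.+1 -> {poly F}, (exists i, c i != 0) /\
    \sum_i pev y (c i) * x i = 0.
Proof.
have [D [P [D0 hP]]] := ff_clear_denom (fun l => y * b l).
pose be := (size D + \sum_l \sum_l' size (P l l'))%N.
have szD : (size D <= be.+1)%N by rewrite /be; lia.
have szP l l' : (size (P l l') <= be.+1)%N.
  by rewrite /be (bigD1 l) //= (bigD1 l') //=; lia.
exists (n * be)%N => x.
have [D' [X [D'0 hX]]] := ff_clear_denom x.
pose xi := (\sum_i \sum_l size (X i l))%N.
have szX i l : (size (X i l) <= xi.+1)%N.
  by rewrite /xi (bigD1 i) //= (bigD1 l) //=; lia.
pose J := (n * xi.+1)%N.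
pose Y j i l := iter j (fun (u : 'I_n -> {poly F}) l => \sum_l' u l' * P l' l) (X i) l.
have hY j i : pev t D ^+ j * y ^+ j * (pev t D' * x i) = \sum_l pev t (Y j i l) * b l.
  elim: j => [|j IH]; first by rewrite !expr0 !mul1r hX.
  transitivity (pev t D * y * (pev t D ^+ j * y ^+ j * (pev t D' * x i))).
    by rewrite !exprS; ring.
  rewrite IH mulr_sumr; under [RHS]eq_bigr => l _ do rewrite rmorph_sum mulr_suml.
  rewrite exchange_big /=; apply: eq_bigr => l _.
  transitivity (pev t (Y j i l) * (pev t D * (y * b l))); first by ring.
  by rewrite hP mulr_sumr; apply: eq_bigr => l' _; rewrite rmorphM /= mulrA.
have szY j i l : (size (Y j i l) <= (xi + j * be).+1)%N.
  elim: j l => [|j IH] l; first by rewrite mul0n addn0; apply: szX.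
  rewrite (_ : Y _ _ _ = \sum_l' Y j i l' * P l' l) //; apply: leq_trans (size_sum _ _ _) _.
  apply/bigmax_leqP => l' _; apply: leq_trans (size_polyMleq _ _) _.
  by have := IH l'; have := szP l' l; rewrite mulSn; lia.
pose R (ij : 'I_(n * be).+1 * 'I_J.+1) l := D ^+ (J - ij.2) * Y ij.2 ij.1 l.
have szR ij l : (size (R ij l) <= (xi + J * be).+1)%N.
  apply: leq_trans (size_polyMleq _ _) _.
  have := size_poly_exp_leq D (J - ij.2); have := szY ij.2 ij.1 l; have := ltn_ord ij.2.
  by move: szD; nia.
pose I := ('I_(n * be).+1 * 'I_J.+1)%type; pose S := ('I_n * 'I_(xi + J * be).+1)%type.
pose A : 'M[F]_(#|{: I}|, #|{: S}|) :=
  \matrix_(r, s) (R (enum_val r : I) (enum_val s : S).1)`_(enum_val s : S).2.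
have [|v v0 vA] := @rank_lt_dep _ _ A.
  by rewrite !card_prod !card_ord /J; nia.
have [r0 vr0] : exists r, v 0 r != 0.
  apply: contrapT => /forallNP H; move/eqP: v0; apply; apply/rowP => r.
  by rewrite mxE; apply/eqP/negPn/negP/H.
pose a i j := v 0 (enum_rank ((i, j) : I)).
exists (fun i => \poly_(j < J.+1) a i (inord j)); split.
  exists (enum_val r0).1; apply/eqP => /polyP/(_ (enum_val r0).2).
  rewrite coef_poly ltn_ord coef0 inord_val /a -surjective_pairing enum_valK.
  exact/eqP.
have R0 l : \sum_ij v 0 (enum_rank ij) *: R ij l = 0.
  apply/polyP => m; rewrite coef0 coef_sum.
  have [ltm|gem] := ltnP m (xi + J * be).+1; last first.
    by rewrite big1 // => ij _; rewrite coefZ nth_default ?mulr0 // (leq_trans (szR _ _)).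
  have /matrixP/(_ 0 (enum_rank ((l, Ordinal ltm) : S))) := vA.
  rewrite !mxE => vA0; apply: etrans vA0; rewrite [RHS](reindex (@enum_rank I)) /=; last exact/onW_bij/enum_rank_bij.
  by apply: eq_bigr => ij _; rewrite coefZ mxE !enum_rankK.
have : pev t D ^+ J * pev t D' * (\sum_i pev y (\poly_(j < J.+1) a i (inord j)) * x i) = 0.
  transitivity (\sum_i \sum_j iota (a i j) * \sum_l pev t (R (i, j) l) * b l); last first.
    rewrite pair_big /=.
    under eq_bigr => ij _ do rewrite /a -surjective_pairing.
    under eq_bigr => ij _ do rewrite mulr_sumr.
    rewrite exchange_big big1 //= => l _.
    under eq_bigr => ij _ do rewrite mulrA -pevZ.
    by rewrite -mulr_suml -rmorph_sum R0 rmorph0 mul0r.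
  rewrite mulr_sumr.
  apply: eq_bigr => i _; rewrite poly_def rmorph_sum mulr_suml mulr_sumr /=.
  apply: eq_bigr => j _; rewrite pevZ rmorphXn /= pevX inord_val.
  under eq_bigr => l _ do rewrite rmorphM rmorphXn /= -mulrA.
  rewrite -mulr_sumr -hY -/(a i j).
  rewrite -{1}(subnK (leq_ord j)) exprD; ring.
move/eqP; rewrite !mulf_eq0 expf_eq0 !(negPf (nonalg_pev nalg_t _)) // andbF /=.
by move/eqP.
Qed.
End Rank.

Hypothesis ffk : is_function_field iota.

(* By counting: over F(t), the powers y^j with j <= J have numerators of degree
   O(J). *)
Lemma ff_rank (y : k) : exists N, forall x : 'I_N.+1 -> k,
  exists c : 'I_N.+1 -> {poly F}, (exists i, c i != 0) /\
    \sum_i pev y (c i) * x i = 0.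
Proof. by case: ffk => t [nt [n [b gen]]]; exact: (ff_rank_aux nt gen). Qed.

End FunctionFieldRank.

Definition vge (K : zmodType) (w : K -> int) (n : int) : set K :=
  [set x | x = 0 \/ n <= w x].

Definition lmul (R : pzRingType) (a x : R) : R := a * x.

Lemma lmul_is_zmod_morphism (R : pzRingType) (a : R) : GRing.zmod_morphism (lmul a).
Proof. by move=> x y; rewrite /lmul mulrBr. Qed.

HB.instance Definition _ (R : pzRingType) (a : R) :=
  GRing.isZmodMorphism.Build _ _ (lmul a) (lmul_is_zmod_morphism a).

Section PlaceTheory.
Variables (F K : fieldType) (iota : {rmorphism F -> K}) (w : K -> int).
Hypothesis pw : is_place iota w.
Implicit Types x y : K.

Lemma plM x y : x != 0 -> y != 0 -> w (x * y) = w x + w y.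
Proof. by case: pw => _ + _ _ _; apply. Qed.

Lemma pl0 : w 0 = 0. Proof. by case: pw. Qed.

Lemma pl1 : w 1 = 0.
Proof.
have := plM (oner_neq0 K) (oner_neq0 K); rewrite mulr1 => /eqP.
by rewrite -subr_eq subrr eq_sym => /eqP.
Qed.

Lemma plX x n : w (x ^+ n) = w x *+ n.
Proof.
have [->|x0] := eqVneq x 0.
  by rewrite expr0n; case: n => [|n]; rewrite /= ?pl1 ?pl0 ?mul0rn.
elim: n => [|n IH]; first by rewrite expr0 pl1.
by rewrite exprS plM ?expf_neq0 // IH mulrS.
Qed.

Lemma plN x : w (- x) = w x.
Proof.
have [->|x0] := eqVneq x 0; first by rewrite oppr0.
rewrite -mulN1r plM ?oppr_eq0 ?oner_eq0 // -[RHS]add0r; congr (_ + _).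
by have := plX (-1) 2; rewrite sqrrN expr1n pl1 => /esym/eqP; rewrite mulrn_eq0 => /eqP.
Qed.

Lemma plV x : w x^-1 = - w x.
Proof.
have [->|x0] := eqVneq x 0; first by rewrite invr0 pl0 oppr0.
apply/eqP; rewrite -addr_eq0 -plM ?invr_eq0 //.
by rewrite mulVf ?pl1.
Qed.

Lemma pl_const c : w (iota c) = 0.
Proof.
have [->|c0] := eqVneq c 0; first by rewrite rmorph0 pl0.
by case: pw => _ _ _ + _; apply.
Qed.

Lemma vge0 n : vge w n 0. Proof. by left. Qed.

Lemma vgeE n x : x != 0 -> vge w n x <-> n <= w x.
Proof. by move=> x0; split=> [[/eqP|//]|]; [rewrite (negPf x0) | right]. Qed.

Lemma vge_id x : vge w (w x) x. Proof. by right. Qed.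

Lemma vge_le m n x : m <= n -> vge w n x -> vge w m x.
Proof. by move=> le [->|ge]; [left | right; apply: le_trans ge]. Qed.

Lemma vgeD n x y : vge w n x -> vge w n y -> vge w n (x + y).
Proof.
have [->|x0] := eqVneq x 0; first by rewrite add0r.
have [->|y0] := eqVneq y 0; first by rewrite addr0.
have [->|xy0] := eqVneq (x + y) 0; first by left.
move=> /(vgeE _ x0) wx /(vgeE _ y0) wy; right.
case: pw => _ _ wD _ _; apply: le_trans (wD _ _ x0 y0 xy0).
by rewrite le_min wx.
Qed.

Lemma vgeN n x : vge w n x -> vge w n (- x).
Proof. by case=> [->|le]; [left; rewrite oppr0 | right; rewrite plN]. Qed.

Lemma vge_subgrp n : subgrp (vge w n).
Proof. by split=> [|x y vx vy]; [exact: vge0 | apply/vgeD/vgeN]. Qed.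

Lemma vge_sum (I : Type) (r : seq I) (Pr : pred I) (f : I -> K) n :
  (forall i, Pr i -> vge w n (f i)) -> vge w n (\sum_(i <- r | Pr i) f i).
Proof. exact: (subgrp_sum (vge_subgrp n)). Qed.

Lemma vgeM m n x y : vge w m x -> vge w n y -> vge w (m + n) (x * y).
Proof.
have [->|x0] := eqVneq x 0; first by rewrite mul0r; left.
have [->|y0] := eqVneq y 0; first by rewrite mulr0; left.
by move=> /(vgeE _ x0) wx /(vgeE _ y0) wy; right; rewrite plM // lerD.
Qed.

Lemma vgeM0 x y : vge w 0 x -> vge w 0 y -> vge w 0 (x * y).
Proof. by move=> vx vy; rewrite -[X in vge w X]addr0; apply: vgeM. Qed.

Lemma vgeX n x m : vge w n x -> vge w (n *+ m) (x ^+ m).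
Proof.
move=> vx; elim: m => [|m IH]; first by rewrite mulr0n expr0 -pl1; apply: vge_id.
by rewrite exprS mulrS; apply: vgeM.
Qed.

Lemma vge_const c : vge w 0 (iota c).
Proof. by right; rewrite pl_const. Qed.

Lemma vge1 : vge w 0 1. Proof. by right; rewrite pl1. Qed.

Lemma vgeMl x n m y : x != 0 -> m = w x -> vge w (m + n) (x * y) <-> vge w n y.
Proof.
move=> x0 ->; split; last exact/vgeM/vge_id.
move=> vxy; rewrite -[y](mulKf x0) -[n](addKr (w x)) -plV.
by apply: vgeM vxy; apply: vge_id.
Qed.

Lemma vge_notP n x : ~ vge w n x -> x != 0 /\ w x < n.
Proof. by move=> /not_orP[/eqP x0]; move/negP; rewrite -ltNge. Qed.

Lemma vge_addl x y : x != 0 -> vge w (w x + 1) y -> x + y != 0 /\ w (x + y) = w x.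
Proof.
move=> x0 vy; have nx : ~ vge w (w x + 1) x.
  by move=> /(vgeE _ x0); rewrite gerDl.
have nxy : ~ vge w (w x + 1) (x + y).
  by move=> /vgeD/(_ (vgeN vy)); rewrite addrK.
have [xy0 lt] := vge_notP nxy; split=> //; apply/eqP; rewrite eq_le.
rewrite -ltzD1 lt /=; apply/(vgeE _ xy0)/vgeD; first exact: vge_id.
by apply: vge_le vy; rewrite lerDl.
Qed.

Lemma vge_integral m x (a : 'I_m -> K) : (forall i, vge w 0 (a i)) ->
  x ^+ m = \sum_i a i * x ^+ i -> vge w 0 x.
Proof.
move=> va E; apply: contrapT => /vge_notP[x0 neg].
case: m a va E => [|m] a va E.
  by move/eqP: E; rewrite expr0 big_ord0 oner_eq0.
have : vge w (w x *+ m) (x ^+ m.+1).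
  rewrite E; apply: vge_sum => i _; rewrite -[_ *+ m]add0r; apply: vgeM => //.
  apply: vge_le (vgeX i (vge_id x)).
  by rewrite ler_wnMn2l ?(ltW neg) // -ltnS.
rewrite vgeE ?expf_neq0 // plX mulrS.
by rewrite -subr_ge0 addrK leNgt neg.
Qed.

Lemma vge_uniformizer : exists2 x, x != 0 & w x = 1.
Proof. by case: pw. Qed.

Lemma vge_uniformizerz m : exists2 x, x != 0 & w x = m.
Proof.
have [x x0 wx] := vge_uniformizer; case: m => m.
  by exists (x ^+ m); rewrite ?expf_neq0 // plX wx natz.
exists (x ^- m.+1); rewrite ?invr_eq0 ?expf_neq0 // plV plX wx natz.
by rewrite NegzE.
Qed.

End PlaceTheory.

Section PlaceExistence.
Variables (F : finFieldType) (k : fieldType) (iota : {rmorphism F -> k}).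
Hypothesis ffk : is_function_field iota.
Variable y : k.
Hypothesis nalg_y : ~ algebraicOver iota y.

Let y0 : y != 0.
Proof.
by apply/eqP => y0; apply: nalg_y; exists 'X; rewrite ?polyX_eq0 // map_polyX y0 rootX.
Qed.

Let good (R : set k) := [/\ forall c, R (iota c), R y, ~ R y^-1,
   forall a b, R a -> R b -> R (a - b) & forall a b, R a -> R b -> R (a * b)].

Let base : set k := [set x | exists p : {poly F}, x = pev iota y p].

Let base_good : good base.
Proof.
split=> [c||[p e]|a b [p ->] [q ->]|a b [p ->] [q ->]].
- by exists c%:P; rewrite pevC.
- by exists 'X; rewrite pevX.
- have : pev iota y (p * 'X - 1) = 0.
    by rewrite rmorphB rmorphM rmorph1 /= pevX -e mulVf ?subrr.
  move/(pev_alg _) => /(_ _)/nalg_y; apply.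
  rewrite subr_eq0; apply/eqP => /(congr1 (fun q : {poly F} => q`_0)) /eqP.
  by rewrite coefMX coef1 /= eq_sym oner_eq0.
- by exists (p - q); rewrite rmorphB.
- by exists (p * q); rewrite rmorphM.
Qed.

Let ex_max : exists2 R, good R & forall R', good R' -> R `<=` R' -> R' `<=` R.
Proof.
have [|A [gA maxA]] := @Zorn_bigcup _ (fun X => good (X `|` base)).
  move=> Fam gF totF.
  have [Fam0|] := pselect (Fam = set0).
    by rewrite Fam0 bigcup_set0 set0U; apply: base_good.
  move=> /eqP/set0P[X0 FX0].
  have two a b : ((\bigcup_(X in Fam) X) `|` base) a -> ((\bigcup_(X in Fam) X) `|` base) b ->
      exists X, [/\ Fam X, (X `|` base) a & (X `|` base) b].
    move=> [[X FX Xa]|Ba] [[Y FY Yb]|Bb].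
    - have [XY|YX] := totF _ _ FX FY.
        by exists Y; split=> //; left=> //; apply: XY.
      by exists X; split=> //; left=> //; apply: YX.
    - by exists X; split=> //; [left | right].
    - by exists Y; split=> //; [right | left].
    - by exists X0; split=> //; right.
  have sub X : Fam X -> (X `|` base) `<=` ((\bigcup_(X in Fam) X) `|` base).
    by move=> FX z [Xz|Bz]; [left; exists X | right].
  case: base_good => bF by_ nby _ _.
  split=> [c||[[X FX Xy]|//]|a b Ra Rb|a b Ra Rb].
  - by right; apply: bF.
  - by right.
  - by case: (gF X FX) => _ _ + _ _; apply; left.
  - have [X [FX Xa Xb]] := two _ _ Ra Rb; apply: (sub X) => //.
    by case: (gF X FX) => _ _ _ + _; apply.
  - have [X [FX Xa Xb]] := two _ _ Ra Rb; apply: (sub X) => //.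
    by case: (gF X FX) => _ _ _ _; apply.
exists (A `|` base) => // R' gR' sub; apply: contrapT => nsub.
apply: (maxA R'); last first.
  by rewrite (_ : R' `|` base = R') //; apply/setUidPl => z Bz; apply: sub; right.
split; first by move=> z Az; apply: sub; left.
by move=> H; apply: nsub => z /H Az; left.
Qed.

Section Maximal.
Variable R : set k.
Hypotheses (gR : good R) (maxR : forall R', good R' -> R `<=` R' -> R' `<=` R).

Let Rc c : R (iota c). Proof. by case: gR. Qed.
Let Ry : R y. Proof. by case: gR. Qed.
Let nRVy : ~ R y^-1. Proof. by case: gR. Qed.
Let RB a b : R a -> R b -> R (a - b). Proof. by case: gR => _ _ _ + _; apply. Qed.
Let RM a b : R a -> R b -> R (a * b). Proof. by case: gR => _ _ _ _; apply. Qed.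
Let R0 : R 0. Proof. by rewrite -(rmorph0 iota). Qed.
Let R1 : R 1. Proof. by rewrite -(rmorph1 iota). Qed.
Let sR : subgrp R. Proof. by split. Qed.
Let RX a n : R a -> R (a ^+ n).
Proof. by move=> Ra; elim: n => [|n IH]; rewrite ?expr0 // exprS; apply: RM. Qed.

Let overR (p : {poly k}) := forall i, R p`_i.

Let adjoin x : ~ R x -> exists2 p, overR p & y * p.[x] = 1.
Proof.
move=> nRx; apply: contrapT => H; apply: nRx.
pose R' : set k := [set z | exists2 p, overR p & z = p.[x]].
have RR' : R `<=` R'.
  move=> z Rz; exists z%:P; last by rewrite hornerC.
  by move=> i; rewrite coefC; case: ifP.
suff gR' : good R'.
  apply: (maxR gR' RR'); exists 'X; last by rewrite hornerX.
  by move=> i; rewrite coefX; case: eqP.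
split=> [c||[p Rp e]|a b [p Rp ->] [q Rq ->]|a b [p Rp ->] [q Rq ->]].
- exact: RR'.
- exact: RR'.
- by apply: H; exists p => //; rewrite -e mulfV.
- exists (p - q); last by rewrite hornerD hornerN.
  by move=> i; rewrite coefB; apply: RB.
- exists (p * q); last by rewrite hornerM.
  by move=> i; rewrite coefM; apply: subgrp_sum => // j _; apply: RM.
Qed.

Let descent N (x : k) (p q : {poly k}) : x != 0 -> (size p + size q <= N)%N -> overR p -> overR q ->
  y * p.[x] = 1 -> y * q.[x^-1] = 1 -> False.
Proof.
elim: N x p q => [|N IH] x p q x0 le Rp Rq ep eq.
  move: le; rewrite leqn0 addn_eq0 size_poly_eq0 => /andP[/eqP p0 _].
  by move/eqP: ep; rewrite p0 horner0 mulr0 eq_sym oner_eq0.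
wlog leqp : x p q x0 le Rp Rq ep eq / (size q <= size p)%N.
  move=> wl; have [?|/ltnW ?] := leqP (size q) (size p).
    exact: (wl x p q).
  by apply: (wl x^-1 q p); rewrite ?invr_eq0 ?invrK // addnC.
have sz2 (r : {poly k}) z : overR r -> y * r.[z] = 1 -> (1 < size r)%N.
  move=> Rr er; rewrite ltnNge; apply/negP => /size1_polyC rE.
  apply: nRVy; rewrite rE hornerC in er.
  by rewrite (_ : y^-1 = r`_0) //; apply: (mulfI y0); rewrite er mulfV.
have szp := sz2 _ _ Rp ep; have szq := sz2 _ _ Rq eq.
pose n := (size p).-1.
have sp : size p = n.+1 by rewrite /n; lia.
pose s : {poly k} := \sum_(j < size q | (0 < j)%N) q`_j *: 'X^(n - j).
have es : (1 - y * q`_0) * x ^+ n = y * s.[x].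
  have -> : 1 - y * q`_0 = y * \sum_(j < size q | (0 < j)%N) q`_j * x^-1 ^+ j.
    rewrite -[X in X - _]eq horner_coef -mulrBr; congr (_ * _).
    have lt0 : (0 < size q)%N by apply: leq_trans szq.
    rewrite (bigD1 (Ordinal lt0)) //= expr0 mulr1 addrAC subrr add0r.
    by apply: eq_bigl => j; rewrite lt0n.
  rewrite -mulrA mulr_suml; congr (_ * _); rewrite /s horner_sum.
  apply: eq_bigr => j _; rewrite hornerZ hornerXn -mulrA; congr (_ * _).
  have lej : (j <= n)%N by have := ltn_ord j; lia.
  by rewrite exprVn -{1}(subnK lej) exprD mulrCA mulVf ?mulr1 // expf_neq0.
pose p' := (q`_0)%:P + (1 - y * q`_0) *: take_poly n p + (p`_n * y) *: s.
have R1q : R (1 - y * q`_0) by apply/RB/RM.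
apply: (IH x p' q) => //.
- rewrite -ltnS; apply: leq_trans le; rewrite -addSn leq_add2r sp ltnS.
  apply: leq_trans (size_polyD _ _) _; rewrite geq_max; apply/andP; split.
    apply: leq_trans (size_polyD _ _) _; rewrite geq_max; apply/andP; split.
      by apply: leq_trans (size_polyC_leq1 _) _; rewrite /n; lia.
    apply: leq_trans (size_scale_leq _ _) _; exact: size_take_poly.
  apply: leq_trans (size_scale_leq _ _) _; apply: leq_trans (size_sum _ _ _) _.
  apply/bigmax_leqP => j j0; apply: leq_trans (size_scale_leq _ _) _.
  by rewrite size_polyXn /n; lia.
- move=> i; rewrite !coefD !coefZ coefC coef_sum.
  apply: subgrpD => //; first apply: subgrpD => //.
  + by case: ifP.
  + by apply: RM => //; rewrite coef_take_poly; case: ifP.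
  + apply: RM; first exact: RM.
    by apply: subgrp_sum => // j _; rewrite coefZ coefXn; case: eqP => _; rewrite ?mulr1 ?mulr0.
have pE : p.[x] = (take_poly n p).[x] + p`_n * x ^+ n.
  rewrite -{1}(poly_take_drop n p) hornerD hornerM hornerXn; congr (_ + _ * _).
  have /size1_polyC -> : (size (drop_poly n p) <= 1)%N by rewrite size_drop_poly sp; lia.
  by rewrite hornerC coef_drop_poly add0n.
rewrite /p' !hornerD !hornerZ hornerC -mulrA -es.
have : y * ((1 - y * q`_0) * p.[x]) = 1 - y * q`_0 by rewrite mulrCA ep mulr1.
rewrite pE => H; rewrite -[RHS](subrK (y * q`_0)) -[in RHS]H; ring.
Qed.

Let R_valuation x : x != 0 -> R x \/ R x^-1.
Proof.
move=> x0; apply: contrapT => /not_orP[/adjoin[p Rp ep] /adjoin[q Rq eq]].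
exact: (descent x0 (leqnn _) Rp Rq ep eq).
Qed.

Let U a := [/\ a != 0, R a & R a^-1].
Let U1 : U 1. Proof. by split; rewrite ?invr1 ?oner_eq0. Qed.
Let UM a b : U a -> U b -> U (a * b).
Proof.
by move=> [a0 Ra Ra'] [b0 Rb Rb']; split; rewrite ?mulf_neq0 ?invfM //; apply: RM.
Qed.
Let UV a : U a -> U a^-1.
Proof. by move=> [a0 Ra Ra']; split; rewrite ?invr_eq0 ?invrK. Qed.
Let UX a n : U a -> U (a ^+ n).
Proof. by move=> Ua; elim: n => [|n IH]; rewrite ?expr0 // exprS; apply: UM. Qed.
Let U_const c : c != 0 -> U (iota c).
Proof. by move=> c0; split; rewrite ?fmorph_eq0 // -fmorphV. Qed.

Let I : set k := [set a | R a /\ ~ U a].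
Let sI : subgrp I.
Proof.
split=> [|a b [Ra nUa] [Rb nUb]]; first by split=> // -[]; rewrite eqxx.
split; first exact: RB.
move=> [s0 _ Rs']; have [b0|b0] := eqVneq b 0.
  by apply: nUa; move: s0 Rs'; rewrite b0 subr0 => s0 Rs'.
have [a0|a0] := eqVneq a 0.
  apply: nUb; split=> //; rewrite -[b^-1]opprK; apply: subgrpN => //.
  by move: Rs'; rewrite a0 sub0r invrN.
have /R_valuation[Rab|Rba] : a / b != 0 by rewrite mulf_neq0 ?invr_eq0.
  apply: nUb; split=> //; rewrite (_ : b^-1 = (a / b - 1) * (a - b)^-1).
    by apply: RM => //; apply: RB.
  by field; rewrite b0 s0.
apply: nUa; split=> //; rewrite (_ : a^-1 = (1 - (a / b)^-1) * (a - b)^-1).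
  by apply: RM => //; apply: RB.
by field; rewrite a0 b0 s0.
Qed.

Let I_scale a b : R a -> I b -> I (a * b).
Proof.
move=> Ra [Rb nUb]; split; first exact: RM.
move=> [ab0 _ Rab']; apply: nUb; have [a0 b0] : a != 0 /\ b != 0 by apply/andP; rewrite -negb_or -mulf_eq0.
split=> //; rewrite (_ : b^-1 = a * (a * b)^-1); first exact: RM.
by rewrite invfM mulVKf.
Qed.

Let UI a b : U a -> I b -> U (a + b).
Proof.
move=> Ua Ib; have [[a0 Ra Ra'] [Rb _]] := (Ua, Ib).
apply: contrapT => nU.
have /(subgrpB sI)/(_ Ib) : I (a + b) by split=> //; apply: subgrpD.
by rewrite addrK => -[_]; apply.
Qed.

Let Iy : I y. Proof. by split=> // -[]. Qed.

Let pev_factor c : c != 0 -> exists n u, U u /\ pev iota y c = y ^+ n * u.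
Proof.
have [n] := ubnP (size c); elim: n c => // n IH c ltc c0.
have [c00|c00] := eqVneq c`_0 0; last first.
  exists 0%N, (pev iota y c); rewrite expr0 mul1r; split=> //.
  rewrite -(poly_take_drop 1 c) rmorphD rmorphM /= expr1 pevX.
  have -> : take_poly 1 c = (c`_0)%:P.
    by apply/polyP => i; rewrite coef_take_poly coefC; case: i.
  rewrite pevC; apply: UI; first exact: U_const.
  apply: I_scale => //; rewrite pevE; apply: subgrp_sum => // i _.
  by apply/RM/RX.
have E : c = drop_poly 1 c * 'X.
  rewrite -{1}(poly_take_drop 1 c) expr1 (_ : take_poly 1 c = 0) ?add0r //.
  by apply/polyP => i; rewrite coef_take_poly coef0; case: i.
have d0 : drop_poly 1 c != 0 by apply: contraNneq c0 => d0; rewrite E d0 mul0r.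
have [|//|m [u [Uu e]]] := IH (drop_poly 1 c).
  by rewrite size_drop_poly; move: ltc; rewrite -size_poly_gt0 in c0; lia.
exists m.+1, u; split=> //; rewrite {1}E rmorphM /= pevX e exprSr; ring.
Qed.

(* In a vanishing sum, the terms of least value cannot be unique. *)
Let dominant (J : finType) (a : J -> k) : (exists i, a i != 0) -> \sum_i a i = 0 ->
  exists i j, [/\ i != j, a i != 0, a j != 0 & U (a i / a j)].
Proof.
move=> [i0 ai0] a_sum.
have [m am0 mmin] : exists2 m, a m != 0 & forall i, R (a i / a m).
  suff [m am0 mmin] : exists2 m, a m != 0 & forall i, i \in enum J -> R (a i / a m).
    by exists m => // i; apply: mmin; rewrite mem_enum.
  elim: (enum J) => [|j s [m am0 IH]]; first by exists i0.
  have [Rjm|nRjm] := pselect (R (a j / a m)).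
    by exists m => // i; rewrite inE => /predU1P[->//|/IH].
  have aj0 : a j != 0 by apply: contra_not_neq nRjm => ->; rewrite mul0r.
  exists j => // i; rewrite inE => /predU1P[->|/IH Ri]; first by rewrite divff.
  have [|//|Rmj] := @R_valuation (a j / a m); first by rewrite mulf_neq0 ?invr_eq0.
  rewrite (_ : a i / a j = a i / a m * (a j / a m)^-1); first exact: RM.
  by field; rewrite am0 aj0.
apply: contrapT => H.
have : I (\sum_(i | i != m) a i / a m).
  apply: subgrp_sum => // i nim; split=> // Ui; apply: H; exists i, m; split=> //.
  by case: Ui => + _ _; apply: contraNneq => ->; rewrite mul0r.
rewrite -mulr_suml; have -> : \sum_(i | i != m) a i = - a m.
  by apply/eqP; rewrite -addr_eq0 addrC; move: a_sum; rewrite (bigD1 m) //= => ->.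
rewrite mulNr divff // => -[_]; apply; split=> //; rewrite ?oppr_eq0 ?oner_eq0 //.
  by rewrite -[-1]sub0r; apply: RB.
by rewrite invrN1 -[-1]sub0r; apply: RB.
Qed.

Let power_value : exists2 N, (0 < N)%N &
  forall x, x != 0 -> exists z : int, U (x ^+ N / y ^ z).
Proof.
have [N hN] := ff_rank ffk y; exists N`!; first exact: fact_gt0.
move=> x x0; have [c [[i ci0] e]] := hN (fun i => x ^+ i).
have fac (j : 'I_N.+1) : exists nu : nat * k,
    c j != 0 -> U nu.2 /\ pev iota y (c j) = y ^+ nu.1 * nu.2.
  have [->|/pev_factor[n [u H]]] := eqVneq (c j) 0; last by exists (n, u).
  by exists (0%N, 0) => /eqP.
have [nu hnu] := choice fac.
have pc0 j : c j != 0 -> pev iota y (c j) != 0.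
  by move=> cj; apply: nonalg_pev.
have [|p [q [npq]]] := @dominant _ (fun i => pev iota y (c i) * x ^+ i) _ e.
  by exists i; rewrite mulf_neq0 ?expf_neq0 ?pc0.
rewrite !mulf_eq0 !negb_or !expf_eq0 (negPf x0) !andbF !andbT => cp0 cq0.
have {}cp0 : c p != 0 by apply: contraNneq cp0 => ->; rewrite rmorph0.
have {}cq0 : c q != 0 by apply: contraNneq cq0 => ->; rewrite rmorph0.
wlog ltqp : p q npq cp0 cq0 / (q < p)%N.
  move=> wl; have [lt|lt|E] := ltngtP q p; last by move/eqP: npq => []; apply: val_inj.
    exact: wl.
  by rewrite -[_ / _]invf_div => /UV; rewrite invrK; apply: wl => //; rewrite eq_sym.
have [Up ->] := hnu _ cp0; have [Uq ->] := hnu _ cq0 => Upq.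
pose d := (p - q)%N.
have Ud : U (x ^+ d / y ^ ((nu q).1%:Z - (nu p).1%:Z)).
  have [up0 _ _] := Up; have [uq0 _ _] := Uq.
  rewrite (_ : _ / _ = y ^+ (nu p).1 * (nu p).2 * x ^+ p / (y ^+ (nu q).1 * (nu q).2 * x ^+ q) * ((nu q).2 / (nu p).2)).
    by apply: UM => //; apply: UM => //; apply: UV.
  rewrite expfzDr // -invr_expz -!exprnP -[in RHS](subnK (ltnW ltqp)) exprD -/d.
  by field; rewrite !expf_neq0 // up0 uq0.
have ltdN : (0 < d <= N)%N by have := ltn_ord p; lia.
have /dvdnP[m mE] : (d %| N`!)%N by rewrite dvdn_fact.
exists (((nu q).1%:Z - (nu p).1%:Z) * m).
by rewrite mE mulnC exprM -exprz_exp -exprnP -exprVn -exprMn; apply: UX.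
Qed.

Let yz_unit z : R (y ^ z) -> 0 <= z.
Proof.
case: z => // n; rewrite NegzE => Ry'; exfalso; apply: nRVy.
rewrite (_ : y^-1 = y ^ (- n.+1%:Z) * y ^+ n); first exact/RM/RX.
by rewrite -exprnN exprS invfM -mulrA mulVf ?mulr1 // expf_neq0.
Qed.

Lemma maximal_place : exists2 w : k -> int, is_place iota w & 0 < w y.
Proof.
have [N N0 hN] := power_value.
have valP (x : k) : exists z : int, if x == 0 then z = 0 else U (x ^+ N / y ^ z).
  by case: eqVneq => [_|x0]; [exists 0 | exact: hN].
have [om omP] := choice valP.
have om0 : om 0 = 0 by have := omP 0; rewrite eqxx.
have omU x : x != 0 -> U (x ^+ N / y ^ (om x)).
  by have := omP x; case: eqVneq.
have yz0 z : y ^ z != 0 by rewrite expfz_neq0.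
have omE x z : x != 0 -> U (x ^+ N / y ^ z) -> om x = z.
  move=> x0 Uz; have Uo := omU x x0.
  have key a b : U (x ^+ N / y ^ a) -> U (x ^+ N / y ^ b) -> a <= b.
    move=> Ua /UV Ub; rewrite -subr_ge0; apply: yz_unit.
    have [_ + _] := UM Ua Ub; congr (R _).
    rewrite expfzDr // -invr_expz.
    by field; rewrite !yz0 expf_neq0.
  by apply/eqP; rewrite eq_le !key.
have omM x z : x != 0 -> z != 0 -> om (x * z) = om x + om z.
  move=> x0 z0; apply: omE; first by rewrite mulf_neq0.
  rewrite exprMn expfzDr // invfM mulrACA; exact: UM (omU _ x0) (omU _ z0).
have omX x n : x != 0 -> om (x ^+ n) = om x *+ n.
  move=> x0; elim: n => [|n IH].
    by apply: omE; rewrite ?oner_eq0 // expr0z divr1 expr1n.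
  by rewrite exprS omM ?expf_neq0 // IH mulrS.
have omV x : x != 0 -> om x^-1 = - om x.
  move=> x0; apply/eqP; rewrite -addr_eq0 -omM ?invr_eq0 // mulVf //.
  by rewrite (omX 1 0%N) ?oner_eq0 // mulr0n.
have omR x : x != 0 -> R x -> 0 <= om x.
  move=> x0 Rx; apply: yz_unit.
  rewrite (_ : y ^ om x = x ^+ N * (x ^+ N / y ^ om x)^-1).
    by have [_ _] := omU x x0; apply/RM/RX.
  by field; rewrite yz0 expf_neq0.
have Rom x : x != 0 -> 0 <= om x -> R x.
  move=> x0 ge; have [//|Rx'] := R_valuation x0.
  have := omR _ _ Rx'; rewrite invr_eq0 omV // => /(_ x0); rewrite oppr_ge0 => le.
  have o0 : om x = 0 by apply/eqP; rewrite eq_le le.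
  have := omU _ x0; rewrite o0 expr0z divr1 => -[_ RxN _].
  rewrite (_ : x = x ^+ N * x^-1 ^+ N.-1); first exact/RM/RX.
  by rewrite -{1}(prednK N0) exprS exprVn mulfK // expf_neq0.
have omD x z : x != 0 -> z != 0 -> x + z != 0 -> Num.min (om x) (om z) <= om (x + z).
  wlog Rxz : x z / R (x / z).
    move=> wl x0 z0 xz0; have [|Rxz|Rzx] := @R_valuation (x / z).
    - by rewrite mulf_neq0 ?invr_eq0.
    - exact: wl.
    - by rewrite minC addrC; apply: wl => //; rewrite 1?addrC // -invf_div.
  move=> x0 z0 xz0; rewrite ge_min; apply/orP; right.
  have -> : x + z = z * (x / z + 1) by rewrite mulrDr mulr1 mulrCA divff ?mulr1.
  have s0 : x / z + 1 != 0.
    by rewrite -(divff z0) -mulrDl mulf_neq0 ?invr_eq0.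
  rewrite omM // lerDl; apply: omR => //; exact: subgrpD.
have omy : om y = N by apply: omE => //; rewrite -exprnP divff ?expf_neq0.
have exd : exists d, `[< exists2 x, x != 0 & om x = d.+1 >].
  by exists N.-1; apply/asboolP; exists y => //; rewrite omy prednK.
case: (ex_minnP exd) => d /asboolP[x1 x10 ox1] dmin.
have div x : x != 0 -> (om x = (om x %/ d.+1)%Z * d.+1)%R.
  move=> x0; have E := divz_eq (om x) d.+1.
  have r0 : (om x %% d.+1)%Z >= 0 by rewrite modz_ge0.
  have rd : (om x %% d.+1)%Z < d.+1 by rewrite ltz_mod.
  suff r0' : (om x %% d.+1)%Z = 0 by rewrite {1}E r0' addr0.
  apply/eqP; rewrite eq_le r0 andbT leNgt; apply/negP => rgt.
  have xz : exists2 x', x' != 0 & om x' = (om x %% d.+1)%Z.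
    have E' : (om x %% d.+1)%Z = om x - (om x %/ d.+1)%Z * d.+1 by rewrite {2}E; ring.
    rewrite E'; case: (om x %/ d.+1)%Z => m.
      exists (x / x1 ^+ m); first by rewrite mulf_neq0 ?invr_eq0 ?expf_neq0.
      rewrite omM ?invr_eq0 ?expf_neq0 // omV ?expf_neq0 // omX // ox1.
      by rewrite -mulr_natr natz mulrC.
    exists (x * x1 ^+ m.+1); first by rewrite mulf_neq0 ?expf_neq0.
    rewrite omM ?expf_neq0 // omX // ox1 NegzE mulNr opprK.
    by rewrite -mulr_natr natz mulrC.
  have [x' x'0 ox'] := xz.
  have := dmin (absz (om x %% d.+1)%Z).-1; rewrite leqNgt => H.
  have : (absz (om x %% d.+1)%Z).-1 \in predT by [].
  suff : ~~ ((absz (om x %% d.+1)%Z).-1 < d)%N by lia.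
  by apply: H; apply/asboolP; exists x' => //; rewrite ox'; lia.
have d0 : (0 : int) < d.+1 by [].
exists (fun x => (om x %/ d.+1)%Z); last first.
  by have := div _ y0; rewrite omy; nia.
split.
- by rewrite om0 div0z.
- move=> x z x0 z0; apply: (mulIf (lt0r_neq0 d0)).
  by rewrite mulrDl -!div ?mulf_neq0 // omM.
- move=> x z x0 z0 xz0; have := omD _ _ x0 z0 xz0.
  by rewrite (div _ x0) (div _ z0) (div _ xz0) !mulzK // -minr_pMl // ler_pM2r.
- move=> c c0; rewrite (_ : om _ = 0) ?div0z //.
  by apply: omE; rewrite ?fmorph_eq0 // expr0z divr1; apply/UX/U_const.
- exists x1 => //; by rewrite ox1 divzz.
Qed.

End Maximal.

Lemma place_exists : exists2 w : k -> int, is_place iota w & 0 < w y.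
Proof. by have [R gR maxR] := ex_max; apply: maximal_place gR maxR. Qed.

End PlaceExistence.

Section Approximation.
Variables (F k : fieldType) (iota : {rmorphism F -> k}).

Lemma place_le_eq (v w : k -> int) : is_place iota v -> is_place iota w ->
  (forall x, x != 0 -> 0 <= v x -> 0 <= w x) -> w = v.
Proof.
move=> pv pw le; have eq0 x : x != 0 -> v x = 0 -> w x = 0.
  move=> x0 vx; apply/eqP; rewrite eq_le le ?vx // andbT -oppr_ge0 -(plV pw).
  by apply: le; rewrite ?invr_eq0 // (plV pv) vx oppr0.
have [a a0 va] := vge_uniformizer pv.
have wE x : x != 0 -> w x = w a * v x.
  move=> x0; have : w (x * a ^ (- v x)) = 0.
    apply: eq0; first by rewrite mulf_neq0 ?expfz_neq0.
    rewrite (plM pv) ?expfz_neq0 //; case: (v x) => n.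
      by rewrite -exprnN (plV pv) (plX pv) va natz subrr.
    by rewrite NegzE opprK -exprnP (plX pv) va natz addrC subrr.
  rewrite (plM pw) ?expfz_neq0 //; case: (v x) => n.
    by rewrite -exprnN (plV pw) (plX pw) -mulr_natr natz => /eqP; rewrite subr_eq0 => /eqP.
  rewrite NegzE opprK -exprnP (plX pw) -mulr_natr natz => /eqP.
  by rewrite addr_eq0 mulrN => /eqP.
have [b b0 wb] := vge_uniformizer pw; have := wE _ b0; rewrite wb => wab.
have wa1 : w a = 1 by have := le _ a0; rewrite va => /(_ isT); have [] := leP 1 (v b); nia.
apply/funext => x; have [->|x0] := eqVneq x 0; first by rewrite (pl0 pv) (pl0 pw).
by rewrite wE // wa1 mul1r.
Qed.

Lemma separate2 (v w : k -> int) : is_place iota v -> is_place iota w -> w <> v ->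
  exists2 z, 0 < v z & w z < 0.
Proof.
have half v' w' : is_place iota v' -> is_place iota w' -> w' <> v' ->
    exists x, [/\ x != 0, 0 <= v' x & w' x < 0].
  move=> pv pw nwv; apply: contrapT => H; apply: nwv; apply: place_le_eq => // x x0 vx.
  by rewrite leNgt; apply/negP => wx; apply: H; exists x.
move=> pv pw nwv; have [x [x0 vx wx]] := half v w pv pw nwv.
have [y [y0 wy vy]] := half w v pw pv (fun e => nwv (esym e)).
exists (x / y); rewrite ?(plM pv) ?(plM pw) ?invr_eq0 // ?(plV pv) ?(plV pw); lia.
Qed.

Lemma neg_add (w : k -> int) z z' m : is_place iota w ->
  (w z < 0 /\ - w z < m%:Z \/ [/\ 0 <= w z, w z' < 0 & (0 < m)%N]) ->
  z + z' ^+ m != 0 /\ w (z + z' ^+ m) < 0.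
Proof.
move=> pw H.
have gen x y : x != 0 -> w x < 0 -> vge w (w x + 1) y -> x + y != 0 /\ w (x + y) < 0.
  by move=> x0 wx /(vge_addl pw x0)[xy0 ->].
have n0 x : w x < 0 -> x != 0 by case: eqVneq => [->|//]; rewrite (pl0 pw).
case: H => [[wz lt]|[wz wz' m0]].
  have [z'0|z'0] := ltP (w z') 0; last first.
    apply: (gen _ _ (n0 _ wz) wz); apply: vge_le (vgeX pw m (vge_id w z')).
    by nia.
  rewrite addrC; have z'n := n0 _ z'0.
  apply: gen; rewrite ?expf_neq0 // (plX pw) -mulr_natr natz; first nia.
  by apply: vge_le (vge_id w z); nia.
rewrite addrC; apply: gen; rewrite ?expf_neq0 ?n0 // (plX pw) -mulr_natr natz; first nia.
by apply: vge_le (vge_id w z); nia.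
Qed.

Lemma separate (v : k -> int) s (ws : nat -> k -> int) : is_place iota v ->
    (forall i, (i < s)%N -> is_place iota (ws i) /\ ws i <> v) ->
  exists2 z, 0 < v z & forall i, (i < s)%N -> ws i z < 0.
Proof.
move=> pv; elim: s => [|s IH] H.
  by have [z _ vz] := vge_uniformizer pv; exists z; rewrite ?vz.
have [i lt|z vz wz] := IH; first by apply: H; apply: ltnW.
have [pw nw] := H s (leqnn _); have [z' vz' wz'] := separate2 pv pw nw.
pose m := (\sum_(i < s.+1) `|ws i z|%N).+1.
have ltm i : (i < s.+1)%N -> - ws i z < m%:Z.
  by move=> lt; rewrite /m (bigD1 (Ordinal lt)) //=; lia.
have nz : z + z' ^+ m != 0 /\ ws s (z + z' ^+ m) < 0.
  apply: neg_add => //; have [lt|ge] := ltP (ws s z) 0; [left | right] => //.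
  by split=> //; apply: ltm.
exists (z + z' ^+ m) => [|i].
  rewrite gtz0_ge1; apply/(vgeE v 1 nz.1)/(vgeD pv); first by right; rewrite -gtz0_ge1.
  apply: vge_le (vgeX pv m (vge_id v z')).
  by rewrite -mulr_natr natz /m; nia.
rewrite ltnS leq_eqVlt => /predU1P[->|lt]; first exact: nz.2.
have [pwi _] := H i (ltnW lt).
by apply: (neg_add (z' := z') (m := m) pwi _).2; left; split; [exact: wz | apply/ltm/ltnW].
Qed.

Lemma approximation (v : k -> int) s (ws : nat -> k -> int) (M : nat) : is_place iota v ->
    (forall i, (i < s)%N -> is_place iota (ws i) /\ ws i <> v) ->
  exists2 th, vge v M (th - 1) & forall i, (i < s)%N -> vge (ws i) M th.
Proof.
move=> pv H; have [z vz wz] := separate pv H.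
have vzM : vge v M.+1 (z ^+ M.+1).
  by right; rewrite (plX pv) -mulr_natr natz; nia.
have [d0 vd] : 1 + z ^+ M.+1 != 0 /\ v (1 + z ^+ M.+1) = 0.
  rewrite -[X in _ /\ _ = X](pl1 pv); apply: (vge_addl pv); first exact: oner_neq0.
  by rewrite (pl1 pv); apply: vge_le vzM; lia.
exists (1 + z ^+ M.+1)^-1.
  rewrite (_ : _ - 1 = - z ^+ M.+1 * (1 + z ^+ M.+1)^-1); last by field; rewrite d0.
  rewrite -[M%:Z]addr0; apply: (vgeM pv).
    by apply: (vgeN pv); apply: vge_le vzM; lia.
  by right; rewrite (plV pv) vd oppr0.
move=> i lt; have [pw _] := H i lt; have wzi := wz i lt; right.
have z0 : z != 0 by apply/eqP => z0; rewrite z0 (pl0 pw) in wzi.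
rewrite (plV pw) addrC.
have [||_ ->] := @vge_addl _ _ _ _ pw (z ^+ M.+1) 1; first by rewrite expf_neq0.
  apply: vge_le (vge1 pw); rewrite (plX pw) -mulr_natr natz; nia.
by rewrite (plX pw) -mulr_natr natz; nia.
Qed.
End Approximation.

Lemma indexp_filtration (V : zmodType) (X : int -> set V) c :
    (forall N, subgrp (X N)) -> (forall N, X (N + 1) `<=` X N) ->
    (forall N, indexp (X N) (X (N + 1)) c) ->
  forall N m, indexp (X (N - m%:Z)) (X N) (c ^ m).
Proof.
move=> sX dX XX N m.
have sub N' m' : X (N' + m'%:Z) `<=` X N'.
  elim: m' => [|m' IH] x; first by rewrite addr0.
  by rewrite -addn1 PoszD addrA => /dX/IH.
elim: m => [|m IH]; first by rewrite subr0; apply: indexp1.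
rewrite expnS; apply: (@indexpM _ _ (X (N - m%:Z))) => //.
- by move=> x Xx; apply: dX; have -> : N - m.+1%:Z + 1 = N - m%:Z by lia.
- by move=> x Xx; apply: (sub _ m); rewrite subrK.
- by have := XX (N - m.+1%:Z); have -> : N - m.+1%:Z + 1 = N - m%:Z by lia.
Qed.

Lemma indexp_coarser (V : zmodType) (X Y Z : set V) a : subgrp X -> subgrp Y -> subgrp Z ->
  Z `<=` Y -> Y `<=` X -> indexp X Z a -> exists d, indexp X Y d.
Proof.
move=> sX sY sZ ZY YX XZ; have [|d _ Xd] := @indexp_ex _ X Y a sY _; last by exists d.
move=> g Xg; have [|i [j [nij Zij]]] := index_collision sZ XZ _ Xg.
  by rewrite card_ord.
by exists i, j; split=> //; apply: ZY.
Qed.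

Section Riemann.
Variables (F : finFieldType) (k : fieldType) (iota : {rmorphism F -> k}).
Hypothesis ffk : is_function_field iota.
Hypothesis constants : algebraically_closed_in iota.

Local Notation q := #|F|.

Lemma place_nonalg w x : is_place iota w -> w x != 0 -> ~ algebraicOver iota x.
Proof. by move=> pw + /constants[c E]; rewrite E (pl_const pw) eqxx. Qed.

Lemma pev_inv y (c : {poly F}) D : y != 0 -> (size c <= D.+1)%N ->
  y ^+ D * pev iota y^-1 c = iota c`_D + y * pev iota y (\poly_(j < D) c`_(D.-1 - j)).
Proof.
move=> y0 szc; rewrite /pev (@horner_coef_wide _ D.+1) ?size_map_poly // (@horner_coef_wide _ D); last first.
  by rewrite size_map_poly size_poly.
rewrite big_ord_recr /= mulrDr addrC !coef_map /=; congr (_ + _).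
  by rewrite mulrCA -exprMn mulfV // expr1n mulr1.
rewrite !mulr_sumr (reindex_inj rev_ord_inj) /=; apply: eq_bigr => j _.
rewrite !coef_map /= coef_poly ltn_ord.
have -> : (D - j.+1 = D.-1 - j)%N by lia.
rewrite [X in X * _ = _](_ : y ^+ D = y * y ^+ j * y ^+ (D.-1 - j)); last first.
  by rewrite -exprS -exprD; congr (_ ^+ _); have := ltn_ord j; lia.
by rewrite exprVn; field; rewrite expf_neq0.
Qed.

Lemma rank_max (t : k) : exists n, exists u : 'I_n -> k,
  (forall c : 'I_n -> {poly F}, \sum_i pev iota t (c i) * u i = 0 -> forall i, c i = 0) /\
  forall x : 'I_n.+1 -> k, exists c : 'I_n.+1 -> {poly F},
    (exists i, c i != 0) /\ \sum_i pev iota t (c i) * x i = 0.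
Proof.
pose indep n (u : 'I_n -> k) := forall c : 'I_n -> {poly F},
  \sum_i pev iota t (c i) * u i = 0 -> forall i, c i = 0.
have [N hN] := ff_rank ffk t.
pose Pr n := `[< exists u : 'I_n -> k, indep n u >].
have P0 : exists n, Pr n by exists 0%N; apply/asboolP; exists (fun=> 0) => c _ [].
have Pub n : Pr n -> (n <= N)%N.
  move=> /asboolP[u indu]; rewrite leqNgt; apply/negP => lt.
  have [c [[i ci0] e]] := hN (fun i => u (widen_ord lt i)).
  pose b (j : 'I_n) : {poly F} := if insub (val j) is Some i then c i else 0.
  move/eqP: ci0; apply; have -> : c i = b (widen_ord lt i) by rewrite /b /= valK.
  apply: indu; rewrite -[RHS]e.
  rewrite (bigID (fun j : 'I_n => (j < N.+1)%N)) /= [X in _ + X]big1 ?addr0.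
    by rewrite (big_ord_narrow lt); apply: eq_bigr => j _; rewrite /b /= valK.
  by move=> j /negPf nj; rewrite /b insubF // rmorph0 mul0r.
case: (ex_maxnP P0 Pub) => n /asboolP[u indu] nmax; exists n, u; split=> // x.
apply: contrapT => H; suff /nmax : Pr n.+1 by rewrite ltnn.
apply/asboolP; exists x => c e i; apply/eqP; apply: contrapT => /negP ci0.
by apply: H; exists c; split=> //; exists i.
Qed.

Lemma leading_dep y n (c : 'I_n -> {poly F}) (x : 'I_n -> k) : y != 0 ->
    (exists i, c i != 0) -> \sum_i pev iota y^-1 (c i) * x i = 0 ->
  exists (a : 'I_n -> F) (e : 'I_n -> {poly F}), (exists i, a i != 0) /\
    \sum_i iota (a i) * x i = - (y * \sum_i pev iota y (e i) * x i).
Proof.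
move=> y0 [i0 ci0] E; pose D := (\max_i size (c i)).-1.
have szc i : (size (c i) <= D.+1)%N.
  by have := @leq_bigmax _ (fun i => size (c i)) i; rewrite /D; lia.
exists (fun i => (c i)`_D), (fun i => \poly_(j < D) (c i)`_(D.-1 - j)); split.
  have [|i Ei] := @bigop.eq_bigmax 'I_n (fun i => size (c i)); first by apply/card_gt0P; exists i0.
  exists i; rewrite /D Ei -lead_coefE lead_coef_eq0 -size_poly_gt0 -Ei.
  by apply: leq_trans (@leq_bigmax _ (fun i => size (c i)) i0); rewrite size_poly_gt0.
apply/eqP; rewrite -addr_eq0 mulr_sumr -big_split /=.
have := congr1 ( *%R (y ^+ D)) E; rewrite mulr0 mulr_sumr => E'; apply/eqP.
apply: etrans E'; apply: eq_bigr => i _.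
by rewrite [RHS]mulrA pev_inv // mulrDl !mulrA.
Qed.

Section Zeros.
Variables (y : k) (s : nat) (ws : nat -> k -> int).
Hypothesis y0 : y != 0.
Hypothesis pws : forall i, (i < s)%N -> is_place iota (ws i) /\ 0 < ws i y.

Definition zeros_ge (N : int) : set k :=
  [set x | forall i, (i < s)%N -> vge (ws i) (N * ws i y) x].

Lemma zeros_ge_subgrp N : subgrp (zeros_ge N).
Proof.
split=> [i _|x z Zx Zz i lt]; first exact: vge0.
by have [pw _] := pws lt; apply: (subgrpB (vge_subgrp pw _)); [apply: Zx | apply: Zz].
Qed.

Lemma zeros_ge_le N N' : N <= N' -> zeros_ge N' `<=` zeros_ge N.
Proof. by move=> le x Zx i lt; have [_ wy] := pws lt; apply: vge_le (Zx i lt); nia. Qed.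

Lemma vge_pev w p : is_place iota w -> vge w 0 y -> vge w 0 (pev iota y p).
Proof.
move=> pw wy; rewrite pevE; apply: (vge_sum pw) => i _; apply: (vgeM0 pw); first exact: vge_const.
by have := vgeX pw i wy; rewrite mul0rn.
Qed.

Lemma zeros_index n :
  (forall x : 'I_n.+1 -> k, exists c : 'I_n.+1 -> {poly F},
    (exists i, c i != 0) /\ \sum_i pev iota y^-1 (c i) * x i = 0) ->
  exists2 m, (m <= n)%N & forall N, indexp (zeros_ge N) (zeros_ge (N + 1)) (q ^ m).
Proof.
move=> dep.
have [|||||||||||m lemn H] := @index_dependence k k^o (range iota) [set 0] (zeros_ge 0) (zeros_ge 1) q n.
- by split=> [|_ _ [a _ <-] [b _ <-]]; [exists 0; rewrite ?rmorph0 | exists (a - b); rewrite ?rmorphB].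
- exact: subgrp_set0.
- by move=> _ _ [a _ <-] [b _ <-]; exists (a * b); rewrite ?rmorphM.
- by move=> _ [a _ <-] _; exists a^-1; rewrite ?fmorphV.
- apply: (@indexp_fin _ _ _ _ iota) => [a|a b|_ [a _ <-]]; first by exists a.
    by rewrite -rmorphB => /eqP; rewrite fmorph_eq0 subr_eq0 => /eqP.
  by exists a; rewrite subrr.
- exact: zeros_ge_subgrp.
- exact: zeros_ge_subgrp.
- move=> _ x [a _ <-] Zx i lt; have [pw _] := pws lt.
  by rewrite -[_ * _]add0r; apply: (vgeM pw (vge_const pw _)); apply: Zx.
- move=> _ x [a _ <-] Zx i lt; have [pw _] := pws lt.
  by rewrite -[_ * _]add0r; apply: (vgeM pw (vge_const pw _)); apply: Zx.
- move=> _ x -> _ i lt; rewrite scale0r; exact: vge0.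
- move=> x Zx; have [c [c0 E]] := dep x.
  have [a [e [[i0 ai0] Ea]]] := leading_dep y0 c0 E.
  exists (fun i => iota (a i)); split; first by move=> i; exists (a i).
    by exists i0 => /eqP; rewrite fmorph_eq0 (negPf ai0).
  move=> j lt; rewrite [\sum_i _]Ea; have [pw wy] := pws lt.
  apply: (vgeN pw); rewrite -[_ * _]addr0; apply: (vgeM pw).
    by rewrite mul1r; apply: vge_id.
  apply: (vge_sum pw) => i _; apply: (vgeM0 pw).
    by apply: vge_pev => //; right; apply: ltW.
  by have := Zx i j lt; rewrite mul0r.
exists m => // N.
have shift x M : zeros_ge M x <-> zeros_ge (N + M) (y ^ N * x).
  have wN i : (i < s)%N -> N * ws i y = ws i (y ^ N).
    move=> lt; have [pw _] := pws lt; case: (N) => n'.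
      by rewrite -exprnP (plX pw) -mulr_natl natz.
    by rewrite NegzE -exprnN (plV pw) (plX pw) -mulr_natl natz mulNr.
  split=> Zx i lt; have [pw _] := pws lt; move: (Zx i lt).
    by rewrite mulrDl => /(vgeMl pw (M * ws i y) x (expfz_neq0 N y0) (wN i lt)).
  by rewrite mulrDl => /(vgeMl pw (M * ws i y) x (expfz_neq0 N y0) (wN i lt)).
apply/(indexp_iso (f := lmul (y ^ N)) (X := zeros_ge 0) (Y := zeros_ge 1)) => //.
- exact: zeros_ge_subgrp.
- by move=> x /shift; rewrite addr0.
- by move=> x _; symmetry; apply: shift.
- exact: zeros_ge_subgrp.
- move=> x Zx; exists (y ^ (- N) * x); last first.
    rewrite /= /lmul mulrA -expfzDr // subrr expr0z mul1r subrr => i _; exact: vge0.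
  apply/shift; rewrite mulrA -expfzDr // subrr expr0z mul1r addr0 //.
Qed.

Lemma zeros_index_pow n :
  (forall x : 'I_n.+1 -> k, exists c : 'I_n.+1 -> {poly F},
    (exists i, c i != 0) /\ \sum_i pev iota y^-1 (c i) * x i = 0) ->
  exists2 m, (m <= n)%N & forall N : nat, indexp (zeros_ge (- N%:Z)) (zeros_ge 0) ((q ^ m) ^ N).
Proof.
move=> /zeros_index[m lemn H]; exists m => // N; rewrite -sub0r.
apply: (indexp_filtration zeros_ge_subgrp _ H) => N'.
by apply: zeros_ge_le; rewrite lerDl.
Qed.
End Zeros.

Lemma place_residue w : is_place iota w ->
  exists2 c, (1 < c)%N & forall N, indexp (vge w N) (vge w (N + 1)) c.
Proof.
move=> pw; have [y y0 wy] := vge_uniformizer pw.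
have [n [u [_ dep]]] := rank_max y^-1.
have pws i : (i < 1)%N -> is_place iota w /\ 0 < w y by rewrite wy.
have [m _ H] := @zeros_index y 1 (fun=> w) y0 pws _ dep.
have E N : zeros_ge y 1 (fun=> w) N = vge w N.
  apply/seteqP; split=> x; first by move/(_ 0%N isT); rewrite wy mulr1.
  by move=> vx i _; rewrite wy mulr1.
exists (q ^ m)%N; last by move=> N; rewrite -!E.
have := H 0; rewrite !E add0r => ind.
have n1 : ~ vge w 1 (1 : k) by move/(vgeE _ _ (oner_neq0 k)); rewrite (pl1 pw).
rewrite -card_bool.
apply: (indexp_ub (g := fun b : bool => if b then 1 else 0 : k) (vge_subgrp pw 1) ind).
  by case; [exact: (vge1 pw) | exact: vge0].
case=> -[] //; first by rewrite subr0 => /n1.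
by rewrite sub0r => /(vgeN pw); rewrite opprK => /n1.
Qed.

Lemma distinct_zeros_ub y : y != 0 -> exists n, forall s (ws : nat -> k -> int),
  (forall i, (i < s)%N -> is_place iota (ws i) /\ 0 < ws i y) ->
  (forall i j, (i < s)%N -> (j < s)%N -> ws i = ws j -> i = j) -> (s <= n)%N.
Proof.
move=> y0; have [n [u [_ dep]]] := rank_max y^-1; exists n => s ws pws ws_inj.
rewrite leqNgt; apply/negP => lt.
have /choice[th hth] (i : 'I_n.+1) : exists th, vge (ws i) 1 (th - 1) /\
    forall j, (j < s)%N -> j != i -> vge (ws j) 1 th.
  have lti : (i < s)%N by apply: leq_trans lt.
  have [pwi _] := pws _ lti.
  have [j ltj|th h1 h2] := @approximation _ _ iota (ws i) s.-1 (fun j => ws (bump i j)) 1 pwi.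
    have ltb : (bump i j < s)%N by rewrite /bump; lia.
    have [pwj _] := pws _ ltb; split=> // /ws_inj => /(_ ltb lti)/eqP.
    by rewrite eq_sym (negPf (neq_bump _ _)).
  exists th; split=> // j ltj nij; have <- : bump i (unbump i j) = j by rewrite unbumpKcond (negPf nij).
  by apply: h2; move: nij; rewrite /unbump; lia.
have [c [c0 E]] := dep th.
have [a [e [[i0 ai0] Ea]]] := leading_dep y0 c0 E.
have lti0 : (i0 < s)%N by apply: leq_trans lt.
have [pw wy] := pws _ lti0.
have thge i : vge (ws i0) 0 (th i).
  have [h1 h2] := hth i; have [E0|nE] := eqVneq i0 i.
    rewrite -[th i](subrK 1); apply: (vgeD pw); last exact: (vge1 pw).
    by rewrite -E0 in h1 *; apply: vge_le h1.
  by apply: vge_le (h2 _ lti0 nE).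
have ge1 : vge (ws i0) 1 (\sum_i iota (a i) * th i).
  rewrite Ea; apply: (vgeN pw); rewrite -[1]addr0; apply: (vgeM pw).
    by right; rewrite -gtz0_ge1.
  apply: (vge_sum pw) => i _; apply: (vgeM0 pw) => //.
  by apply: (@vge_pev y) => //; right; apply: ltW.
have : vge (ws i0) 1 (iota (a i0)).
  rewrite (bigD1 i0) //= in ge1.
  have ge2 : vge (ws i0) 1 (\sum_(i | i != i0) iota (a i) * th i).
    apply: (vge_sum pw) => i ni; rewrite -[1]add0r; apply: (vgeM pw (vge_const pw _)).
    by have [_] := hth i; apply=> //; rewrite eq_sym.
  have ge3 : vge (ws i0) 1 (iota (a i0) * (th i0 - 1)).
    by rewrite -[1]add0r; apply: (vgeM pw (vge_const pw _)); case: (hth i0).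
  have := vgeD pw (vgeD pw ge1 (vgeN pw ge2)) (vgeN pw ge3).
  by rewrite addrK mulrBr opprB mulr1 addrCA subrr addr0.
rewrite vgeE ?fmorph_eq0 // (pl_const pw); lia.
Qed.

Lemma zeros_enum P y : is_place iota P -> 0 < P y -> exists s (ws : nat -> k -> int),
  [/\ ws 0%N = P, forall i, (i < s.+1)%N -> is_place iota (ws i) /\ 0 < ws i y,
   forall i, (0 < i < s.+1)%N -> ws i <> P &
   forall w, is_place iota w -> 0 < w y -> exists2 i, (i < s.+1)%N & w = ws i].
Proof.
move=> pP Py; have y0 : y != 0 by apply: contraTneq Py => ->; rewrite (pl0 pP).
have [n hn] := distinct_zeros_ub y0.
pose ok s (ws : nat -> k -> int) := [/\ ws 0%N = P,
  forall i, (i < s.+1)%N -> is_place iota (ws i) /\ 0 < ws i y &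
  forall i j, (i < s.+1)%N -> (j < s.+1)%N -> ws i = ws j -> i = j].
pose Pr s := `[< exists ws, ok s ws >].
have P0 : exists s, Pr s.
  by exists 0%N; apply/asboolP; exists (fun=> P); split=> // -[|i] [|j].
have Pub s : Pr s -> (s <= n)%N.
  by move=> /asboolP[ws [_ h1 h2]]; apply: ltnW; apply: hn h1 h2.
case: (ex_maxnP P0 Pub) => s /asboolP[ws [ws0 pws ws_inj]] smax.
exists s, ws; split=> // [i /andP[i0 lti] E|w pw wy].
  by move: i0; rewrite (ws_inj i 0%N) // E ws0.
apply: contrapT => H; suff /smax : Pr s.+1 by rewrite ltnn.
apply/asboolP; exists (fun i => if i == s.+1 then w else ws i).
have nH i : (i < s.+1)%N -> w <> ws i by move=> lt E; apply: H; exists i.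
have lts i : (i < s.+2)%N -> i != s.+1 -> (i < s.+1)%N by lia.
split=> //= [i|i j] lti; first by case: eqVneq => // /(lts _ lti)/pws.
move=> ltj; case: eqVneq => [->|/(lts _ lti) lti']; case: eqVneq => [->|/(lts _ ltj) ltj'] // E.
- by case: (nH _ ltj' E).
- by case: (nH _ lti' (esym E)).
- exact: ws_inj.
Qed.

Lemma integral_multiple y x : y != 0 -> ~ algebraicOver iota y -> exists2 c : {poly F}, c != 0 &
  forall w, is_place iota w -> w y <= 0 -> vge w 0 (pev iota y^-1 c * x).
Proof.
move=> y0 nay; have nat_ : ~ algebraicOver iota y^-1.
  move=> /constants[c E]; apply: nay; rewrite -[y]invrK E -fmorphV.
  exists ('X - (c^-1)%:P); first by rewrite polyXsubC_eq0.
  by rewrite rmorphB /= map_polyX map_polyC root_XsubC.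
have [N hN] := ff_rank ffk y^-1; have [c [c0 E]] := hN (fun i => x ^+ i).
pose ok m := [exists i : 'I_N.+1, (c i != 0) && (i == m :> nat)].
have ex : exists m, ok m by case: c0 => i ci; exists i; apply/existsP; exists i; rewrite ci eqxx.
have ub m : ok m -> (m <= N)%N by move=> /existsP[i /andP[_ /eqP<-]]; rewrite -ltnS.
case: (ex_maxnP ex ub) => m /existsP[im /andP[cm0 /eqP Em]] mmax.
have big0 (i : 'I_N.+1) : (m < i)%N -> c i = 0.
  move=> lt; apply/eqP/negPn/negP => ci0; have := mmax i; rewrite leqNgt lt => H.
  by have /H : ok i by apply/existsP; exists i; rewrite ci0 eqxx.
exists (c im) => // w pw wy.
have vp p : vge w 0 (pev iota y^-1 p).
  rewrite pevE; apply: (vge_sum pw) => i _; apply: (vgeM0 pw); first exact: vge_const.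
  rewrite -(mul0rn _ i); apply: (vgeX pw); right; rewrite (plV pw) oppr_ge0 //.
have lt_mN (i : 'I_m) : (i < N.+1)%N by apply: ltn_trans (ltn_ord i) _; rewrite -Em.
pose b := pev iota y^-1 (c im).
apply: (@vge_integral _ _ _ _ pw m _
  (fun i => - (pev iota y^-1 (c (Ordinal (lt_mN i))) * b ^+ (m - i.+1)))).
  move=> i; apply/(vgeN pw)/(vgeM0 pw); first exact: vp.
  by rewrite -(mul0rn _ (m - i.+1)); apply/(vgeX pw)/vp.
case: m => [|m] in Em mmax big0 lt_mN *.
  exfalso; move: E; rewrite (bigD1 im) //= big1 ?addr0; last first.
    move=> i ni; rewrite big0 ?rmorph0 ?mul0r // lt0n.
    by apply: contraNneq ni => i0; apply/eqP/val_inj; rewrite /= i0 Em.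
  rewrite Em expr0 mulr1 => /eqP; rewrite (negPf (nonalg_pev nat_ cm0)) //.
apply/eqP; rewrite -subr_eq0 -sumrN; apply/eqP.
transitivity (b ^+ m * \sum_i pev iota y^-1 (c i) * x ^+ i); last by rewrite E mulr0.
rewrite (bigID (fun i : 'I_N.+1 => (i < m.+2)%N)) /= [X in _ = _ * (_ + X)]big1 ?addr0; last first.
  by move=> i nlt; rewrite big0 ?rmorph0 ?mul0r //; move: nlt; lia.
have le2 : (m.+2 <= N.+1)%N by rewrite -Em.
rewrite (big_ord_narrow le2) [in RHS]big_ord_recr /= [RHS]mulrDr [RHS]addrC; congr (_ + _); last first.
  rewrite mulr_sumr; apply: eq_bigr => i _; rewrite mulNr opprK.
  have -> : Ordinal (lt_mN i) = widen_ord le2 (widen_ord (leqnSn _) i) by apply: val_inj.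
  have Eb : b ^+ m = b ^+ (m - i) * b ^+ i by rewrite -exprD subnK // leq_ord.
  by rewrite subSS exprMn -/b Eb; ring.
have -> : widen_ord le2 ord_max = im by apply: val_inj; rewrite /= Em.
by rewrite -/b exprMn exprSr mulrA.
Qed.

Definition pole_space (P : k -> int) (N : nat) : set k :=
  [set x | (forall w, is_place iota w -> w <> P -> vge w 0 x) /\ vge P (- N%:Z) x].

Lemma pole_space_subgrp P N : is_place iota P -> subgrp (pole_space P N).
Proof.
move=> pP; split=> [|x z [Vx Px] [Vz Pz]]; first by split=> [w _ _|]; apply: vge0.
split=> [w pw nw|]; last exact: (subgrpB (vge_subgrp pP _)).
by apply: (subgrpB (vge_subgrp pw _)); [apply: Vx | apply: Vz].
Qed.

Section Count.
Variables (P : k -> int) (cP : nat).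
Hypotheses (pP : is_place iota P).
Hypothesis indP : forall N, indexp (vge P N) (vge P (N + 1)) cP.
Variables (y : k) (s : nat) (ws : nat -> k -> int).
Hypotheses (y0 : y != 0) (Py : P y = 1) (ws0 : ws 0%N = P).
Hypothesis pws : forall i, (i < s.+1)%N -> is_place iota (ws i) /\ 0 < ws i y.
Hypothesis nws : forall i, (0 < i < s.+1)%N -> ws i <> P.
Hypothesis all_zeros : forall w, is_place iota w -> 0 < w y ->
  exists2 i, (i < s.+1)%N & w = ws i.

Let W := zeros_ge y s.+1 ws.
Let W' N : set k := [set x | W (- N%:Z) x /\ forall i, (0 < i < s.+1)%N -> vge (ws i) 0 x].
Let V N : set k := [set x | (forall w, is_place iota w -> w y <= 0 -> vge w 0 x) /\ W (- N%:Z) x].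

Let W_sub N : subgrp (W N). Proof. by apply: zeros_ge_subgrp. Qed.

Let W'_sub N : subgrp (W' N).
Proof.
split=> [|x z [Wx Hx] [Wz Hz]].
  by split=> [|i lt]; [apply: (subgrp0 (W_sub _)) | apply: vge0].
split=> [|i lt]; first exact: (subgrpB (W_sub _)).
have [pw _] := pws (proj2 (andP lt)).
by apply: (subgrpB (vge_subgrp pw _)); [apply: Hx | apply: Hz].
Qed.

Let V_sub N : subgrp (V N).
Proof.
split=> [|x z [Vx Wx] [Vz Wz]].
  by split=> [w _ _|]; [apply: vge0 | apply: (subgrp0 (W_sub _))].
split=> [w pw wy|]; last exact: (subgrpB (W_sub _)).
by apply: (subgrpB (vge_subgrp pw _)); [apply: Vx | apply: Vz].
Qed.

Let VW'_pole N : V N `&` W' N `<=` pole_space P N.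
Proof.
move=> x [[Vx Wx] [_ W'x]]; split=> [w pw nwP|]; last first.
  by have := Wx 0%N isT; rewrite ws0 Py mulr1.
have [wy|wy] := leP (w y) 0; first exact: Vx.
have [[|i] lt E] := all_zeros pw wy; first by rewrite E ws0 in nwP.
by rewrite E; apply: W'x.
Qed.

Let index_W'_W N : indexp (W' N) (W 0) (cP ^ N).
Proof.
apply/(indexp_iso (f := idfun) (X := W' N) (Y := W 0) (X' := vge P (- N%:Z)) (Y' := vge P 0)).
- exact: vge_subgrp pP _.
- by move=> x [Wx _]; have := Wx 0%N isT; rewrite ws0 Py mulr1.
- move=> x [Wx H]; split=> [Px [|i] lt|/(_ 0%N isT)]; last by rewrite ws0 Py mul0r.
    by rewrite ws0 mul0r.
  by rewrite mul0r; apply: H.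
- exact: W'_sub.
- move=> x Px; pose M := (N + \sum_(i < s.+1) `|ws i x|)%N.
  have [i lt|th h1 h2] := @approximation _ _ iota P s (fun i => ws i.+1) M pP.
    by split; [exact: (@pws i.+1 lt).1 | exact: (@nws i.+1 lt)].
  have P0 : vge P 0 (x - th * x).
    rewrite -[X in X - _]mul1r -mulrBl -opprB mulNr; apply: (vgeN pP).
    by apply: vge_le (vgeM pP h1 Px); rewrite /M; lia.
  have w0 i : (0 < i < s.+1)%N -> vge (ws i) 0 (th * x).
    case: i => // i lt; have [pw _] := pws lt.
    apply: vge_le (vgeM pw (h2 i lt) (vge_id _ x)).
    by rewrite /M (bigD1 (Ordinal lt)) //=; lia.
  exists (th * x) => //; split=> // -[|i] lt.
    rewrite ws0 Py mulr1 -[th * x](subKr x); apply: (vgeD pP Px); apply: (vgeN pP).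
    by apply: vge_le P0; lia.
  by have [_ wy] := pws lt; apply: vge_le (w0 i.+1 lt); nia.
have := @indexp_filtration _ (vge P) cP (vge_subgrp pP) _ indP 0 N; rewrite sub0r; apply.
by move=> N' x; apply: vge_le; lia.
Qed.

Variables (n : nat) (u : 'I_n -> k).
Hypothesis indu : forall c : 'I_n -> {poly F}, \sum_i pev iota y^-1 (c i) * u i = 0 ->
  forall i, c i = 0.
Hypothesis dep : forall x : 'I_n.+1 -> k, exists c : 'I_n.+1 -> {poly F},
    (exists i, c i != 0) /\ \sum_i pev iota y^-1 (c i) * x i = 0.
Hypothesis intu : forall i w, is_place iota w -> w y <= 0 -> vge w 0 (u i).

Let ka := (\sum_(i < s.+1) \sum_(l < n) `|ws i (u l)|)%N.

Let V_card J : card_ge (V (J + ka)) ((q ^ n) ^ J).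
Proof.
rewrite -expnM.
have -> : (q ^ (n * J) = #|{ffun 'I_n * 'I_J -> F}|)%N.
  by rewrite card_ffun card_prod !card_ord.
pose p (f : {ffun 'I_n * 'I_J -> F}) i : {poly F} :=
  \poly_(j < J) (if insub j is Some j' then f (i, j') else 0).
apply: (@card_ge_inj _ _ _ (fun f => \sum_i pev iota y^-1 (p f i) * u i)).
  move=> f g E; apply/ffunP => -[i j].
  have /indu/(_ i)/(congr1 (fun r : {poly F} => r`_j)) :
      \sum_i pev iota y^-1 (p f i - p g i) * u i = 0.
    rewrite -[RHS](subrr (\sum_i pev iota y^-1 (p f i) * u i)) {2}E -sumrB.
    by apply: eq_bigr => l _; rewrite rmorphB mulrBl.
  by rewrite coefB !coef_poly ltn_ord valK coef0 => /eqP; rewrite subr_eq0 => /eqP.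
move=> f; split=> [w pw wy|i lt].
  apply: (vge_sum pw) => l _; apply: (vgeM0 pw); last exact: intu.
  apply: (vge_pev _ pw); right; by rewrite (plV pw) oppr_ge0.
have [pw wy] := pws lt; apply: (vge_sum pw) => l _.
have -> : - (J + ka)%:Z * ws i y = (- J%:Z * ws i y) + (- ka%:Z * ws i y) by rewrite PoszD; ring.
apply: (vgeM pw).
  rewrite pevE; apply: (vge_sum pw) => j _; rewrite -[_ * _]add0r; apply: (vgeM pw (vge_const pw _)).
  right; rewrite (plX pw) (plV pw) -mulr_natr natz.
  have ltj : (j < J)%N by apply: leq_trans (ltn_ord j) _; apply: size_poly.
  nia.
right; have : (`|ws i (u l)| <= ka)%N.
  by rewrite /ka (bigD1 (Ordinal lt)) //= (bigD1 l) //=; lia.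
nia.
Qed.

Lemma riemann_count : exists C, forall N, exists2 m, card_ge (pole_space P N) m &
  (cP ^ N <= C * m)%N.
Proof.
have [r lern indW] := zeros_index_pow y0 pws dep.
have cP0 : (0 < cP)%N by apply: indexp_gt0 (indP 0); apply: vge_subgrp pP _.
have q1 : (1 < q)%N by apply: finNzRing_gt1.
exists (2 * q ^ (n * ka) * cP ^ ka)%N => N.
have card1 : card_ge (pole_space P N) 1.
  exists [:: 0]; split=> // x; rewrite inE => /eqP->.
  exact: (subgrp0 (pole_space_subgrp _ pP)).
have [ltN|leN] := ltnP N ka.
  exists 1%N => //; rewrite muln1 -[X in (X <= _)%N]mul1n leq_mul //.
    by rewrite muln_gt0 expn_gt0 (ltnW q1).
  by rewrite leq_pexp2l // ltnW.
have WW' : W' N `<=` W (- N%:Z) by move=> x [].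
have W0W' : W 0 `<=` W' N.
  move=> x Wx; split=> [|i /andP[_ lt]]; last by have := Wx i lt; rewrite mul0r.
  by apply: zeros_ge_le Wx => //; lia.
have [d indd] := indexp_coarser (W_sub _) (W'_sub N) (W_sub 0) W0W' WW' (indW N).
have dE : (d * cP ^ N = (q ^ r) ^ N)%N.
  apply: (indexp_unique (W_sub 0) _ (indW N)).
  exact: (indexpM (W_sub _) (W'_sub N) (W_sub 0) WW' W0W' indd (index_W'_W N)).
pose m := (cP ^ N %/ q ^ (n * ka))%N.
have qnk : (0 < q ^ (n * ka))%N by rewrite expn_gt0 (ltnW q1).
have cpk : (0 < cP ^ ka)%N by rewrite expn_gt0 cP0.
have le_m : (m * q ^ (n * ka) <= cP ^ N)%N by apply: leq_divM.
have lt_m : (cP ^ N < m.+1 * q ^ (n * ka))%N by apply: ltn_ceil.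
exists (maxn 1 m); last first.
  have le2 : (m.+1 <= 2 * maxn 1 m)%N by lia.
  apply: leq_trans (ltnW lt_m) (leq_trans (leq_mul le2 (leqnn _)) _).
  have -> : (2 * q ^ (n * ka) * cP ^ ka * maxn 1 m = cP ^ ka * (2 * maxn 1 m * q ^ (n * ka)))%N by lia.
  exact: leq_pmull.
have [m0|m0] := leqP m 1; first by [].
apply: (card_ge_mono (leqnn m) (VW'_pole (N := N))).
have := V_card (N - ka); rewrite subnK // => cardV.
apply: (card_ge_pigeonhole (f := idfun) (V_sub N) (W'_sub N) _ indd _ cardV) => [x []//|].
rewrite -(leq_pmul2r qnk) -mulnA.
have -> : ((q ^ n) ^ (N - ka) * q ^ (n * ka) = q ^ (n * N))%N.
  by rewrite -expnM -expnD -mulnDr subnK.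
apply: (@leq_trans (d * cP ^ N)%N); first by rewrite leq_mul2l le_m orbT.
by rewrite dE -expnM leq_exp2l // leq_mul2r lern orbT.
Qed.
End Count.

Lemma riemann P cP : is_place iota P ->
    (forall N, indexp (vge P N) (vge P (N + 1)) cP) ->
  exists C, forall N, exists2 m, card_ge (pole_space P N) m & (cP ^ N <= C * m)%N.
Proof.
move=> pP indP; have [y y0 Py] := vge_uniformizer pP.
have nay : ~ algebraicOver iota y by apply: (place_nonalg pP); rewrite Py.
have Py0 : 0 < P y by rewrite Py.
have [s [ws [ws0 pws nws all_zeros]]] := zeros_enum pP Py0.
have [n [u [indu dep]]] := rank_max y^-1.
have /choice[c hc] i : exists c : {poly F}, c != 0 /\ forall w, is_place iota w -> w y <= 0 ->
    vge w 0 (pev iota y^-1 c * u i).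
  by have [c] := integral_multiple (u i) y0 nay; exists c.
apply: (riemann_count pP indP y0 Py ws0 pws nws all_zeros
  (u := fun i => pev iota y^-1 (c i) * u i) _ dep) => [a E i|i w]; last by case: (hc i) => _; apply.
have [ci0 _] := hc i; apply: (mulIf ci0); rewrite mul0r.
apply: (indu (fun i => a i * c i)); rewrite -[RHS]E; apply: eq_bigr => j _.
by rewrite rmorphM /= mulrA.
Qed.

Lemma regular_pos0 P x : is_place iota P -> regular_outside iota P x -> vge P 1 x -> x = 0.
Proof.
move=> pP Ax Px; apply/eqP; apply: contrapT => /negP x0.
have {}Px : 0 < P x by rewrite gtz0_ge1; apply/(vgeE _ _ x0).
have nax : ~ algebraicOver iota x^-1.
  by apply: (place_nonalg pP); rewrite (plV pP) oppr_eq0; lia.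
have [w pw wx] := place_exists ffk nax.
have nwP : w <> P by move=> E; move: wx; rewrite E (plV pP); lia.
have [/eqP|] := Ax w pw nwP; first by rewrite (negPf x0).
by move: wx; rewrite (plV pw); lia.
Qed.

End Riemann.

(** * The ring B *)

Section RegularRing.
Variables (F k : fieldType) (iota : {rmorphism F -> k}) (P : k -> int).

Definition regb : {pred k} := fun x => `[< regular_outside iota P x >].

Lemma regbP x : reflect (regular_outside iota P x) (x \in regb).
Proof. exact: asboolP. Qed.

Lemma regularP x : regular_outside iota P x <->
  forall w, is_place iota w -> w <> P -> vge w 0 x.
Proof. by []. Qed.

Lemma regular_subring : subring_closed regb.
Proof.
split=> [|x y /regbP/regularP Ax /regbP/regularP Ay|x y /regbP/regularP Ax /regbP/regularP Ay].
- by apply/regbP/regularP => w pw _; apply: (vge1 pw).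
- by apply/regbP/regularP => w pw nw; apply: (vgeD pw (Ax _ pw nw) (vgeN pw (Ay _ pw nw))).
- by apply/regbP/regularP => w pw nw; apply: (vgeM0 pw (Ax _ pw nw) (Ay _ pw nw)).
Qed.

HB.instance Definition _ := GRing.isSubringClosed.Build k regb regular_subring.

Record reg_ring := RegRing { regval :> k; _ : regval \in regb }.

HB.instance Definition _ := [isSub for regval].
HB.instance Definition _ := [Choice of reg_ring by <:].
HB.instance Definition _ := [SubChoice_isSubComNzRing of reg_ring by <:].

Lemma regular_sub x y : regular_outside iota P x -> regular_outside iota P y ->
  regular_outside iota P (x - y).
Proof. by move=> /regbP Ax /regbP Ay; apply/regbP; apply: (rpredB Ax Ay). Qed.

Lemma regular_mul x y : regular_outside iota P x -> regular_outside iota P y ->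
  regular_outside iota P (x * y).
Proof. by move=> /regbP Ax /regbP Ay; apply/regbP; apply: (rpredM Ax Ay). Qed.

Lemma regular1 : regular_outside iota P 1.
Proof. by apply/regbP; apply: rpred1. Qed.

Lemma regular_integral (p : {poly k}) x : p \is monic ->
  (forall i, regular_outside iota P p`_i) -> root p x -> regular_outside iota P x.
Proof.
move=> pm Ap rx; apply/regularP => w pw nw.
apply: (@vge_integral _ _ _ _ pw (size p).-1 _ (fun i => - p`_i)).
  by move=> i; apply: (vgeN pw); apply: Ap.
move: rx => /rootP; rewrite (horner_coef_wide _ (leqSpred (size p))) big_ord_recr /=.
rewrite -lead_coefE (monicP pm) mul1r => /eqP; rewrite addrC addr_eq0 => /eqP ->.
by rewrite -sumrN; apply: eq_bigr => i _; rewrite mulNr.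
Qed.

Variable L : fieldExtType k.
Local Notation B := (integral_closure L (regular_outside iota P)).

Lemma integral_closureE (x : L) : B x <-> integralOver (in_alg L \o (\val : reg_ring -> k)) x.
Proof.
split=> [[p [pm Ap rx]]|[p pm rx]]; last first.
  exists (map_poly (\val : reg_ring -> k) p); split; first exact: monic_map.
    by move=> i; rewrite coef_map; have /regbP := valP p`_i.
  by rewrite -map_poly_comp.
pose p' : {poly reg_ring} := \poly_(i < size p) (insubd 0 p`_i).
have Ep : map_poly (\val : reg_ring -> k) p' = p.
  apply/polyP => i; rewrite coef_map coef_poly; case: ltnP => [_|le]; last by rewrite nth_default.
  by rewrite /= insubdK //; apply/regbP.
exists p'; last by rewrite map_poly_comp Ep.
rewrite monicE -(inj_eq val_inj) /=.
have lead : lead_coef (map_poly (\val : reg_ring -> k) p') = \val (lead_coef p').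
  by apply: lead_coef_map_inj => //; apply: val_inj.
by rewrite -lead Ep; apply/eqP; rewrite (monicP pm).
Qed.

Lemma B_sub x y : B x -> B y -> B (x - y).
Proof. by rewrite !integral_closureE; apply: integral_sub. Qed.
Lemma B_add x y : B x -> B y -> B (x + y).
Proof. by rewrite !integral_closureE; apply: integral_add. Qed.
Lemma B_mul x y : B x -> B y -> B (x * y).
Proof. by rewrite !integral_closureE; apply: integral_mul. Qed.
Lemma B_1 : B 1. Proof. by rewrite integral_closureE; apply: integral1. Qed.
Lemma B_0 : B 0. Proof. by rewrite integral_closureE; apply: integral0. Qed.
Lemma B_regular a : regular_outside iota P a -> B a%:A.
Proof.
move=> Aa; exists ('X - a%:P); split; first exact: monicXsubC.
  move=> i; rewrite coefB coefX coefC; apply/regbP; apply: rpredB.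
    by case: eqP => _; [apply: rpred1 | apply: rpred0].
  by case: eqP => _; [apply/regbP | apply: rpred0].
by rewrite rmorphB /= map_polyX map_polyC root_XsubC.
Qed.

Lemma B_scalar a : B (a%:A : L) -> regular_outside iota P a.
Proof.
case=> p [pm Ap]; rewrite (_ : a%:A = in_alg L a) // fmorph_root.
exact: regular_integral.
Qed.

End RegularRing.

Section Quadratic.
Variables (k : fieldType) (L : quad_ext k).

Lemma qconj_alg (a : k) : qconj (a%:A : L) = a%:A.
Proof. by rewrite linearZ /= rmorph1. Qed.

Lemma qconj_eq0 (x : L) : (qconj x == 0) = (x == 0).
Proof. by rewrite fmorph_eq0. Qed.

Lemma qconj_fixed (x : L) : qconj x = x -> exists a : k, x = a%:A.
Proof.
move=> fx; have sub1 : (1 <= fixedSpace (qconj : 'End(L)))%VS.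
  by apply/subvP => y /vlineP[a ->]; apply/fixedSpaceP; apply: qconj_alg.
have : (\dim (fixedSpace (qconj : 'End(L))) <= 1)%N.
  rewrite -ltnS -(quad_ext_dim L) ltn_neqAle dimvS ?subvf // andbT.
  apply/negP => /eqP E; have /eqP fixT : fixedSpace (qconj : 'End(L)) == fullv.
    by rewrite eqEdim subvf E leqnn.
  have /eqP := qconj_neq1 L; apply; apply/val_inj/lfunP => y /=.
  by rewrite lfunE /=; apply/fixedSpaceP; rewrite fixT memvf.
move=> le; have /eqP E : 1%VS == fixedSpace (qconj : 'End(L)).
  by rewrite eqEdim sub1 dimv1.
have : x \in fixedSpace (qconj : 'End(L)) by apply/fixedSpaceP.
by rewrite -E => /vlineP[a ->]; exists a.
Qed.

Lemma qconj_anti : exists2 d : L, d != 0 & qconj d = - d.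
Proof.
have [x nx] : exists x : L, qconj x != x.
  apply: contrapT => /forallNP H; have /eqP := qconj_neq1 L; apply.
  apply/val_inj/lfunP => x /=; rewrite lfunE /=; apply/eqP/negPn/negP/H.
exists (x - qconj x); first by rewrite subr_eq0 eq_sym.
by rewrite rmorphB /= qconjK opprB.
Qed.

End Quadratic.

Section ExtensionPlace.
Variables (F : finFieldType) (k : fieldType) (iota : {rmorphism F -> k}).
Hypothesis char_neq2 : 2%N \notin [pchar F].
Hypothesis ffk : is_function_field iota.
Hypothesis constants : algebraically_closed_in iota.
Variables (L : quad_ext k) (P : k -> int) (Q : L -> int) (e : nat).
Hypothesis pP : is_place iota P.
Hypothesis pQ : is_place (in_alg L \o iota) Q.
Hypothesis QP : lies_over e Q P.
Hypothesis Quniq : forall (e' : nat) (Q' : L -> int),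
  is_place (in_alg L \o iota) Q' -> lies_over e' Q' P -> Q' = Q.

Local Notation A := (regular_outside iota P).
Local Notation B := (integral_closure L A).

Let e0 : (0 < e)%N. Proof. by case: QP. Qed.
Lemma Q_alg c : Q (c%:A : L) = e%:Z * P c. Proof. by case: QP. Qed.

Lemma Q_conj x : Q (qconj x) = Q x.
Proof.
suff H : (Q \o qconj : L -> int) = Q by rewrite -[in RHS]H.
apply: (Quniq (e' := e)); last by split=> // c /=; rewrite qconj_alg Q_alg.
split=> [|x' y x0 y0|x' y x0 y0 xy0|c c0|] /=.
- by rewrite rmorph0 (pl0 pQ).
- by rewrite rmorphM (plM pQ) ?qconj_eq0.
- rewrite rmorphD; case: pQ => _ _ + _ _; apply; rewrite ?qconj_eq0 //.
  by rewrite -rmorphD qconj_eq0.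
- by rewrite qconj_alg Q_alg (pl_const pP) mulr0.
- have [x' x0 Qx] := vge_uniformizer pQ.
  by exists (qconj x'); rewrite ?qconj_eq0 ?qconjK.
Qed.

Lemma vgeQ_conj n x : vge Q n (qconj x) <-> vge Q n x.
Proof.
by rewrite /vge /= Q_conj; split=> -[/eqP|]; rewrite ?qconj_eq0 => ?; [left; apply/eqP|right|left; apply/eqP|right]; rewrite ?qconj_eq0.
Qed.

Lemma two_neq0 : (2 : F) != 0.
Proof. by apply: contra char_neq2 => /eqP H; rewrite inE /= H eqxx. Qed.

Lemma two_neq0L : (2 : L) != 0.
Proof.
have -> : (2 : L) = (in_alg L \o iota) 2 by rewrite rmorph_nat.
by rewrite fmorph_eq0 two_neq0.
Qed.

Lemma Q_2 : Q 2 = 0.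
Proof.
have -> : (2 : L) = (in_alg L \o iota) 2 by rewrite rmorph_nat.
exact: pl_const.
Qed.

Lemma vgeQ_half n x : vge Q n (x / 2) <-> vge Q n x.
Proof.
have H2 : 2^-1 != 0 :> L by rewrite invr_eq0 two_neq0L.
rewrite mulrC -[n in vge Q n (_ * _)]add0r.
by apply: (vgeMl pQ n x H2); rewrite (plV pQ) Q_2 oppr0.
Qed.

Section Coordinates.
Variable d : L.
Hypotheses (d0 : d != 0) (cd : qconj d = - d).

Lemma qdecomp x : exists a b : k, x = a%:A + b%:A * d.
Proof.
have c2 : qconj (2 : L) = 2 by rewrite rmorph_nat.
have [a Ea] : exists a : k, (x + qconj x) / 2 = a%:A.
  by apply: qconj_fixed; rewrite rmorphM fmorphV /= c2 rmorphD /= qconjK addrC.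
have [b Eb] : exists b : k, (x - qconj x) / (2 * d) = b%:A.
  apply: qconj_fixed; rewrite rmorphM fmorphV rmorphM /= c2 rmorphB /= qconjK cd.
  by field; rewrite oppr_eq0 two_neq0L d0.
by exists a, b; rewrite -Ea -Eb; field; rewrite two_neq0L d0.
Qed.

Lemma qconj_decomp a b : qconj (a%:A + b%:A * d) = a%:A - b%:A * d.
Proof. by rewrite rmorphD rmorphM /= !qconj_alg cd mulrN. Qed.

Lemma vgeQ_decomp n a b :
  vge Q n (a%:A + b%:A * d) <-> vge Q n a%:A /\ vge Q n (b%:A * d).
Proof.
split=> [H|[]]; last exact: (vgeD pQ).
have : vge Q n (a%:A - b%:A * d) by rewrite -qconj_decomp; apply/vgeQ_conj.
move=> H'; split.
  rewrite (_ : a%:A = (a%:A + b%:A * d + (a%:A - b%:A * d)) / 2); last first.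
    by field; exact: two_neq0L.
  by apply/vgeQ_half; apply: (vgeD pQ).
rewrite (_ : b%:A * d = (a%:A + b%:A * d - (a%:A - b%:A * d)) / 2); last first.
  by field; exact: two_neq0L.
by apply/vgeQ_half; apply: (vgeD pQ H (vgeN pQ H')).
Qed.

Definition ceil_div (n : int) : int := - ((- n) %/ e%:Z)%Z.

Lemma ceil_divP n y : (n <= e%:Z * y) = (ceil_div n <= y).
Proof. by rewrite /ceil_div lerNl lez_divRL // mulNr lerN2 mulrC. Qed.

Lemma ceil_divD n : ceil_div (n + e%:Z) = ceil_div n + 1.
Proof.
have -> : n + e%:Z = n - (-1) * e%:Z by ring.
rewrite /ceil_div opprB divzMDl ?opprD ?opprK 1?addrC //.
by move: e0; case: e.
Qed.

Lemma vgeQ_alg n a : vge Q n (a%:A : L) <-> vge P (ceil_div n) a.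
Proof.
have [->|a0] := eqVneq a 0; first by rewrite scale0r; split=> _; apply: vge0.
by rewrite !vgeE ?scaler_eq0 ?oner_eq0 ?orbF // Q_alg ceil_divP.
Qed.

Lemma vgeQ_algd n b : vge Q n (b%:A * d) <-> vge P (ceil_div (n - Q d)) b.
Proof.
by rewrite -vgeQ_alg mulrC -{1}[n](subrKC (Q d)); apply: (vgeMl pQ).
Qed.

Lemma index_e cP : (forall N, indexp (vge P N) (vge P (N + 1)) cP) ->
  indexp (vge Q 0) (vge Q e) (cP * cP).
Proof.
move=> indP; pose f (ab : k * k) : L := ab.1%:A + ab.2%:A * d.
have fB : GRing.zmod_morphism f.
  by move=> x y; rewrite /f /= !scalerBl mulrBl; ring.
pose fA := GRing.isZmodMorphism.Build _ _ f fB.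
pose f' : {additive (k * k)%type -> L} := HB.pack f fA.
have ce : ceil_div e = ceil_div 0 + 1 by rewrite -ceil_divD add0r.
have ced : ceil_div (e%:Z - Q d) = ceil_div (- Q d) + 1 by rewrite -ceil_divD addrC.
have := indexpX (indP (ceil_div 0)) (indP (ceil_div (- Q d))).
rewrite -ce -ced => H; apply: (iffLR (@indexp_iso _ _ f' _ _ _ _ _ _ _ _ _ _) H).
- exact: vge_subgrp pQ _.
- by move=> [a b] /= [Pa Pb]; apply/vgeQ_decomp; rewrite vgeQ_alg vgeQ_algd sub0r.
- by move=> [a b] /= [Pa Pb]; rewrite vgeQ_decomp vgeQ_alg vgeQ_algd.
- split=> [|[a b] [a' b'] /= [Pa Pb] [Pa' Pb']]; first by split; apply: vge0.
  by split; apply: (subgrpB (vge_subgrp pP _)).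
- move=> x; have [a [b ->]] := qdecomp x => /vgeQ_decomp[].
  rewrite vgeQ_alg vgeQ_algd sub0r => Pa Pb; exists (a, b) => //=.
  by rewrite subrr; apply: vge0.
Qed.

End Coordinates.

Lemma vgeQ_mono m n : m <= n -> vge Q n `<=` vge Q m.
Proof. by move=> le x; apply: vge_le. Qed.

Lemma residue_Q cP : (1 < cP)%N -> (forall N, indexp (vge P N) (vge P (N + 1)) cP) ->
  exists cQ, [/\ (1 < cQ)%N, forall N, indexp (vge Q N) (vge Q (N + 1)) cQ &
                (cQ ^ e = cP * cP)%N].
Proof.
move=> cP1 indP; have [d d0 cd] := qconj_anti L.
have inde := index_e d0 cd indP.
have [||cQ ind0] := indexp_coarser (vge_subgrp pQ 0) (vge_subgrp pQ 1) (vge_subgrp pQ e) _ _ inde.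
- by apply: vgeQ_mono; lia.
- exact: vgeQ_mono.
have ind N : indexp (vge Q N) (vge Q (N + 1)) cQ.
  have [a a0 Qa] := vge_uniformizerz pQ N.
  have shift m x : vge Q (N + m) (a * x) <-> vge Q m x by apply: (vgeMl pQ m x a0 (esym Qa)).
  apply: (iffLR (@indexp_iso _ _ (lmul a) _ _ _ _ _ _ _ _ _ _) ind0).
  - exact: (vge_subgrp pQ).
  - by move=> x /shift; rewrite addr0.
  - by move=> x _; exact: shift.
  - exact: (vge_subgrp pQ).
  - move=> x Qx; exists (a^-1 * x); last by rewrite /= /lmul mulVKf // subrr; apply: vge0.
    by apply/shift; rewrite addr0 mulVKf.
have E : (cQ ^ e = cP * cP)%N.
  apply: (indexp_unique (vge_subgrp pQ e)) inde.
  rewrite -[0](subrr e%:Z); apply: (indexp_filtration (vge_subgrp pQ) _ ind).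
  by move=> N; apply: vgeQ_mono; lia.
exists cQ; split=> //; rewrite ltnNge; apply/negP => le.
have : (cQ ^ e <= 1)%N by rewrite -[X in (_ <= X)%N](exp1n e) leq_exp2r.
by rewrite E; nia.
Qed.


Lemma place_Q_gt1 : exists2 cP, (1 < cP)%N & forall N, indexp (vge P N) (vge P (N + 1)) cP.
Proof. exact: (place_residue ffk pP). Qed.

Lemma regular_infinite M : card_ge A M.
Proof.
have [cP cP1 indP] := place_Q_gt1; have [C hC] := riemann ffk constants pP indP.
have [m cm le] := hC (C * M)%N.
apply: (card_ge_mono (m := m)) cm; last by move=> x [].
have : (C * M < cP ^ (C * M))%N by apply: ltn_expl.
by case: C {hC} le => [|C] le lt; nia.
Qed.

Lemma nonconstant_regular : exists2 a, A a & ~ algebraicOver iota a.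
Proof.
have [s [us ss As]] := regular_infinite #|F|.+1; apply: contrapT => H.
have sub x : x \in s -> exists c, x = iota c.
  by move=> /As Ax; apply: constants; apply: contrapT => nx; apply: H; exists x.
have : (size s <= size [seq iota c | c : F])%N.
  apply: uniq_leq_size => // x /sub[c ->]; apply/mapP; exists c => //.
  by rewrite mem_enum.
by rewrite size_map -cardE ss ltnn.
Qed.

Lemma fraction_regular x : exists a, [/\ a != 0, A a & A (a * x)].
Proof.
have [a Aa na] := nonconstant_regular.
have a0 : a != 0.
  by apply/eqP => a0; apply: na; exists 'X; rewrite ?polyX_eq0 // map_polyX a0 rootX.
have nVa : ~ algebraicOver iota a^-1.
  move=> /constants[c E]; apply: na; rewrite -[a]invrK E -fmorphV.
  exists ('X - (c^-1)%:P); first by rewrite polyXsubC_eq0.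
  by rewrite rmorphB /= map_polyX map_polyC root_XsubC.
have [|c c0 Hc] := @integral_multiple _ _ _ ffk constants a^-1 x _ nVa; first by rewrite invr_eq0.
rewrite invrK in Hc.
exists (pev iota a c); split; first exact: nonalg_pev.
  by apply/regularP => w pw nw; apply: vge_pev => //; apply: Aa.
apply/regularP => w pw nw; apply: Hc => //; rewrite (plV pw) oppr_le0.
by apply/(vgeE w 0 a0); apply: Aa.
Qed.

Lemma B_conj x : B x -> B (qconj x).
Proof.
case=> p [pm Ap rx]; exists p; split=> //.
have -> : map_poly (in_alg L) p = map_poly qconj (map_poly (in_alg L) p).
  by rewrite -map_poly_comp; apply: eq_map_poly => a /=; rewrite qconj_alg.
by rewrite fmorph_root.
Qed.

Lemma B_pos0 x : B x -> vge Q 1 x -> x = 0.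
Proof.
move=> Bx Qx; have [c Nc] : exists c : k, x * qconj x = c%:A.
  by apply: qconj_fixed; rewrite rmorphM /= qconjK mulrC.
have Ac : A c by apply: (@B_scalar _ _ _ _ L); rewrite -Nc; apply/B_mul/B_conj.
have c0 : c = 0.
  apply: (regular_pos0 ffk constants pP Ac).
  have : vge Q 1 (c%:A : L).
    rewrite -Nc; apply: vge_le (vgeM pQ Qx _); last by apply/vgeQ_conj; exact: Qx.
    by [].
  have [->|c0] := eqVneq c 0; first by move=> _; apply: vge0.
  by rewrite !vgeE ?scaler_eq0 ?oner_eq0 ?orbF // Q_alg; nia.
move/eqP: Nc; rewrite c0 scale0r mulf_eq0 qconj_eq0 orbb => /eqP //.
Qed.

Lemma B_sqrt y c : A c -> y * y = c%:A -> B y.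
Proof.
move=> Ac yy; exists ('X^2 - c%:P); split.
- by rewrite monicE lead_coefDl ?lead_coefXn // size_polyN size_polyXn (leq_ltn_trans (size_polyC_leq1 _)).
- move=> i; rewrite coefB coefXn coefC; apply: regular_sub.
    by case: eqP => _; [exact: regular1 | apply/regbP; apply: rpred0].
  by case: eqP => _ //; apply/regbP; apply: rpred0.
- by rewrite rmorphB /= map_polyXn map_polyC /root hornerD hornerN hornerXn hornerC expr2 yy subrr.
Qed.

Lemma fraction_B x : exists a, [/\ a != 0, A a & B (a%:A * x)].
Proof.
have [d d0 cd] := qconj_anti L; have [a [b ->]] := qdecomp d0 cd x.
have [D ED] : exists D : k, d * d = D%:A.
  by apply: qconj_fixed; rewrite rmorphM /= cd mulrNN.
have [a1 [a10 Aa1 Aa1a]] := fraction_regular a.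
have [a2 [a20 Aa2 Aa2b]] := fraction_regular (b * (b * D)).
exists (a1 * a2); split; [by rewrite mulf_neq0 | exact: regular_mul |].
rewrite mulrDr; apply: B_add.
  have -> : (a1 * a2)%:A * a%:A = (a2 * (a1 * a))%:A :> L.
    by rewrite -!in_algE -!rmorphM; congr (in_alg L _); ring.
  by apply: B_regular; apply: regular_mul.
apply: (@B_sqrt _ (a1 * a1 * (a2 * (a2 * (b * (b * D)))))).
  by do 2 apply: regular_mul => //.
transitivity ((a1 * a2 * b * (a1 * a2 * b))%:A * (d * d) : L).
  by rewrite -!in_algE !rmorphM; ring.
by rewrite ED -!in_algE -rmorphM; congr (in_alg L _); ring.
Qed.

Lemma trace0_elt : exists d : L, [/\ d != 0, qconj d = - d & B d].
Proof.
have [d d0 cd] := qconj_anti L; have [a [a0 Aa Bad]] := fraction_B d.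
exists (a%:A * d); split=> //; last by rewrite rmorphM /= qconj_alg cd mulrN.
by rewrite mulf_neq0 // scaler_eq0 oner_eq0 orbF.
Qed.

Lemma trace0_infinite M : card_ge [set x : L | B x /\ qconj x = - x] M.
Proof.
have [d [d0 cd Bd]] := trace0_elt; have [s [us ss As]] := regular_infinite M.
exists [seq (a%:A : L) * d | a <- s]; split; last 1 first.
- move=> _ /mapP[a /As Aa ->]; split; first by apply: B_mul Bd; apply: B_regular.
  by rewrite rmorphM /= qconj_alg cd mulrN.
- by rewrite map_inj_uniq // => a b /(mulIf d0)/eqP; rewrite -subr_eq0 -scalerBl scaler_eq0 oner_eq0 orbF subr_eq0 => /eqP.
- by rewrite size_map.
Qed.

Lemma H_value m : exists u v : L, [/\ in_H (u, v), v != 0 & Q v = m].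
Proof.
have [d d0 cd] := qconj_anti L.
have trace0 v : qconj v = - v -> in_H ((0 : L), v).
  by move=> cv; rewrite /in_H /qnorm /qtrace /= cv subrr mul0r addr0.
have [t t0 Qt] := vge_uniformizer pQ.
have [a [b Et]] := qdecomp d0 cd t.
have alg0 c : ((c%:A : L) == 0) = (c == 0) by rewrite scaler_eq0 oner_eq0 orbF.
have [Qa|Qb] : (a != 0 /\ Q (a%:A : L) = 1) \/ (b != 0 /\ Q (b%:A * d) = 1).
  have : vge Q 1 t by right; rewrite Qt.
  have : ~ vge Q 2 t by rewrite vgeE // Qt.
  rewrite Et !vgeQ_decomp // => n2 [va vb].
  have [va2|na2] := pselect (vge Q 2 (a%:A : L)).
    have nb2 : ~ vge Q 2 (b%:A * d) by move=> vb2; apply: n2.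
    have [bd0 lt] := vge_notP nb2; right; move: vb => /(vgeE _ _ bd0) ge.
    split; last by lia.
    by apply: contraNneq bd0 => ->; rewrite scale0r mul0r.
  have [a0 lt] := vge_notP na2; left; move: va => /(vgeE _ _ a0) ge.
  by split; [rewrite alg0 in a0 | lia].
- case: Qa => a0 Qa; exists 0, (d * (a ^ (m - Q d))%:A).
  rewrite trace0; last by rewrite rmorphM /= qconj_alg cd mulNr.
  rewrite mulf_neq0 ?alg0 ?expfz_neq0 //; split=> //.
  rewrite (plM pQ) ?alg0 ?expfz_neq0 // -[RHS](subrKC (Q d)); congr (_ + _).
  have Qa' : Q (in_alg L a) = 1 by []; case: (m - Q d) => n.
    by rewrite -exprnP -in_algE rmorphXn (plX pQ) Qa' natz.
  by rewrite NegzE -exprnN -in_algE fmorphV rmorphXn (plV pQ) (plX pQ) Qa' natz.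
- case: Qb => b0 Qb; pose tau := b%:A * d; have tau0 : tau != 0 by rewrite mulf_neq0 ?alg0.
  have ctau : qconj tau = - tau by rewrite rmorphM /= qconj_alg cd mulrN.
  have Qz (z : int) : Q (tau ^ z) = z.
    case: z => n; first by rewrite -exprnP (plX pQ) Qb natz.
    by rewrite NegzE -exprnN (plV pQ) (plX pQ) Qb natz.
  have cz (z : int) : qconj (tau ^ z) = (-1) ^ z * tau ^ z.
    by rewrite -expfzMl mulN1r -ctau; case: z => n; rewrite ?NegzE -?exprnP -?exprnN ?fmorphV rmorphXn.
  pose h := (m %/ 2)%Z; have [Em|Em] : m = h + h \/ m = h + h + 1.
    by rewrite /h; lia.
    exists (tau ^ h), (- (tau ^ h * qconj (tau ^ h)) / 2).
    have n0 : tau ^ h * qconj (tau ^ h) != 0 by rewrite mulf_neq0 ?qconj_eq0 ?expfz_neq0.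
    split.
    + rewrite /in_H /qnorm /qtrace /= rmorphM fmorphV rmorphN rmorphM /= qconjK.
      have -> : qconj (2 : L) = 2 by rewrite rmorph_nat.
      apply/eqP; field; exact: two_neq0L.
    + by rewrite mulf_neq0 ?oppr_eq0 ?invr_eq0 ?two_neq0L.
    + rewrite (plM pQ) ?oppr_eq0 ?invr_eq0 ?two_neq0L // (plV pQ) Q_2 subr0 (plN pQ).
      by rewrite (plM pQ) ?qconj_eq0 ?expfz_neq0 // Q_conj Qz -Em.
  exists 0, (tau ^ m); rewrite expfz_neq0 // Qz trace0 // cz.
  rewrite {1}Em !expfzDr ?oppr_eq0 ?oner_eq0 // -expfzMl mulrNN mulr1 exp1rz mul1r expr1z.
  by rewrite mulN1r.
Qed.

Variable cQ : nat.
Hypothesis cQ1 : (1 < cQ)%N.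
Hypothesis indQ : forall N, indexp (vge Q N) (vge Q (N + 1)) cQ.

Lemma indexQ N m : indexp (vge Q (N - m%:Z)) (vge Q N) (cQ ^ m).
Proof.
apply: (indexp_filtration (vge_subgrp pQ) _ indQ) => N'; apply: vgeQ_mono; lia.
Qed.

Definition B_ge (N : int) : set L := [set x | B x /\ vge Q N x].

Lemma B_ge_subgrp N : subgrp (B_ge N).
Proof.
split=> [|x y [Bx Qx] [By Qy]]; first by split; [exact: B_0 | exact: vge0].
by split; [exact: B_sub | exact: (subgrpB (vge_subgrp pQ _))].
Qed.

Lemma B_ge_index N : exists2 c, (0 < c)%N & indexp (B_ge N) [set 0] c.
Proof.
have [c _ H] : exists2 c, (c <= cQ ^ `|1 - N|)%N & indexp (B_ge N) [set 0] c.
  apply: indexp_ex (subgrp_set0 _) _ => g Bg.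
  have [||i [j [nij Qij]]] := index_collision (vge_subgrp pQ 1) (indexQ 1 `|1 - N|%N) (g := g).
  - by rewrite card_ord.
  - by move=> i; have [_] := Bg i; apply: vgeQ_mono; lia.
  exists i, j; split=> //; apply: B_pos0 Qij.
  by apply: B_sub; [case: (Bg i) | case: (Bg j)].
by exists c => //; apply: indexp_gt0 H; apply: B_ge_subgrp.
Qed.

Lemma B_ge_finite N : exists s : seq L, forall x, B_ge N x -> x \in s.
Proof.
have [c _ [f [_ _ fc]]] := B_ge_index N; exists [seq f i | i : 'I_c] => x /fc[i /eqP].
by rewrite subr_eq0 => /eqP->; apply: map_f; rewrite mem_enum.
Qed.

Lemma B_riemann : exists C, forall M : nat, exists2 m, card_ge (B_ge (- (e * M)%:Z)) m &
  (cQ ^ (e * M) <= C * m)%N.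
Proof.
have [cP cP1 indP] := place_Q_gt1; have [C hC] := riemann ffk constants pP indP.
have [cQ' [_ indQ' EcQ]] := residue_Q cP1 indP.
have {cQ' indQ'}EcQ : (cQ ^ e = cP * cP)%N.
  by rewrite (indexp_unique (vge_subgrp pQ _) (indQ 0) (indQ' 0)).
have [d [d0 cd Bd]] := trace0_elt; pose ka := `|Q d|%N.
exists (C * C * cP ^ ka + cP ^ (2 * ka))%N => M.
have EM : (cQ ^ (e * M) = cP ^ M * cP ^ M)%N by rewrite expnM EcQ expnMn.
have [ltM|leM] := ltnP M ka.
  exists 1%N; first by exists [:: 0]; split=> // x; rewrite inE => /eqP ->; apply: (subgrp0 (B_ge_subgrp _)).
  rewrite muln1 EM -expnD; apply: leq_trans (leq_addl _ _).
  by rewrite leq_exp2l //; lia.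
have [m1 /card_geP[f [fi Af]] le1] := hC M; have [m2 /card_geP[g [gi Ag]] le2] := hC (M - ka)%N.
exists (m1 * m2)%N; last first.
  rewrite EM -{2}(subnK leM) expnD.
  have := leq_mul le1 le2; nia.
have -> : (m1 * m2 = #|{: 'I_m1 * 'I_m2}|)%N by rewrite card_prod !card_ord.
apply: (@card_ge_inj _ _ _ (fun ij : 'I_m1 * 'I_m2 => (f ij.1)%:A + (g ij.2)%:A * d)).
  have dz n a b a' b' : (a%:A + b%:A * d = a'%:A + b'%:A * d :> L) -> vge Q n ((a - a')%:A + (b - b')%:A * d).
    move=> E; rewrite !scalerBl mulrBl (_ : _ + _ = 0); first exact: vge0.
    by apply/eqP; rewrite addrACA -opprD -E subrr.
  move=> [i j] [i' j'] /= E.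
  have alg0 c : (c%:A : L) = 0 -> c = 0.
    by move/eqP; rewrite scaler_eq0 oner_eq0 orbF => /eqP.
  have z x : (forall n, vge Q n x) -> x = 0.
    move=> H; have [//|x0] := eqVneq x 0; have /(vgeE _ _ x0) := H (Q x + 1); lia.
  have a0 : f i - f i' = 0.
    by apply/alg0/z => n; have /(vgeQ_decomp cd)[] := dz n _ _ _ _ E.
  have b0 : (g j - g j')%:A * d = 0.
    by apply/z => n; have /(vgeQ_decomp cd)[] := dz n _ _ _ _ E.
  congr (_, _); first by apply: fi; apply/eqP; rewrite -subr_eq0 a0.
  apply: gi; apply/eqP; rewrite -subr_eq0; apply/eqP/alg0/eqP.
  by move/eqP: b0; rewrite mulf_eq0 (negPf d0) orbF.
move=> [i j] /=; have [Afi Pfi] := Af i; have [Agj Pgj] := Ag j; split.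
  by apply: B_add; [|apply: B_mul Bd]; apply: B_regular.
have alg N c : vge P (- N%:Z) c -> vge Q (- (e * N)%:Z) (c%:A : L).
  have [->|c0] := eqVneq c 0; first by rewrite scale0r => _; apply: vge0.
  by rewrite !vgeE ?scaler_eq0 ?oner_eq0 ?orbF // Q_alg PoszM; nia.
apply: (vgeD pQ); first exact: alg.
apply: vge_le (vgeM pQ (alg _ _ Pgj) (vge_id Q d)).
by move: leM e0; rewrite /ka -[(M - _)%N]/(M - `|Q d|)%N; nia.
Qed.

Lemma B_mod_finite d : B d -> d != 0 -> exists s : seq L, forall x, B x ->
  exists2 r, r \in s & exists2 y, B y & x - r = d * y.
Proof.
move=> Bd d0; pose dB : set L := [set x | exists2 y, B y & x = d * y].
have sdB : subgrp dB.
  split=> [|_ _ [x Bx ->] [y By ->]]; first by exists 0; rewrite ?mulr0 //; apply: B_0.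
  by exists (x - y); [apply: B_sub | rewrite mulrBr].
have Qd : Q d <= 0.
  rewrite leNgt gtz0_ge1; apply/negP => Qd; move/eqP: d0; apply.
  by apply: B_pos0 => //; right.
pose D := `|Q d|%N.
have [c _ [f [_ _ fc]]] : exists2 c, (c <= cQ ^ D)%N & indexp B dB c.
  apply: indexp_ex => // g Bg.
  pose N := (\sum_i `|Q (g i)|)%N.
  have BN i : B_ge (- N%:Z) (g i).
    by split=> //; right; rewrite /N (bigD1 i) //=; lia.
  pose dBN : set L := [set x | exists2 y, B_ge (- N%:Z + D%:Z) y & x = d * y].
  have sdBN : subgrp dBN.
    split=> [|_ _ [x Bx ->] [y By ->]].
      by exists 0; rewrite ?mulr0 //; apply: (subgrp0 (B_ge_subgrp _)).
    by exists (x - y); [apply: (subgrpB (B_ge_subgrp _)) | rewrite mulrBr].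
  have BNs : B_ge (- N%:Z + D%:Z) `<=` B_ge (- N%:Z).
    by move=> x [Bx Qx]; split=> //; apply: vge_le Qx; lia.
  have dBNs : dBN `<=` B_ge (- N%:Z).
    move=> _ [y [By Qy] ->]; split; first exact: B_mul.
    by apply: vge_le (vgeM pQ (vge_id Q d) Qy); rewrite /D; lia.
  have z0 (X : set L) : subgrp X -> [set 0] `<=` X by move=> sX _ ->; apply: subgrp0.
  have [b b0 indb] := B_ge_index (- N%:Z + D%:Z).
  have [b' b'0 indb'] := B_ge_index (- N%:Z).
  have indd : indexp dBN [set 0] b.
    apply: (iffLR (@indexp_iso _ _ (lmul d) _ _ _ _ _ _ _ _ _ _) indb).
    - exact: subgrp_set0.
    - by move=> x Bx; exists x.
    - move=> x _; split=> [/eqP|->]; last by rewrite /= /lmul mulr0.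
      by rewrite mulf_eq0 (negPf d0) => /eqP.
    - exact: B_ge_subgrp.
    - by move=> _ [x Bx ->]; exists x => //; rewrite /= /lmul subrr.
  have [q1 le1 ind1] : exists2 q1, (q1 <= cQ ^ D)%N & indexp (B_ge (- N%:Z)) (B_ge (- N%:Z + D%:Z)) q1.
    apply: indexp_ex; first exact: B_ge_subgrp.
    move=> h Bh; have [||i [j [nij Qij]]] := index_collision (vge_subgrp pQ _) (indexQ (- N%:Z + D%:Z) D) (g := h).
    - by rewrite card_ord.
    - by move=> i; rewrite addrK; case: (Bh i).
    by exists i, j; do 2 split=> //; apply: B_sub; [case: (Bh i) | case: (Bh j)].
  have [q2 ind2] := indexp_coarser (B_ge_subgrp _) sdBN (subgrp_set0 _) (z0 _ sdBN) dBNs indb'.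
  have E1 := indexp_unique (subgrp_set0 _) indb' (indexpM (B_ge_subgrp _) (B_ge_subgrp _) (subgrp_set0 _) BNs (z0 _ (B_ge_subgrp _)) ind1 indb).
  have E2 := indexp_unique (subgrp_set0 _) indb' (indexpM (B_ge_subgrp _) sdBN (subgrp_set0 _) dBNs (z0 _ sdBN) ind2 indd).
  have E12 : q1 = q2 by nia.
  have [|i [j [nij [y [By _] Ey]]]] := index_collision sdBN ind2 _ BN.
    by rewrite card_ord -E12.
  by exists i, j; split=> //; exists y.
exists [seq f i | i : 'I_c] => x /fc[i [y By E]].
by exists (f i); [apply: map_f; rewrite mem_enum | exists y].
Qed.

End ExtensionPlace.

(** * The tree *)

Section UnitaryElements.
Variables (k : fieldType) (L : quad_ext k).
Implicit Types (u v t : L) (g h : SU L).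

Lemma prod_ord3 (f : 'I_3 -> L) : \prod_i f i = f 0 * f 1 * f 2.
Proof.
rewrite !big_ord_recl big_ord0 mulr1 mulrA.
by congr (_ * f _ * f _); apply: val_inj.
Qed.

Definition uaS u v (H : in_H (u, v)) : SU L := mkSU (ua_mx_su (eqP H)).
Definition sS : SU L := mkSU (s_mx_su L).

Lemma a_mx_su t : t != 0 -> is_su (a_mx t).
Proof.
move=> t0; have c0 : qconj t != 0 by rewrite qconj_eq0.
split=> [|x y].
  rewrite -det_tr det_trig; last by apply/is_trig_mxP; do 2!elim/ord3P=> //; rewrite !mxE.
  rewrite prod_ord3 !mxE /=; field; by rewrite t0 c0.
rewrite /herm !mul3 !mxE /= !(rmorphD, rmorphM, rmorphN, rmorph0, rmorph1, fmorphV) /= !qconjK.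
by field; rewrite t0 c0.
Qed.

Definition aS t (t0 : t != 0) : SU L := mkSU (a_mx_su t0).

Lemma mx3E (s : seq (seq L)) i j : mx3 s i j = nth 0 (nth [::] s i) j.
Proof. by rewrite mxE. Qed.

Lemma ua_mx_mul u v u' v' :
  ua_mx u v *m ua_mx u' v' = ua_mx (u + u') (v + v' - qconj u * u').
Proof.
by apply/matrixP; do 2!elim/ord3P; rewrite !mul3 !mxE /= ?rmorphD /=; ring.
Qed.

Lemma in_HV u v : in_H (u, v) -> in_H (- u, qconj v).
Proof.
rewrite /in_H /qnorm /qtrace /= qconjK rmorphN mulrNN => /eqP <-.
by apply/eqP; rewrite (addrC v).
Qed.

Lemma in_HM u v u' v' : in_H (u, v) -> in_H (u', v') ->
  in_H (u + u', v + v' - qconj u * u').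
Proof.
rewrite /in_H /qnorm /qtrace /= => /eqP H1 /eqP H2; apply/eqP.
rewrite !(rmorphD, rmorphN, rmorphM) /= qconjK.
transitivity (u * qconj u + (v + qconj v) + (u' * qconj u' + (v' + qconj v'))); first ring.
by rewrite H1 H2 addr0.
Qed.

Lemma in_H_conj u v : in_H (u, v) -> qconj v = - v - qconj u * u.
Proof.
by rewrite /in_H /qnorm /qtrace /= => /eqP H; apply/eqP; rewrite -subr_eq0 -[X in _ == X]H; apply/eqP; ring.
Qed.

Lemma uaS_mul u v u' v' (H : in_H (u, v)) (H' : in_H (u', v')) (H'' : in_H (u + u', v + v' - qconj u * u')) :
  (uaS H * uaS H')%g = uaS H''.
Proof. by apply: val_inj; rewrite /= ua_mx_mul. Qed.

Lemma uaS_inv u v (H : in_H (u, v)) (H' : in_H (- u, qconj v)) : (uaS H)^-1%g = uaS H'.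
Proof.
apply/eqP; rewrite eq_sym; apply/eqP/(mulgI (uaS H)); rewrite mulgV; apply: val_inj.
rewrite /= ua_mx_mul; apply/matrixP; do 2!elim/ord3P; rewrite !mxE /= ?subrr ?rmorph0 ?oppr0 //.
by rewrite (in_H_conj H); ring.
Qed.

Lemma s_mxE (w : 'cV[L]_3) : (s_mx L *m w) 0 0 = - w 2 0 /\
  (s_mx L *m w) 1 0 = - w 1 0 /\ (s_mx L *m w) 2 0 = - w 0 0.
Proof. by rewrite !mul3 !mxE /=; split; [|split]; ring. Qed.

Lemma sS_inv : (sS^-1 = sS)%g.
Proof.
apply/eqP; rewrite eq_sym; apply/eqP/(mulgI sS); rewrite mulgV; apply: val_inj.
by apply/matrixP; do 2!elim/ord3P; rewrite /= !mul3 !mxE /=; ring.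
Qed.

Lemma sS_sq : (sS * sS = 1)%g. Proof. by rewrite -{2}sS_inv mulgV. Qed.

Lemma aS_inv t (t0 : t != 0) (t0' : t^-1 != 0) : ((aS t0)^-1 = aS t0')%g.
Proof.
apply/eqP; rewrite eq_sym; apply/eqP/(mulgI (aS t0)); rewrite mulgV; apply: val_inj.
have c0 : qconj t != 0 by rewrite qconj_eq0.
by apply/matrixP; do 2!elim/ord3P; rewrite /= !mul3 !mxE /= ?fmorphV /=; field; rewrite ?t0 ?c0 ?oner_eq0.
Qed.

Definition uma_prod u v (H : in_H (u, v)) : SU L := (sS * uaS H * sS)%g.

Lemma uma_prodE u v (H : in_H (u, v)) : suval (uma_prod H) = uma_mx u v.
Proof. by []. Qed.

Definition iso_vec (w : 'cV[L]_3) : Prop :=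
  w 0 0 * qconj (w 2 0) + w 1 0 * qconj (w 1 0) + w 2 0 * qconj (w 0 0) = 0.

Lemma iso_herm w : iso_vec w <-> herm w w = 0.
Proof. by []. Qed.

Definition e1 : 'cV[L]_3 := delta_mx 0 0.

Lemma su_herm g x y : herm (suval g *m x) (suval g *m y) = herm x y.
Proof. by case: (suP g). Qed.

Lemma iso_col0 g : iso_vec (suval g *m e1).
Proof.
by rewrite iso_herm su_herm /herm !mxE /= rmorph0 !(mulr0, mul0r) !addr0.
Qed.

Lemma col0E g i : (suval g *m e1) i 0 = suval g i 0.
Proof. by rewrite -colE mxE. Qed.

Lemma suM g h : suval (g * h)%g = suval g *m suval h. Proof. by []. Qed.

Lemma su_mulK g (w : 'cV[L]_3) : suval (g^-1)%g *m (suval g *m w) = w.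
Proof. by rewrite mulmxA -suM mulVg mul1mx. Qed.

Lemma su_mulVK g (w : 'cV[L]_3) : suval g *m (suval (g^-1)%g *m w) = w.
Proof. by rewrite mulmxA -suM mulgV mul1mx. Qed.

Lemma borel_decomp g : borel g -> exists t (t0 : t != 0) u v (H : in_H (u, v)),
  t = suval g 0 0 /\ g = (uaS H * aS t0)%g.
Proof.
move=> Bg; have [g10 g20] := (borelE g).1 Bg.
have t0 : suval g 0 0 != 0 by apply/eqP => g00; apply: (col0_neq0 g00).
exists (suval g 0 0), t0; set t := suval g 0 0.
have [y Ey] : exists y : SU L, y = (g * (aS t0)^-1)%g by exists (g * (aS t0)^-1)%g.
have t0' : t^-1 != 0 by rewrite invr_eq0.
have y00 : suval y 0 0 = 1.
  by rewrite Ey (aS_inv t0 t0') suM mul3 !mxE /= !mulr0 !addr0 divff.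
have y10 : suval y 1 0 = 0 by rewrite Ey (aS_inv t0 t0') suM mul3 !mxE /= g10; ring.
have y20 : suval y 2 0 = 0 by rewrite Ey (aS_inv t0 t0') suM mul3 !mxE /= g20; ring.
have yB : borel y by apply/borelE.
have y21 : suval y 2 1 = 0 by apply: yB.
have hy i j : herm (suval y *m delta_mx i 0) (suval y *m delta_mx j 0) = herm (delta_mx i 0) (delta_mx j 0) :> L.
  exact: su_herm.
have y22 : suval y 2 2 = 1.
  have := hy 0 2; rewrite -!colE /herm !mxE /= y00 y10 y20 !(rmorph1, rmorph0, mul0r, mul1r, addr0, add0r, mulr1).
  by move=> /(congr1 qconj); rewrite qconjK rmorph1.
have y11 : suval y 1 1 = 1.
  have [dy _] := suP y; move: dy; rewrite -det_tr det_trig ?prod_ord3 ?mxE ?y00 ?y22 ?mul1r ?mulr1 //.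
  by apply/is_trig_mxP => i j lt; rewrite mxE; apply: yB.
have y01 : suval y 0 1 = - qconj (suval y 1 2).
  have := hy 1 2; rewrite -!colE /herm !mxE /= y11 y22 y21 !(rmorph1, rmorph0, mul0r, mul1r, addr0, add0r, mulr1, mulr0).
  by move/eqP; rewrite addr_eq0 => /eqP.
have Hy : in_H (suval y 1 2, suval y 0 2).
  have := hy 2 2; rewrite -!colE /herm !mxE /= y22 !(rmorph1, rmorph0, mul0r, mul1r, addr0, mulr1, mulr0).
  by rewrite /in_H /qnorm /qtrace /= => E; apply/eqP; rewrite -[RHS]E; ring.
exists (suval y 1 2), (suval y 0 2), Hy; split=> //.
have -> : uaS Hy = y; last by rewrite Ey mulgVK.
apply: val_inj; apply/matrixP; do 2!elim/ord3P; rewrite /= ?mxE /= ?y00 ?y10 ?y20 ?y21 ?y22 ?y11 ?y01 //.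
Qed.

Lemma borel_uaS u v (H : in_H (u, v)) : borel (uaS H).
Proof. by apply/borelE; rewrite !mxE. Qed.

Lemma borel_aS t (t0 : t != 0) : borel (aS t0).
Proof. by apply/borelE; rewrite !mxE. Qed.

Lemma borelV g : borel g -> borel (g^-1)%g.
Proof.
move=> /borel_decomp[t [t0 [u [v [H [_ ->]]]]]]; rewrite invgM.
have t0' : t^-1 != 0 by rewrite invr_eq0.
by rewrite (aS_inv t0 t0') (uaS_inv H (in_HV H)); apply: borelM; [exact: borel_aS | exact: borel_uaS].
Qed.

Lemma clear_low w : iso_vec w -> w 0 0 != 0 -> in_H (w 1 0 / w 0 0, w 2 0 / w 0 0).
Proof.
rewrite /iso_vec /in_H /qnorm /qtrace /= => iw w0; rewrite !(rmorphM, fmorphV) /=.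
have c0 : qconj (w 0 0) != 0 by rewrite qconj_eq0.
apply/eqP; rewrite [LHS](_ : _ = (w 0 0 * qconj (w 2 0) + w 1 0 * qconj (w 1 0) + w 2 0 * qconj (w 0 0)) / (w 0 0 * qconj (w 0 0))).
  by rewrite iw mul0r.
by field; rewrite w0 c0.
Qed.

Lemma clear_up w : iso_vec w -> w 2 0 != 0 -> in_H (w 1 0 / w 2 0, w 0 0 / w 2 0).
Proof.
rewrite /iso_vec /in_H /qnorm /qtrace /= => iw w0; rewrite !(rmorphM, fmorphV) /=.
have c0 : qconj (w 2 0) != 0 by rewrite qconj_eq0.
apply/eqP; rewrite [LHS](_ : _ = (w 0 0 * qconj (w 2 0) + w 1 0 * qconj (w 1 0) + w 2 0 * qconj (w 0 0)) / (w 2 0 * qconj (w 2 0))).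
  by rewrite iw mul0r.
by field; rewrite w0 c0.
Qed.

Lemma uma_mxE u v : uma_mx u v = mx3 [:: [:: 1; 0; 0]; [:: u; 1; 0]; [:: v; - qconj u; 1]].
Proof.
by apply/matrixP; do 2!elim/ord3P; rewrite /uma_mx !mul3 !mxE /=; ring.
Qed.

Lemma iso_w1 w : iso_vec w -> w 0 0 = 0 -> w 1 0 = 0.
Proof.
rewrite /iso_vec => + w0; rewrite w0 rmorph0 mul0r mulr0 addr0 add0r => /eqP.
by rewrite mulf_eq0 qconj_eq0 orbb => /eqP.
Qed.

Lemma low_borel g h w u v (H : in_H (u, v)) : w = suval (h^-1 * g)%g *m e1 ->
  w 0 0 != 0 -> u = w 1 0 / w 0 0 -> v = w 2 0 / w 0 0 ->
  borel ((h * uma_prod H)^-1 * g)%g.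
Proof.
move=> Ew w0 Eu Ev.
have E : suval (h^-1 * g)%g *m e1 = w 0 0 *: (suval (uma_prod H) *m e1).
  rewrite -Ew; apply/matrixP => i j; rewrite ord1 mxE col0E uma_prodE uma_mxE.
  by elim/ord3P: i; rewrite mxE /= ?Eu ?Ev ?mulr1 // mulrCA divff ?mulr1.
apply/borelE; rewrite -!col0E invgM -mulgA suM -mulmxA E -scalemxAr su_mulK !mxE /=.
by rewrite mulr0.
Qed.

Lemma up_borel g h w u v (H : in_H (u, v)) : w = suval (h^-1 * g)%g *m e1 ->
  w 2 0 != 0 -> u = w 1 0 / w 2 0 -> v = w 0 0 / w 2 0 ->
  borel ((h * uaS H * sS)^-1 * g)%g.
Proof.
move=> Ew w0 Eu Ev.
have E : suval (h^-1 * g)%g *m e1 = (- w 2 0) *: (suval (uaS H * sS)%g *m e1).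
  rewrite -Ew; apply/matrixP => i j; rewrite ord1 mxE col0E suM mul3.
  by elim/ord3P: i; rewrite !mxE /= ?Eu ?Ev; field; rewrite ?fmorph_eq0 ?w0.
apply/borelE; rewrite -!col0E -mulgA invgM -mulgA suM -mulmxA E -scalemxAr su_mulK !mxE /=.
by rewrite mulr0.
Qed.

End UnitaryElements.

Section Norms.
Variables (R : realType) (F : fieldType) (k : fieldType) (L : quad_ext k).
Variables (iotaL : {rmorphism F -> L}) (Q : L -> int) (e : nat).
Hypothesis pQ : is_place iotaL Q.
Hypothesis Qc : forall x, Q (qconj x) = Q x.
Hypothesis e0 : (0 < e)%N.
Implicit Types (u v t : L) (g h : SU L) (w : 'cV[L]_3) (r X Y : R).

(* The factor 2 avoids halves: norms take values in (1/2)Q. *)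
Definition rge r x : Prop := x = 0 \/ r <= 2 * (Q x)%:~R.

Lemma rge0 r : rge r 0. Proof. by left. Qed.

Lemma rgeE r x : x != 0 -> rge r x <-> r <= 2 * (Q x)%:~R.
Proof. by move=> x0; split=> [[/eqP|//]|]; [rewrite (negPf x0) | right]. Qed.

Lemma rge_le r s x : s <= r -> rge r x -> rge s x.
Proof. by move=> le [->|ge]; [left | right; apply: le_trans ge]. Qed.

Lemma rgeM r s x y : rge r x -> rge s y -> rge (r + s) (x * y).
Proof.
have [->|x0] := eqVneq x 0; first by rewrite mul0r; left.
have [->|y0] := eqVneq y 0; first by rewrite mulr0; left.
move=> /(rgeE _ x0) rx /(rgeE _ y0) ry; right.
by rewrite (plM pQ) // rmorphD /= mulrDr lerD.
Qed.

Lemma rgeN r x : rge r x -> rge r (- x).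
Proof. by case=> [->|le]; [left; rewrite oppr0 | right; rewrite (plN pQ)]. Qed.

Lemma rge_conj r x : rge r x -> rge r (qconj x).
Proof. by case=> [->|le]; [left; rewrite rmorph0 | right; rewrite Qc]. Qed.

Lemma rgeD r x y : rge r x -> rge r y -> rge r (x + y).
Proof.
have [->|x0] := eqVneq x 0; first by rewrite add0r.
have [->|y0] := eqVneq y 0; first by rewrite addr0.
move=> /(rgeE _ x0) rx /(rgeE _ y0) ry.
have : vge Q (Num.min (Q x) (Q y)) (x + y).
  by apply: (vgeD pQ); right; rewrite ge_min lexx ?orbT.
case=> [->|ge]; first by left.
right; have [le|lt] := leP (Q x) (Q y).
  apply: le_trans rx _; rewrite ler_pM2l ?ltr0n // ler_int.
  by move: ge; rewrite (min_idPl le).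
apply: le_trans ry _; rewrite ler_pM2l ?ltr0n // ler_int.
by move: ge; rewrite (min_idPr (ltW lt)).
Qed.

Lemma rge1 r : rge r (1 : L) <-> r <= 0.
Proof. by rewrite rgeE ?oner_neq0 // (pl1 pQ) mulr0. Qed.

Lemma rge_div r x t : t != 0 -> rge r (x / t) <-> rge (r + 2 * (Q t)%:~R) x.
Proof.
move=> t0; have tt : rge (2 * (Q t)%:~R) t by right.
have ttV : rge (- (2 * (Q t)%:~R)) t^-1 by right; rewrite (plV pQ) mulrNz mulrN.
split=> H; first by rewrite -[x](divfK t0); apply: rgeM.
by rewrite -[r](addrK (2 * (Q t)%:~R)); apply: rgeM.
Qed.

Lemma rge_scale r x t : t != 0 -> rge r (t * x) <-> rge (r - 2 * (Q t)%:~R) x.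
Proof.
move=> t0; have tV : t^-1 != 0 by rewrite invr_eq0.
by rewrite mulrC -{1}[t]invrK rge_div // (plV pQ) mulrNz mulrN.
Qed.

Lemma rge_u u v r : in_H (u, v) -> rge r v -> rge (r / 2) u.
Proof.
rewrite /in_H /qnorm /qtrace /= => /eqP H rv.
have [->|u0] := eqVneq u 0; first exact: rge0.
have : rge r (u * qconj u).
  have -> : u * qconj u = - (v + qconj v) by apply/eqP; rewrite -addr_eq0 H.
  by apply/rgeN/rgeD => //; apply: rge_conj.
rewrite !rgeE ?mulf_neq0 ?qconj_eq0 // (plM pQ) ?qconj_eq0 // Qc rmorphD /=; lra.
Qed.

(* The ball of radius r of the norm on L^3 attached to the point of the
   apartment whose scaled coordinate 4 e x is X. *)
Definition nrm X r w : Prop := [/\ rge (r - X) (w 0 0), rge r (w 1 0) & rge (r + X) (w 2 0)].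

Lemma nrmD X r w w' : nrm X r w -> nrm X r w' -> nrm X r (w + w').
Proof. by move=> [a b c] [a' b' c']; split; rewrite mxE; apply: rgeD. Qed.

Lemma nrmZ X r s t w : rge s t -> nrm X r w -> nrm X (s + r) (t *: w).
Proof.
by move=> st [a b c]; split; rewrite mxE -?addrA; apply: rgeM => //.
Qed.

Lemma nrm_le X r s w : s <= r -> nrm X r w -> nrm X s w.
Proof.
by move=> le [a b c]; split; [apply: rge_le a | apply: rge_le b | apply: rge_le c]; rewrite ?lerD2r.
Qed.

Lemma nrm_ua X r u v (H : in_H (u, v)) w : rge (- 2 * X) v -> nrm X r w ->
  nrm X r (suval (uaS H) *m w).
Proof.
move=> rv [a b c]; have ru : rge (- X) u by apply: rge_le (rge_u H rv); lra.
split; rewrite mul3 !mxE /= ?mul1r ?mul0r ?add0r ?addr0.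
- apply: rgeD; first apply: rgeD => //.
    by apply: rge_le (rgeM (rgeN (rge_conj ru)) b); lra.
  by apply: rge_le (rgeM rv c); lra.
- by apply: rgeD => //; apply: rge_le (rgeM ru c); lra.
- exact: c.
Qed.

Lemma nrm_s X r w : nrm X r w <-> nrm (- X) r (s_mx L *m w).
Proof.
have [E0 [E1 E2]] := s_mxE w; rewrite /nrm E0 E1 E2 opprK.
split=> -[a b c]; split; try exact: rgeN.
- by rewrite -[w 0 0]opprK; apply: rgeN.
- by rewrite -[w 1 0]opprK; apply: rgeN.
- by rewrite -[w 2 0]opprK; apply: rgeN.
Qed.

Lemma nrm_uma X r u v (H : in_H (u, v)) w : rge (2 * X) v -> nrm X r w ->
  nrm X r (suval (uma_prod H) *m w).
Proof.
move=> rv Nw; rewrite /uma_prod !suM -!mulmxA -[X]opprK.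
apply: (nrm_s (- X) r _).1.
apply: nrm_ua; first by rewrite mulrNN.
by apply: (nrm_s X r w).1.
Qed.

Lemma nrm_a X r t (t0 : t != 0) w : nrm X r w <-> nrm (X - 2 * (Q t)%:~R) r (a_mx t *m w).
Proof.
have c0 : qconj t != 0 by rewrite qconj_eq0.
have E : [/\ (a_mx t *m w) 0 0 = t * w 0 0, (a_mx t *m w) 1 0 = qconj t / t * w 1 0 &
   (a_mx t *m w) 2 0 = w 2 0 / qconj t].
  by rewrite !mul3 !mxE /=; split; ring.
have h0 : rge (r - (X - 2 * (Q t)%:~R)) (t * w 0 0) = rge (r - X) (w 0 0).
  by rewrite (propext (rge_scale _ _ t0)); congr (rge _ _); ring.
have h1 : rge r (qconj t / t * w 1 0) = rge r (w 1 0).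
  have ct0 : qconj t / t != 0 by rewrite mulf_neq0 ?invr_eq0.
  rewrite (propext (rge_scale _ _ ct0)) (plM pQ) ?invr_eq0 // (plV pQ) Qc subrr.
  by rewrite mulr0 subr0.
have h2 : rge (r + (X - 2 * (Q t)%:~R)) (w 2 0 / qconj t) = rge (r + X) (w 2 0).
  by rewrite (propext (rge_div _ _ c0)) Qc; congr (rge _ _); ring.
by rewrite /nrm; case: E => -> -> ->; rewrite h0 h1 h2.
Qed.

Lemma nrm_e1 X r : nrm X r (e1 L) <-> r <= X.
Proof.
rewrite /nrm /e1 !mxE /= (propext (rge1 _)) subr_le0; split=> [[]//|le].
by split=> //; apply: rge0.
Qed.

Definition preserves X g : Prop := forall r w, nrm X r w <-> nrm X r (suval g *m w).

Lemma preserves1 X : preserves X 1%g.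
Proof. by move=> r w; rewrite /= mul1mx. Qed.
Lemma preservesM X g h : preserves X g -> preserves X h -> preserves X (g * h)%g.
Proof. by move=> pg ph r w; rewrite suM -mulmxA -pg -ph. Qed.
Lemma preservesV X g : preserves X g -> preserves X (g^-1)%g.
Proof. by move=> pg r w; rewrite [X in _ <-> X]pg su_mulVK. Qed.

Lemma preserves_ua X u v (H : in_H (u, v)) : rge (- 2 * X) v -> preserves X (uaS H).
Proof.
move=> rv r w; split; first exact: nrm_ua.
move=> /(nrm_ua (in_HV H) (rge_conj rv)).
by rewrite -(uaS_inv H) su_mulK.
Qed.

Lemma preserves_uma X u v (H : in_H (u, v)) : rge (2 * X) v -> preserves X (uma_prod H).
Proof.
move=> rv r w; split; first exact: nrm_uma.
move=> /(nrm_uma (in_HV H) (rge_conj rv)).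
have -> : uma_prod (in_HV H) = ((uma_prod H)^-1)%g.
  by rewrite /uma_prod !invgM sS_inv -(uaS_inv H) mulgA.
by rewrite su_mulK.
Qed.

Lemma preserves_ua_rge X u v (H : in_H (u, v)) : preserves X (uaS H) -> rge (- 2 * X) v.
Proof.
move=> pu; have /pu[+ _ _] : nrm X (- X) (delta_mx 2 0).
  split; rewrite !mxE /=; try exact: rge0.
  by rewrite addNr; apply/rge1.
by rewrite -colE !mxE /= => H'; apply: rge_le H'; lra.
Qed.

Lemma preserves_uma_rge X u v (H : in_H (u, v)) : preserves X (uma_prod H) -> rge (2 * X) v.
Proof.
move=> pu; have /pu[_ _ +] : nrm X X (e1 L) by apply/nrm_e1.
by rewrite col0E uma_prodE uma_mxE !mxE /= => H'; apply: rge_le H'; lra.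
Qed.

Local Notation nu := (nu_ext R e Q).
Definition sc (x : R) : R := 4 * e%:R * x.

Let eR0 : (e%:R : R) != 0. Proof. by rewrite pnatr_eq0 -lt0n. Qed.

Lemma sc_inj : injective sc.
Proof. by move=> x y /mulfI; apply; rewrite mulf_neq0 ?pnatr_eq0 -?lt0n. Qed.

Lemma sc_opp (x : R) : sc (- x) = - sc x. Proof. by rewrite /sc mulrN. Qed.

Lemma sc_shift (x : R) t : sc (x - 1 / 2 * nu t) = sc x - 2 * (Q t)%:~R.
Proof. by rewrite /sc /nu_ext; field. Qed.

Lemma apt_act_nrm (n : SU L) f : apt_act nu n f -> forall (x : R) r w,
  nrm (sc x) r w <-> nrm (sc (f x)) r (suval n *m w).
Proof.
elim=> {n f} [n En x r w|n t t0 En x r w|m n f g _ IHm _ IHn x r w].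
- by rewrite En sc_opp; apply: nrm_s.
- by rewrite En sc_shift; apply: nrm_a.
- by rewrite suM -mulmxA /= IHn IHm.
Qed.

Lemma apt_act_aS t (t0 : t != 0) : apt_act nu (aS t0) (fun x => x - 1 / 2 * nu t).
Proof. exact: apt_act_a. Qed.

Lemma apt_act_sS : apt_act nu (sS L) (fun x => - x).
Proof. exact: apt_act_s. Qed.

Lemma nu_rge v (x : R) : v = 0 \/ - 2 * a_form x <= nu v <-> rge (- 2 * sc x) v.
Proof.
rewrite /rge /nu_ext /a_form /sc ler_pdivlMr ?ltr0n //; split=> -[->|le]; [by left|right|by left|right].
  by move: le; lra.
by move: le; lra.
Qed.

Lemma nu_rgeN v (x : R) : v = 0 \/ - 2 * (- a_form x) <= nu v <-> rge (2 * sc x) v.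
Proof.
rewrite /rge /nu_ext /a_form /sc ler_pdivlMr ?ltr0n //; split=> -[->|le]; [by left|right|by left|right].
  by move: le; lra.
by move: le; lra.
Qed.

Definition stabb X : {pred SU L} := fun g => `[< preserves X g >].

Lemma stabb_closed X : group_closed (stabb X).
Proof.
split; first by apply/asboolP; apply: preserves1.
by move=> g h /asboolP pg /asboolP ph; apply/asboolP/preservesM/preservesV.
Qed.

HB.instance Definition _ X := isMulClosed.Build (SU L) (stabb X) (group_closedM (stabb_closed X)).
HB.instance Definition _ X := isMul1Closed.Build (SU L) (stabb X) (proj1 (stabb_closed X)).
HB.instance Definition _ X := isInvClosed.Build (SU L) (stabb X) (group_closedV (stabb_closed X)).

Lemma parahoric_preserves (x : R) g : parahoric nu x g -> preserves (sc x) g.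
Proof.
move=> /(_ (stabb (sc x)))H; apply/asboolP; apply: H => {}g [] [u [v [H /[swap] Eg]]].
  move=> /nu_rge rv; apply/asboolP.
  by have -> : g = uaS H; [apply: val_inj | apply: preserves_ua].
move=> /nu_rgeN rv; apply/asboolP.
by have -> : g = uma_prod H; [apply: val_inj | apply: preserves_uma].
Qed.

Lemma parahoricM (x : R) g h : parahoric nu x g -> parahoric nu x h -> parahoric nu x (g * h)%g.
Proof. by move=> pg ph S sub; apply: gpredM; [apply: pg | apply: ph]. Qed.

Lemma parahoric_ua (x : R) u v (H : in_H (u, v)) : rge (- 2 * sc x) v -> parahoric nu x (uaS H).
Proof. by move=> rv S sub; apply: sub; left; exists u, v; split=> //; apply/nu_rge. Qed.

Lemma parahoric_uma (x : R) u v (H : in_H (u, v)) : rge (2 * sc x) v -> parahoric nu x (uma_prod H).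
Proof. by move=> rv S sub; apply: sub; right; exists u, v; split=> //; apply/nu_rgeN. Qed.

(* The dichotomy behind the Bruhat and Iwasawa decompositions. *)
Lemma iso_dichotomy X w : iso_vec w -> w != 0 ->
  (w 0 0 != 0 /\ rge (2 * X) (w 2 0 / w 0 0)) \/ (w 2 0 != 0 /\ rge (- 2 * X) (w 0 0 / w 2 0)).
Proof.
move=> iw w0; have [a0|a0] := eqVneq (w 0 0) 0.
  right; rewrite a0 mul0r; split; last exact: rge0.
  apply: contraNneq w0 => c0; apply/eqP/matrixP => i j; rewrite ord1 mxE.
  by elim/ord3P: i => //; apply: iso_w1.
have [c0|c0] := eqVneq (w 2 0) 0; first by left; rewrite c0 mul0r; split=> //; exact: rge0.
rewrite !rgeE ?mulf_neq0 ?invr_eq0 // !(plM pQ) ?invr_eq0 // !(plV pQ) !rmorphB /=.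
have [le|lt] := leP X ((Q (w 2 0))%:~R - (Q (w 0 0))%:~R); [left | right].
  by split=> //; rewrite ler_pM2l ?ltr0n.
by split=> //; move: lt; lra.
Qed.

Lemma nrm_iso1 X r w : iso_vec w -> w 0 0 != 0 -> rge (2 * X) (w 2 0 / w 0 0) ->
  nrm X r w <-> r <= X + 2 * (Q (w 0 0))%:~R.
Proof.
move=> iw a0 rc; have H := clear_low iw a0.
have rb := rge_u H rc; rewrite !rge_div // in rc rb.
split=> [[+ _ _]|le]; first by rewrite rgeE // lerBlDr addrC.
split; first by rewrite rgeE // lerBlDr addrC.
  by apply: rge_le rb; lra.
by apply: rge_le rc; lra.
Qed.

Lemma nrm_iso2 X r w : iso_vec w -> w 2 0 != 0 -> rge (- 2 * X) (w 0 0 / w 2 0) ->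
  nrm X r w <-> r <= - X + 2 * (Q (w 2 0))%:~R.
Proof.
move=> iw a0 rc; have H := clear_up iw a0.
have rb := rge_u H rc; rewrite !rge_div // in rc rb.
split=> [[_ _ +]|le]; first by rewrite rgeE //; lra.
split; first by apply: rge_le rc; lra.
  by apply: rge_le rb; lra.
by rewrite rgeE //; lra.
Qed.

Lemma su_e1_neq0 g : suval g *m e1 L != 0.
Proof.
apply/eqP => /(congr1 (mulmx (suval g^-1)%g)); rewrite su_mulK mulmx0.
by move=> /matrixP/(_ 0 0)/eqP; rewrite !mxE /= oner_eq0.
Qed.

Lemma le_iff_eq (X Y : R) : (forall r, r <= X <-> r <= Y) -> X = Y.
Proof. by move=> H; apply/eqP; rewrite eq_le (H X).1 ?(H Y).2. Qed.

Lemma preserves_decomp (x : R) g : preserves (sc x) g ->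
  exists n f, [/\ apt_act nu n f, f x = x & parahoric nu x (g * n)%g].
Proof.
move=> pg; set X := sc x in pg *; have [w Ew] : exists w, w = suval g *m e1 L by eexists.
have iw : iso_vec w by rewrite Ew; apply: iso_col0.
have w0 : w != 0 by rewrite Ew; apply: su_e1_neq0.
have Nw r : nrm X r w <-> r <= X by rewrite Ew -pg nrm_e1.
rewrite -[g]mul1g -invg1 in Ew.
have [[a0 rc]|[c0 ra]] := iso_dichotomy X iw w0.
  have Qa : Q (w 0 0) = 0.
    have : X = X + 2 * (Q (w 0 0))%:~R.
      by apply: le_iff_eq => r; rewrite -Nw nrm_iso1.
    move/eqP; rewrite -subr_eq0 opprD addNKr oppr_eq0 mulf_eq0 pnatr_eq0 /=.
    by rewrite intr_eq0 => /eqP.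
  have H := clear_low iw a0.
  have := @low_borel _ _ g 1%g w _ _ H Ew a0 erefl erefl; rewrite mul1g.
  move=> /borel_decomp[t [t0 [u [v [H' [Et Eg]]]]]].
  have ph := preserves_uma H rc.
  have pua : preserves X (uaS H' * aS t0)%g by rewrite -Eg; apply/preservesM/pg/preservesV.
  have Qt : Q t = 0.
    have E : suval (uaS H' * aS t0)%g *m e1 L = t *: e1 L.
      rewrite suM -mulmxA; apply/matrixP => i j; rewrite ord1 mul3 !col0E !mxE /=.
      by elim/ord3P: i; rewrite ?mxE /=; ring.
    have : X = X + 2 * (Q t)%:~R.
      apply: le_iff_eq => r; rewrite -nrm_e1 pua E /nrm !mxE /= mulr1 (propext (rgeE _ t0)) lerBlDr addrC.
      by rewrite !mulr0; split=> [[]//|le]; split=> //; apply: rge0.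
    move/eqP; rewrite -subr_eq0 opprD addNKr oppr_eq0 mulf_eq0 pnatr_eq0 /=.
    by rewrite intr_eq0 => /eqP.
  have pat : preserves X (aS t0).
    by move=> r w'; rewrite [X in X <-> _](nrm_a X r t0) Qt mulr0 subr0.
  have pu : preserves X (uaS H').
    by rewrite -[uaS H'](mulgK (aS t0)); apply/preservesM/preservesV.
  have tV : t^-1 != 0 by rewrite invr_eq0.
  exists (aS tV), (fun y => y - 1 / 2 * nu t^-1); split; first exact: apt_act_aS.
    by rewrite /nu_ext (plV pQ) Qt oppr0 mul0r mulr0 subr0.
  have -> : (g * aS tV = uma_prod H * uaS H')%g.
    by rewrite -(mulVKg (uma_prod H) g) Eg -(aS_inv t0 tV) -!mulgA mulgV mulg1.
  apply: parahoricM; first exact: (parahoric_uma H rc).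
  exact: (parahoric_ua _ (preserves_ua_rge pu)).
have Qw : X = (Q (w 2 0))%:~R.
  have : X = - X + 2 * (Q (w 2 0))%:~R.
    by apply: le_iff_eq => r; rewrite -Nw nrm_iso2.
  lra.
have H := clear_up iw c0.
have := @up_borel _ _ g 1%g w _ _ H Ew c0 erefl erefl; rewrite mul1g.
move=> /borel_decomp[t [t0 [u [v [H' [Et Eg]]]]]].
have ph := preserves_ua H ra.
have Qt : Q t = Q (w 2 0).
  have E : suval ((uaS H * sS L)^-1 * g)%g *m e1 L = suval (sS L * (uaS H)^-1)%g *m w.
    by rewrite [X in _ = _ *m X]Ew invgM sS_inv invg1 mul1g !suM -!mulmxA.
  have : t = - w 2 0; last by move=> ->; rewrite (plN pQ).
  rewrite Et -col0E E suM -mulmxA (s_mxE _).1 (uaS_inv H (in_HV H)) mul3 !mxE /=.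
  by rewrite !(mul0r, add0r, mul1r).
have tV : t^-1 != 0 by rewrite invr_eq0.
have fx : (fun y => y - 1 / 2 * nu t^-1) (- x) = x.
  apply: sc_inj; rewrite sc_shift sc_opp -/X (plV pQ) Qt mulrNz -Qw; ring.
have pn : preserves X (aS tV * sS L)%g.
  move=> r w'; have := apt_act_nrm (apt_act_mul (apt_act_aS tV) apt_act_sS) x r w'.
  by rewrite /= fx.
have En : ((aS tV * sS L)^-1 = sS L * aS t0)%g.
  by rewrite invgM sS_inv -(aS_inv t0 tV) invgK.
have Eg' : (g = uaS H * uma_prod H' * (sS L * aS t0))%g.
  rewrite -(mulVKg (uaS H * sS L)%g g) Eg /uma_prod -!mulgA; congr (_ * _)%g.
  by rewrite (mulgA (sS L) (sS L)) sS_sq mul1g.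
exists (aS tV * sS L)%g, ((fun y => y - 1 / 2 * nu t^-1) \o (fun y => - y)); split=> //.
  exact: apt_act_mul (apt_act_aS tV) apt_act_sS.
have -> : (g * (aS tV * sS L) = uaS H * uma_prod H')%g.
  by rewrite Eg' -En mulgVK.
apply: parahoricM; first exact: (parahoric_ua H ra).
apply: (parahoric_uma H'); apply: (@preserves_uma_rge _ _ _ H').
have -> : (uma_prod H' = (uaS H)^-1 * g * (aS tV * sS L))%g.
  have key (a b c : SU L) : (b = a^-1 * (a * b * c^-1) * c)%g by rewrite -!mulgA mulVg mulg1 mulKg.
  by rewrite Eg' -En; apply: key.
by apply: preservesM => //; apply: preservesM => //; apply: preservesV.
Qed.

Lemma tree_relP g (x : R) h (y : R) : tree_rel nu (g, x) (h, y) <->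
  forall r w, nrm (sc x) r (suval (g^-1)%g *m w) <-> nrm (sc y) r (suval (h^-1)%g *m w).
Proof.
split=> [[n [f [/= an -> /parahoric_preserves pn]]] r w|H].
  have E : w = suval g *m (suval (g^-1 * h * n)%g *m (suval (n^-1)%g *m (suval (h^-1)%g *m w))).
    by rewrite !suM -!mulmxA !su_mulVK.
  rewrite {1}E su_mulK -pn (apt_act_nrm an) su_mulVK //.
pose m := (g^-1 * h)%g; have mP r w : nrm (sc x) r (suval m *m w) <-> nrm (sc y) r w.
  by rewrite suM -mulmxA H su_mulK.
have [n [f [an fx]]] : exists n f, apt_act nu n f /\ y = f x.
  have iw := iso_col0 m.
  have Nw r : nrm (sc x) r (suval m *m e1 L) <-> r <= sc y by rewrite mP nrm_e1.
  have [[a0 rc]|[c0 ra]] := iso_dichotomy (sc x) iw (su_e1_neq0 m).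
    have E : sc y = sc x + 2 * (Q ((suval m *m e1 L) 0 0))%:~R.
      by apply: le_iff_eq => r; rewrite -Nw nrm_iso1.
    have tV : ((suval m *m e1 L) 0 0)^-1 != 0 by rewrite invr_eq0.
    exists (aS tV), (fun y => y - 1 / 2 * nu ((suval m *m e1 L) 0 0)^-1); split; first exact: apt_act_aS.
    by apply: sc_inj; rewrite E sc_shift (plV pQ) mulrNz; ring.
  have E : sc y = - sc x + 2 * (Q ((suval m *m e1 L) 2 0))%:~R.
    by apply: le_iff_eq => r; rewrite -Nw nrm_iso2.
  have tV : ((suval m *m e1 L) 2 0)^-1 != 0 by rewrite invr_eq0.
  exists (aS tV * sS L)%g, ((fun y => y - 1 / 2 * nu ((suval m *m e1 L) 2 0)^-1) \o (fun y => - y)).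
  split; first exact: apt_act_mul (apt_act_aS tV) apt_act_sS.
  by apply: sc_inj; rewrite E /= sc_shift sc_opp (plV pQ) mulrNz; ring.
have pmn : preserves (sc x) (m * n)%g.
  by move=> r w; rewrite suM -mulmxA mP fx -(apt_act_nrm an).
have [n' [f' [an' f'x pn']]] := preserves_decomp pmn.
exists (n * n')%g, (f \o f'); split; first exact: apt_act_mul.
  by rewrite /= f'x.
by rewrite /= mulgA.
Qed.

Lemma tree_rel_coord g (x : R) h (y : R) : tree_rel nu (g, x) (h, y) ->
  exists z : int, sc y = sc x + 2 * z%:~R \/ sc y = - sc x + 2 * z%:~R.
Proof.
move=> /tree_relP H; pose m := (g^-1 * h)%g.
have mP r w : nrm (sc x) r (suval m *m w) <-> nrm (sc y) r w.
  by rewrite suM -mulmxA H su_mulK.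
have iw := iso_col0 m.
have Nw r : nrm (sc x) r (suval m *m e1 L) <-> r <= sc y by rewrite mP nrm_e1.
have [[a0 rc]|[c0 ra]] := iso_dichotomy (sc x) iw (su_e1_neq0 m).
  exists (Q ((suval m *m e1 L) 0 0)); left.
  by apply: le_iff_eq => r; rewrite -Nw nrm_iso1.
exists (Q ((suval m *m e1 L) 2 0)); right.
by apply: le_iff_eq => r; rewrite -Nw nrm_iso2.
Qed.

Lemma tree_point_eq g (x : R) h (y : R) : tree_point nu g x = tree_point nu h y <->
  forall r w, nrm (sc x) r (suval (g^-1)%g *m w) <-> nrm (sc y) r (suval (h^-1)%g *m w).
Proof.
split=> [E|H].
  apply/tree_relP; rewrite -[tree_rel _ _ _]/(tree_point nu g x (h, y)) E.
  by apply/tree_relP.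
apply/seteqP; split=> -[h' y'] /tree_relP H'; apply/tree_relP => r w.
  by rewrite -H H'.
by rewrite H H'.
Qed.

Lemma tree_act_point g h (x : R) : tree_act g (tree_point nu h x) = tree_point nu (g * h)%g x.
Proof.
apply/seteqP; split=> [_ [[h' y] /tree_relP H <-]|[h' y] /tree_relP H].
  apply: (tree_relP _ _ (g * h')%g y).2 => r w.
  by rewrite !invgM !(suM _ (g^-1)%g) -!mulmxA H.
exists ((g^-1 * h')%g, y); last by rewrite /= mulVKg.
apply/tree_relP => r w; have := H r (suval g *m w).
by rewrite !invgM invgK !suM -!mulmxA su_mulK.
Qed.

End Norms.

Section TreeCombinatorics.
Variables (R : realType) (F : fieldType) (k : fieldType) (L : quad_ext k).
Variables (iotaL : {rmorphism F -> L}) (Q : L -> int) (e : nat).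
Hypothesis pQ : is_place iotaL Q.
Hypothesis Qc : forall x, Q (qconj x) = Q x.
Hypothesis e0 : (0 < e)%N.
Implicit Types (g h : SU L) (i j : int) (z : boundary L).

Local Notation nu := (nu_ext R e Q).
Local Notation nrm := (@nrm R k L Q).
Local Notation preserves := (@preserves R k L Q).
Local Notation rge := (@rge R k L Q).

Definition lv j : R := j%:~R / (4 * e%:R).

Let eR0 : (e%:R : R) != 0. Proof. by rewrite pnatr_eq0 -lt0n. Qed.

Lemma sc_lv j : sc e (lv j) = j%:~R.
Proof. by rewrite /sc /lv mulrC divfK // mulf_neq0 ?pnatr_eq0 -?lt0n. Qed.

Lemma lv_sc x j : sc e x = j%:~R -> x = lv j.
Proof. by rewrite -sc_lv => /(sc_inj e0). Qed.

Lemma apt_vertexP (x : R) : apt_vertex nu x <-> exists j, x = lv j.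
Proof.
split=> [[t t0]|[j ->]].
  rewrite /a_form /nu_ext => E; exists (Q t); apply: lv_sc; rewrite /sc.
  have -> : 4 * e%:R * x = 2 * e%:R * (2 * x) by ring.
  by rewrite E; field.
have [t t0 Qt] := vge_uniformizerz pQ j; exists t => //.
by rewrite /a_form /nu_ext Qt /lv; field.
Qed.

Record vert := Vert { vset : set (SU L * R); _ : `[< tree_vertices nu vset >] }.

HB.instance Definition _ := [isSub for vset].
HB.instance Definition _ := [Choice of vert by <:].

Fact pt_vertex g j : `[< tree_vertices nu (tree_point nu g (lv j)) >].
Proof. by apply/asboolP; exists g, (lv j); split=> //; apply/apt_vertexP; exists j. Qed.

Definition pt g j : vert := Vert (pt_vertex g j).

Lemma pt_eq g i h j : pt g i = pt h j <->
  forall r w, nrm i%:~R r (suval (g^-1)%g *m w) <-> nrm j%:~R r (suval (h^-1)%g *m w).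
Proof.
rewrite -!sc_lv; split=> [/(congr1 vset)|]; first by move/(tree_point_eq pQ Qc e0).
by move=> H; apply/val_inj/(tree_point_eq pQ Qc e0).
Qed.

Lemma ptP (v : vert) : exists g j, v = pt g j.
Proof.
have /asboolP[g [x [/apt_vertexP[j ->] E]]] := valP v.
by exists g, j; apply: val_inj.
Qed.

Fact vact_vertex g (v : vert) : `[< tree_vertices nu (tree_act g (val v)) >].
Proof.
have [h [j ->]] := ptP v; rewrite /= (tree_act_point pQ Qc e0).
exact: pt_vertex.
Qed.

Definition vact g (v : vert) : vert := Vert (vact_vertex g v).

Lemma vact_pt g h j : vact g (pt h j) = pt (g * h)%g j.
Proof. by apply: val_inj; rewrite /= (tree_act_point pQ Qc e0). Qed.

Lemma vact1 v : vact 1%g v = v.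
Proof. by have [g [j ->]] := ptP v; rewrite vact_pt mul1g. Qed.

Lemma vactM g h v : vact g (vact h v) = vact (g * h)%g v.
Proof. by have [g' [j ->]] := ptP v; rewrite !vact_pt mulgA. Qed.

Definition vert_act := LAction vact1 vactM.

Lemma pt_preserves g h j : pt (g * h)%g j = pt g j <-> preserves j%:~R h.
Proof.
rewrite pt_eq; split=> H r w.
  have := H r (suval (g * h)%g *m w).
  by rewrite su_mulK suM -mulmxA su_mulK.
rewrite invgM suM -mulmxA; apply: iff_sym.
exact: (preservesV H).
Qed.

Lemma pt_aS g t (t0 : t != 0) j : pt (g * aS t0)%g j = pt g (j - 2 * Q t).
Proof.
apply/pt_eq => r w; rewrite (nrm_a pQ Qc _ r t0) -[a_mx t]/(suval (aS t0)).
rewrite invgM suM -mulmxA su_mulVK.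
by have -> : (j - 2 * Q t)%:~R = j%:~R - 2 * (Q t)%:~R :> R by rewrite rmorphB rmorphM.
Qed.

Lemma pt_sS g j : pt (g * sS L)%g j = pt g (- j).
Proof.
apply/pt_eq => r w; rewrite (nrm_s pQ) -[s_mx L]/(suval (sS L)).
by rewrite invgM suM -mulmxA su_mulVK rmorphN.
Qed.

Definition bd g : boundary L := boundary_fun g None.

Lemma bdM g h : bd (g * h)%g = boundary_fun g (bd h).
Proof. by rewrite /bd boundary_funM. Qed.

Lemma bd_eq g h : bd g = bd h <-> borel (g^-1 * h)%g.
Proof.
have bg : borel (g_ (bd g) * g)%g.
  by have := (boundary_funP g None (bd g)).2 erefl; rewrite /boundary_rel invg1 mulg1.
split=> [E|B].
  have bh : borel (g_ (bd h) * h)%g.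
    by have := (boundary_funP h None (bd h)).2 erefl; rewrite /boundary_rel invg1 mulg1.
  rewrite E in bg; have := borelM (borelV bg) bh.
  by rewrite invgM -mulgA mulKg.
symmetry; apply/boundary_funP; rewrite /boundary_rel invg1 mulg1.
by have := borelM bg B; rewrite -mulgA mulVKg.
Qed.

Lemma bd_ex z : exists g, bd g = z.
Proof.
exists ((g_ z)^-1)%g; apply/boundary_funP; rewrite /boundary_rel invg1 mulg1 mulgV.
by apply/borelE; rewrite !mxE.
Qed.

Lemma bd_borel g h : borel h -> bd (g * h)%g = bd g.
Proof. by move=> B; symmetry; apply/bd_eq; rewrite mulKg. Qed.

Definition Par z (v w : vert) : Prop := exists g j, [/\ bd g = z, v = pt g j & w = pt g (j + 1)].

Lemma rge_int i x : rge (2 * i%:~R + 1) x -> rge (2 * (i + 1)%:~R) x.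
Proof.
case=> [->|le]; [by left|right; rewrite ler_pM2l ?ltr0n // ler_int].
have : (2 * i + 1)%:~R <= (2 * Q x)%:~R :> R by rewrite rmorphD !rmorphM.
by rewrite ler_int; lia.
Qed.

Lemma iwasawa2 z h i : exists g, bd g = z /\
  ((pt h i = pt g i /\ pt h (i + 1) = pt g (i + 1)) \/
   (pt h i = pt g (- i) /\ pt h (i + 1) = pt g (- (i + 1)))).
Proof.
have [g0 <-] := bd_ex z.
have [w Ew] : exists w, w = suval (h^-1 * g0)%g *m e1 L by eexists.
have iw : iso_vec w by rewrite Ew; apply: iso_col0.
have w0 : w != 0 by rewrite Ew; apply: su_e1_neq0.
have [[a0 rc]|[c0 ra]] := iso_dichotomy pQ (i%:~R + 1 / 2 : R) iw w0.
  have H := clear_low iw a0; exists (h * uma_prod H)%g.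
  have rc1 : rge (2 * (i + 1)%:~R) (w 2 0 / w 0 0).
    by apply: rge_int; apply: rge_le rc; lra.
  split; first by apply/bd_eq; apply: (low_borel (w := w)).
  left; split; symmetry; apply/pt_preserves; apply: (preserves_uma pQ Qc) => //.
  by apply: rge_le rc1; rewrite rmorphD /=; lra.
have H := clear_up iw c0; exists (h * uaS H * sS L)%g.
have ra1 : rge (- 2 * i%:~R) (w 0 0 / w 2 0).
  have -> : - 2 * i%:~R = 2 * (- (i + 1) + 1)%:~R :> R by rewrite !(rmorphD, rmorphN) /=; ring.
  by apply: rge_int; apply: rge_le ra; rewrite !(rmorphD, rmorphN) /=; lra.
split; first by apply/bd_eq; apply: (up_borel (w := w)).
right; rewrite !pt_sS !opprK; split; symmetry; apply/pt_preserves; apply: (preserves_ua pQ Qc) => //.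
by apply: rge_le ra1; rewrite rmorphD /=; lra.
Qed.

Lemma iwasawa z v : exists g j, bd g = z /\ v = pt g j.
Proof.
have [h [i ->]] := ptP v; have [g [bg [[E _]|[E _]]]] := iwasawa2 z h i.
  by exists g, i.
by exists g, (- i).
Qed.

Lemma pt_col0 g h i j : borel (g^-1 * h)%g -> suval (g^-1 * h)%g 0 0 = 1 -> pt g i = pt h j -> i = j.
Proof.
move=> /borelE[B1 B2] B0 /pt_eq H.
have E : suval (g^-1 * h)%g *m e1 L = e1 L.
  apply/matrixP => a b; rewrite ord1 col0E [RHS]mxE.
  by elim/ord3P: a; rewrite ?B0 ?B1 ?B2.
have : (i%:~R : R) = j%:~R.
  apply: le_iff_eq => r; rewrite -!(nrm_e1 pQ).
  have := H r (suval h *m e1 L); rewrite su_mulK.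
  by rewrite mulmxA -suM E.
by move/eqP; rewrite eqr_int => /eqP.
Qed.

Lemma pt_inj g i j : pt g i = pt g j -> i = j.
Proof.
apply: pt_col0; last by rewrite mulVg mxE.
by rewrite mulVg; apply/borelE; rewrite !mxE.
Qed.

Lemma same_end g g' i' : bd g = bd g' -> exists u v (H : in_H (u, v)) j, forall m,
  pt g' (i' + m) = pt (g * uaS H)%g (j + m).
Proof.
move=> /bd_eq/borel_decomp[t [t0 [u [v [H [_ E]]]]]].
exists u, v, H, (i' - 2 * Q t) => m.
by rewrite -[g'](mulVKg g) E mulgA pt_aS; congr pt; ring.
Qed.

Lemma pt_uaS g u v (H : in_H (u, v)) i j : pt g i = pt (g * uaS H)%g j ->
  i = j /\ rge (- 2 * i%:~R) v.
Proof.
move=> E; have Eij : i = j.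
  apply: pt_col0 E; rewrite mulKg; first exact: borel_uaS.
  by rewrite mxE.
split=> //; apply: (@preserves_ua_rge _ _ _ _ _ _ pQ _ _ _ H).
by apply: (pt_preserves g _ _).1; rewrite E Eij.
Qed.

Lemma Par_uniq z v w w' : Par z v w -> Par z v w' -> w = w'.
Proof.
move=> [g [i [bg -> ->]]] [g' [i' [bg' Ev ->]]].
have [|u [v' [H [j Ej]]]] := @same_end g g' i'; first by rewrite bg bg'.
have E := Ev; rewrite -[i']addr0 Ej in E; have [Eij rv] := pt_uaS E.
rewrite Ej; rewrite addr0 in Eij; rewrite -Eij; symmetry; apply/pt_preserves.
by apply: (preserves_ua pQ Qc); apply: rge_le rv; rewrite rmorphD /=; lra.
Qed.

Lemma Par_ex z v : exists w, Par z v w.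
Proof. by have [g [j [bg ->]]] := iwasawa z v; exists (pt g (j + 1)), g, j. Qed.

(* The next vertex on the ray from v to the end z. *)
Definition par z v : vert := xget v (Par z v).

Lemma parP z v : Par z v (par z v).
Proof. by apply: xgetPex; apply: Par_ex. Qed.

Lemma par_pt g j : par (bd g) (pt g j) = pt g (j + 1).
Proof. by apply: (Par_uniq (parP _ _)); exists g, j. Qed.

Lemma par_iter g j n : iter n (par (bd g)) (pt g j) = pt g (j + n%:Z).
Proof.
elim: n => [|n IH]; first by rewrite addr0.
by rewrite iterS IH par_pt -addrA -[n.+1]addn1 PoszD.
Qed.

Lemma par_equiv h z v : vact h (par z v) = par (boundary_fun h z) (vact h v).
Proof.
have [g [j [<- ->]]] := iwasawa z v.
by rewrite par_pt !vact_pt -bdM par_pt.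
Qed.

Lemma par_merge z v w : exists n m, iter n (par z) v = iter m (par z) w.
Proof.
have [g [i [bg ->]]] := iwasawa z v; have [g' [i' [bg' ->]]] := iwasawa z w.
have [|u [x [H [j Ej]]]] := @same_end g g' i'; first by rewrite bg bg'.
pose J : int := `|i|%N%:Z + `|j|%N%:Z + `|Q x|%N%:Z.
exists `|J - i|%N, `|J - j|%N; rewrite -{1}bg -bg' !par_iter Ej.
have -> : i + `|J - i|%N%:Z = J by rewrite /J; lia.
have -> : j + `|J - j|%N%:Z = J by rewrite /J; lia.
symmetry; apply/pt_preserves; apply: (preserves_ua pQ Qc); right.
have : - 2 * J <= 2 * Q x by rewrite /J; lia.
by rewrite -(ler_int R) !rmorphM.
Qed.

Lemma par_nocycle z v n : iter n (par z) v = v -> n = 0%N.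
Proof.
have [g [j [<- ->]]] := iwasawa z v; rewrite par_iter => /pt_inj; lia.
Qed.

Lemma par_adj z z' v : par z' v = par z v \/ par z (par z' v) = v.
Proof.
have [h [i [<- ->]]] := iwasawa z' v; rewrite par_pt.
have [g [<- [[-> ->]|[-> ->]]]] := iwasawa2 z h i.
  by left; rewrite par_pt.
by right; rewrite par_pt; congr pt; ring.
Qed.

Definition vtype (v : vert) : bool := `[< exists g j, v = pt g j /\ odd `|j|%N >].

Lemma vtype_pt g j : vtype (pt g j) = odd `|j|%N.
Proof.
apply/asboolP/idP => [[h [i [E oi]]]|oj]; last by exists g, j.
have /asboolP : `[< exists z : int, sc e (lv j) = sc e (lv i) + 2 * z%:~R \/ sc e (lv j) = - sc e (lv i) + 2 * z%:~R >].
  apply/asboolP/(tree_rel_coord pQ Qc e0 (g := h) (h := g)).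
  apply/(tree_relP pQ Qc e0) => r w; rewrite !sc_lv.
  exact: (iff_sym ((pt_eq _ _ _ _).1 E r w)).
rewrite !sc_lv => -[z [H|H]].
  have : j = i + 2 * z by apply/eqP; rewrite -(eqr_int R) H rmorphD rmorphM.
  by lia.
have : j = - i + 2 * z by apply/eqP; rewrite -(eqr_int R) H rmorphD rmorphN rmorphM.
by lia.
Qed.

Lemma vtype_act g v : vtype (vact g v) = vtype v.
Proof. by have [h [j ->]] := ptP v; rewrite vact_pt !vtype_pt. Qed.

Lemma vtype_par z v : vtype (par z v) = ~~ vtype v.
Proof. by have [g [j [<- ->]]] := iwasawa z v; rewrite par_pt !vtype_pt; lia. Qed.

Variable cQ : nat.
Hypothesis indQ : forall N, indexp (vge Q N) (vge Q (N + 1)) cQ.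

Lemma rge_vge i x : rge (2 * i%:~R) x <-> vge Q i x.
Proof.
rewrite /rge /vge; split=> -[->|le]; [by left | right | by left | right].
  by move: le; rewrite ler_pM2l ?ltr0n // ler_int.
by rewrite ler_pM2l ?ltr0n // ler_int.
Qed.

Lemma child_form g J v : par (bd g) v = pt g J -> exists u x (H : in_H (u, x)),
  v = pt (g * uaS H)%g (J - 1) /\ vge Q (- J) x.
Proof.
have [g' [i' [bg' ->]]] := iwasawa (bd g) v; rewrite -bg' par_pt => E.
have [|u [x [H [j Ej]]]] := @same_end g g' i'; first by rewrite bg'.
rewrite Ej in E; have [Ej1 rx] := pt_uaS (esym E).
exists u, x, H; split; first by rewrite -[i']addr0 Ej Ej1; congr pt; ring.
by apply/rge_vge; move: rx; rewrite rmorphN /= mulNr mulrN.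
Qed.

Lemma children_ub z w (f : 'I_(cQ * cQ).+1 -> vert) : (forall a, par z (f a) = w) ->
  exists a b, a != b /\ f a = f b.
Proof.
have [g [J [<- ->]]] := iwasawa z w => fP.
have [u0 Hu0] := choice (fun a => child_form (fP a)).
have [x0 Hx0] := choice Hu0.
have H0 a : in_H (u0 a, x0 a) by case: (Hx0 a).
have HH0 a : f a = pt (g * uaS (H0 a))%g (J - 1) /\ vge Q (- J) (x0 a).
  by case: (Hx0 a) => H; rewrite (bool_irrelevance (H0 a) H).
pose c : int := - J - ((- J) %/ 2)%Z.
have Qu a : vge Q c (u0 a).
  have := rge_u pQ Qc (H0 a) ((rge_vge _ _).2 (HH0 a).2).
  have -> : 2 * (- J)%:~R / 2 = (- J)%:~R :> R by field.
  case=> [->|le]; [by left | right].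
  have : - J <= 2 * Q (u0 a) by rewrite -(ler_int R) rmorphM.
  by rewrite /c; lia.
have [r1 [_ _ cov1]] := indQ c; have [r2 [_ _ cov2]] := indQ (- J).
have [p1 hp1] := choice (fun a => cov1 _ (Qu a)).
have [p2 hp2] := choice (fun a => cov2 _ (HH0 a).2).
have [|a [b [nab [E1 E2]]]] := fin_collision (fun a => (p1 a, p2 a)).
  by rewrite card_prod !card_ord.
exists a, b; split=> //; rewrite (HH0 a).1 (HH0 b).1; symmetry.
rewrite -[(g * uaS (H0 b))%g](mulVKg (g * uaS (H0 a))%g); apply/pt_preserves.
have HV := in_HV (H0 a).
rewrite invgM -mulgA mulKg (uaS_inv (H0 a) HV) (uaS_mul HV (H0 b) (in_HM HV (H0 b))).
apply: (preserves_ua pQ Qc); rewrite mulNr -mulrN -rmorphN; apply/rge_vge.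
have -> : qconj (x0 a) + x0 b - qconj (- u0 a) * u0 b = (x0 b - x0 a) + qconj (u0 a) * (u0 b - u0 a).
  by rewrite (in_H_conj (H0 a)) rmorphN /=; ring.
have vN := vge_subgrp pQ.
have -> : - (J - 1) = - J + 1 by ring.
apply: (vgeD pQ).
  by apply: (subgrp_trans (vN _) (hp2 b)); rewrite -E2; apply: (subgrpBC (vN _)).
have v1 : vge Q (c + 1) (u0 b - u0 a).
  by apply: (subgrp_trans (vN _) (hp1 b)); rewrite -E1; apply: (subgrpBC (vN _)).
have v2 : vge Q c (qconj (u0 a)).
  by case: (Qu a) => [->|le]; [left; rewrite rmorph0 | right; rewrite Qc].
by apply: vge_le (vgeM pQ v2 v1); rewrite /c; lia.
Qed.

Hypothesis Hval : forall m, exists u v : L, [/\ in_H (u, v), v != 0 & Q v = m].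

Lemma two_children z w : exists v1 v2, [/\ v1 != v2, par z v1 = w & par z v2 = w].
Proof.
have [g [J [<- ->]]] := iwasawa z w; have [u [x [H x0 Qx]]] := Hval (- J).
exists (pt g (J - 1)), (pt (g * uaS H)%g (J - 1)); split.
- apply/eqP => /pt_uaS[_]; rewrite mulNr -mulrN -rmorphN => /rge_vge /(vgeE _ _ x0).
  by rewrite Qx; lia.
- by rewrite par_pt subrK.
rewrite -(bd_borel g (borel_uaS H)) par_pt subrK; apply/pt_preserves.
apply: (preserves_ua pQ Qc); rewrite mulNr -mulrN -rmorphN; apply/rge_vge.
by right; rewrite Qx.
Qed.

Definition cf (a : 'I_3) : int := (val a)%:Z - 1.

Lemma nrmE X r (w : 'cV[L]_3) : nrm X r w <-> forall a, rge (r + (cf a)%:~R * X) (w a 0).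
Proof.
have [c0 [c1 c2]] : cf 0 = -1 /\ cf 1 = 0 /\ cf 2 = 1 by [].
split=> [[h0 h1 h2]|H].
  by elim/ord3P; rewrite ?c0 ?c1 ?c2 ?mulN1r ?mul0r ?mul1r ?addr0.
by split; [have := H 0 | have := H 1 | have := H 2]; rewrite ?c0 ?c1 ?c2 ?mulN1r ?mul0r ?mul1r ?addr0.
Qed.

Lemma nrm_map_entries X Y (m : 'M[L]_3) :
  (forall r w, nrm Y r w -> nrm X r (m *m w)) <->
  forall a b, rge ((cf a)%:~R * X - (cf b)%:~R * Y) (m a b).
Proof.
split=> [H a b|H r w /nrmE Hw].
  have : nrm Y (- (cf b)%:~R * Y) (delta_mx b 0).
    apply/nrmE => a'; rewrite mxE andbT mulNr; case: eqP => [->|_]; last exact: rge0.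
    by rewrite addNr; apply/(rge1 pQ).
  move=> /H/nrmE/(_ a); rewrite -colE mxE; apply: rge_le.
  by rewrite mulNr addrC.
apply/nrmE => a; rewrite mxE; elim/big_ind: _ => [|x y|b _]; first exact: rge0.
  exact: (rgeD pQ).
by apply: rge_le (rgeM pQ (H a b) (Hw b)); lra.
Qed.

Lemma rge_convex r0 r1 s x : 0 <= s <= 1 -> rge r0 x -> rge r1 x -> rge ((1 - s) * r0 + s * r1) x.
Proof.
move=> /andP[s0 s1] [->|h0]; first by left.
case=> [->|h1]; [by left | right].
have a1 : (1 - s) * r0 <= (1 - s) * (2 * (Q x)%:~R) by apply: ler_wpM2l => //; lra.
have a2 : s * r1 <= s * (2 * (Q x)%:~R) by apply: ler_wpM2l.
lra.
Qed.

Lemma nrm_map_convex X0 Y0 X1 Y1 s (m : 'M[L]_3) : 0 <= s <= 1 ->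
  (forall r w, nrm Y0 r w -> nrm X0 r (m *m w)) ->
  (forall r w, nrm Y1 r w -> nrm X1 r (m *m w)) ->
  forall r w, nrm ((1 - s) * Y0 + s * Y1) r w -> nrm ((1 - s) * X0 + s * X1) r (m *m w).
Proof.
move=> hs /nrm_map_entries H0 /nrm_map_entries H1; apply/nrm_map_entries => a b.
by have := rge_convex hs (H0 a b) (H1 a b); congr (rge _ _); ring.
Qed.

Lemma norm_convex g g' X0 Y0 X1 Y1 s : 0 <= s <= 1 ->
  (forall r w, nrm X0 r (suval (g^-1)%g *m w) <-> nrm Y0 r (suval (g'^-1)%g *m w)) ->
  (forall r w, nrm X1 r (suval (g^-1)%g *m w) <-> nrm Y1 r (suval (g'^-1)%g *m w)) ->
  forall r w, nrm ((1 - s) * X0 + s * X1) r (suval (g^-1)%g *m w) <->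
              nrm ((1 - s) * Y0 + s * Y1) r (suval (g'^-1)%g *m w).
Proof.
move=> hs H0 H1 r w.
have conv h h' X Y : (forall r w, nrm X r (suval (h^-1)%g *m w) <-> nrm Y r (suval (h'^-1)%g *m w)) ->
    forall r w, nrm Y r w -> nrm X r (suval (h^-1 * h')%g *m w).
  by move=> H r' w' Nw; rewrite suM -mulmxA H su_mulK.
have E : suval (g^-1)%g *m w = suval (g^-1 * g')%g *m (suval (g'^-1)%g *m w).
  by rewrite suM -mulmxA su_mulVK.
have E' : suval (g'^-1)%g *m w = suval (g'^-1 * g)%g *m (suval (g^-1)%g *m w).
  by rewrite suM -mulmxA su_mulVK.
split=> Nw.
  rewrite E'; apply: (nrm_map_convex hs) Nw; apply: conv => r' w'; exact: iff_sym.
by rewrite E; apply: (nrm_map_convex hs) Nw; apply: conv.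
Qed.

Definition segment g j : set (set (SU L * R)) :=
  [set tree_point nu g x | x in [set x | lv j <= x <= lv (j + 1)]].

Let e4 : (0 : R) < 4 * e%:R. Proof. by rewrite mulr_gt0 ?ltr0n. Qed.

Lemma lv_le i j : (lv i <= lv j) = (i <= j).
Proof. by rewrite /lv ler_pM2r ?invr_gt0 // ler_int. Qed.

Lemma lv_lt i j : (lv i < lv j) = (i < j).
Proof. by rewrite /lv ltr_pM2r ?invr_gt0 // ltr_int. Qed.

Lemma consecutiveP x y : consecutive nu x y <-> exists j, x = lv j /\ y = lv (j + 1).
Proof.
split=> [[/apt_vertexP[i ->] /apt_vertexP[j ->]]|[j [-> ->]]].
  rewrite lv_lt => lt H; exists i; split=> //; congr lv.
  have := H (lv (i + 1)); rewrite !lv_lt => /(_ _)/negP Hn.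
  have : ~ (i < i + 1 < j) by apply: Hn; apply/apt_vertexP; exists (i + 1).
  by lia.
split; try by apply/apt_vertexP; eexists.
  by rewrite lv_lt; lia.
by move=> _ /apt_vertexP[i ->]; rewrite !lv_lt; apply/negP; lia.
Qed.

Lemma tree_edgesP E : tree_edges nu E <-> exists g j, E = segment g j.
Proof.
split=> [[g [x [y [/consecutiveP[j [-> ->]] ->]]]]|[g [j ->]]]; first by exists g, j.
by exists g, (lv j), (lv (j + 1)); split=> //; apply/consecutiveP; exists j.
Qed.

Lemma segment_vert g j (v : vert) : segment g j (vset v) <-> v = pt g j \/ v = pt g (j + 1).
Proof.
split=> [[x /andP[le1 le2] Ev]|[->|->]]; last first.
- by exists (lv (j + 1)) => //=; rewrite !lv_le; lia.
- by exists (lv j) => //=; rewrite !lv_le; lia.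
have [h [i Eh]] := ptP v.
have /(tree_rel_coord pQ Qc e0) : tree_rel nu (h, lv i) (g, x).
  apply/(tree_relP pQ Qc e0); apply/(tree_point_eq pQ Qc e0).
  by rewrite Ev Eh.
rewrite sc_lv => -[m Hm].
have [l Ex] : exists l, x = lv l.
  case: Hm => H; [exists (i + 2 * m) | exists (- i + 2 * m)]; apply: lv_sc.
    by rewrite H rmorphD rmorphM.
  by rewrite H rmorphD rmorphN rmorphM.
rewrite Ex !lv_le in le1 le2; have [El|El] : l = j \/ l = j + 1 by lia.
  by left; apply: val_inj; rewrite /= -Ev Ex El.
by right; apply: val_inj; rewrite /= -Ev Ex El.
Qed.

Lemma segment_eq g j g' j' : pt g j = pt g' j' -> pt g (j + 1) = pt g' (j' + 1) ->
  segment g j = segment g' j'.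
Proof.
have sub h i h' i' : pt h i = pt h' i' -> pt h (i + 1) = pt h' (i' + 1) ->
    segment h i `<=` segment h' i'.
  move=> /pt_eq H0 /pt_eq H1 _ [x /andP[le1 le2] <-].
  pose s := sc e x - i%:~R.
  have scle (x' y' : R) : (sc e x' <= sc e y') = (x' <= y') by rewrite /sc (ler_pM2l e4).
  have hs : 0 <= s <= 1.
    move: le1 le2; rewrite -[lv i <= x]scle -[x <= _]scle !sc_lv rmorphD /= /s => le1 le2.
    by apply/andP; split; lra.
  have Esc (y' : R) : y' = sc e (y' / (4 * e%:R)) by rewrite /sc mulrC divfK // gt_eqF.
  exists ((i'%:~R + s) / (4 * e%:R)).
    rewrite /= -[lv i' <= _]scle -[_ <= lv (i' + 1)]scle !sc_lv -Esc rmorphD /=.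
    by case/andP: hs => s0 s1; apply/andP; split; lra.
  symmetry; apply/(tree_point_eq pQ Qc e0) => r w; have := norm_convex hs H0 H1 r w.
  rewrite -Esc !rmorphD /=.
  have -> : (1 - s) * i%:~R + s * (i%:~R + 1) = sc e x by rewrite /s; ring.
  by have -> : (1 - s) * i'%:~R + s * (i'%:~R + 1) = i'%:~R + s by ring.
by move=> E0 E1; apply/seteqP; split; apply: sub.
Qed.

Lemma segment_sS g j : segment (g * sS L)%g (- j - 1) = segment g j.
Proof.
have E x : tree_point nu (g * sS L)%g x = tree_point nu g (- x).
  apply/(tree_point_eq pQ Qc e0) => r w; rewrite (nrm_s pQ) -[s_mx L]/(suval (sS L)).
  by rewrite invgM suM -mulmxA su_mulVK sc_opp.
have lvN i : lv (- i) = - lv i by rewrite /lv rmorphN mulNr.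
have E1 : - j - 1 = - (j + 1) by ring.
have E2 : - j - 1 + 1 = - j by ring.
apply/seteqP; split=> _ [x /andP[le1 le2] <-]; exists (- x); rewrite /= ?E ?opprK //.
  by rewrite E1 lvN in le1; rewrite E2 lvN in le2; lra.
by rewrite E2 E1 !lvN; lra.
Qed.

Lemma edge_uniq E E' (a b : vert) : tree_edges nu E -> tree_edges nu E' -> a <> b ->
  E (vset a) -> E (vset b) -> E' (vset a) -> E' (vset b) -> E = E'.
Proof.
move=> /tree_edgesP[g [j ->]] /tree_edgesP[g' [j' ->]] nab.
move=> /segment_vert Ea /segment_vert Eb /segment_vert Ea' /segment_vert Eb'.
have rev : pt g j = pt g' (j' + 1) -> pt g (j + 1) = pt g' j' -> segment g j = segment g' j'.
  move=> H1 H2; rewrite -(segment_sS g' j'); apply: segment_eq; rewrite pt_sS ?H1 ?H2; congr pt; ring.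
case: Ea => Ea; case: Eb => Eb; try by case: nab; rewrite Ea Eb.
  case: Ea' => Ea'; case: Eb' => Eb'; try by case: nab; rewrite Ea' Eb'.
    by apply: segment_eq; rewrite -?Ea -?Eb.
  by apply: rev; rewrite -?Ea -?Eb.
case: Ea' => Ea'; case: Eb' => Eb'; try by case: nab; rewrite Ea' Eb'.
  by apply: rev; rewrite -?Ea -?Eb.
by apply: segment_eq; rewrite -?Ea -?Eb.
Qed.

Lemma edge_ex z v : exists E, [/\ tree_edges nu E, E (vset v) & E (vset (par z v))].
Proof.
have [g [j [<- ->]]] := iwasawa z v; exists (segment g j); rewrite par_pt.
split; [by apply/tree_edgesP; exists g, j | apply/segment_vert; by left | apply/segment_vert; by right].
Qed.

Lemma edge_verts E : tree_edges nu E -> exists v w, [/\ par None v = w \/ par None w = v,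
  E (vset v) /\ E (vset w), ~~ vtype v, vtype w & forall u, E (vset u) -> u = v \/ u = w].
Proof.
move=> /tree_edgesP[g [j ->]].
have adj := par_adj None (bd g) (pt g j); rewrite par_pt in adj.
have e1' : segment g j (vset (pt g j)) by apply/segment_vert; left.
have e2' : segment g j (vset (pt g (j + 1))) by apply/segment_vert; right.
have [oj|ej] := boolP (vtype (pt g j)).
  exists (pt g (j + 1)), (pt g j); split=> //; last by move=> u /segment_vert[]; [right|left].
    by case: adj => ->; [right | left].
  by move: oj; rewrite !vtype_pt; lia.
exists (pt g j), (pt g (j + 1)); split=> //; last by move=> u /segment_vert.
  by case: adj => ->; [left | right].
by move: ej; rewrite !vtype_pt; lia.
Qed.

Lemma tree_edge_act g E : tree_edges nu E -> tree_edges nu (tree_act g @` E).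
Proof.
move=> /tree_edgesP[h [j ->]]; apply/tree_edgesP; exists (g * h)%g, j.
apply/seteqP; split=> [_ [_ [x Hx <-] <-]|_ [x Hx <-]].
  by exists x => //; rewrite (tree_act_point pQ Qc e0).
by exists (tree_point nu h x); [exists x | rewrite (tree_act_point pQ Qc e0)].
Qed.

End TreeCombinatorics.

(** * Reduction theory *)

Lemma fin_cover (V C : eqType) (D : V -> Prop) (E : V -> V -> Prop) (s : seq C) (c : V -> C -> Prop) :
  (forall v, D v -> exists2 a, a \in s & c v a) ->
  (forall a, exists l : seq V, forall v, D v -> c v a -> exists2 v', v' \in l & E v v') ->
  exists l : seq V, forall v, D v -> exists2 v', v' \in l & E v v'.
Proof.
move=> cs /choice[l hl]; exists (flatten [seq l a | a <- s]) => v Dv.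
have [a sa va] := cs v Dv; have [v' lv' Ev] := hl a v Dv va.
by exists v' => //; apply/flattenP; exists (l a) => //; apply: map_f.
Qed.

Lemma fin_mx (T : eqType) m n (s : seq T) : exists t : seq 'M[T]_(m, n),
  forall A : 'M[T]_(m, n), (forall i j, A i j \in s) -> A \in t.
Proof.
case: s => [|x0 s].
  have [[A0 HA0]|no] := pselect (exists A : 'M[T]_(m, n), forall i j, A i j \in [::]).
    by exists [:: A0] => A HA; rewrite inE; apply/eqP/matrixP => i j; have := HA i j.
  by exists [::] => A HA; case: no; exists A.
set s' := x0 :: s.
exists [seq \matrix_(i, j) nth x0 s' (f (i, j)) | f : {ffun 'I_m * 'I_n -> 'I_(size s')}] => A HA.
apply/mapP; pose f : {ffun 'I_m * 'I_n -> 'I_(size s')} := [ffun ij => inord (index (A ij.1 ij.2) s')].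
exists f; first by rewrite mem_enum.
have lt i j : (index (A i j) s' < size s')%N by rewrite index_mem.
by apply/matrixP => i j; rewrite mxE ffunE inordK ?nth_index //; apply: lt.
Qed.

Lemma card_ge_prod3 (V : zmodType) (S : set V) b : card_ge S b ->
  card_ge [set w : 'cV[V]_3 | forall i, S (w i 0)] (b * b * b).
Proof.
move=> /card_geP[f [fi Sf]].
have -> : (b * b * b = #|{: 'I_b * 'I_b * 'I_b}|)%N by rewrite !card_prod !card_ord.
apply: (@card_ge_inj _ _ _ (fun t : 'I_b * 'I_b * 'I_b =>
   \col_(i < 3) f (if val i == 0%N then t.1.1 else if val i == 1%N then t.1.2 else t.2))).
  move=> [[a1 a2] a3] [[b1 b2] b3] /matrixP E.
  have := E 0 0; have := E 1 0; have := E (Ordinal (isT : (2 < 3)%N)) 0.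
  by rewrite !mxE /= => /fi -> /fi -> /fi ->.
by move=> t i; rewrite mxE.
Qed.

Lemma indexp_filtration_le (V : zmodType) (X : int -> set V) c :
    (forall N, subgrp (X N)) -> (forall N, X (N + 1) `<=` X N) ->
    (forall N, exists2 c', (c' <= c)%N & indexp (X N) (X (N + 1)) c') ->
  forall N m, exists2 c', (c' <= c ^ m)%N & indexp (X (N - m%:Z)) (X N) c'.
Proof.
move=> sX dX XX N m.
have sub N' m' : X (N' + m'%:Z) `<=` X N'.
  elim: m' => [|m' IH] x; first by rewrite addr0.
  by rewrite -addn1 PoszD addrA => /dX/IH.
elim: m => [|m [c1 le1 IH]]; first by exists 1%N => //; rewrite subr0; apply: indexp1.
have [c2 le2 H2] := XX (N - m.+1%:Z); exists (c2 * c1)%N; first by rewrite expnS leq_mul.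
have E : N - m.+1%:Z + 1 = N - m%:Z by lia.
rewrite E in H2; apply: (@indexpM _ _ (X (N - m%:Z))) => //.
- by move=> x Xx; apply: dX; rewrite E.
- by move=> x Xx; apply: (sub _ m); rewrite subrK.
Qed.

Section Transvections.
Variables (k : fieldType) (L : quad_ext k).
Implicit Types (g h : SU L) (w : 'cV[L]_3).

Lemma herm_delta w (i : 'I_3) : herm w (delta_mx i 0) = w (rev_ord i) 0.
Proof.
by elim/ord3P: i; rewrite /herm !mxE /= !(rmorph0, rmorph1, mulr0, mulr1, addr0, add0r); congr (w _ _); apply: val_inj.
Qed.

Lemma delta_herm w (i : 'I_3) : herm (delta_mx i 0) w = qconj (w (rev_ord i) 0).
Proof.
by elim/ord3P: i; rewrite /herm !mxE /= !(mul0r, mul1r, addr0, add0r); congr (qconj (w _ _)); apply: val_inj.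
Qed.

Lemma su_inv_entry g i j : suval (g^-1)%g i j = qconj (suval g (rev_ord j) (rev_ord i)).
Proof.
have -> : suval (g^-1)%g i j = (suval (g^-1)%g *m (delta_mx j 0 : 'cV[L]_3)) i 0 by rewrite -colE mxE.
rewrite -[i in LHS]rev_ordK -herm_delta -(su_herm g) su_mulVK delta_herm.
by rewrite -colE mxE.
Qed.

Lemma in_H0v (v : L) : qconj v = - v -> in_H (0 : L, v).
Proof. by move=> cv; rewrite /in_H /qnorm /qtrace /= cv subrr mul0r addr0. Qed.

Definition tau g v (cv : qconj v = - v) : SU L := (g * uaS (in_H0v cv) * g^-1)%g.

Lemma tau_entry g v (cv : qconj v = - v) i j :
  suval (tau g cv) i j = (i == j)%:R + v * suval g i 0 * qconj (suval g (rev_ord j) 0).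
Proof.
have -> : suval (tau g cv) = 1%:M + (v *: (suval g *m delta_mx 0 2%:R)) *m suval (g^-1)%g.
  rewrite /tau !suM (_ : suval (uaS (in_H0v cv)) = 1%:M + v *: delta_mx 0 2%:R).
    rewrite mulmxDr mulmxDl mulmx1 -suM mulgV -scalemxAr; congr (_ + _).
  by apply/matrixP; do 2!elim/ord3P; rewrite !mxE /= ?rmorph0 ?oppr0; ring.
rewrite mxE [X in X + _]mxE; congr (_ + _).
rewrite -scalemxAl mxE mul3 !mul3 !mxE /= !(mulr0, mulr1, add0r, addr0, mul0r).
rewrite su_inv_entry mulrA; congr (v * _ * qconj (suval g _ _)); apply: val_inj => //.
Qed.

Lemma tauM g v v' (cv : qconj v = - v) (cv' : qconj v' = - v') (cvv : qconj (v + v') = - (v + v')) :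
  (tau g cv * tau g cv' = tau g cvv)%g.
Proof.
rewrite /tau -!mulgA mulKg; congr (_ * _)%g; rewrite !mulgA; congr (_ * _)%g.
by apply: val_inj; rewrite /= ua_mx_mul rmorph0 mul0r subr0 addr0.
Qed.

Lemma tau_inj g v v' (cv : qconj v = - v) (cv' : qconj v' = - v') :
  tau g cv = tau g cv' -> v = v'.
Proof.
move=> /(mulIg _)/(mulgI _)/(congr1 (fun h : SU L => suval h 0 2)).
by rewrite !mxE.
Qed.

Lemma tau1 g v (cv : qconj v = - v) : tau g cv = 1%g -> v = 0.
Proof.
have c0 : qconj (0 : L) = - 0 by rewrite rmorph0 oppr0.
move=> E; apply: (@tau_inj g _ _ cv c0); rewrite E.
have -> : tau g c0 = (g * 1 * g^-1)%g; last by rewrite mulg1 mulgV.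
rewrite /tau; congr (_ * _ * _)%g; apply: val_inj.
by apply/matrixP; do 2!elim/ord3P; rewrite !mxE /= ?rmorph0 ?oppr0.
Qed.

Lemma iso_orbit w : iso_vec w -> w != 0 -> exists g (b : L), b != 0 /\ w = b *: (suval g *m e1 L).
Proof.
move=> iw w0; have [a0|a0] := eqVneq (w 0 0) 0; last first.
  have H := clear_low iw a0; exists (uma_prod H), (w 0 0); split=> //.
  apply/matrixP => i j; rewrite ord1 mxE col0E uma_prodE uma_mxE.
  by elim/ord3P: i; rewrite mxE /= ?mulr1 // mulrCA divff ?mulr1.
have c0 : w 2 0 != 0.
  apply: contraNneq w0 => c0; apply/eqP/matrixP => i j; rewrite ord1 mxE.
  by elim/ord3P: i => //; apply: iso_w1.
have H := clear_up iw c0; exists (uaS H * sS L)%g, (- w 2 0); rewrite oppr_eq0; split=> //.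
apply/matrixP => i j; rewrite ord1 mxE col0E suM mul3.
by elim/ord3P: i; rewrite !mxE /=; field; rewrite ?fmorph_eq0 ?c0.
Qed.

End Transvections.

Lemma fiber_pigeonhole (I J : finType) (f : I -> J) M : (#|J| * M < #|I|)%N ->
  exists j, (M < #|[set i | f i == j]%SET|)%N.
Proof.
move=> lt; apply: contrapT => /forallNP H; move: lt; apply/negP; rewrite -leqNgt.
rewrite -sum1_card (partition_big f predT) //= -sum_nat_const leq_sum // => j _.
have := H j => /negP; rewrite -leqNgt => le; apply: leq_trans le.
by rewrite sum1_card; apply: subset_leq_card; apply/fintype.subsetP => i; rewrite !inE.
Qed.

Section ArithmeticStabilizers.
Variables (R : realType) (F : fieldType) (k : fieldType) (L : quad_ext k).
Variables (iotaL : {rmorphism F -> L}) (Q : L -> int) (e : nat).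
Hypothesis pQ : is_place iotaL Q.
Hypothesis Qc : forall x, Q (qconj x) = Q x.
Hypothesis e0 : (0 < e)%N.
Implicit Types (g h : SU L) (z : boundary L) (v : vert R Q e).

Local Notation pt := (pt R pQ e0).
Local Notation vact := (vact pQ Qc e0).
Local Notation par := (par pQ e0).

Variable B : set L.
Hypothesis B1 : B 1.
Hypothesis BB : forall x y, B x -> B y -> B (x - y).
Hypothesis BM : forall x y, B x -> B y -> B (x * y).
Hypothesis Bc : forall x, B x -> B (qconj x).
Hypothesis Bpos : forall x, B x -> vge Q 1 x -> x = 0.
Hypothesis Bfin : forall N, exists s : seq L, forall x, B x -> vge Q N x -> x \in s.
Hypothesis Btr : forall M, card_ge [set x | B x /\ qconj x = - x] M.
Hypothesis Bfrac : forall x : L, exists a : L, [/\ a != 0, qconj a = a, B a & B (a * x)].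
Variable G : groupClosed (SU L).
Hypothesis Gfi : finite_index_subgroup G (arith_group B).

Lemma Bzero : B 0. Proof. by rewrite -(subrr 1); apply: BB. Qed.
Lemma BN x : B x -> B (- x). Proof. by rewrite -sub0r; apply: BB; apply: Bzero. Qed.
Lemma BD x y : B x -> B y -> B (x + y).
Proof. by move=> Bx /BN By; rewrite -[y]opprK; apply: BB. Qed.
Lemma Bsum (I : Type) (r : seq I) (f : I -> L) : (forall i, B (f i)) -> B (\sum_(i <- r) f i).
Proof. by move=> Bf; elim/big_ind: _ => // [|x y]; [apply: Bzero | apply: BD]. Qed.
Lemma Bmx n p q (m1 : 'M[L]_(n, p)) (m2 : 'M[L]_(p, q)) : (forall i j, B (m1 i j)) ->
  (forall i j, B (m2 i j)) -> forall i j, B ((m1 *m m2) i j).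
Proof. by move=> H1 H2 i j; rewrite mxE; apply: Bsum => l; apply: BM. Qed.

Lemma G_arith g : g \in G -> arith_group B g.
Proof. by case: Gfi => sub _; apply: sub. Qed.

Lemma arith_cosets : exists s : seq (SU L), forall g, arith_group B g ->
  exists2 r, r \in s & (r^-1 * g)%g \in G.
Proof.
case: Gfi => _ /finite_seqP[t Et].
have ex (C : set (SU L)) : exists r,
    [set [set (g * x)%g | x in [set` G]] | g in arith_group B] C -> C r.
  have [[g Bg E]|no] := pselect ([set [set (g * x)%g | x in [set` G]] | g in arith_group B] C).
    by exists g => _; rewrite -E; exists 1%g; rewrite ?mulg1 //=; apply: gpred1.
  by exists 1%g => /no.
have [r Hr] := choice ex; exists (map r t) => g Bg.
have EC : [set [set (g * x)%g | x in [set` G]] | g in arith_group B] [set (g * x)%g | x in [set` G]].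
  by exists g.
exists (r [set (g * x)%g | x in [set` G]]).
  by apply: map_f; move: EC; rewrite Et.
have [x Gx <-] := Hr _ EC; rewrite invgM -mulgA mulVg mulg1.
exact: gpredVr.
Qed.

Definition vnrm v (r : R) (w : 'cV[L]_3) := exists g j, v = pt g j /\ nrm Q j%:~R r (suval (g^-1)%g *m w).

Lemma vnrm_pt g (j : int) r w : vnrm (pt g j) r w <-> nrm Q j%:~R r (suval (g^-1)%g *m w).
Proof.
split=> [[h [i [/(pt_eq R pQ Qc e0) H nw]]]|nw]; first exact/H.
by exists g, j.
Qed.

Lemma vnrm_act h v r w : vnrm (vact h v) r (suval h *m w) <-> vnrm v r w.
Proof.
have [g [j ->]] := ptP pQ e0 v; rewrite vact_pt !vnrm_pt.
by rewrite invgM suM -mulmxA su_mulK.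
Qed.

Lemma rge_vgeI (i : int) x : rge Q (i%:~R : R) x -> vge Q (- `|i|%N%:Z) x.
Proof.
case=> [->|le]; [by left | right].
have : i <= 2 * Q x by rewrite -(ler_int R) rmorphM.
by lia.
Qed.

Lemma mx_vge n p (m : 'M[L]_(n, p)) : exists N : nat, forall i j, vge Q (- N%:Z) (m i j).
Proof.
exists (\max_(ij : 'I_n * 'I_p) `|Q (m ij.1 ij.2)|)%N => i j; right.
by have := @leq_bigmax _ (fun ij : 'I_n * 'I_p => `|Q (m ij.1 ij.2)|%N) (i, j) => /=; lia.
Qed.

Lemma mulmx_vge n p q (m1 : 'M[L]_(n, p)) (m2 : 'M[L]_(p, q)) N1 N2 :
  (forall i j, vge Q N1 (m1 i j)) -> (forall i j, vge Q N2 (m2 i j)) ->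
  forall i j, vge Q (N1 + N2) ((m1 *m m2) i j).
Proof. by move=> H1 H2 i j; rewrite mxE; apply: (vge_sum pQ) => l _; apply: (vgeM pQ). Qed.

Lemma stab_fixP g (j : int) h : vact h (pt g j) = pt g j <-> preserves Q (j%:~R : R) (g^-1 * h * g)%g.
Proof.
rewrite vact_pt -(pt_preserves R pQ Qc e0 g).
by rewrite -!mulgA mulVKg.
Qed.

Lemma preserves_entries (j : int) g : preserves Q (j%:~R : R) g <->
  (forall a b, rge Q ((cf a - cf b)%:~R * j%:~R : R) (suval g a b)) /\
  (forall a b, rge Q ((cf a - cf b)%:~R * j%:~R : R) (suval (g^-1)%g a b)).
Proof.
have ent (m : 'M[L]_3) : (forall r w, nrm Q (j%:~R : R) r w -> nrm Q (j%:~R : R) r (m *m w)) <->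
    forall a b, rge Q ((cf a - cf b)%:~R * j%:~R : R) (m a b).
  have E a b : (cf a - cf b)%:~R * j%:~R = (cf a)%:~R * j%:~R - (cf b)%:~R * j%:~R :> R.
    by rewrite rmorphB mulrBl.
  split=> [/(nrm_map_entries pQ) H a b|H]; first by rewrite E.
  by apply/(nrm_map_entries pQ) => a b; rewrite -E.
split=> [pg|[H1 H2] r w]; last first.
  split; first exact: (ent _).2.
  by move/((ent _).2 H2); rewrite su_mulK.
split; apply/ent => r w; first by move/pg.
by move/(preservesV pg).
Qed.

Lemma stab_finite v : exists s : seq (SU L), forall h, arith_group B h -> vact h v = v -> h \in s.
Proof.
have [g [j ->]] := ptP pQ e0 v.
have [N1 H1] := mx_vge (suval g); have [N2 H2] := mx_vge (suval (g^-1)%g).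
pose J : nat := (2 * `|j|)%N.
have [s Hs] := Bfin (- N1%:Z + - J%:Z + - N2%:Z).
have [t Ht] := fin_mx 3 3 s; exists (pmap insub t) => h Bh /stab_fixP/preserves_entries[H _].
rewrite mem_pmap_sub; apply: Ht => a b; apply: Hs; first exact: Bh.
have E : suval h = suval g *m suval (g^-1 * h * g)%g *m suval (g^-1)%g.
  by rewrite -!suM !mulgA mulgV mul1g mulgK.
rewrite -[val h]/(suval h) E.
apply: mulmx_vge => {a b} // a b; apply: mulmx_vge => {a b} // a b.
have := H a b; rewrite -rmorphM /= => /rge_vgeI; apply: (vge_le (w := Q)).
have : `|cf a - cf b|%N <= 2%N :> int by move: a b; do 2!elim/ord3P.
rewrite /J abszM => le.
have : (`|cf a - cf b| * `|j| <= 2 * `|j|)%N by rewrite leq_mul2r; apply/orP; right.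
by lia.
Qed.

Lemma tau_fix_bd g x (cx : qconj x = - x) : boundary_fun (tau g cx) (bd g) = bd g.
Proof.
rewrite -bdM /tau -!mulgA mulVg mulg1; apply: bd_borel; exact: borel_uaS.
Qed.

Lemma tau_quot g x y (cx : qconj x = - x) (cy : qconj y = - y) (cyx : qconj (y - x) = - (y - x)) :
  ((tau g cx)^-1 * tau g cy)%g = tau g cyx.
Proof.
apply: (mulgI (tau g cx)); rewrite mulVKg; symmetry.
have cs : qconj (x + (y - x)) = - (x + (y - x)) by rewrite addrC subrK.
rewrite (tauM g cx cyx cs); move: cs; rewrite addrC subrK => cs.
by rewrite (eq_irrelevance cs cy).
Qed.

(* Unipotent elements of G fixing the end z fix every vertex far enough towards z. *)
Lemma par_unstable z v : exists n h, [/\ h \in G, h <> 1%g, boundary_fun h z = z &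
  vact h (iter n (par z) v) = iter n (par z) v].
Proof.
have [g [j [<- ->]]] := iwasawa pQ Qc e0 z v.
have [b [b0 cb Bb]] : exists b, [/\ b != 0, qconj b = b & forall i, B (b * suval g i 0)].
  have [a0 [n0 c0 Ba0 H0]] := Bfrac (suval g 0 0).
  have [a1 [n1 c1 Ba1 H1]] := Bfrac (suval g 1 0).
  have [a2 [n2 c2 Ba2 H2]] := Bfrac (suval g 2 0).
  exists (a0 * a1 * a2); rewrite !mulf_neq0 // !rmorphM /= c0 c1 c2; split=> //.
  elim/ord3P.
  - suff -> : a0 * a1 * a2 * suval g 0 0 = a1 * a2 * (a0 * suval g 0 0) by exact: (BM (BM Ba1 Ba2) H0).
    by move: (suval g 0 0) => y; ring.
  - suff -> : a0 * a1 * a2 * suval g 1 0 = a0 * a2 * (a1 * suval g 1 0) by exact: (BM (BM Ba0 Ba2) H1).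
    by move: (suval g 1 0) => y; ring.
  - suff -> : a0 * a1 * a2 * suval g 2 0 = a0 * a1 * (a2 * suval g 2 0) by exact: (BM (BM Ba0 Ba1) H2).
    by move: (suval g 2 0) => y; ring.
have ct x : qconj x = - x -> qconj (b * b * x) = - (b * b * x).
  by move=> cx; rewrite !rmorphM /= cb cx mulrN.
have [s Hs] := arith_cosets.
have [t [ut st Ht]] := Btr (size s).+1.
pose x (i : 'I_(size s).+1) := t`_i.
have xt i : x i \in t by apply: mem_nth; rewrite st.
have cx i := (Ht _ (xt i)).2; have Bx i := (Ht _ (xt i)).1.
have At i : arith_group B (tau g (ct _ (cx i))).
  move=> c d; rewrite tau_entry; apply: BD; first by case: eqP => _; [apply: B1 | apply: Bzero].
  rewrite -mulrA (_ : _ * _ = x i * ((b * suval g c 0) * qconj (b * suval g (rev_ord d) 0))).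
    by apply: BM => //; apply: BM => //; apply: Bc.
  by rewrite rmorphM /= cb; ring.
have [r Hr] := choice (fun i => let: ex_intro2 r rs H := Hs _ (At i) in ex_intro (fun r => r \in s /\ (r^-1 * tau g (ct _ (cx i)))%g \in G) r (conj rs H)).
have lr i : (index (r i) s < size s)%N by rewrite index_mem; case: (Hr i).
have [|i [i' [nii Er]]] := fin_collision (fun i => Ordinal (lr i)); first by rewrite !card_ord.
have {}Er : r i = r i'.
  by move: Er => [] Er; rewrite -(nth_index 1%g (Hr i).1) Er nth_index //; apply: (Hr i').1.
have nx : x i != x i'.
  apply: contraNneq nii => E; apply/eqP/val_inj/eqP.
  have lt (l : 'I_(size s).+1) : (l < size t)%N by rewrite st.
  by have := nth_uniq 0 (lt i) (lt i') ut; rewrite -/(x i) -/(x i') E eqxx => /esym.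
pose y := b * b * x i' - b * b * x i.
have cy : qconj y = - y by rewrite /y rmorphB /= !ct //; ring.
have y0 : y != 0 by rewrite /y -mulrBr !mulf_neq0 // subr_eq0 eq_sym.
exists (`|j| + `|Q y|)%N, (tau g cy); split.
- rewrite -(tau_quot g (ct _ (cx i)) (ct _ (cx i')) cy).
  rewrite -[X in (_ * X)%g](mulVKg (r i')) mulgA; apply: gpredM; last exact: (Hr i').2.
  by rewrite -[X in X \in G]invgK invgM invgK -Er gpredVr //; apply: (Hr i).2.
- by move/tau1 => E; rewrite E eqxx in y0.
- exact: tau_fix_bd.
rewrite par_iter //; apply/stab_fixP; rewrite /tau !mulgA mulVg mul1g mulgVK.
apply: (preserves_ua pQ Qc); right.
have : - 2 * (j + (`|j| + `|Q y|)%N%:Z) <= 2 * Q y by lia.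
by rewrite -(ler_int R) !rmorphM.
Qed.

End ArithmeticStabilizers.

Section CoordinateMap.
Variables (K : pzRingType) (n : nat) (m : 'M[K]_n) (a : 'I_n).

Definition mx_coord (w : 'cV[K]_n) : K := (m *m w) a 0.

Lemma mx_coord_is_zmod_morphism : GRing.zmod_morphism mx_coord.
Proof. by move=> w w'; rewrite /mx_coord mulmxBr !mxE. Qed.

HB.instance Definition _ := GRing.isZmodMorphism.Build _ _ mx_coord mx_coord_is_zmod_morphism.
End CoordinateMap.

Section LatticePoints.
Variables (R : realType) (F : fieldType) (k : fieldType) (L : quad_ext k).
Variables (iotaL : {rmorphism F -> L}) (Q : L -> int) (e : nat).
Hypothesis pQ : is_place iotaL Q.
Hypothesis Qc : forall x, Q (qconj x) = Q x.
Hypothesis e0 : (0 < e)%N.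
Implicit Types (g h : SU L) (z : boundary L) (v : vert R Q e).

Local Notation pt := (pt R pQ e0).
Local Notation vact := (vact pQ Qc e0).
Local Notation vnrm := (vnrm pQ e0).

Variable B : set L.
Hypothesis B1 : B 1.
Hypothesis BB : forall x y, B x -> B y -> B (x - y).
Hypothesis BM : forall x y, B x -> B y -> B (x * y).
Hypothesis Bc : forall x, B x -> B (qconj x).
Hypothesis Bpos : forall x, B x -> vge Q 1 x -> x = 0.
Hypothesis Btr : forall M, card_ge [set x | B x /\ qconj x = - x] M.
Variable G : groupClosed (SU L).
Hypothesis Gfi : finite_index_subgroup G (arith_group B).

Let B_0 := Bzero B1 BB.
Let B_D x y (Bx : B x) (By : B y) : B (x + y) := BD B1 BB Bx By.

Lemma Bherm (w w' : 'cV[L]_3) : (forall i, B (w i 0)) -> (forall i, B (w' i 0)) -> B (herm w w').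
Proof. by move=> Bw Bw'; do !apply: B_D; apply: BM => //; apply: Bc. Qed.

Lemma tau_conj g h x (cx : qconj x = - x) : (g^-1 * tau h cx * g = tau (g^-1 * h) cx)%g.
Proof. by rewrite /tau invgM invgK !mulgA. Qed.

Lemma tauV g x (cx : qconj x = - x) (cx' : qconj (- x) = - - x) : ((tau g cx)^-1 = tau g cx')%g.
Proof.
have c0 : qconj (0 : L) = - 0 by rewrite rmorph0 oppr0.
have t0 : tau g c0 = 1%g.
  rewrite /tau (_ : uaS _ = 1%g) ?mulg1 ?mulgV //; apply: val_inj.
  by apply/matrixP; do 2!elim/ord3P; rewrite !mxE /= ?rmorph0 ?oppr0.
apply: (mulgI (tau g cx)); rewrite mulgV -t0.
have cs : qconj (x + - x) = - (x + - x) by rewrite subrr.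
rewrite (tauM g cx cx' cs); move: cs; rewrite subrr => cs.
by rewrite (eq_irrelevance cs c0).
Qed.

Lemma cf_rev (a : 'I_3) : cf (rev_ord a) = - cf a.
Proof. by elim/ord3P: a. Qed.

Lemma tau_stab_entries h g (w : 'cV[L]_3) (b x : L) (c j : int) (y : L) (cy : qconj y = - y) :
    y = b * qconj b * x -> w = b *: (suval h *m e1 L) -> - c <= Q x ->
    nrm Q (j%:~R : R) c%:~R (suval (g^-1)%g *m w) ->
  forall i i', rge Q ((cf i - cf i')%:~R * j%:~R : R) (suval (g^-1 * tau h cy * g)%g i i').
Proof.
move=> Ey Ew Qx /(nrmE Q) nw i i'; rewrite tau_conj tau_entry.
apply: (rgeD pQ).
  by case: eqP => [->|_]; [rewrite subrr mul0r; apply/(rge1 pQ) | left].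
have Ew' a : (suval (g^-1)%g *m w) a 0 = b * suval (g^-1 * h)%g a 0.
  by rewrite Ew -scalemxAr mulmxA -suM mxE col0E.
have -> : y * suval (g^-1 * h)%g i 0 * qconj (suval (g^-1 * h)%g (rev_ord i') 0) =
   x * ((suval (g^-1)%g *m w) i 0 * qconj ((suval (g^-1)%g *m w) (rev_ord i') 0)).
  by rewrite !Ew' rmorphM /= Ey; ring.
have rx : rge Q ((2 * - c)%:~R : R) x by right; rewrite rmorphM /= ler_pM2l ?ltr0n // ler_int.
have := rgeM pQ rx (rgeM pQ (nw i) (rge_conj Qc (nw (rev_ord i')))).
rewrite cf_rev; apply: rge_le.
rewrite !(rmorphM, rmorphN, rmorphB) /=; lra.
Qed.

(* A short vector w of B^3 is isotropic, as its norm is an element of B of positive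
   valuation; so it defines transvections in the arithmetic group, many of which
   stabilize v. *)
Lemma short_vector M : exists2 c : nat, (0 < c)%N & forall v (w : 'cV[L]_3), w != 0 ->
  (forall i, B (w i 0)) -> vnrm v c%:~R w ->
  card_ge [set h | h \in G /\ vact h v = v] M.+1.
Proof.
have [s Hs] := arith_cosets Gfi.
pose n := (size s * M).+1.
have /card_geP[x [xinj Hx]] := Btr n.
pose c := (\max_(i < n) `|Q (x i)|).+1%N.
have Qx i : - c%:Z <= Q (x i).
  by have := @leq_bigmax _ (fun i => `|Q (x i)|%N) i; rewrite /c /=; move: (\max_(i < n) _) => C; lia.
exists c => // v w w0 Bw; have [g [j ->]] := ptP pQ e0 v.
move/(vnrm_pt pQ Qc e0) => nw.
have iw : iso_vec w.
  apply/iso_herm/Bpos; first exact: Bherm.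
  rewrite -[w](su_mulVK g) su_herm; move: (suval (g^-1)%g *m w) nw => y [n0 n1 n2].
  have r1 t : rge Q (1 : R) t -> vge Q 1 t.
    case=> [->|le]; [by left | right].
    by have : 1 <= 2 * Q t; [rewrite -(ler_int R) rmorphM | lia].
  have c1 : 1 <= (c%:Z)%:~R :> R by rewrite -[1]/((1%:Z)%:~R) ler_int.
  apply: r1; apply: (rgeD pQ); [apply: (rgeD pQ)|].
  - by apply: rge_le (rgeM pQ n0 (rge_conj Qc n2)); lra.
  - by apply: rge_le (rgeM pQ n1 (rge_conj Qc n1)); lra.
  - by apply: rge_le (rgeM pQ n2 (rge_conj Qc n0)); lra.
have [h [b [b0 Ew]]] := iso_orbit iw w0.
pose y i := b * qconj b * x i.
have cy i : qconj (y i) = - y i.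
  by rewrite /y !rmorphM /= qconjK (Hx i).2 mulrN (mulrC b).
have yinj : injective y.
  by move=> i i' /(mulfI (mulf_neq0 b0 _)); rewrite qconj_eq0 b0 => /(_ isT)/xinj.
have At i : arith_group B (tau h (cy i)).
  move=> a a'; rewrite tau_entry; apply: B_D; first by case: eqP => _; [apply: B1 | apply: B_0].
  have -> : y i * suval h a 0 * qconj (suval h (rev_ord a') 0) =
     x i * (w a 0 * qconj (w (rev_ord a') 0)).
    have Ewa a1 : w a1 0 = b * suval h a1 0 by rewrite Ew mxE col0E.
    by rewrite /y !Ewa rmorphM /=; ring.
  by apply: BM; [apply: (Hx i).1 | apply: BM => //; apply: Bc].
have fixt i : vact (tau h (cy i)) (pt g j) = pt g j.
  apply/(stab_fixP R)/(preserves_entries R pQ); split.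
    exact: (tau_stab_entries (cy i) erefl Ew (Qx i) nw).
  have cN : qconj (- y i) = - - y i by rewrite rmorphN /= cy.
  have -> : ((g^-1 * tau h (cy i) * g)^-1 = g^-1 * tau h cN * g)%g.
    by rewrite -(tauV h (cy i) cN) invgM [X in (_ * X)%g]invgM invgK mulgA.
  apply: (tau_stab_entries (x := - x i)) Ew _ nw; first by rewrite /y mulrN.
  by rewrite (plN pQ).
have ex i : exists r, r \in s /\ (r^-1 * tau h (cy i))%g \in G.
  by have [r rs H] := Hs _ (At i); exists r.
have [r Hr] := choice ex.
have lr i : (index (r i) s < size s)%N by rewrite index_mem; case: (Hr i).
have [|l lM] := @fiber_pigeonhole _ _ (fun i => Ordinal (lr i)) M; first by rewrite !card_ord.
have /card_gt0P[i0 Hi0] : (0 < #|[set i | Ordinal (lr i) == l]%SET|)%N by apply: leq_trans lM.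
pose I := {i | i \in [set i | Ordinal (lr i) == l]%SET}.
have cI : (M.+1 <= #|{: I}|)%N by rewrite card_sig.
apply: (card_ge_mono cI (S := [set h | h \in G /\ vact h (pt g j) = pt g j])) => //.
apply: (card_ge_inj (f := fun i : I => ((tau h (cy i0))^-1 * tau h (cy (val i)))%g)).
  by move=> i i' /mulgI/tau_inj/yinj/val_inj.
move=> [i /= Hi]; split; last first.
  by rewrite -(vactM pQ Qc e0) fixt -{1}(fixt i0) (vactM pQ Qc e0) mulVg (vact1 pQ Qc e0).
have Er : r i = r i0.
  move: Hi Hi0; rewrite !inE => /eqP <- /eqP[] Er.
  by rewrite -(nth_index 1%g (Hr i).1) -Er nth_index //; apply: (Hr i0).1.
have -> : ((tau h (cy i0))^-1 * tau h (cy i) = ((r i0)^-1 * tau h (cy i0))^-1 * ((r i)^-1 * tau h (cy i)))%g.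
  by rewrite Er; move: (tau h (cy i)) (tau h (cy i0)) => t1 t2; rewrite invgM invgK -mulgA mulVKg.
by apply: gpredM; [apply: gpredVr; apply: (Hr i0).2 | apply: (Hr i).2].
Qed.

End LatticePoints.

Lemma subgrp_preim (V W : zmodType) (f : {additive V -> W}) (Y : set W) :
  subgrp Y -> subgrp (f @^-1` Y).
Proof.
by case=> Y0 YB; split=> [|x y]; rewrite /preimage /= ?raddf0 // raddfB; apply: YB.
Qed.

Section Minkowski.
Variables (R : realType) (F : fieldType) (k : fieldType) (L : quad_ext k).
Variables (iotaL : {rmorphism F -> L}) (Q : L -> int) (e : nat).
Hypothesis pQ : is_place iotaL Q.
Hypothesis Qc : forall x, Q (qconj x) = Q x.
Hypothesis e0 : (0 < e)%N.
Implicit Types (g h : SU L) (z : boundary L) (v : vert R Q e).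

Local Notation pt := (pt R pQ e0).
Local Notation vact := (vact pQ Qc e0).
Local Notation vnrm := (vnrm pQ e0).

Variable cQ : nat.
Hypothesis cQ1 : (1 < cQ)%N.
Hypothesis indQ : forall N, indexp (vge Q N) (vge Q (N + 1)) cQ.

Variable B : set L.
Hypothesis B1 : B 1.
Hypothesis BB : forall x y, B x -> B y -> B (x - y).
Hypothesis Briem : exists C, forall M : nat,
  exists2 m, card_ge [set x | B x /\ vge Q (- (e * M)%N%:Z) x] m & (cQ ^ (e * M) <= C * m)%N.

Let vN := vge_subgrp pQ.

Lemma index_vge (N N' : int) : N <= N' -> indexp (vge Q N) (vge Q N') (cQ ^ `|N' - N|).
Proof.
move=> le; have := indexp_filtration vN (fun N x => @vge_le _ Q N (N + 1) x _) indQ N' `|N' - N|.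
have -> : N' - `|N' - N|%N%:Z = N by lia.
by apply; move=> *; rewrite lerDl.
Qed.

Lemma rge_int2 (r : int) x : rge Q (r%:~R : R) x <-> vge Q (- ((- r) %/ 2)%Z) x.
Proof.
have E : (r%:~R <= 2 * (Q x)%:~R :> R) = (- ((- r) %/ 2)%Z <= Q x).
  by rewrite -[2]/((2%:Z)%:~R) -rmorphM ler_int; lia.
by rewrite /rge /vge E.
Qed.

Lemma vnrm_horo v : exists u x (H : in_H (u, x)) j, v = pt (uaS H) j.
Proof.
have [g [j [bg ->]]] := iwasawa pQ Qc e0 None v.
have /borel_decomp[t [t0 [u [x [H [_ ->]]]]]] : borel g.
  have := (bd_eq 1%g g).1; rewrite invg1 mul1g; apply.
  by rewrite bg /bd boundary_fun1.
by exists u, x, H, (j - 2 * Q t); rewrite (pt_aS R pQ Qc e0).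
Qed.

Lemma minkowski : exists C, forall (N : nat) v,
  exists2 m, card_ge [set w : 'cV[L]_3 | (forall i, B (w i 0)) /\ vnrm v (- (2 * N)%N%:Z)%:~R w] m &
  (cQ ^ (3 * N) <= C * m.+1)%N.
Proof.
have [C HC] := Briem; exists (C * C * C * cQ)%N => N v.
have [u [x [H [j ->]]]] := vnrm_horo v.
pose n0 : int := - ((- (- (2 * N)%N%:Z - j)) %/ 2)%Z.
pose n1 : int := - N%:Z.
pose n2 : int := - ((- (- (2 * N)%N%:Z + j)) %/ 2)%Z.
pose M : nat := (`|n0| + `|n1| + `|n2| + `|Q u| + `|Q u| + `|Q x|)%N.
pose K : nat := (e * M)%N.
have KM : (M <= K)%N by rewrite /K leq_pmull.
have [m Sm Cm] := HC M.
set S := [set x | _ /\ _] in Sm.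
have sS : subgrp S.
  split; first by split; [apply: Bzero | left].
  by move=> a b [Ba va] [Bb vb]; split; [apply: BB | apply: (vN _).2].
have S3 := card_ge_prod3 Sm.
set S0 := [set w | _] in S3.
have sS0 : subgrp S0.
  split=> [i|w w' Sw Sw' i]; first by rewrite mxE; case: sS.
  by rewrite !mxE; apply: sS.2.
pose mu := suval (uaS H)^-1%g.
have HV := in_HV H.
have mu0 (w : 'cV[L]_3) : mx_coord mu 0 w = w 0 0 + qconj u * w 1 0 + qconj x * w 2 0.
  by rewrite /mx_coord /mu (uaS_inv H HV) mul3 !mx3E /= rmorphN; ring.
have mu1 (w : 'cV[L]_3) : mx_coord mu 1 w = w 1 0 - u * w 2 0.
  by rewrite /mx_coord /mu (uaS_inv H HV) mul3 !mx3E /=; ring.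
have mu2 (w : 'cV[L]_3) : mx_coord mu 2%:R w = w 2 0.
  by rewrite /mx_coord /mu (uaS_inv H HV) mul3 !mx3E /=; ring.
have Qu : vge Q (- `|Q u|%N%:Z) u by right; lia.
have Qu' : vge Q (- `|Q u|%N%:Z) (qconj u) by right; rewrite Qc; lia.
have Qx' : vge Q (- `|Q x|%N%:Z) (qconj x) by right; rewrite Qc; lia.
have le (l : int) : (`|l| <= M)%N -> - K%:Z <= l by lia.
have l0 : - K%:Z <= n0 by apply: le; rewrite /M; lia.
have l1 : - K%:Z <= n1 by apply: le; rewrite /M; lia.
have l2 : - K%:Z <= n2 by apply: le; rewrite /M; lia.
pose k0 := `|n0 - - K%:Z|%N; pose k1 := `|n1 - - K%:Z|%N; pose k2 := `|n2 - - K%:Z|%N.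
have P2 : card_ge (S0 `&` mx_coord mu 2%:R @^-1` vge Q n2) (m * m * m %/ cQ ^ k2).
  apply: card_ge_pigeonhole sS0 (vN n2) _ (index_vge l2) _ S3; last by rewrite mulnC leq_trunc_div.
  by move=> w Sw; rewrite /= mu2; case: (Sw 2%:R).
have sS1 := subgrpI sS0 (subgrp_preim (mx_coord mu 2%:R) (vN n2)).
have P1 : card_ge (S0 `&` mx_coord mu 2%:R @^-1` vge Q n2 `&` mx_coord mu 1 @^-1` vge Q n1)
    (m * m * m %/ cQ ^ k2 %/ cQ ^ k1).
  apply: card_ge_pigeonhole sS1 (vN n1) _ (index_vge l1) _ P2; last by rewrite mulnC leq_trunc_div.
  move=> w [Sw]; rewrite /preimage /= mu2 mu1 => w2; apply: (vN _).2; first by case: (Sw 1).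
  by apply: vge_le (vgeM pQ Qu w2); rewrite /M in KM; lia.
have sS2 := subgrpI sS1 (subgrp_preim (mx_coord mu 1) (vN n1)).
have P0 : card_ge (S0 `&` mx_coord mu 2%:R @^-1` vge Q n2 `&` mx_coord mu 1 @^-1` vge Q n1 `&`
    mx_coord mu 0 @^-1` vge Q n0) (m * m * m %/ cQ ^ k2 %/ cQ ^ k1 %/ cQ ^ k0).
  apply: card_ge_pigeonhole sS2 (vN n0) _ (index_vge l0) _ P1; last by rewrite mulnC leq_trunc_div.
  move=> w [[Sw]]; rewrite /preimage /= mu2 mu1 mu0 => w2 w1.
  have w1' : vge Q (- (`|n1| + `|n2| + `|Q u|)%N%:Z) (w 1 0).
    rewrite -[w 1 0](subrK (u * w 2 0)); apply: (vgeD pQ); first by apply: vge_le w1; lia.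
    by apply: vge_le (vgeM pQ Qu w2); lia.
  rewrite /M in KM; apply: (vgeD pQ); [apply: (vgeD pQ); first by case: (Sw 0)|].
    by apply: vge_le (vgeM pQ Qu' w1'); lia.
  by apply: vge_le (vgeM pQ Qx' w2); lia.
exists (m * m * m %/ cQ ^ k2 %/ cQ ^ k1 %/ cQ ^ k0)%N.
  apply: card_ge_mono P0 => // w [[[Sw w2] w1] w0]; split=> [i|]; first by case: (Sw i).
  apply/(vnrm_pt pQ Qc e0)/(nrmE Q) => a; rewrite -[_ * _]rmorphM -rmorphD /=; apply/rge_int2.
  have [c0 [c1 c2]] : cf 0 = -1 /\ cf 1 = 0 /\ cf 2 = 1 by [].
  elim/ord3P: a; [apply: vge_le w0 | apply: vge_le w1 | apply: vge_le w2]; rewrite /n0 /n1 /n2 ?c0 ?c1 ?c2; lia.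
rewrite -!divnMA -!expnD addnA.
have cQ0 n : (0 < cQ ^ n)%N by rewrite expn_gt0 (ltn_trans _ cQ1).
have Ek : (k2 + k1 + k0 + 3 * N <= 3 * K + 1)%N by rewrite /k0 /k1 /k2 /n0 /n1 /n2; lia.
rewrite -(leq_pmul2r (cQ0 (k2 + k1 + k0)%N)) -mulnA.
apply: (@leq_trans (C * C * C * cQ * (m * m * m)))%N; last first.
  rewrite leq_mul2l; apply/orP; right; apply: ltnW; apply: ltn_ceil; apply: cQ0.
rewrite -expnD addnC; apply: (@leq_trans (cQ ^ (3 * K + 1))%N).
  by rewrite leq_exp2l.
rewrite expnD expn1 [(C * C * C * cQ * _)%N]mulnAC leq_mul2r; apply/orP; right.
have := leq_mul (leq_mul Cm Cm) Cm; rewrite -!expnD -/K (_ : K + K + K = 3 * K)%N; last by lia.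
by have -> : (C * m * (C * m) * (C * m) = C * C * C * (m * m * m))%N by ring.
Qed.

End Minkowski.

Section ReductionTheory.
Variables (R : realType) (F : fieldType) (k : fieldType) (L : quad_ext k).
Variables (iotaL : {rmorphism F -> L}) (Q : L -> int) (e : nat).
Hypothesis pQ : is_place iotaL Q.
Hypothesis Qc : forall x, Q (qconj x) = Q x.
Hypothesis e0 : (0 < e)%N.
Implicit Types (g h : SU L) (z : boundary L) (v : vert R Q e).

Local Notation pt := (pt R pQ e0).
Local Notation vact := (vact pQ Qc e0).
Local Notation vnrm := (vnrm pQ e0).

Variable cQ : nat.
Hypothesis cQ1 : (1 < cQ)%N.
Hypothesis indQ : forall N, indexp (vge Q N) (vge Q (N + 1)) cQ.

Variable B : set L.
Hypothesis B1 : B 1.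
Hypothesis BB : forall x y, B x -> B y -> B (x - y).
Hypothesis BM : forall x y, B x -> B y -> B (x * y).
Hypothesis Bc : forall x, B x -> B (qconj x).
Hypothesis Bpos : forall x, B x -> vge Q 1 x -> x = 0.
Hypothesis Bfin : forall N, exists s : seq L, forall x, B x -> vge Q N x -> x \in s.
Hypothesis Btr : forall M, card_ge [set x | B x /\ qconj x = - x] M.
Hypothesis Briem : exists C, forall M : nat,
  exists2 m, card_ge [set x | B x /\ vge Q (- (e * M)%N%:Z) x] m & (cQ ^ (e * M) <= C * m)%N.
Hypothesis Bmod : forall d, B d -> d != 0 -> exists s : seq L, forall x, B x ->
  exists2 r, r \in s & exists2 y, B y & x - r = d * y.
Variable G : groupClosed (SU L).
Hypothesis Gfi : finite_index_subgroup G (arith_group B).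

Let vN := vge_subgrp pQ.

Lemma maximal_row_free (S : set 'rV[L]_3) : exists n (A : 'M[L]_(n, 3)),
  [/\ row_free A, forall i, S (row i A) & forall w, S w -> (w <= A)%MS].
Proof.
pose Pr n := `[< exists A : 'M[L]_(n, 3), row_free A /\ forall i, S (row i A) >].
have P0 : exists n, Pr n.
  by exists 0%N; apply/asboolP; exists 0; split=> [|[]//]; rewrite /row_free mxrank0.
have Pub n : Pr n -> (n <= 3)%N by case/asboolP=> A [/eqP E _]; have := rank_leq_col A; rewrite E.
case: (ex_maxnP P0 Pub) => n /asboolP[A [fA SA]] nmax; exists n, A; split=> // w Sw.
apply/negPn/negP => nw; suff /nmax : Pr (n + 1)%N by lia.
apply/asboolP; exists (col_mx A w); split=> [|i].
  rewrite /row_free eqn_leq rank_leq_row /=.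
  have lt : (A < A + w)%MS by rewrite ltmxE addsmxSl /= addsmx_sub submx_refl.
  by have := rank_ltmx lt; rewrite (eqP fA) addsmxE => H; apply: leq_trans H; rewrite addn1.
case: (split_ordP i) => i' ->; first by rewrite rowKu.
by rewrite rowKd [i']ord1 row_id.
Qed.

Lemma max_scale n (a : 'rV[L]_n) : a != 0 -> exists b : L, [/\ b != 0,
  forall i, vge Q 0 (b * a 0 i) & exists i, b * a 0 i = 1].
Proof.
move=> a0; have [i0 ai0] : exists i, a 0 i != 0.
  apply: contrapT => /forallNP H; move/eqP: a0; apply; apply/rowP => i; rewrite mxE.
  by apply/eqP/negPn/negP; apply: H.
have [im aim min] : exists2 i, a 0 i != 0 & forall i', a 0 i' != 0 -> Q (a 0 i) <= Q (a 0 i').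
  by case: (arg_minP (P := fun i => a 0 i != 0) (fun i => Q (a 0 i)) ai0) => i ai mi; exists i.
exists (a 0 im)^-1; split; rewrite ?invr_eq0 //; last by exists im; rewrite mulVf.
move=> i; have [->|ai] := eqVneq (a 0 i) 0; first by rewrite mulr0; left.
by right; rewrite (plM pQ) ?invr_eq0 // (plV pQ) addrC subr_ge0; apply: min.
Qed.

Definition sub_ball n (A : 'M[L]_(n, 3)) X (l : int) : set 'cV[L]_3 :=
  [set w | (w^T <= A)%MS /\ nrm Q X ((2 * l)%:~R : R) w].

Lemma sub_ball_subgrp n (A : 'M[L]_(n, 3)) X l : subgrp (sub_ball A X l).
Proof.
split=> [|w w' [Aw nw] [Aw' nw']].
  by split; [rewrite trmx0 sub0mx | split; rewrite mxE; left].
split; first by rewrite linearB /= addmx_sub // eqmx_opp.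
apply: (nrmD pQ) => //; rewrite -scaleN1r -[(2 * l)%:~R]add0r; apply: (nrmZ pQ) => //.
by right; rewrite (plN pQ) (pl1 pQ) mulr0.
Qed.

Lemma sub_ball_index n (A : 'M[L]_(n, 3)) X l : (n <= 2)%N ->
  exists2 c, (c <= cQ ^ 2)%N & indexp (sub_ball A X l) (sub_ball A X (l + 1)) c.
Proof.
move=> n2; have scale s a l' w : vge Q s a -> sub_ball A X l' w -> sub_ball A X (s + l') (a *: w).
  move=> va [Aw nw]; split; first by rewrite linearZ /= scalemx_sub.
  rewrite mulrDr rmorphD /=; apply: (nrmZ pQ) => //.
  case: va => [->|le]; [by left | right].
  by rewrite rmorphM ler_pM2l ?ltr0n // ler_int.
have [||||||||x Xx|m mn H] := @index_dependence L _ (vge Q 0) (vge Q 1) (sub_ball A X l) (sub_ball A X (l + 1)) cQ n (vN 0) (vN 1).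
- exact: (vgeM0 pQ).
- move=> a [->|le nM]; first by rewrite invr0; left.
  right; rewrite (plV pQ) leNgt; apply/negP => lt; apply: nM; right; lia.
- exact: indQ.
- exact: sub_ball_subgrp.
- exact: sub_ball_subgrp.
- by move=> a x va /(scale _ _ _ _ va); rewrite add0r.
- by move=> a x va /(scale _ _ _ _ va); rewrite add0r.
- by move=> a x va /(scale _ _ _ _ va); rewrite addrC.
- pose M : 'M[L]_(n.+1, 3) := \matrix_i (x i)^T.
  have MA : (M <= A)%MS by apply/row_subP => i; rewrite rowK; case: (Xx i).
  have [a a0 aM] : exists2 a : 'rV[L]_n.+1, a != 0 & a *m M = 0.
    have : ~~ row_free M.
      apply/negP => /eqP E; have := leq_trans (mxrankS MA) (rank_leq_row A).
      by rewrite E ltnn.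
    rewrite -kermx_eq0 => /rowV0Pn[a /sub_kermxP aM a0]; by exists a.
  have [b [b0 vb [i bi]]] := max_scale a0.
  exists (fun i => b * a 0 i); split=> //.
    exists i; rewrite bi; case=> [/eqP|]; first by rewrite oner_eq0.
    by rewrite (pl1 pQ).
  have -> : \sum_i (b * a 0 i) *: x i = 0.
    apply: trmx_inj; rewrite trmx0 linear_sum /=.
    have := congr1 (fun r => b *: r) aM; rewrite mulmx_sum_row scaler0 scaler_sumr => {2}<-.
    by apply: eq_bigr => i' _; rewrite linearZ /= rowK scalerA.
  exact: (sub_ball_subgrp _ _ _).1.
by exists (cQ ^ m)%N => //; rewrite leq_exp2l //; apply: leq_trans mn n2.
Qed.

Definition few_stab M v := ~ card_ge [set h | h \in G /\ vact h v = v] M.+1.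

Lemma full_rank M : exists N : nat, forall v, few_stab M v -> exists W : 'M[L]_3,
  [/\ \det W != 0, forall a b, B (W a b) & forall b, vnrm v (- (2 * N)%N%:Z)%:~R (col b W)].
Proof.
have [c c0 Hc] := short_vector R pQ Qc e0 B1 BB BM Bc Bpos Btr Gfi M.
have [C HC] := minkowski R pQ Qc e0 cQ1 indQ B1 BB Briem.
pose N := (2 * C * cQ ^ (2 * c))%N; exists N => v fv.
have [n [A [fA SA maxA]]] := maximal_row_free
  [set w : 'rV[L]_3 | (forall i, B (w 0 i)) /\ vnrm v (- (2 * N)%N%:Z)%:~R w^T].
have n3 : (n <= 3)%N by have := rank_leq_col A; rewrite (eqP fA).
have [n2|n2] := leqP n 2; last first.
  have En : n = 3%N by lia.
  subst n; exists A^T; split.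
  - by rewrite det_tr -unitfE -unitmxE -row_free_unit.
  - by move=> a b; rewrite mxE; have [/(_ a)] := SA b; rewrite mxE.
  by move=> b; have [_] := SA b; rewrite tr_row.
exfalso; have [g [j Ev]] := ptP pQ e0 v.
have [m Sm Cm] := HC N v.
have [f [finj Hf]] := card_geP Sm.
have Af i : ((f i)^T <= A)%MS.
  by apply: maxA; split=> [l|]; [rewrite mxE; case: (Hf i) | rewrite trmxK; case: (Hf i)].
pose A' := A *m (suval (g^-1)%g)^T.
have sub (l : int) w : sub_ball A' (j%:~R : R) (l + 1) w -> sub_ball A' (j%:~R : R) l w.
  case=> Aw nw; split=> //; apply: nrm_le nw; rewrite ler_int; lia.
have [c' le ind] := indexp_filtration_le (fun l => sub_ball_subgrp A' (j%:~R : R) l) (fun l w => @sub l w)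
  (fun l => sub_ball_index A' (j%:~R : R) l n2) c (N + c).
have Ec : c%:Z - (N + c)%N%:Z = - N%:Z by lia.
rewrite Ec in ind.
have mle : (m <= c')%N.
  rewrite -[m in (m <= _)%N]card_ord.
  apply: (indexp_ub (g := fun i => suval (g^-1)%g *m f i) (sub_ball_subgrp A' (j%:~R : R) c) ind).
    move=> i; split; first by rewrite trmx_mul submxMr.
    have [_] := Hf i; rewrite Ev => /(vnrm_pt pQ Qc e0).
    by have -> : 2 * - N%:Z = - (2 * N)%N%:Z by lia.
  move=> i i' [_ nw]; apply: finj; apply/eqP; rewrite -subr_eq0; apply/negPn/negP => w0; apply: fv.
  apply: (Hc v _ w0) => [l|]; first by rewrite !mxE; apply: BB; [case: (Hf i) | case: (Hf i')].
  rewrite Ev; apply/(vnrm_pt pQ Qc e0); rewrite mulmxBr; apply: nrm_le nw; rewrite ler_int; lia.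
have lt := ltn_expl N cQ1.
have cQ0 l : (0 < cQ ^ l)%N by rewrite expn_gt0 (ltn_trans _ cQ1).
have mle' : (m.+1 <= 2 * cQ ^ (2 * (N + c)))%N.
  apply: leq_trans (_ : (1 + cQ ^ (2 * (N + c)) <= _))%N.
    by rewrite add1n ltnS; apply: leq_trans mle _; rewrite -expnM in le.
  by have := cQ0 (2 * (N + c))%N; lia.
have := leq_trans Cm (leq_mul (leqnn C) mle').
rewrite (_ : 3 * N = N + 2 * N)%N; last by lia.
rewrite mulnDr (expnD cQ N (2 * N)) (expnD cQ (2 * N) (2 * c)).
rewrite (_ : C * _ = (N * cQ ^ (2 * N)))%N; last first.
  by move: (cQ ^ (2 * N))%N => X; rewrite /N; ring.
by rewrite leq_pmul2r // leqNgt lt.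
Qed.

End ReductionTheory.

Lemma col_mul (K : pzRingType) m n p (A : 'M[K]_(m, n)) (C : 'M[K]_(n, p)) i :
  col i (A *m C) = A *m col i C.
Proof. by apply/matrixP => a b; rewrite !mxE; apply: eq_bigr => l _; rewrite mxE. Qed.

Section Classification.
Variables (R : realType) (F : fieldType) (k : fieldType) (L : quad_ext k).
Variables (iotaL : {rmorphism F -> L}) (Q : L -> int) (e : nat).
Hypothesis pQ : is_place iotaL Q.
Hypothesis Qc : forall x, Q (qconj x) = Q x.
Hypothesis e0 : (0 < e)%N.
Implicit Types (g h : SU L) (z : boundary L) (v : vert R Q e).

Local Notation pt := (pt R pQ e0).
Local Notation vact := (vact pQ Qc e0).
Local Notation vnrm := (vnrm pQ e0).

Variable cQ : nat.
Hypothesis cQ1 : (1 < cQ)%N.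
Hypothesis indQ : forall N, indexp (vge Q N) (vge Q (N + 1)) cQ.

Variable B : set L.
Hypothesis B1 : B 1.
Hypothesis BB : forall x y, B x -> B y -> B (x - y).
Hypothesis BM : forall x y, B x -> B y -> B (x * y).
Hypothesis Bc : forall x, B x -> B (qconj x).
Hypothesis Bpos : forall x, B x -> vge Q 1 x -> x = 0.
Hypothesis Bfin : forall N, exists s : seq L, forall x, B x -> vge Q N x -> x \in s.
Hypothesis Btr : forall M, card_ge [set x | B x /\ qconj x = - x] M.
Hypothesis Briem : exists C, forall M : nat,
  exists2 m, card_ge [set x | B x /\ vge Q (- (e * M)%N%:Z) x] m & (cQ ^ (e * M) <= C * m)%N.
Hypothesis Bmod : forall d, B d -> d != 0 -> exists s : seq L, forall x, B x ->
  exists2 r, r \in s & exists2 y, B y & x - r = d * y.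
Variable G : groupClosed (SU L).
Hypothesis Gfi : finite_index_subgroup G (arith_group B).

Let vN := vge_subgrp pQ.


Let B_0 := Bzero B1 BB.
Let B_N x (Bx : B x) : B (- x) := BN B1 BB Bx.
Let B_D x y (Bx : B x) (By : B y) : B (x + y) := BD B1 BB Bx By.

Lemma B_sign n : B ((-1) ^+ n).
Proof. by elim: n => [|n IH]; [rewrite expr0 | rewrite exprS mulN1r; apply: B_N]. Qed.

Lemma Bdet n (A : 'M[L]_n) : (forall a b, B (A a b)) -> B (\det A).
Proof.
move=> BA; rewrite /determinant; elim/big_ind: _ => // s _.
by apply: BM; [apply: B_sign | elim/big_ind: _].
Qed.

Lemma Badj n (A : 'M[L]_n) : (forall a b, B (A a b)) -> forall a b, B ((\adj A) a b).
Proof.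
move=> BA a b; rewrite mxE /cofactor; apply: BM; first exact: B_sign.
by apply: Bdet => c d; rewrite !mxE.
Qed.

Lemma herm_mulmx (W : 'M[L]_3) (s t : 'cV[L]_3) : herm (W *m s) (W *m t) =
  \sum_a \sum_b s a 0 * qconj (t b 0) * herm (col a W) (col b W).
Proof.
rewrite big_ord3 !big_ord3 /herm !mul3 ![(col _ _) _ _]mxE !(rmorphD, rmorphM) /=.
move: (qconj (W 0 0)) (qconj (W 0 1)) (qconj (W 0 2)) => A00 A01 A02.
move: (qconj (W 1 0)) (qconj (W 1 1)) (qconj (W 1 2)) => A10 A11 A12.
move: (qconj (W 2 0)) (qconj (W 2 1)) (qconj (W 2 2)) => A20 A21 A22.
ring.
Qed.

Definition gram (W : 'M[L]_3) : 'M[L]_3 := \matrix_(a, b) herm (col a W) (col b W).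

(* g = W' W^-1 = 1 + Y adj(W). *)
Lemma same_class (W W' Y : 'M[L]_3) : (forall a b, B (W a b)) -> (forall a b, B (Y a b)) ->
    \det W != 0 -> \det W' = \det W -> gram W' = gram W -> W' = W + \det W *: Y ->
  exists g : SU L, arith_group B g /\ suval g *m W = W'.
Proof.
move=> BW BY d0 Ed Eg EW.
have uW : W \in unitmx by rewrite unitmxE unitfE.
have Sg : is_su (W' *m invmx W).
  split=> [|x y]; first by rewrite det_mulmx Ed det_inv mulfV.
  rewrite -[in RHS](mulKVmx uW x) -[in RHS](mulKVmx uW y) -!mulmxA !herm_mulmx.
  apply: eq_bigr => a _; apply: eq_bigr => b _; congr (_ * _).
  by move/matrixP: Eg => /(_ a b); rewrite !mxE.
exists (mkSU Sg); split; last by rewrite /= mulmxKV.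
move=> a b; have -> : suval (mkSU Sg) = 1%:M + Y *m \adj W.
  rewrite /= {1}EW mulmxDl mulmxV // -scalemxAl /invmx uW -scalemxAr scalerA mulfV //.
  by rewrite scale1r.
rewrite mxE; apply: B_D; last by apply: (Bmx B1 BB BM) => // c d; apply: Badj.
by rewrite mxE; case: eqP => _; [apply: B1 | apply: B_0].
Qed.

Lemma rge_2int (r : int) x : rge Q ((2 * r)%:~R : R) x -> vge Q r x.
Proof.
case=> [->|le]; [by left | right].
by move: le; rewrite rmorphM ler_pM2l ?ltr0n // ler_int.
Qed.

Lemma gram_vge v (W : 'M[L]_3) N : (forall b, vnrm v ((2 * N)%:~R) (col b W)) ->
  forall a b, vge Q (2 * N) (gram W a b).
Proof.
have [g [j ->]] := ptP pQ e0 v => H a b; apply: rge_2int; rewrite mxE.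
have Ha c := (vnrm_pt pQ Qc e0 g j _ _).1 (H c).
rewrite -[col a W](su_mulVK g) -[col b W](su_mulVK g) su_herm.
have [a0 a1 a2] := Ha a; have [b0 b1 b2] := Ha b.
have E : (2 * (2 * N))%:~R = 2 * (2 * N)%:~R :> R by rewrite rmorphM.
rewrite E; apply: (rgeD pQ); [apply: (rgeD pQ)|].
- by apply: rge_le (rgeM pQ a0 (rge_conj Qc b2)); lra.
- by apply: rge_le (rgeM pQ a1 (rge_conj Qc b1)); lra.
- by apply: rge_le (rgeM pQ a2 (rge_conj Qc b0)); lra.
Qed.

Lemma det_vge v (W : 'M[L]_3) N : (forall b, vnrm v ((2 * N)%:~R) (col b W)) ->
  vge Q (3 * N) (\det W).
Proof.
have [g [j ->]] := ptP pQ e0 v => H; apply: rge_2int.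
have Ha c := (nrmE Q _ _ _).1 ((vnrm_pt pQ Qc e0 g j _ _).1 (H c)).
have -> : \det W = \det (suval (g^-1)%g *m W).
  by rewrite det_mulmx; have [-> _] := suP (g^-1)%g; rewrite mul1r.
have Hab a b : rge Q ((2 * N)%:~R + (cf a)%:~R * j%:~R : R) ((suval (g^-1)%g *m W) a b).
  by have := Ha b a; rewrite -col_mul mxE.
rewrite /determinant; elim/big_ind: _ => [|x y|s _]; first exact: rge0.
  exact: (rgeD pQ).
have sgn n x r : rge Q (r : R) x -> rge Q r ((-1) ^+ n * x).
  by elim: n => [|n IH] rx; rewrite ?expr0 ?mul1r // exprS -mulrA mulN1r; apply/(rgeN pQ)/IH.
apply: sgn; rewrite prod_ord3.
apply: rge_le (rgeM pQ (rgeM pQ (Hab 0 _) (Hab 1 _)) (Hab 2%:R _)).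
have [c0 [c1 c2]] : cf 0 = -1 /\ cf 1 = 0 /\ cf 2%:R = 1 by [].
rewrite c0 c1 c2; rewrite !(rmorphM, rmorphN) /= rmorph0 rmorph1; lra.
Qed.

Lemma pt_uaS_eq u x (H : in_H (u, x)) u' x' (H' : in_H (u', x')) (j T : int) :
    - T <= j <= T -> vge Q (- T) u -> vge Q (2 * T) (u' - u) -> vge Q T (x' - x) ->
  pt (uaS H) j = pt (uaS H') j.
Proof.
move=> /andP[j1 j2] vu vuu vxx; symmetry.
rewrite -[uaS H'](mulVKg (uaS H)); apply/(pt_preserves R pQ Qc e0).
have HV := in_HV H; rewrite (uaS_inv H HV) (uaS_mul HV H' (in_HM HV H')).
apply: (preserves_ua pQ Qc); have -> : - 2 * j%:~R = 2 * (- j)%:~R :> R by rewrite rmorphN /=; ring.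
apply/rge_vge.
have -> : qconj x + x' - qconj (- u) * u' = (x' - x) + qconj u * (u' - u).
  by rewrite (in_H_conj H) rmorphN /=; ring.
apply: (vgeD pQ); first by apply: vge_le vxx; lia.
have vu' : vge Q (- T) (qconj u) by case: vu => [->|le]; [left; rewrite rmorph0 | right; rewrite Qc].
by apply: vge_le (vgeM pQ vu' vuu); lia.
Qed.

(* The norm of v is bounded on the columns of the invertible matrix W, hence on the
   standard basis. *)
Lemma finite_vertices (W : 'M[L]_3) (N : nat) : \det W != 0 -> exists l : seq (vert R Q e),
  forall v, (forall b, vnrm v (- (2 * N)%N%:Z)%:~R (col b W)) -> v \in l.
Proof.
move=> d0; have uW : W \in unitmx by rewrite unitmxE unitfE.
have [K HK] := mx_vge Q e0 (invmx W).
pose T : nat := (2 * N + 2 * K)%N.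
have T2 : - T%:Z <= 2 * T%:Z by lia.
have T1 : - T%:Z <= T%:Z by lia.
have [r1 [_ _ cov1]] := index_vge pQ e0 cQ1 indQ T2.
have [r2 [_ _ cov2]] := index_vge pQ e0 cQ1 indQ T1.
pose cls v (a : _ * _ * 'I_(2 * T).+1) := exists u x (H : in_H (u, x)) (j : int),
  [/\ v = pt (uaS H) j, vge Q (- T%:Z) u, vge Q (2 * T%:Z) (u - r1 a.1.1), vge Q T%:Z (x - r2 a.1.2) & j = a.2%:Z - T%:Z].
have [|a|l Hl] := @fin_cover _ _ (fun v => forall b, vnrm v (- (2 * N)%N%:Z)%:~R (col b W)) eq (enum {: _ * _ * _}) cls.
- move=> v; have [u [x [H [j ->]]]] := vnrm_horo pQ Qc e0 v => Hv.
  have Ha b := (nrmE Q _ _ _).1 ((vnrm_pt pQ Qc e0 _ j _ _).1 (Hv b)).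
  have Hm a b : rge Q ((- T%:Z + cf a * j)%:~R : R) (suval (uaS H)^-1%g a b).
    rewrite -[suval _](mulmxK uW) mxE; elim/big_ind: _ => [|y y'|c _]; first exact: rge0.
      exact: (rgeD pQ).
    have r1' : rge Q ((2 * - K%:Z)%:~R : R) (invmx W c b).
      by case: (HK c b) => [->|le]; [left | right; rewrite rmorphM ler_pM2l ?ltr0n // ler_int].
    have := Ha c a; rewrite -col_mul mxE => h; apply: rge_le (rgeM pQ h r1').
    by rewrite -[_ * j%:~R]rmorphM -!rmorphD ler_int /T; lia.
  have HV := in_HV H; rewrite (uaS_inv H HV) in Hm.
  have [c0 [c1 c2]] : cf 0 = -1 /\ cf 1 = 0 /\ cf 2%:R = 1 by [].
  have j1 : - T%:Z <= j.
    by have := Hm 0 0; rewrite c0 mx3E /= => /(rge1 pQ); rewrite (ler_int _ _ 0); lia.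
  have j2 : j <= T%:Z.
    by have := Hm 2%:R 2%:R; rewrite c2 mx3E /= => /(rge1 pQ); rewrite (ler_int _ _ 0); lia.
  have vu : vge Q (- T%:Z) u.
    have := Hm 0 1; rewrite c0 mx3E /= rmorphN opprK => h.
    apply: rge_2int; rewrite -[u]qconjK; apply: (rge_conj Qc); apply: rge_le h; rewrite ler_int; lia.
  have vx : vge Q (- T%:Z) x.
    have := Hm 0 2%:R; rewrite c0 mx3E /= => h.
    apply: rge_2int; rewrite -[x]qconjK; apply: (rge_conj Qc); apply: rge_le h; rewrite ler_int; lia.
  have [i1 h1] := cov1 _ vu; have [i2 h2] := cov2 _ vx.
  have lt : (absz (j + T%:Z)%R < (2 * T).+1)%N by lia.
  exists (i1, i2, Ordinal lt); first by rewrite mem_enum.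
  by exists u, x, H, j; split=> //=; lia.
- have [[v0 H0]|no] := pselect (exists v, cls v a); last by exists [::] => v _ cv; case: no; exists v.
  exists [:: v0] => v _ cv; exists v0; rewrite ?mem_head //.
  have [u [x [H [j [-> vu h1 h2 Ej]]]]] := cv; have [u' [x' [H' [j' [-> _ h1' h2' Ej']]]]] := H0.
  rewrite Ej' -Ej; apply: (@pt_uaS_eq _ _ _ _ _ _ _ T%:Z) => //.
  + by rewrite Ej; case: (a.2) => i /= lt; lia.
  + by apply: (subgrp_trans (vN _) h1'); apply: (subgrpBC (vN _)).
  + by apply: (subgrp_trans (vN _) h2'); apply: (subgrpBC (vN _)).
by exists l => v Hv; have [v' lv' ->] := Hl v Hv.
Qed.

Theorem finitely_many_orbits M : exists l : seq (vert R Q e), forall v, few_stab pQ Qc e0 G M v ->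
  exists2 v', v' \in l & exists2 h, h \in G & vact h v = v'.
Proof.
have [N HN] := full_rank R pQ Qc e0 cQ1 indQ B1 BB BM Bc Bpos Btr Briem Gfi M.
have [s Hs] := arith_cosets Gfi.
have [s1 Hs1] := Bfin (2 * - N%:Z); have [t1 Ht1] := fin_mx 3 3 s1.
have [s2 Hs2] := Bfin (3 * - N%:Z).
have ex d : exists t : seq 'M[L]_3, B d -> d != 0 -> forall W : 'M[L]_3, (forall a b, B (W a b)) ->
    exists2 T, T \in t & exists2 Y : 'M[L]_3, (forall a b, B (Y a b)) & W = T + d *: Y.
  have [[Bd d0]|no] := pselect (B d /\ d != 0); last by exists [::] => Bd d0; case: no.
  have [r Hr] := Bmod Bd d0; have [t Ht] := fin_mx 3 3 r; exists t => _ _ W BW.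
  have ex2 (ab : 'I_3 * 'I_3) : exists xy : L * L, [/\ xy.1 \in r, B xy.2 & W ab.1 ab.2 - xy.1 = d * xy.2].
    by have [x rx [y By E]] := Hr _ (BW ab.1 ab.2); exists (x, y).
  have [f Hf] := choice ex2.
  exists (\matrix_(a, b) (f (a, b)).1); first by apply: Ht => a b; rewrite mxE; case: (Hf (a, b)).
  exists (\matrix_(a, b) (f (a, b)).2) => [a b|]; first by rewrite mxE; case: (Hf (a, b)).
  by apply/matrixP => a b; rewrite !mxE; case: (Hf (a, b)) => _ _ /= <-; rewrite addrC subrK.
have [t Ht] := choice ex.
have EN : 2 * - N%:Z = - (2 * N)%N%:Z by lia.
pose adm v (W : 'M[L]_3) := [/\ \det W != 0, forall a b, B (W a b) & forall b, vnrm v (- (2 * N)%N%:Z)%:~R (col b W)].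
pose cls v (a : 'M[L]_3 * L * 'M[L]_3) := exists W, [/\ adm v W, gram W = a.1.1, \det W = a.1.2 &
  exists2 Y : 'M[L]_3, (forall a b, B (Y a b)) & W = a.2 + \det W *: Y].
apply: (@fin_cover _ _ _ (fun v v' => exists2 h, h \in G & vact h v = v')
  [seq (gd, T) | gd <- [seq (gm, d) | gm <- t1, d <- s2], T <- t gd.2] cls).
- move=> v /HN[W [d0 BW nW]].
  have [T tT [Y BY EY]] := Ht (\det W) (Bdet BW) d0 W BW.
  have nW' b : vnrm v ((2 * - N%:Z)%:~R) (col b W) by rewrite EN.
  exists (gram W, \det W, T); last by exists W; split=> //; exists Y.
  apply: allpairs_f_dep => //; apply: allpairs_f.
    apply: Ht1 => a b; apply: Hs1; last exact: gram_vge nW' a b.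
    by rewrite mxE; apply: (Bherm B1 BB BM Bc) => i; rewrite mxE.
  by apply: Hs2; [apply: Bdet | apply: det_vge nW'].
move=> a; have [[v0 [W0 [[d0 BW0 nW0] Eg0 Ed0 [Y0 BY0 EY0]]]]|no] := pselect (exists v, cls v a); last first.
  by exists [::] => v _ cv; case: no; exists v.
have [l Hl] := finite_vertices N d0.
exists [seq vact (r^-1)%g v' | r <- s, v' <- l] => v _ [W [[d1 BW nW] Eg Ed [Y BY EY]]].
have [||||||g [Bg Eg']] := @same_class W W0 (Y0 - Y) => //.
- by move=> i j; rewrite !mxE; apply: BB.
- by rewrite Ed0 Ed.
- by rewrite Eg0 Eg.
- have E0 : W0 = a.2 + \det W *: Y0 by move: EY0; rewrite Ed0 -Ed.
  apply: (etrans E0); have -> : a.2 = W - \det W *: Y by rewrite {1}EY addrK.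
  by rewrite scalerBr -addrA [- _ + _]addrC.
have lv : vact g v \in l by apply: Hl => b; rewrite -Eg' col_mul vnrm_act.
have [r rs Gr] := Hs g Bg.
exists (vact (r^-1)%g (vact g v)); first by apply: allpairs_f.
by exists (r^-1 * g)%g => //; rewrite vactM.
Qed.

End Classification.

(** * Fixed ends of finite p-subgroups *)

Section FiniteSubgroups.
Variables (T : groupType) (s : seq T).

Definition subgroup_seq : Prop :=
  [/\ 1%g \in s, {in s &, forall x y, (x * y)%g \in s} & {in s, forall x, (x^-1)%g \in s}].

(* The phantom argument makes the group structure inferable. *)
Definition seq_group of subgroup_seq : Type := seq_sub s.

Variable sG : subgroup_seq.
Local Notation gT := (seq_group sG).
Local Notation GT := (finset.setTfor gT).

HB.instance Definition _ := Finite.on gT.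

Let s1 : 1%g \in s. Proof. by case: sG. Qed.
Let sM (x y : gT) : (val x * val y)%g \in s.
Proof. by case: sG => _ + _; apply; apply: valP. Qed.
Let sV (x : gT) : (val x)^-1%g \in s.
Proof. by case: sG => _ _; apply; apply: valP. Qed.

Definition seq_mul (x y : gT) : gT := SeqSub (sM x y).
Definition seq_one : gT := SeqSub s1.
Definition seq_inv (x : gT) : gT := SeqSub (sV x).

Fact seq_mulA : associative seq_mul.
Proof. by move=> x y z; apply/val_inj/mulgA. Qed.
Fact seq_mul1 : left_id seq_one seq_mul.
Proof. by move=> x; apply/val_inj/mul1g. Qed.
Fact seq_mulV : left_inverse seq_one seq_inv seq_mul.
Proof. by move=> x; apply/val_inj/mulVg. Qed.

HB.instance Definition _ := Finite_isGroup.Build gT seq_mulA seq_mul1 seq_mulV.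

Lemma val_seqM (x y : gT) : val (x * y)%g = (val x * val y)%g. Proof. by []. Qed.
Lemma val_seqX (x : gT) n : val (x ^+ n)%g = (val x ^+ n)%g.
Proof. by elim: n => [|n IH] //; rewrite !expgS val_seqM IH. Qed.

Variable p : nat.
Hypothesis p_pr : prime p.
Hypothesis tors : forall x n, x \in s -> has_order x n -> exists m, n = (p ^ m)%N.

Let pG : (p.-group GT)%g.
Proof.
apply/pgroupP => q q_pr /(Cauchy q_pr)[x _ ox].
have [|m Eq] := tors (valP x) (n := q).
  split; first exact: prime_gt0.
    by rewrite -val_seqX -{1}ox expg_order.
  move=> m /andP[m0 lt]; rewrite -val_seqX => E'.
  have E : (x ^+ m = 1)%g by apply: val_inj.
  have : (#[x]%g %| m)%N by rewrite order_dvdn E.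
  by rewrite ox => /(dvdn_leq m0); lia.
have m0 : (0 < m)%N by case: (m) Eq q_pr => // ->.
have : (p %| q)%N by rewrite Eq dvdn_exp.
by rewrite dvdn_prime2 // inE eq_sym.
Qed.

Lemma seq_order x : x \in s -> exists m, (x ^+ (p ^ m) = 1)%g.
Proof.
move=> xs; pose y : gT := SeqSub xs.
have /p_natP[m E] := mem_p_elt pG (finset.in_setT y).
by exists m; rewrite -E -[x]/(val y) -val_seqX expg_order.
Qed.

Lemma seq_central x : x \in s -> x != 1%g -> exists c, [/\ c \in s, c != 1%g &
  {in s, forall y, (c * y = y * c)%g}].
Proof.
move=> xs x1; have : ('Z(GT) != 1)%g.
  apply: contraNneq x1 => /(trivg_center_pgroup pG) E.
  have : (SeqSub xs : gT) \in GT by rewrite inE.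
  by rewrite E inE => /eqP/(congr1 val) /= ->.
move/trivgPn => [c /centerP[_ Zc] c1]; exists (val c); split; first exact: valP.
  by apply: contraNneq c1 => E; apply/eqP/val_inj.
by move=> y ys; have /(congr1 val) := Zc (SeqSub ys) (finset.in_setT _).
Qed.

End FiniteSubgroups.

Section UnipotentFixedPoint.
Variables (k : fieldType) (L : quad_ext k) (p : nat).
Hypothesis pL : p \in [pchar L].
Implicit Types (g h : SU L) (z : boundary L).

Lemma suX g n : suval (g ^+ n)%g = suval g ^+ n.
Proof. by elim: n => [|n IH] //; rewrite expgS exprS -IH. Qed.

Lemma pchar_mx : p \in [pchar 'M[L]_3].
Proof.
rewrite inE (pcharf_prime pL) /=; apply/eqP/matrixP => i j.
by rewrite -[_%:R]scaler_nat !mxE (pcharf0 pL) mul0r.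
Qed.

Lemma unipotent_sub1 (x : 'M[L]_3) m : x ^+ (p ^ m) = 1 -> (x - 1) ^+ (p ^ m) = 0.
Proof.
move=> E; rewrite -[RHS](subrr 1) -{2}E; elim: m {E} => [|m IH]; first by rewrite expn0 !expr1.
rewrite expnSr !exprM IH -!(pFrobenius_autE pchar_mx).
by rewrite (pFrobenius_autB_comm pchar_mx) ?pFrobenius_aut1 //; apply: commr1.
Qed.

Lemma fixed_isotropic g m : g != 1%g -> (g ^+ (p ^ m) = 1)%g ->
  exists y, [/\ y != 0, iso_vec y & suval g *m y = y].
Proof.
move=> g1 gm; pose N := suval g - 1.
have N0 : exists n, N ^+ n == 0.
  by exists (p ^ m)%N; apply/eqP/unipotent_sub1; rewrite -suX gm.
case: (ex_minnP N0) => -[|[|n]]; first by rewrite expr0 oner_eq0.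
  rewrite expr1 subr_eq0 => /eqP E; case/eqP: g1; exact: val_inj.
move=> /eqP Nn min; have nz : N ^+ n.+1 != 0 by apply/negP => /min; rewrite ltnn.
have [c c0] : exists c, col c (N ^+ n.+1) != 0.
  apply: contrapT => /forallNP H; case/eqP: nz; apply/matrixP => i j.
  have /negP/negPn/eqP/matrixP/(_ i 0) := H j.
  by rewrite [LHS]mxE [RHS]mxE => ->; rewrite [RHS]mxE.
pose y' := col c (N ^+ n); exists (col c (N ^+ n.+1)).
have Ey : col c (N ^+ n.+1) = suval g *m y' - y'.
  by rewrite exprS -[N * _]/(N *m _) col_mul /N mulmxBl mul1mx.
have fixy : suval g *m col c (N ^+ n.+1) = col c (N ^+ n.+1).
  apply/eqP; rewrite -subr_eq0 -{2}[col c _]mul1mx -mulmxBl -/N -col_mul.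
  by rewrite -[N *m _]/(N * _) -exprS Nn; apply/eqP/matrixP => i j; rewrite !mxE.
split=> //; apply/iso_herm; set y := col c _ in fixy Ey *.
have hB (a b d : 'cV[L]_3) : herm (a - b) d = herm a d - herm b d by rewrite /herm !mxE; ring.
by rewrite {1}Ey hB -{1}fixy su_herm subrr.
Qed.

Lemma uaS_M (u v u' v' : L) (H : in_H (u, v)) (H' : in_H (u', v')) : (uaS H * uaS H')%g = uaS (in_HM H H').
Proof. exact: uaS_mul. Qed.

Lemma fixed_end g m : g != 1%g -> (g ^+ (p ^ m) = 1)%g ->
  exists z, forall z', boundary_fun g z' = z' <-> z' = z.
Proof.
move=> g1 gm; have [y [y0 iy fy]] := fixed_isotropic g1 gm.
have [h [b [b0 Ey]]] := iso_orbit iy y0.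
have fe : suval (h^-1 * g * h)%g *m e1 L = e1 L.
  have E : suval h *m e1 L = b^-1 *: y by rewrite Ey scalerA mulVf // scale1r.
  by rewrite !suM -!mulmxA E -scalemxAr fy -E su_mulK.
have e1c i : suval (h^-1 * g * h)%g i 0 = (i == 0)%:R by rewrite -col0E fe mxE andbT.
have Bg : borel (h^-1 * g * h)%g by apply/borelE; rewrite !e1c.
exists (bd h) => z'; split=> [fz|->]; last first.
  by rewrite -bdM; symmetry; apply/bd_eq; rewrite mulgA.
have [t [t0 [u [x [H [Et Eg]]]]]] := borel_decomp Bg.
have {}Eg : (h^-1 * g * h = uaS H)%g.
  rewrite Eg (_ : aS t0 = 1%g) ?mulg1 //; apply: val_inj.
  rewrite /= Et e1c /=; apply/matrixP; do 2!elim/ord3P; rewrite !mxE /= ?rmorph1 ?invr1 ?mulr1 //.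
set g' := (h^-1 * g * h)%g in Eg.
pose z2 := boundary_fun (h^-1)%g z'.
have fz2 : boundary_fun g' z2 = z2.
  by rewrite /z2 boundary_funM /g' mulgK -boundary_funM fz.
have Ez' : z' = boundary_fun h z2 by rewrite /z2 boundary_funM mulgV boundary_fun1.
rewrite Ez' /bd; congr boundary_fun.
case Ez2: z2 => [w|] //; exfalso; case/eqP: g1.
pose A := uaS (valP w : in_H ((val w).1, (val w).2)).
have Eb : bd (A^-1 * sS L)%g = z2.
  rewrite Ez2; apply/boundary_funP; rewrite /boundary_rel invg1 mulg1.
  suff -> : (g_ (Some w) * (A^-1 * sS L) = 1)%g by apply/borelE; rewrite !mxE.
  have -> : g_ (Some w) = (sS L * A)%g by apply: val_inj.
  by rewrite -mulgA mulVKg sS_sq.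
have : borel ((A^-1 * sS L)^-1 * (g' * (A^-1 * sS L)))%g.
  by apply/bd_eq; rewrite (bdM g') Eb fz2.
have HA := in_HV (valP w : in_H ((val w).1, (val w).2)).
have [u1 [x1 [H1 E1]]] : exists u1 x1 (H1 : in_H (u1, x1)), (A * g' * A^-1)%g = uaS H1.
  by rewrite Eg (uaS_inv _ HA) !uaS_M; do 3!eexists.
have -> : ((A^-1 * sS L)^-1 * (g' * (A^-1 * sS L)) = uma_prod H1)%g.
  by rewrite invgM invgK sS_inv /uma_prod -E1 !mulgA.
move=> /borelE; rewrite uma_prodE uma_mxE !mx3E /= => -[u0 x0].
have E : (A * g' * A^-1 = 1)%g.
  rewrite E1; apply: val_inj; rewrite /= u0 x0.
  by apply/matrixP; do 2!elim/ord3P; rewrite !mxE /= ?rmorph0 ?oppr0.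
have {}E : g' = 1%g by rewrite -[g'](mulKg A) -[X in (_ * X)%g](mulgK A^-1%g) E mul1g invgK mulVg.
have : (h * g' * h^-1 = 1)%g by rewrite E mulg1 mulgV.
by rewrite /g' !mulgA mulgV mul1g mulgK.
Qed.

End UnipotentFixedPoint.

Lemma common_fixed_end (k : fieldType) (L : quad_ext k) p (pL : p \in [pchar L]) (s : seq (SU L)) :
    subgroup_seq s -> (forall x n, x \in s -> has_order x n -> exists m, n = (p ^ m)%N) ->
  exists z, forall h, h \in s -> h != 1%g -> forall z', boundary_fun h z' = z' <-> z' = z.
Proof.
move=> sG tors; have p_pr := pcharf_prime pL.
have [[x [xs x1]]|no] := pselect (exists x, x \in s /\ x != 1%g); last first.
  by exists None => h hs h1; case: no; exists h.
have fixE h : h \in s -> h != 1%g -> exists z, forall z', boundary_fun h z' = z' <-> z' = z.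
  by move=> hs h1; have [m hm] := seq_order sG p_pr tors hs; apply: fixed_end hm.
have [c [cs c1 cc]] := seq_central sG p_pr tors xs x1.
have [z Hz] := fixE c cs c1; exists z => h hs h1.
have [z2 Hz2] := fixE h hs h1; suff E : z = z2 by rewrite E.
apply/Hz2/Hz; rewrite boundary_funM cc // -boundary_funM.
by congr boundary_fun; apply/Hz.
Qed.

(** * The Steinberg module of a group acting on a tree *)

Lemma linear_inverse (A : nzRingType) (U W : lmodType A) (g : {linear U -> W}) :
  bijective g -> exists2 f : {linear W -> U}, cancel g f & cancel f g.
Proof.
case=> g' gK g'K; have lin : linear g'.
  by move=> a x y; apply: (can_inj gK); rewrite linearP !g'K.
pose m := GRing.isLinear.Build A W U _ g' lin.
by exists (HB.pack g' m : {linear W -> U}).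
Qed.

Section RowMap.
Variables (A : nzRingType) (U : lmodType A) (n : nat) (c : 'I_n -> U).

Definition row_map (x : 'rV[A]_n) : U := \sum_i x 0 i *: c i.

Lemma row_map_is_linear : linear row_map.
Proof.
move=> a x y; rewrite /row_map scaler_sumr -big_split /=; apply: eq_bigr => i _.
by rewrite !mxE scalerDl scalerA.
Qed.

HB.instance Definition _ := GRing.isLinear.Build A _ U _ row_map row_map_is_linear.

Lemma row_map_delta i : row_map (delta_mx 0 i) = c i.
Proof.
rewrite /row_map (bigD1 i) //= big1 ?addr0 => [|j ji]; first by rewrite mxE !eqxx scale1r.
by rewrite mxE eqxx /= (negPf ji) scale0r.
Qed.

Lemma row_map_comp (W : lmodType A) (f : {linear U -> W}) x :
  f (row_map x) = \sum_i x 0 i *: f (c i).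
Proof. by rewrite linear_sum; apply: eq_bigr => i _; rewrite linearZ. Qed.
End RowMap.

Section StablyFree.
Variables (A : nzRingType) (M : lmodType A) (l0 l1 : nat).
Variable psi : {linear 'rV[A]_l1 -> (M * 'rV[A]_l0)%type}.
Hypothesis psi_bij : bijective psi.

Lemma stably_free_fg : fg_module M.
Proof.
have [psi' _ psiK] := linear_inverse psi_bij.
have lin : linear (fun x => (psi x).1) by move=> a x y; rewrite linearP.
pose m := GRing.isLinear.Build A _ M _ (fun x => (psi x).1) lin.
exists l1, (HB.pack (fun x => (psi x).1) m : {linear 'rV[A]_l1 -> M}) => x.
by exists (psi' (x, 0)) => /=; rewrite psiK.
Qed.

Lemma stably_free_projective : projective_module M.
Proof.
have [psi' _ psiK] := linear_inverse psi_bij.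
move=> U W q f qs; have [u Hu] := choice (fun i => qs (f (psi (delta_mx 0 i)).1)).
have lin : linear (fun x : M => row_map u (psi' (x, 0))).
  move=> a x y; have E : (a *: x + y, 0) = a *: (x, 0) + (y, 0) :> (M * 'rV[A]_l0)%type.
    by rewrite [RHS]surjective_pairing /= scaler0 addr0.
  by rewrite E !linearP.
pose m := GRing.isLinear.Build A M U _ (fun x : M => row_map u (psi' (x, 0))) lin.
exists (HB.pack (fun x : M => row_map u (psi' (x, 0))) m : {linear M -> U}) => x /=.
have qrow y : q (row_map u y) = f (psi y).1.
  have lin2 : linear (fun y => f (psi y).1) by move=> a z z'; rewrite linearP /= linearP.
  pose m2 := GRing.isLinear.Build A _ W _ (fun y => f (psi y).1) lin2.
  pose phi : {linear 'rV[A]_l1 -> W} := HB.pack (fun y => f (psi y).1) m2.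
  rewrite row_map_comp -[RHS]/(phi y) [y in RHS]row_sum_delta linear_sum.
  by apply: eq_bigr => i _; rewrite linearZ /= Hu.
by rewrite qrow psiK.
Qed.

Lemma stably_free_iso : exists f : {linear (M * 'rV[A]_l0)%type -> 'rV[A]_l1}, bijective f.
Proof. by have [f fK Kf] := linear_inverse psi_bij; exists f; exists psi. Qed.
End StablyFree.

Section OrbitRepresentatives.
Variables (T : groupType) (Y : choiceType) (to : laction T Y).

Definition same_orbit (y y' : Y) : Prop := exists g, to g y = y'.

Lemma same_orbit_refl y : same_orbit y y. Proof. by exists 1%g; rewrite lact1. Qed.

Lemma lactK g y : to g^-1%g (to g y) = y. Proof. by rewrite lactM mulVg lact1. Qed.
Lemma same_orbit_sym y y' : same_orbit y y' -> same_orbit y' y.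
Proof. by case=> g <-; exists g^-1%g; rewrite lactK. Qed.

Lemma same_orbit_trans y1 y2 y3 : same_orbit y1 y2 -> same_orbit y2 y3 -> same_orbit y1 y3.
Proof. by case=> g <- [h <-]; exists (h * g)%g; rewrite lactM. Qed.

Definition orep y : Y := choose (fun y' => `[< same_orbit y y' >]) y.

Lemma orepP y : same_orbit y (orep y).
Proof.
by apply/asboolP; apply: (chooseP (P := fun y' => `[< same_orbit y y' >])); apply/asboolP/same_orbit_refl.
Qed.

Lemma orep_eq y y' : orep y = orep y' <-> same_orbit y y'.
Proof.
split=> [E|yy'].
  by apply: same_orbit_trans (orepP y) _; rewrite E; apply/same_orbit_sym/orepP.
have E : (fun y1 => `[< same_orbit y y1 >]) =1 (fun y1 => `[< same_orbit y' y1 >]).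
  move=> y1; apply/asboolP/asboolP => H.
    exact: same_orbit_trans (same_orbit_sym yy') H.
  exact: same_orbit_trans yy' H.
rewrite /orep (eq_choose E); apply: choose_id; apply/asboolP.
  exact: same_orbit_sym.
exact: same_orbit_refl.
Qed.

Lemma orbit_reps (S : set Y) (l : seq Y) : (forall g y, S y -> S (to g y)) ->
    (forall y, S y -> exists2 y', y' \in l & same_orbit y y') ->
  exists n (r : 'I_n -> Y), [/\ forall i, S (r i), forall y, S y -> exists i g, y = to g (r i) &
    forall i j, same_orbit (r i) (r j) -> i = j].
Proof.
move=> Sinv cov; pose s := undup [seq orep y | y <- l & `[< S y >]].
have Sr y : S y -> S (orep y) by move=> Sy; have [g <-] := orepP y; apply: Sinv.
have sP y : y \in s -> S y /\ orep y = y.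
  rewrite mem_undup => /mapP[y'] ; rewrite mem_filter => /andP[/asboolP Sy' _] ->.
  by split; [apply: Sr | apply/orep_eq/same_orbit_sym/orepP].
exists (size s), (fun i => tnth (in_tuple s) i); split=> [i|y Sy|i j].
- by have [] := sP _ (mem_tnth i (in_tuple s)).
- have [y' y'l yy'] := cov y Sy; have ys : orep y \in s.
    rewrite mem_undup (orep_eq y y').2 //; apply: map_f; rewrite mem_filter y'l andbT.
    by apply/asboolP; have [g <-] := yy'; apply: Sinv.
  have [i Ei] := tnthP (in_tuple s) (orep y) ys; exists i.
  by rewrite -Ei; have [g Eg] := orepP y; exists g^-1%g; rewrite -Eg lactK.
move=> /orep_eq; rewrite (sP _ (mem_tnth i (in_tuple s))).2 (sP _ (mem_tnth j (in_tuple s))).2.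
have [y0 _] : exists y0 : Y, True by exists (tnth (in_tuple s) i).
rewrite !(tnth_nth y0) /= => /eqP.
by rewrite nth_uniq ?undup_uniq // => /eqP/val_inj.
Qed.

End OrbitRepresentatives.

Lemma seq_of_collisions (Y : eqType) (S : set Y) n :
  (forall f : 'I_n.+1 -> Y, (forall a, S (f a)) -> exists a b, a != b /\ f a = f b) ->
  exists l : seq Y, forall y, S y -> y \in l.
Proof.
move=> col; apply: contrapT => /forallNP no.
have big m : exists s : seq Y, [/\ uniq s, size s = m & {in s, forall y, S y}].
  elim: m => [|m [s [us ss Ss]]]; first by exists [::].
  have /existsNP[y /not_implyP[Sy ny]] := no s.
  exists (y :: s); split=> /=; rewrite ?ss //; first by rewrite us andbT; apply/negP.
  by move=> y'; rewrite inE => /predU1P[->|/Ss].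
have [s [us ss Ss]] := big n.+1.
have lt (a : 'I_n.+1) : (a < size s)%N by rewrite ss.
have [y0 _] : exists y0 : Y, True by case: (s) ss => // y0; exists y0.
have [|a [b [nab]]] := col (fun a => nth y0 s a); first by move=> a; apply/Ss/mem_nth.
by move/eqP; rewrite nth_uniq // => /eqP/val_inj E; rewrite E eqxx in nab.
Qed.

Section TreeModule.
Variables (T : groupType) (V Bd : choiceType).
Variables (aV : laction T V) (aB : laction T Bd) (par : Bd -> V -> V) (ty : V -> bool).
Implicit Types (u v w : V) (z : Bd) (g h : T).
Hypothesis par_act : forall g z v, aV g (par z v) = par (aB g z) (aV g v).
Hypothesis par_merge : forall z v w, exists n m, iter n (par z) v = iter m (par z) w.
Hypothesis par_adj : forall z z' v, par z' v = par z v \/ par z (par z' v) = v.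
Hypothesis par_nocycle : forall z v n, iter n (par z) v = v -> n = 0%N.
Hypothesis ty_act : forall g v, ty (aV g v) = ty v.
Hypothesis ty_par : forall z v, ty (par z v) = ~~ ty v.
Hypothesis fixed_bd : forall v, exists z, forall g, g <> 1%g -> aV g v = v ->
  forall z', aB g z' = z' <-> z' = z.
Hypothesis ray_unstable : forall z v, exists n g, [/\ g <> 1%g, aB g z = z &
  aV g (iter n (par z) v) = iter n (par z) v].
Variable oo : Bd.

Definition stable v : Prop := forall g, aV g v = v -> g = 1%g.

Definition edge (e : V * V) : Prop := par oo e.1 = e.2 \/ par oo e.2 = e.1.

Lemma edge_par z v : edge (v, par z v).
Proof. by case: (par_adj oo z v) => E; [left | right]. Qed.

Lemma edgeP z e : edge e -> par z e.1 = e.2 \/ par z e.2 = e.1.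
Proof.
by case: e => a b /= [] /= <-; [case: (par_adj z oo a) => ->|case: (par_adj z oo b) => ->]; [left|right|right|left].
Qed.

Definition pair_fun g (e : V * V) : V * V := (aV g e.1, aV g e.2).

Fact pair_act1 e : pair_fun 1%g e = e.
Proof. by rewrite /pair_fun !lact1; case: e. Qed.

Fact pair_actM g h e : pair_fun g (pair_fun h e) = pair_fun (g * h)%g e.
Proof. by rewrite /pair_fun !lactM. Qed.

Definition pair_act : laction T (V * V : choiceType)%type := @LAction T (V * V : choiceType)%type pair_fun pair_act1 pair_actM.

Lemma edge_act g e : edge e -> edge (pair_act g e).
Proof.
case: e => a b [] /= <-; rewrite /= /pair_fun /= par_act; first exact: edge_par.
by case: (edge_par (aB g oo) (aV g b)) => /= E; [right | left].
Qed.

Lemma stable_act g v : stable v -> stable (aV g v).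
Proof.
move=> sv h; rewrite lactM => E.
have /sv : aV (g^-1 * (h * g))%g v = v by rewrite -lactM E lactK.
by move=> E'; have := congr1 (fun x => (g * x * g^-1)%g) E'; rewrite !mulgA mulgV mul1g mulgK mulg1 mulgV.
Qed.

Definition stable_edge (e : V * V) : Prop := forall g, pair_act g e = e -> g = 1%g.

Lemma stable_edge_act g e : stable_edge e -> stable_edge (pair_act g e).
Proof.
move=> se h; rewrite lactM => E.
have /se : pair_act (g^-1 * (h * g))%g e = e by rewrite -lactM E lactK.
by move=> E'; have := congr1 (fun x => (g * x * g^-1)%g) E'; rewrite !mulgA mulgV mul1g mulgK mulg1 mulgV.
Qed.

Lemma unstable_ex v : ~ stable v -> exists2 g, g <> 1%g & aV g v = v.
Proof. by move=> /existsNP[g /not_implyP[E n]]; exists g. Qed.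

Definition end_of v : Bd := sval (cid (fixed_bd v)).

Lemma end_ofP v g : g <> 1%g -> aV g v = v -> forall z, aB g z = z <-> z = end_of v.
Proof. exact: svalP (cid (fixed_bd v)) g. Qed.

Lemma end_of_act g v : ~ stable v -> end_of (aV g v) = aB g (end_of v).
Proof.
move=> /unstable_ex[x x1 xv]; symmetry.
have x'1 : (g * x * g^-1)%g <> 1%g.
  move=> E; apply: x1; have := congr1 (fun y => (g^-1 * y * g)%g) E.
  by rewrite !mulgA mulVg mul1g mulgVK mulg1 mulVg.
apply/(end_ofP x'1).
  by rewrite lactM mulgVK -lactM xv.
by rewrite lactM mulgVK -lactM ((end_ofP x1 xv _).2 erefl).
Qed.

Section Halfspace.
Variables (z0 : Bd) (v0 : V).
Local Notation w0 := (par z0 v0).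
Hypothesis stable0 : stable_edge (v0, w0) \/ stable_edge (w0, v0).

Definition below u : bool := `[< exists n, iter n (par z0) u = v0 >].

Lemma below_par u : u <> v0 -> below (par z0 u) = below u.
Proof.
move=> nu; apply/asboolP/asboolP => -[n E]; first by exists n.+1; rewrite iterSr.
case: n E => [|n] E; first by case: nu.
by exists n; rewrite -iterSr.
Qed.

Lemma below_v0 : below v0. Proof. by apply/asboolP; exists 0%N. Qed.

Lemma below_w0 : below w0 = false.
Proof. by apply/asboolP => -[n]; rewrite -iterSr => /par_nocycle. Qed.

Lemma below_cross z u : below (par z u) <> below u -> u = v0 /\ par z u = w0 \/ u = w0 /\ par z u = v0.
Proof.
case: (par_adj z0 z u) => E nb.
  have [Ev|nv] := pselect (u = v0); first by left; rewrite -Ev.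
  by case: nb; rewrite E below_par.
have [Ev|nv] := pselect (par z u = v0); first by right; rewrite -Ev E.
by case: nb; rewrite -(below_par nv) E.
Qed.

Definition end_below z : bool := par z v0 != w0.

Lemma below_ray z n : below (iter n.+1 (par z) v0) = end_below z.
Proof.
elim: n => [|n IH].
  rewrite /= /end_below; case: eqVneq => [->|nE]; first exact: below_w0.
  case: (par_adj z0 z v0) => [/eqP E|E]; first by rewrite E in nE.
  have [Ev|nv] := pselect (par z v0 = v0).
    by have := @par_nocycle z v0 1 Ev.
  by rewrite -(below_par nv) E below_v0.
rewrite iterS; have [E|ne] := pselect (below (par z (iter n.+1 (par z) v0)) = below (iter n.+1 (par z) v0)).
  by rewrite E.
case: (below_cross ne) => [[E _]|[_ E]]; first by have := par_nocycle E.
by have := @par_nocycle z v0 n.+2; rewrite iterS E => /(_ erefl).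
Qed.

(* Otherwise the ray from u to its end crosses the edge {v0, w0}, which would then
   be fixed by the stabilizer of u. *)
Lemma below_unstable u : ~ stable u -> below u = end_below (end_of u).
Proof.
move=> nu; set z := end_of u.
have [n [m E]] := par_merge z u v0.
rewrite -(below_ray z m) iterS -E -iterS.
elim: n.+1 => [|n' ->] //; rewrite iterS.
set u' := iter n' _ u; apply: contrapT => ne.
have [g g1 gu] := unstable_ex nu.
have fz : aB g z = z by apply/(end_ofP g1 gu).
have fi l : aV g (iter l (par z) u) = iter l (par z) u.
  by elim: l => [|l IH] //; rewrite iterS par_act fz IH.
have fu' : aV g u' = u' by apply: fi.
have fpu' : aV g (par z u') = par z u' by rewrite par_act fz fu'.
apply: g1; case: (below_cross (nesym ne)) => -[E1 E2]; rewrite E1 in fu'; rewrite E2 in fpu'.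
  by case: stable0; apply; rewrite /= /pair_fun /= fu' fpu'.
by case: stable0; apply; rewrite /= /pair_fun /= fu' fpu'.
Qed.

End Halfspace.

Variables (l0 : nat) (r0 : 'I_l0 -> V).
Hypothesis r0_stable : forall i, stable (r0 i).
Hypothesis r0_cov : forall v, stable v -> exists i g, v = aV g (r0 i).
Hypothesis r0_uniq : forall i j, same_orbit aV (r0 i) (r0 j) -> i = j.

Lemma dec_ex v : exists x : option ('I_l0 * T), if x is Some (i, g) then v = aV g (r0 i) else ~ stable v.
Proof.
have [sv|nv] := pselect (stable v); last by exists None.
by have [i [g E]] := r0_cov sv; exists (Some (i, g)).
Qed.

Definition dec v := sval (cid (dec_ex v)).

Lemma decP v : if dec v is Some (i, g) then v = aV g (r0 i) else ~ stable v.
Proof. exact: svalP (cid (dec_ex v)). Qed.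

Lemma dec_rep g i : dec (aV g (r0 i)) = Some (i, g).
Proof.
have := decP (aV g (r0 i)); case: (dec _) => [[j h] E|]; last by case; apply: stable_act.
have Eij : j = i by apply: r0_uniq; exists (g^-1 * h)%g; rewrite -lactM -E lactK.
rewrite Eij in E *; have /r0_stable E1 : aV (g^-1 * h)%g (r0 i) = r0 i by rewrite -lactM -E lactK.
by congr (Some (_, _)); apply: (mulgI g^-1%g); rewrite E1 mulVg.
Qed.

Local Notation ZT := (gring T).
Local Notation St := (aug_kernel aB).

(* [v |-> (lamB v, lamR v)] is equivariant: the stable vertex [g (r0 i)] goes to
   [(g oo, g e_i)], and an unstable vertex to its end. *)
Definition lamB v : Bd := if dec v is Some (i, g) then aB g oo else end_of v.
Definition lamR v : 'rV[ZT]_l0 := if dec v is Some (i, g) then (<< g >> : ZT) *: delta_mx 0 i else 0.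

Lemma lam_unstable v : ~ stable v -> lamB v = end_of v /\ lamR v = 0.
Proof.
move=> nv; rewrite /lamB /lamR; have := decP v; case: (dec v) => [[i g] E|//].
by case: nv; rewrite E; apply: stable_act.
Qed.

Lemma gringM g h : (<< g >> : ZT) * (<< h >> : ZT) = << (g * h)%g >>.
Proof. by rewrite /GRing.mul /= /gring_mul convUU. Qed.

Lemma lam_act g v : lamB (aV g v) = aB g (lamB v) /\ lamR (aV g v) = (<< g >> : ZT) *: lamR v.
Proof.
have [sv|nv] := pselect (stable v).
  have [i [h ->]] := r0_cov sv; rewrite /lamB /lamR lactM !dec_rep lactM.
  by rewrite scalerA gringM.
have ngv : ~ stable (aV g v) by move=> /(@stable_act g^-1%g _); rewrite lactK.
have [-> ->] := lam_unstable nv; have [-> ->] := lam_unstable ngv.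
by rewrite scaler0 end_of_act.
Qed.

Lemma aug_diff z z' : (<< z >> - << z' >> : permmod aB) \in @aug_ker T Bd aB.
Proof. by rewrite unfold_in /augmentation raddfB /= !zliftU subrr. Qed.

Definition bdiff z z' : St := AugKernel (aug_diff z z').

Definition ldiff v w : (St * 'rV[ZT]_l0)%type := (bdiff (lamB v) (lamB w), lamR v - lamR w).

Lemma bdiff_eq z z' (x : St) : akval x = << z >> - << z' >> -> x = bdiff z z'.
Proof. by move=> E; apply: val_inj; rewrite /= -E. Qed.

Lemma ldiff_trans u v w : ldiff v w = ldiff v u + ldiff u w.
Proof.
rewrite /ldiff; apply/pair_equal_spec; split=> /=; last by rewrite addrA subrK.
by symmetry; apply: bdiff_eq; rewrite [LHS](_ : _ = (<< lamB v >> - << lamB u >> : permmod aB) + (<< lamB u >> - << lamB w >>)) // addrA subrK.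
Qed.

Lemma permmod_scaleU g (x : permmod aB) : (<< g >> : ZT) *: x = conv aB << g >> x.
Proof. by []. Qed.

Lemma ldiff_act g v w : ldiff (aV g v) (aV g w) = (<< g >> : ZT) *: ldiff v w.
Proof.
have [Ev Rv] := lam_act g v; have [Ew Rw] := lam_act g w.
rewrite /ldiff Ev Ew Rv Rw; apply/pair_equal_spec; split=> /=; last by rewrite scalerBr.
symmetry; apply: bdiff_eq.
rewrite [LHS](_ : _ = (<< g >> : ZT) *: (<< lamB v >> - << lamB w >> : permmod aB)) //.
by rewrite scalerBr !permmod_scaleU !convUU.
Qed.

Lemma ldiff_refl v : ldiff v v = 0.
Proof. by apply: (addrI (ldiff v v)); rewrite -ldiff_trans addr0. Qed.

Lemma ldiff_sym v w : ldiff w v = - ldiff v w.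
Proof. by apply/eqP; rewrite -addr_eq0 -ldiff_trans ldiff_refl. Qed.

Variables (l1 : nat) (r1 : 'I_l1 -> V * V).
Hypothesis r1_edge : forall i, [/\ edge (r1 i), ~~ ty (r1 i).1 & stable_edge (r1 i)].
Hypothesis r1_cov : forall e, edge e -> ~~ ty e.1 -> stable_edge e -> exists i g, e = pair_act g (r1 i).
Hypothesis r1_uniq : forall i j, same_orbit pair_act (r1 i) (r1 j) -> i = j.

Definition edge_map : 'rV[ZT]_l1 -> (St * 'rV[ZT]_l0)%type :=
  row_map (fun i => ldiff (r1 i).1 (r1 i).2).

HB.instance Definition _ := GRing.Linear.on edge_map.

Definition in_im (y : (St * 'rV[ZT]_l0)%type) : Prop := exists x, edge_map x = y.

Lemma in_im0 : in_im 0. Proof. by exists 0; rewrite linear0. Qed.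
Lemma in_imD y y' : in_im y -> in_im y' -> in_im (y + y').
Proof. by case=> x <- [x' <-]; exists (x + x'); rewrite linearD. Qed.
Lemma in_imN y : in_im y -> in_im (- y).
Proof. by case=> x <-; exists (- x); rewrite linearN. Qed.
Lemma in_imZ (a : ZT) y : in_im y -> in_im (a *: y).
Proof. by case=> x <-; exists (a *: x); rewrite linearZ. Qed.

Lemma edge_im e : edge e -> in_im (ldiff e.1 e.2).
Proof.
wlog t1 : e / ~~ ty e.1 => [wl ee|ee].
  have [/wl|/negPn t1] := boolP (~~ ty e.1); first exact.
  case: e ee t1 => a b ee t1; rewrite /= ldiff_sym; apply: in_imN.
  apply: (wl (b, a)); last by case: ee; [right | left].
  by case: ee => /= E; [rewrite -E ty_par negbK | move: t1; rewrite /= -E ty_par].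
have [se|nse] := pselect (stable_edge e).
  have [i [g ->]] := r1_cov ee t1 se; rewrite ldiff_act; apply: in_imZ.
  by exists (delta_mx 0 i); rewrite /edge_map row_map_delta.
have /existsNP[g /not_implyP[gE g1]] := nse.
case: e gE {nse ee t1} => a b /= /pair_equal_spec[ga gb].
have na : ~ stable a by move/(_ g ga).
have nb : ~ stable b by move/(_ g gb).
have [Ba Ra] := lam_unstable na; have [Bb Rb] := lam_unstable nb.
have E : end_of a = end_of b by apply/(end_ofP g1 gb)/(end_ofP g1 ga).
suff -> : ldiff a b = ldiff a a by rewrite ldiff_refl; apply: in_im0.
by rewrite /ldiff Ba Bb Ra Rb E.
Qed.

Lemma ldiff_im v w : in_im (ldiff v w).
Proof.
have ray u n : in_im (ldiff u (iter n (par oo) u)).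
  elim: n => [|n IH]; first by rewrite ldiff_refl; apply: in_im0.
  rewrite (ldiff_trans (iter n (par oo) u)); apply: in_imD => //.
  exact: (edge_im (edge_par oo _)).
have [n [m E]] := par_merge oo v w.
rewrite (ldiff_trans (iter n (par oo) v)); apply: in_imD => //.
by rewrite E ldiff_sym; apply: in_imN.
Qed.

Lemma vertex_at_end z v : exists w, [/\ lamB w = z, lamR w = 0 & exists n, w = iter n (par z) v].
Proof.
have [n [g [g1 gz gw]]] := ray_unstable z v; exists (iter n (par z) v).
have nw : ~ stable (iter n (par z) v) by move/(_ g gw).
have [-> ->] := lam_unstable nw; split=> //; last by exists n.
by symmetry; apply/(end_ofP g1 gw).
Qed.

Hypothesis inhV : inhabited V.

Lemma edge_map_surj y : in_im y.
Proof.
case: inhV => v.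
have imB z z' : in_im (bdiff z z', 0).
  have [w [Bw Rw _]] := vertex_at_end z v; have [w' [Bw' Rw' _]] := vertex_at_end z' v.
  by have := ldiff_im w w'; rewrite /ldiff Bw Bw' Rw Rw' subrr.
have imS (x : permmod aB) : forall s : St, akval s = x - << oo >> *~ augmentation x -> in_im (s, 0).
  elim/malg_zind: x => [|x x' IH IH'|z] s Es.
  - have -> : (s, 0) = 0 :> (St * 'rV[ZT]_l0)%type; last exact: in_im0.
    by congr pair; apply: val_inj; rewrite /= Es /augmentation raddf0 mulr0z subr0.
  - have pr (t : permmod aB) : (t - << oo >> *~ augmentation t : permmod aB) \in @aug_ker T Bd aB.
      rewrite unfold_in /augmentation raddfB /= raddfMz /= zliftU; apply/eqP.
      by rewrite intz subrr.
    have := in_imD (IH (AugKernel (pr x)) erefl) (in_imN (IH' (AugKernel (pr x')) erefl)).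
    congr in_im; rewrite [LHS]surjective_pairing /= oppr0 addr0; congr pair; apply: val_inj.
    have Eo : << oo >> *~ augmentation (x - x' : permmod aB) =
        << oo >> *~ augmentation (x : permmod aB) - << oo >> *~ augmentation (x' : permmod aB) :> permmod aB.
      by rewrite -mulrzBr /augmentation raddfB.
    by rewrite /= Es Eo !opprD !opprK addrACA.
  - rewrite (_ : s = bdiff z oo) //; apply: bdiff_eq.
    by rewrite Es /augmentation zliftU mulr1z.
case: y => s r; have -> : (s, r) = (s, 0) + (0, r) by rewrite [RHS]surjective_pairing /= addr0 add0r.
apply: in_imD.
  apply: (imS (akval s)); rewrite (_ : augmentation _ = 0) ?mulr0z ?subr0 //.
  by apply/eqP; case: s.
have imE j : in_im (0, delta_mx 0 j).
  have [w [Bw Rw _]] := vertex_at_end oo v; have := ldiff_im (r0 j) w.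
  rewrite /ldiff Bw Rw; have Ed := dec_rep 1%g j; rewrite lact1 in Ed.
  rewrite /lamB /lamR Ed lact1 subr0 scale1r; congr in_im; congr pair.
  by apply: val_inj; rewrite /= subrr.
rewrite (row_sum_delta r).
have -> : (0, \sum_j r 0 j *: delta_mx 0 j) = \sum_j r 0 j *: (0, delta_mx 0 j) :> (St * 'rV[ZT]_l0)%type.
  rewrite [RHS]surjective_pairing (raddf_sum fst) (raddf_sum snd) /=; congr pair.
  by rewrite big1 // => j _; rewrite scaler0.
by elim/big_ind: _ => [||j _]; [apply: in_im0 | apply: in_imD | apply: in_imZ].
Qed.

Section Functional.
Variables (z0 : Bd) (v0 : V).
Hypothesis stable0 : stable_edge (v0, par z0 v0) \/ stable_edge (par z0 v0, v0).

Local Notation ind u := ((below z0 v0 u)%:Z).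
Local Notation indB z := ((end_below z0 v0 z)%:Z).

Definition height (y : (St * 'rV[ZT]_l0)%type) : int :=
  zlift (fun z => indB z) (akval y.1) +
  \sum_j zlift (fun g => ind (aV g (r0 j)) - indB (aB g oo)) (y.2 0 j).

Lemma heightB y y' : height (y - y') = height y - height y'.
Proof.
rewrite /height /= (raddfB (zlift (fun z => indB z))) /= opprD addrACA; congr (_ + _).
by rewrite -sumrB; apply: eq_bigr => j _; rewrite !mxE (raddfB (zlift _)).
Qed.

Lemma height_ldiff v w : height (ldiff v w) = ind v - ind w.
Proof.
pose h1 (u : V) : int := zlift (fun z => indB z) (<< lamB u >> : {malg int[Bd]}) +
  \sum_j zlift (fun g => ind (aV g (r0 j)) - indB (aB g oo)) (lamR u 0 j).
have h1E u : h1 u = ind u.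
  rewrite /h1 zliftU; have [su|nu] := pselect (stable u); last first.
    have [-> ->] := lam_unstable nu; rewrite (below_unstable stable0 nu).
    by rewrite big1 ?addr0 // => j _; rewrite mxE raddf0.
  have [i [g ->]] := r0_cov su; rewrite /lamB /lamR dec_rep (bigD1 i) //= big1 => [|j ji].
    by rewrite !mxE !eqxx mulr1 zliftU addr0 addrC subrK.
  by rewrite !mxE eqxx /= (negPf ji) mulr0 raddf0.
rewrite -(h1E v) -(h1E w) /h1 /height /= (raddfB (zlift (fun z => indB z))) /= opprD addrACA; congr (_ + _).
by rewrite -sumrB; apply: eq_bigr => j _; rewrite !mxE (raddfB (zlift _)).
Qed.

Lemma heightZ (a : ZT) v w :
  height (a *: ldiff v w) = zlift (fun g => ind (aV g v) - ind (aV g w)) a.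
Proof.
elim/malg_zind: a => [|a b IHa IHb|g]; first by rewrite scale0r raddf0 -(subrr (ldiff v v)) heightB subrr.
  by rewrite scalerBl heightB IHa IHb (raddfB (zlift _)).
by rewrite -ldiff_act height_ldiff zliftU.
Qed.

End Functional.

Lemma zlift_delta h (c : int) (a : ZT) : zlift (fun g => if g == h then c else 0) a = c *~ a@_h.
Proof.
elim/malg_zind: a => [|a b IHa IHb|g]; first by rewrite raddf0 mcoeff0 mulr0z.
  by rewrite raddfB /= IHa IHb mcoeffB mulrzBr.
by rewrite zliftU mcoeffU; case: eqP => _; rewrite ?mulr1z ?mulr0z.
Qed.

(* The edge e separates the tree, and [height] counts a chain across it. *)
Lemma edge_map_inj x : edge_map x = 0 -> x = 0.
Proof.
move=> Ex; apply/rowP => i; rewrite mxE; apply/malgP => h; rewrite mcoeff0.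
have [ei ti si] := r1_edge i; pose e := pair_act h (r1 i).
have ee : edge e by apply: edge_act.
have [v0 Hv0] : exists v0, v0 = e.1 /\ par oo v0 = e.2 \/ v0 = e.2 /\ par oo v0 = e.1.
  by case: ee => E; [exists e.1; left | exists e.2; right].
have se : stable_edge e by apply: stable_edge_act.
have st0 : stable_edge (v0, par oo v0) \/ stable_edge (par oo v0, v0).
  by case: Hv0 => -[-> ->]; [left | right]; move: se; case: (e).
pose c : int := (below oo v0 e.1)%:Z - (below oo v0 e.2)%:Z.
have c0 : c != 0.
  rewrite /c; case: Hv0 => -[E1 E2]; rewrite -E1 -E2 below_v0 below_w0 //.
have cross j g : below oo v0 (aV g (r1 j).1) <> below oo v0 (aV g (r1 j).2) -> pair_act g (r1 j) = e.
  move=> ne; have [ej tj _] := r1_edge j.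
  have te : ~~ ty e.1 by rewrite /e /= /pair_fun /= ty_act.
  have tp : ~~ ty (aV g (r1 j).1) by rewrite ty_act.
  have Ee : e = (v0, par oo v0) \/ e = (par oo v0, v0).
    by case: Hv0 => -[-> ->]; [left | right]; case: (e).
  have Ep : pair_act g (r1 j) = (v0, par oo v0) \/ pair_act g (r1 j) = (par oo v0, v0).
    have := edge_act g ej; rewrite /= /pair_fun /edge /= => -[] E; rewrite -E in ne *.
      by case: (below_cross (nesym ne)) => -[E1 E2]; rewrite E2 E1; [left | right].
    by case: (below_cross ne) => -[E1 E2]; rewrite E2 E1; [right | left].
  case: Ee => Ee; case: Ep => Ep; rewrite Ep Ee //; exfalso; move: te tp.
    by rewrite Ee -[aV g _]/((pair_act g (r1 j)).1) Ep /= ty_par => /negPf ->.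
  by rewrite Ee -[aV g _]/((pair_act g (r1 j)).1) Ep /= ty_par => /negPn ->.
have : height oo v0 (edge_map x) = c *~ (x 0 i)@_h.
  rewrite /edge_map /row_map.
  have hsum (I : Type) (s : seq I) (f : I -> (St * 'rV[ZT]_l0)%type) :
      height oo v0 (\sum_(j <- s) f j) = \sum_(j <- s) height oo v0 (f j).
    have h0 : height oo v0 0 = 0 by rewrite -(subrr 0) heightB subrr.
    have hD y y' : height oo v0 (y + y') = height oo v0 y + height oo v0 y'.
      have hN : height oo v0 (- y') = - height oo v0 y' by rewrite -sub0r heightB h0 sub0r.
      by rewrite -{1}[y']opprK heightB hN opprK.
    by elim/big_rec2: _ => // j a b _ <-; rewrite hD.
  rewrite hsum (bigD1 i) //= [X in _ + X]big1 ?addr0 => [|j ji]; rewrite (heightZ st0).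
    rewrite -zlift_delta; congr zlift; apply: boolp.funext => g.
    case: eqP => [->|ng] //; have [->|ne] := pselect (below oo v0 (aV g (r1 i).1) = below oo v0 (aV g (r1 i).2)).
      by rewrite subrr.
    case: ng; have E := cross _ _ ne; apply: (mulgI h^-1%g); rewrite mulVg.
    by apply: si; rewrite -lactM E lactK.
  have -> : (fun g => (below oo v0 (aV g (r1 j).1))%:Z - (below oo v0 (aV g (r1 j).2))%:Z) =
      (fun g => if g == 1%g then 0 else 0).
    apply: boolp.funext => g; have [->|ne] := pselect (below oo v0 (aV g (r1 j).1) = below oo v0 (aV g (r1 j).2)).
      by rewrite subrr; case: eqP.
    case/eqP: ji; apply: r1_uniq; exists (h^-1 * g)%g.
    by rewrite -lactM (cross _ _ ne) lactK.
  by rewrite zlift_delta mul0rz.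
rewrite Ex (_ : height _ _ 0 = 0); last by rewrite -(subrr 0) heightB subrr.
by move/esym/eqP; rewrite mulrz_eq0 (negPf c0) orbF => /eqP.
Qed.

Lemma edge_map_bij : bijective edge_map.
Proof.
have inj : injective edge_map.
  by move=> x y E; apply/eqP; rewrite -subr_eq0; apply/eqP/edge_map_inj; rewrite linearB /= E subrr.
have [g Hg] := choice edge_map_surj; exists g => // x.
by apply: inj; rewrite Hg.
Qed.

End TreeModule.

(** * Euler characteristics *)

Section FiniteCardinals.
Variable X : choiceType.

Lemma nfs_le_inj (Y : choiceType) (f : X -> Y) (A : set X) (C : set Y) :
  finite_set A -> finite_set C -> (forall x, A x -> C (f x)) ->
  (forall x x', A x -> A x' -> f x = f x' -> x = x') ->
  (#|` fset_set A| <= #|` fset_set C|)%N.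
Proof.
move=> fA fC AC inj; rewrite -(size_map f (fset_set A)); apply: uniq_leq_size.
  rewrite map_inj_in_uniq ?fset_uniq // => x x'.
  by rewrite !in_fset_set // !in_setE; apply: inj.
by move=> y /mapP[x]; rewrite !in_fset_set // !in_setE => Ax ->; apply: AC.
Qed.

Lemma card_ge_nfs (A : set X) m : finite_set A -> card_ge A m <-> (m <= #|` fset_set A|)%N.
Proof.
move=> fA; split=> [[s [us <- As]]|le].
  by apply: uniq_leq_size => // x /As Ax; rewrite in_fset_set // in_setE.
exists (take m (fset_set A)); split; rewrite ?take_uniq ?fset_uniq ?size_takel //.
by move=> x /mem_take; rewrite in_fset_set // in_setE.
Qed.

End FiniteCardinals.

Section OrbitSums.
Variables (R : realType) (T : groupType) (Y : choiceType) (to : laction T Y).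

Definition ostab (y : Y) : set T := [set g | to g y = y].
Definition nstab (y : Y) : nat := #|` fset_set (ostab y)|.
Definition ostab_weight (y : Y) : R := (nstab y)%:R^-1.

Hypothesis fin : forall y, finite_set (ostab y).

Lemma nstab_gt0 y : (0 < nstab y)%N.
Proof.
rewrite cardfs_gt0; apply/fset0Pn; exists 1%g; rewrite in_fset_set // in_setE /ostab /=.
exact: lact1.
Qed.

Lemma nstab_act g y : nstab (to g y) = nstab y.
Proof.
have le h x : (nstab x <= nstab (to h x))%N.
  apply: (nfs_le_inj (f := fun a => (h * a * h^-1)%g)) => // [a ax|a b _ _ /mulIg/mulgI //].
  by rewrite /ostab /= lactM mulgVK -lactM ax.
apply/eqP; rewrite eqn_leq le andbT; have := le g^-1%g (to g y).
by rewrite lactK.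
Qed.

Definition orbit_sum (S : set Y) : \bar R :=
  \esum_(y in [set y | S y /\ orep to y = y]) (ostab_weight y)%:E.

Lemma ostab_weight_ge0 y : 0 <= ostab_weight y. Proof. by rewrite invr_ge0. Qed.


Lemma orep_idem y : orep to (orep to y) = orep to y.
Proof. exact/orep_eq/same_orbit_sym/orepP. Qed.

Lemma weight_orep y : ostab_weight (orep to y) = ostab_weight y.
Proof. by have [g <-] := orepP to y; rewrite /ostab_weight nstab_act. Qed.

Lemma orbit_sumID (S S' : set Y) : orbit_sum S = (orbit_sum (S `&` S') + orbit_sum (S `&` ~` S'))%E.
Proof.
rewrite /orbit_sum (esumID S') => [|y _]; last by rewrite lee_fin ostab_weight_ge0.
have E S2 : [set y | S y /\ orep to y = y] `&` S2 = [set y | (S `&` S2) y /\ orep to y = y].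
  by apply/seteqP; split=> y /= => [[[? ?] ?]|[[? ?] ?]].
by rewrite !E.
Qed.

Lemma orbit_sum_fin (S : set Y) n (r : 'I_n -> Y) : (forall g y, S y -> S (to g y)) ->
    (forall i, S (r i)) -> (forall y, S y -> exists i g, y = to g (r i)) ->
    (forall i j, same_orbit to (r i) (r j) -> i = j) ->
  orbit_sum S = (\sum_(i < n) ostab_weight (r i))%:E.
Proof.
move=> Sinv Sr cov uniq; rewrite /orbit_sum.
rewrite (reindex_esum [set: 'I_n] _ (fun i => orep to (r i))).
  rewrite (eq_esum (b := fun i => (ostab_weight (r i))%:E)); last by move=> i _; rewrite weight_orep.
  have -> : [set: 'I_n] = [set` index_enum 'I_n] by apply/seteqP; split=> i //= _; rewrite mem_index_enum.
  rewrite -[X in esum X _](set_mem_set [set` _]).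
  rewrite set_mem_set esum_fset //; last by move=> i _; rewrite lee_fin ostab_weight_ge0.
  by rewrite -fsbig_seq ?index_enum_uniq // sumEFin.
split.
- move=> i _ /=; split; last exact: orep_idem.
  by have [g <-] := orepP to (r i); apply: Sinv.
- by move=> i j _ _ /orep_eq; apply: uniq.
- move=> y [Sy ry]; have [i [g Ey]] := cov y Sy; exists i => //.
  by rewrite -ry; apply/orep_eq; exists g.
Qed.

End OrbitSums.

Section OrbitSumBijection.
Variables (R : realType) (T : groupType) (Y1 Y2 : choiceType) (to1 : laction T Y1) (to2 : laction T Y2).
Hypothesis fin2 : forall y, finite_set (ostab to2 y).
Variables (S1 : set Y1) (S2 : set Y2) (f : Y1 -> Y2).
Hypothesis S1inv : forall g y, S1 y -> S1 (to1 g y).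
Hypothesis S2inv : forall g y, S2 y -> S2 (to2 g y).
Hypothesis fS : forall y, S1 y -> S2 (f y).
Hypothesis f_act : forall g y, S1 y -> f (to1 g y) = to2 g (f y).
Hypothesis f_inj : forall y y', S1 y -> S1 y' -> f y = f y' -> y = y'.
Hypothesis f_surj : forall y, S2 y -> exists2 y', S1 y' & f y' = y.

Lemma orbit_sum_bij : orbit_sum R to1 S1 = orbit_sum R to2 S2.
Proof.
rewrite /orbit_sum [RHS](reindex_esum [set y | S1 y /\ orep to1 y = y] _ (fun y => orep to2 (f y))).
  apply: eq_esum => y [Sy _]; rewrite weight_orep // /ostab_weight /nstab.
  congr ((_ #|` fset_set _|)^-1)%:E; apply/seteqP; split=> g; rewrite /ostab /= => E.
    by rewrite -f_act // E.
  by apply: f_inj => //; rewrite ?f_act //; apply: S1inv.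
split.
- move=> y [Sy _]; split; last exact: orep_idem.
  by have [g <-] := orepP to2 (f y); apply: S2inv; apply: fS.
- move=> y y' /[!in_setE] -[Sy ry] [Sy' ry'] /orep_eq[g E]; rewrite -ry -ry'; apply/orep_eq; exists g.
  by apply: f_inj => //; rewrite ?f_act //; apply: S1inv.
move=> y2 [Sy2 ry2]; have [y1 Sy1 E] := f_surj Sy2.
exists (orep to1 y1).
  by split; last exact: orep_idem; have [g <-] := orepP to1 y1; apply: S1inv.
rewrite -ry2 -E; apply/orep_eq; have [g Eg] := orepP to1 y1.
by exists g^-1%g; rewrite -f_act; [rewrite -Eg lactK | rewrite -Eg; apply: S1inv].
Qed.
End OrbitSumBijection.

Section InvStabSum.
Variables (R : realType) (T : groupType) (G : groupClosed T) (Y : choiceType) (Z : pointedType).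
Variables (to : laction (subgroup_elt G) Y) (act : T -> Z -> Z) (S1 : set Y) (S2 : set Z) (f : Y -> Z).
Hypothesis fin : forall y, finite_set (ostab to y).
Hypothesis S1inv : forall g y, S1 y -> S1 (to g y).
Hypothesis fS : forall y, S1 y -> S2 (f y).
Hypothesis f_act : forall g y, S1 y -> f (to g y) = act (val g) (f y).
Hypothesis f_inj : forall y y', S1 y -> S1 y' -> f y = f y' -> y = y'.
Hypothesis f_surj : forall z, S2 z -> exists2 y, S1 y & f y = z.

Let orb z := [set act g z | g in [set` G]].

Lemma orb_same y y' : S1 y -> S1 y' -> orb (f y) = orb (f y') <-> same_orbit to y y'.
Proof.
move=> Sy Sy'; split=> [E|[g Eg]].
  have : orb (f y') (f y') by exists 1%g; [exact: gpred1 | rewrite -[1%g]/(val (1%g : subgroup_elt G)) -f_act // lact1].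
  rewrite -E => -[g Gg Eg]; exists (exist _ g Gg : subgroup_elt G).
  by apply: f_inj => //; [apply: S1inv | rewrite f_act].
have sub y1 y2 h : S1 y1 -> to h y1 = y2 -> orb (f y2) `<=` orb (f y1).
  move=> Sy1 <- _ [x Gx <-]; exists (x * val h)%g; first by apply: gpredM => //; apply: valP.
  rewrite -[x]/(val (exist _ x Gx : subgroup_elt G)) -[(_ * _)%g]/(val ((exist _ x Gx : subgroup_elt G) * h)%g).
  by rewrite -!f_act ?lactM //; apply: S1inv.
apply/seteqP; split; last exact: sub Eg.
by apply: (sub _ _ g^-1%g) => //; rewrite -Eg lactK.
Qed.

Lemma inv_stab_sumE : inv_stab_sum G R act S2 = orbit_sum R to S1.
Proof.
rewrite /inv_stab_sum /orbit_sum -/orb.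
rewrite (reindex_esum [set y | S1 y /\ orep to y = y] _ (fun y => orb (f y))).
  apply: eq_esum => y [Sy _]; congr ((_ _)^-1)%:E.
  have [g Gg Eg] : orb (f y) (get (orb (f y))).
    apply: getPex; exists (f y), 1%g; first exact: gpred1.
    by rewrite -[1%g]/(val (1%g : subgroup_elt G)) -f_act // lact1.
  pose h : subgroup_elt G := exist _ g Gg; rewrite -(nstab_act fin h y) /nstab.
  have Ez : get (orb (f y)) = f (to h y) by rewrite f_act.
  have Sh : S1 (to h y) by apply: S1inv.
  have E : [set x | x \in G /\ act x (get (orb (f y))) = get (orb (f y))] = val @` ostab to (to h y).
    apply/seteqP; split=> [x [Gx]|_ [x Ex <-]].
      rewrite Ez -[x]/(val (exist _ x Gx : subgroup_elt G)) -f_act // => /f_inj Ex.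
      by exists (exist _ x Gx : subgroup_elt G) => //; apply: Ex => //; apply: S1inv.
    by split; [apply: valP | rewrite Ez -f_act // Ex].
  rewrite E; apply/eqP; rewrite eqn_leq; apply/andP; split.
    by rewrite -(size_map val (fset_set (ostab to (to h y)))); apply: uniq_leq_size => [|x];
      rewrite ?fset_uniq // in_fset_set ?in_setE; [move=> [x' Ex' <-]; apply: map_f; rewrite in_fset_set ?in_setE | exact: finite_image].
  apply: nfs_le_inj => //; [exact: finite_image | by move=> x Ax; exists x | by move=> x x' _ _; apply: val_inj].
split.
- by move=> y [Sy _]; exists (f y) => //; apply: fS.
- move=> y y' /[!in_setE] -[Sy ry] [Sy' ry'] /(orb_same Sy Sy')/orep_eq.
  by rewrite ry ry'.
move=> _ [z Sz <-]; have [y Sy <-] := f_surj Sz; exists (orep to y).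
  by split; last exact: orep_idem; have [g <-] := orepP to y; apply: S1inv.
apply/orb_same => //; last exact/same_orbit_sym/orepP.
by have [g <-] := orepP to y; apply: S1inv.
Qed.

End InvStabSum.

Section TreeSums.
Variables (R : realType) (T : groupType) (V Bd : choiceType).
Variables (aV : laction T V) (aB : laction T Bd) (par : Bd -> V -> V) (ty : V -> bool).
Implicit Types (u v w : V) (z : Bd) (g h : T).
Hypothesis par_act : forall g z v, aV g (par z v) = par (aB g z) (aV g v).
Hypothesis par_merge : forall z v w, exists n m, iter n (par z) v = iter m (par z) w.
Hypothesis par_adj : forall z z' v, par z' v = par z v \/ par z (par z' v) = v.
Hypothesis par_nocycle : forall z v n, iter n (par z) v = v -> n = 0%N.
Hypothesis ty_act : forall g v, ty (aV g v) = ty v.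
Hypothesis ty_par : forall z v, ty (par z v) = ~~ ty v.
Hypothesis fixed_bd : forall v, exists z, forall g, g <> 1%g -> aV g v = v ->
  forall z', aB g z' = z' <-> z' = z.
Hypothesis ray_unstable : forall z v, exists n g, [/\ g <> 1%g, aB g z = z &
  aV g (iter n (par z) v) = iter n (par z) v].
Hypothesis fin_stab : forall v, finite_set (ostab aV v).
Variable N : nat.
Hypothesis child_collision : forall z w (f : 'I_N.+1 -> V), (forall a, par z (f a) = w) ->
  exists a b, a != b /\ f a = f b.
Hypothesis two_child : forall z w, exists v1 v2, [/\ v1 != v2, par z v1 = w & par z v2 = w].
Hypothesis finite_orbits : forall M, exists l : seq V, forall v,
  ~ card_ge (ostab aV v) M.+1 -> exists2 v', v' \in l & same_orbit aV v v'.
Variable oo : Bd.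

Local Notation stable := (stable aV).
Local Notation aE := (pair_act aV).
Local Notation end_of := (end_of fixed_bd).
Local Notation edge := (edge par oo).

Definition oriented_edges : set (V * V) := [set e | edge e /\ ~~ ty e.1].

Lemma nstab_le M v : (nstab aV v <= M)%N -> ~ card_ge (ostab aV v) M.+1.
Proof. by move=> le /(card_ge_nfs _ (fin_stab v)); rewrite ltnNge le. Qed.

Lemma fin_stab_edge e : finite_set (ostab aE e).
Proof.
by apply: sub_finite_set (fin_stab e.1) => g; rewrite /ostab /= => E; rewrite -{2}E.
Qed.

Lemma fix_end w g : ~ stable w -> aV g w = w -> aB g (end_of w) = end_of w.
Proof.
have [->|g1] := pselect (g = 1%g); first by rewrite !lact1.
by move=> _ gw; apply: (end_ofP fixed_bd g1 gw _).2.
Qed.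

Lemma stab_le_children w v : ~ stable w -> par (end_of w) v = w ->
  (forall g, aV g w = w -> aV g v = v -> g = 1%g) -> ~ card_ge (ostab aV w) N.+1.
Proof.
move=> nw pv triv /card_geP[f [finj fw]].
have [|a [b [nab E]]] := @child_collision (end_of w) w (fun a => aV (f a) v).
  by move=> a; rewrite -{1}(fix_end nw (fw a)) -par_act pv; apply: fw.
move/eqP: nab; apply; apply: finj; apply: (mulgI (f a)^-1%g); rewrite mulVg; symmetry.
apply: triv; rewrite -lactM.
  by rewrite [aV (f b) w](fw b) -{1}(fw a : aV (f a) w = w) lactK.
by rewrite -E lactK.
Qed.

Lemma stable_orbits : exists l0 (r0 : 'I_l0 -> V), [/\ forall i, stable (r0 i),
  forall v, stable v -> exists i g, v = aV g (r0 i) & forall i j, same_orbit aV (r0 i) (r0 j) -> i = j].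
Proof.
have [l Hl] := finite_orbits 1.
apply: (@orbit_reps _ _ aV [set v | stable v] l) => [g v|v sv]; first exact: stable_act.
apply: Hl => -[s [us ss sub]]; case: s us ss sub => [|g1 [|g2 [|]]] //= + _ sub.
have -> := sv _ (sub g1 (mem_head _ _)).
by have -> := sv _ (sub g2 _); rewrite !inE ?eqxx ?orbT.
Qed.

Lemma neighbours v : exists l : seq V, forall u, edge (v, u) -> u \in l.
Proof.
have [l Hl] := @seq_of_collisions V [set u | par oo u = v] N (@child_collision oo v).
by exists (par oo v :: l) => u [] /= E; rewrite inE ?E ?eqxx // Hl ?orbT.
Qed.

Lemma stable_edge_orbits : exists l1 (r1 : 'I_l1 -> V * V), [/\
  forall i, [/\ edge (r1 i), ~~ ty (r1 i).1 & stable_edge aV (r1 i)],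
  forall e, edge e -> ~~ ty e.1 -> stable_edge aV e -> exists i g, e = aE g (r1 i) &
  forall i j, same_orbit aE (r1 i) (r1 j) -> i = j].
Proof.
have [l Hl] := finite_orbits N.+1; have [nb Hnb] := choice neighbours.
have [||l1 [r1 [H1 H2 H3]]] := @orbit_reps _ _ aE
  [set e | [/\ edge e, ~~ ty e.1 & stable_edge aV e]] (flatten [seq [seq (v, u) | u <- nb v] | v <- l]).
- move=> g e [ee te se]; split; last exact: stable_edge_act.
    exact: (edge_act par_act par_adj).
  by rewrite /= ty_act.
- move=> e [ee te se].
  have few : ~ card_ge (ostab aV e.1) N.+2.
    have [s1|n1] := pselect (stable e.1).
      move=> -[s [us ss sub]]; case: s us ss sub => [|g1 [|g2 s]] //= + _ sub.
      have -> := s1 _ (sub g1 (mem_head _ _)).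
      by have -> := s1 _ (sub g2 _); rewrite !inE ?eqxx ?orbT.
    move=> /(card_ge_mono (leqnSn _) (fun (x : T) (hx : ostab aV e.1 x) => hx)); apply: (@stab_le_children _ e.2) => //.
      case: (edgeP par_adj (end_of e.1) ee) => // E; exfalso.
      have [g g1 ge] := unstable_ex n1; apply: g1; apply: se.
      by rewrite /= /pair_fun ge -E par_act (fix_end n1 ge) ge E; case: (e).
    by move=> g g1 g2; apply: se; rewrite /= /pair_fun g1 g2; case: (e).
  have [v' v'l [g Eg]] := Hl _ few; exists (aE g e); last by exists g.
  apply/flattenP; exists [seq (v', u) | u <- nb v']; first exact: (map_f (fun v => [seq (v, u) | u <- nb v])).
  have -> : aE g e = (v', aV g e.2) by rewrite /= /pair_fun Eg.
  apply: map_f; apply: Hnb; have := edge_act par_act par_adj g ee.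
  by rewrite /= /pair_fun Eg.
by exists l1, r1; split=> // e ee te se; apply: H2.
Qed.

Lemma stable_weight v : stable v -> ostab_weight R aV v = 1.
Proof.
move=> sv; rewrite /ostab_weight /nstab (_ : ostab aV v = [set 1%g]); first by rewrite fset_set1 cardfs1 invr1.
by apply/seteqP; split=> g /=; [apply: sv | move=> ->; apply: lact1].
Qed.

Lemma stable_edge_weight e : stable_edge aV e -> ostab_weight R aE e = 1.
Proof.
move=> se; rewrite /ostab_weight /nstab (_ : ostab aE e = [set 1%g]); first by rewrite fset_set1 cardfs1 invr1.
by apply/seteqP; split=> g; [apply: se | move=> ->; apply: lact1].
Qed.

Definition end_edge v : V * V :=
  if ty v then (par (end_of v) v, v) else (v, par (end_of v) v).

Lemma unstable_sums : orbit_sum R aV [set v | ~ stable v] =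
  orbit_sum R aE [set e | oriented_edges e /\ ~ stable_edge aV e].
Proof.
apply: (@orbit_sum_bij R _ _ _ _ _ fin_stab_edge _ _ end_edge).
- by move=> g v nv /(@stable_act _ _ _ g^-1%g _); rewrite lactK.
- move=> g e [[ee te] ne]; split; last by move=> /(@stable_edge_act _ _ _ g^-1%g _); rewrite lactK.
  by split; [apply: (edge_act par_act par_adj) | rewrite /= ty_act].
- move=> v nv; have [g g1 gv] := unstable_ex nv.
  have gp : aV g (par (end_of v) v) = par (end_of v) v by rewrite par_act (fix_end nv gv) gv.
  rewrite /end_edge /oriented_edges /=; case: ifPn => tv; split.
  + split; last by rewrite /= ty_par tv.
    by case: (edge_par par_adj oo (end_of v) v) => E; [right | left].
  + by move=> /(_ g); rewrite /= /pair_fun /= gp gv => /(_ erefl).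
  + by split=> //; apply: (edge_par par_adj).
  + by move=> /(_ g); rewrite /= /pair_fun /= gp gv => /(_ erefl).
- move=> g v nv; rewrite /end_edge ty_act (end_of_act fixed_bd g nv) -par_act.
  by case: ifP.
- have twice v w : ~ stable v -> ~ stable w -> par (end_of v) v = w -> par (end_of w) w = v -> False.
    move=> nv nw Ev Ew; have [g g1 gv] := unstable_ex nv.
    have gw : aV g w = w by rewrite -Ev par_act (fix_end nv gv) gv.
    have E : end_of v = end_of w by apply/(end_ofP fixed_bd g1 gw)/(end_ofP fixed_bd g1 gv).
    by have := @par_nocycle (end_of v) v 2; rewrite /= Ev {1}E Ew => /(_ erefl).
  move=> v w nv nw; rewrite /end_edge; case: ifP => _; case: ifP => _ /pair_equal_spec[E1 E2] //.
    by case: (twice v w).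
  by case: (twice v w).
move=> [a b] [[ee ta] ne].
have [g gE g1] : exists2 g, aE g (a, b) = (a, b) & g <> 1%g.
  by have /existsNP[g /not_implyP[gE g1]] := ne; exists g.
move: gE => /pair_equal_spec[/= ga gb].
have na : ~ stable a by move/(_ g ga). have nb : ~ stable b by move/(_ g gb).
have E : end_of a = end_of b by apply/(end_ofP fixed_bd g1 gb)/(end_ofP fixed_bd g1 ga).
case: (edgeP par_adj (end_of a) ee) => /= Ep.
  by exists a => //; rewrite /end_edge Ep ifN.
by exists b => //; rewrite /end_edge -E Ep; move: ta; rewrite /= -Ep ty_par negbK => ->.
Qed.

Definition good_child z v : Prop := ~ stable v /\ end_of v = z.

Definition deep w : bool := `[< forall v, par (end_of w) v = w -> good_child (end_of w) v >].

Definition small_reps n : set V := [set v | [/\ ~ stable v, orep aV v = v & (nstab aV v <= n)%N]].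

Lemma small_reps_finite n : finite_set (small_reps n).
Proof.
have [l Hl] := finite_orbits n.
apply: (@sub_finite_set _ _ [set` map (orep aV) l]); last exact: finite_seq.
move=> v [_ rv /nstab_le /Hl[v' v'l vv']] /=; rewrite -rv (orep_eq aV v v').2 //.
exact: map_f.
Qed.

Lemma shallow_small w : ~ stable w -> ~~ deep w -> (nstab aV w <= N)%N.
Proof.
move=> nw /asboolP /existsNP[v /not_implyP[pv bad]]; rewrite leqNgt; apply/negP.
move=> /(card_ge_nfs _ (fin_stab w)); apply: (stab_le_children nw pv) => g gw gv.
apply: contrapT => g1; apply: bad; split; first by move/(_ g gv).
by symmetry; apply/(end_ofP fixed_bd g1 gv); apply: fix_end.
Qed.

Definition up v := orep aV (par (end_of v) v).

Lemma nstab_par v : ~ stable v -> (nstab aV v <= nstab aV (par (end_of v) v))%N.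
Proof.
move=> nv; apply: (nfs_le_inj (f := id)) => // g gv.
by rewrite /ostab /= par_act (fix_end nv gv) gv.
Qed.

Lemma up_orep v : ~ stable v -> up (orep aV v) = up v.
Proof.
move=> nv; have [g <-] := orepP aV v; rewrite /up (end_of_act fixed_bd g nv) -par_act.
by apply/orep_eq/same_orbit_sym; exists g.
Qed.

Lemma weight_le1 v : ostab_weight R aV v <= 1.
Proof. by rewrite invf_le1 ?ltr0n ?nstab_gt0 // ler1n nstab_gt0. Qed.

(* The stabilizer of a deep vertex w fixes the end of w, hence permutes its children;
   either two children lie in distinct orbits or the stabilizer is at least twice as
   large as that of a child. *)
Lemma deep_weight n (s : seq V) w : uniq s -> (forall v, v \in s <-> small_reps n v) ->
  w \in s -> deep w -> 2 * ostab_weight R aV w <= \sum_(v <- s | up v == w) ostab_weight R aV v.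
Proof.
move=> us Hs /Hs[nw rw sw] /asboolP dw.
have [v1 [v2 [nv p1 p2]]] := two_child (end_of w) w.
have [n1 e1] := dw v1 p1; have [n2 e2] := dw v2 p2.
have le v : ~ stable v -> end_of v = end_of w -> par (end_of w) v = w -> (nstab aV v <= nstab aV w)%N.
  by move=> nv' ev pv; have := nstab_par nv'; rewrite ev pv.
have ms v : ~ stable v -> end_of v = end_of w -> par (end_of w) v = w -> orep aV v \in s /\ up (orep aV v) = w.
  move=> nv' ev pv; split; last by rewrite up_orep // /up ev pv rw.
  apply/Hs; split; [|exact: orep_idem|].
    by have [g <-] := orepP aV v => /(@stable_act _ _ _ g^-1%g _); rewrite lactK.
  by have [g <-] := orepP aV v; rewrite (nstab_act fin_stab); apply: leq_trans (le v nv' ev pv) sw.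
have [m1 u1] := ms v1 n1 e1 p1; have [m2 u2] := ms v2 n2 e2 p2.
have wt v : ~ stable v -> end_of v = end_of w -> par (end_of w) v = w ->
    ostab_weight R aV w <= ostab_weight R aV (orep aV v).
  move=> nv' ev pv; rewrite (weight_orep R fin_stab) /ostab_weight lef_pV2 ?posrE ?ltr0n ?nstab_gt0 //.
  by rewrite ler_nat; apply: le.
have ge0 v := ostab_weight_ge0 R aV v.
rewrite (big_rem _ m1) /= u1 eqxx.
have [E|nE] := eqVneq (orep aV v1) (orep aV v2).
  have /orep_eq[g gv] := E.
  have gz : aB g (end_of w) = end_of w by rewrite -{1}e1 -(end_of_act fixed_bd g n1) gv e2.
  have gw : aV g w = w by rewrite -{1}p1 par_act gz gv p2.
  have dbl : (2 * nstab aV v1 <= nstab aV w)%N.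
    have sub1 h : aV h v1 = v1 -> aV h w = w.
      by move=> hv; rewrite -{1}p1 par_act -e1 (fix_end n1 hv) hv e1 p1.
    have g_notin h : aV h v1 = v1 -> aV (g * h)%g v1 = v1 -> False.
      by move=> hv; rewrite -lactM hv gv => E'; rewrite E' eqxx in nv.
    pose A := fset_set (ostab aV v1).
    have inA h : h \in A -> aV h v1 = v1 by rewrite in_fset_set // in_setE.
    have -> : (2 * nstab aV v1)%N = size ((A : seq T) ++ [seq (g * h)%g | h <- A]).
      by rewrite size_cat size_map mul2n addnn.
    apply: uniq_leq_size => [|x].
      rewrite cat_uniq fset_uniq map_inj_uniq ?fset_uniq ?andbT /=; last exact: mulgI.
      apply/hasPn => x /mapP[h hA ->]; apply/negP => gh.
      exact: g_notin (inA _ hA) (inA _ gh).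
    rewrite mem_cat => /orP xA; suff xw : aV x w = w by rewrite in_fset_set // in_setE.
    by case: xA => [/inA/sub1 //|/mapP[h /inA/sub1 hA ->]]; rewrite -lactM hA.
  apply: le_trans (_ : ostab_weight R aV (orep aV v1) <= _); last first.
    by rewrite lerDl; apply: sumr_ge0.
  rewrite (weight_orep R fin_stab) /ostab_weight.
  have p0 : (0 : R) < (nstab aV v1)%:R by rewrite ltr0n nstab_gt0.
  have q0 : (0 : R) < (nstab aV w)%:R by rewrite ltr0n nstab_gt0.
  rewrite ler_pdivrMr // mulrC ler_pdivlMr //.
  by rewrite -natrM ler_nat.
have m2' : orep aV v2 \in rem (orep aV v1) s by rewrite mem_rem_uniq // !inE eq_sym nE m2.
rewrite (big_rem _ m2') /= u2 eqxx addrA.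
apply: le_trans (_ : ostab_weight R aV (orep aV v1) + ostab_weight R aV (orep aV v2) <= _).
  by rewrite mulr_natl mulr2n; apply: lerD; apply: wt.
by rewrite lerDl; apply: sumr_ge0.
Qed.

Lemma small_sum_bound n (s : seq V) : uniq s -> (forall v, v \in s <-> small_reps n v) ->
  \sum_(v <- s) ostab_weight R aV v <= 2 * #|` fset_set (small_reps N)|%:R.
Proof.
move=> us Hs; set W := \sum_(v <- s) _; set C := #|` _|%:R.
have shallow : \sum_(v <- s | ~~ deep v) ostab_weight R aV v <= C.
  apply: le_trans (_ : \sum_(v <- s | ~~ deep v) 1 <= _); first by apply: ler_sum => v _; apply: weight_le1.
  rewrite -big_filter big_const_seq count_predT iter_addr_0 /C ler_nat.
  apply: uniq_leq_size; first by rewrite filter_uniq.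
  move=> v; rewrite mem_filter => /andP[dv /Hs[nv rv _]].
  rewrite in_fset_set ?in_setE; last exact: small_reps_finite.
  by split=> //; apply: shallow_small.
have deeps : 2 * \sum_(v <- s | deep v) ostab_weight R aV v <= W.
  rewrite mulr_sumr.
  apply: le_trans (_ : \sum_(w <- s | deep w) \sum_(v <- s | up v == w) ostab_weight R aV v <= _).
    rewrite big_seq_cond [X in _ <= X]big_seq_cond; apply: ler_sum => w /andP[ws dw].
    exact: deep_weight us Hs ws dw.
  rewrite (exchange_big_dep predT) //=; apply: ler_sum => v _.
  rewrite -big_filter big_const_seq count_predT iter_addr_0.
  rewrite -mulr_natl; apply: ler_piMl; first exact: ostab_weight_ge0.
  rewrite (ler_nat _ _ 1).
  rewrite size_filter; apply: leq_trans (_ : count (pred1 (up v)) s <= 1)%N.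
    by apply: sub_count => w /= /andP[_]; rewrite eq_sym.
  by rewrite (count_uniq_mem _ us) leq_b1.
have : W = \sum_(v <- s | deep v) ostab_weight R aV v + \sum_(v <- s | ~~ deep v) ostab_weight R aV v.
  by rewrite /W (bigID deep).
lra.
Qed.

Lemma unstable_sum_bound :
  (orbit_sum R aV [set v | ~ stable v] <= (2 * #|` fset_set (small_reps N)|%:R)%:E)%E.
Proof.
rewrite /orbit_sum; apply: ge_ereal_sup => _ [A [finA subA] <-].
rewrite fsbig_finite // sumEFin lee_fin.
pose n := (\max_(v <- fset_set A) nstab aV v)%N.
have Hs v : v \in (fset_set (small_reps n) : seq V) <-> small_reps n v.
  by rewrite in_fset_set ?in_setE //; exact: small_reps_finite.
apply: le_trans (small_sum_bound (fset_uniq _) Hs).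
rewrite [X in _ <= X](bigID (mem (fset_set A))) /=.
have -> : \sum_(v <- fset_set (small_reps n) | v \in fset_set A) ostab_weight R aV v =
    \sum_(v <- fset_set A) ostab_weight R aV v.
  rewrite -big_filter; apply: perm_big; apply: uniq_perm; rewrite ?filter_uniq ?fset_uniq // => v.
  rewrite mem_filter; apply: andb_idr => vA; apply/Hs.
  have /subA[nv rv] : A v by move: vA; rewrite in_fset_set ?in_setE.
  by split=> //; have := @leq_bigmax_seq V (enum_fset (fset_set A)) predT (nstab aV) v vA isT.
by rewrite lerDl; apply: sumr_ge0 => v _; apply: ostab_weight_ge0.
Qed.

Theorem steinberg_presentation : inhabited V -> exists l0 l1
    (psi : {linear 'rV[gring T]_l1 -> (aug_kernel aB * 'rV[gring T]_l0)%type}) (U : R),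
  [/\ bijective psi, orbit_sum R aV [set: V] = (l0%:R + U)%:E &
      orbit_sum R aE oriented_edges = (l1%:R + U)%:E].
Proof.
move=> inhV; have [l0 [r0 [r0s r0c r0u]]] := stable_orbits.
have [l1 [r1 [r1e r1c r1u]]] := stable_edge_orbits.
exists l0, l1, (edge_map fixed_bd oo r0c r1), (fine (orbit_sum R aV [set v | ~ stable v])).
have U0 : (0 <= orbit_sum R aV [set v | ~ stable v])%E.
  by apply: esum_ge0 => v _; rewrite lee_fin; apply: ostab_weight_ge0.
have EU : orbit_sum R aV [set v | ~ stable v] = (fine (orbit_sum R aV [set v | ~ stable v]))%:E.
  rewrite fineK // ge0_fin_numE //; apply: le_lt_trans unstable_sum_bound _; exact: ltry.
split.
- exact: (edge_map_bij par_act par_merge par_adj par_nocycle ty_act ty_par fixed_bd ray_unstable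
    r0s r0c r0u r1e r1c r1u inhV).
- rewrite (orbit_sumID R aV _ [set v | stable v]) setTI setTI.
  rewrite (orbit_sum_fin R fin_stab _ r0s r0c r0u); last by move=> g v; apply: stable_act.
  rewrite EFinD; congr (_ + _)%E; last exact: EU.
  by congr _%:E; rewrite (eq_bigr (fun=> 1)) => [|i _]; rewrite ?sumr_const ?card_ord // stable_weight.
rewrite (orbit_sumID R aE _ [set e | stable_edge aV e]).
rewrite (orbit_sum_fin R fin_stab_edge (n := l1) (r := r1)) //.
- rewrite EFinD; congr (_ + _)%E.
    congr _%:E; rewrite (eq_bigr (fun=> 1)) => [|i _]; rewrite ?sumr_const ?card_ord //.
    by rewrite stable_edge_weight //; case: (r1e i).
  by rewrite -EU unstable_sums.
- move=> g e [[ee te] se]; split; last exact: stable_edge_act.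
  by split; [apply: (edge_act par_act par_adj) | rewrite /= ty_act].
- by move=> i; have [? ? ?] := r1e i.
- by move=> e [[ee te] se]; apply: r1c.
Qed.

End TreeSums.

Section SteinbergModule.
Variables (F : finFieldType) (p r : nat).
Hypothesis p_prime : prime p.
Hypothesis cardF : #|F| = (p ^ r)%N.
Hypothesis char_neq2 : 2%N \notin [pchar F].
Variables (k : fieldType) (iota : {rmorphism F -> k}).
Hypothesis ffk : is_function_field iota.
Hypothesis constants : algebraically_closed_in iota.
Variables (L : quad_ext k) (P : k -> int) (Q : L -> int) (e : nat).
Hypothesis pP : is_place iota P.
Hypothesis pQ : is_place (in_alg L \o iota) Q.
Hypothesis QP : lies_over e Q P.
Hypothesis Quniq : forall (e' : nat) (Q' : L -> int),
  is_place (in_alg L \o iota) Q' -> lies_over e' Q' P -> Q' = Q.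
Variables (R : realType) (G : groupClosed (SU L)).
Hypothesis Gfi : finite_index_subgroup G
  (arith_group (integral_closure L (regular_outside iota P))).
Hypothesis tors : no_p'_torsion G p.

Let e0 : (0 < e)%N. Proof. by case: QP. Qed.
Let Qc x : Q (qconj x) = Q x. Proof. exact: (Q_conj pP pQ QP Quniq). Qed.
Let B := integral_closure L (regular_outside iota P).
Let V := vert R Q e.
Local Notation T := (subgroup_elt G).
Local Notation nu := (nu_ext R e Q).
Local Notation vact := (vact pQ Qc e0).
Local Notation par := (par pQ e0).
Local Notation aV := (lact_res G (vert_act R pQ Qc e0)).
Local Notation aB := (lact_res G (boundary_act L)).
Local Notation ty := (vtype pQ e0).

Let B1 : B 1 := B_1 iota P L.
Let BB x y : B x -> B y -> B (x - y). Proof. exact: B_sub. Qed.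
Let BM x y : B x -> B y -> B (x * y). Proof. exact: B_mul. Qed.
Let Bc x : B x -> B (qconj x). Proof. exact: B_conj. Qed.
Let Bpos x : B x -> vge Q 1 x -> x = 0.
Proof. exact: (B_pos0 char_neq2 ffk constants pP pQ QP Quniq). Qed.
Let Btr M : card_ge [set x : L | B x /\ qconj x = - x] M.
Proof. exact: (trace0_infinite char_neq2 ffk constants pP QP). Qed.
Let Bfrac (x : L) : exists a : L, [/\ a != 0, qconj a = a, B a & B (a * x)].
Proof.
have [a [a0 Aa Bax]] := fraction_B char_neq2 ffk constants pP QP x.
exists a%:A; split=> //; first by rewrite scaler_eq0 negb_or a0 oner_eq0.
  exact: qconj_alg.
exact: B_regular.
Qed.
Let residue : exists cQ, (1 < cQ)%N /\ forall N, indexp (vge Q N) (vge Q (N + 1)) cQ.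
Proof.
have [cP cP1 indP] := place_Q_gt1 ffk pP.
have [cQ [cQ1 indQ _]] := residue_Q char_neq2 pP pQ QP Quniq cP1 indP.
by exists cQ.
Qed.
Let Bfin N : exists s : seq L, forall x, B x -> vge Q N x -> x \in s.
Proof.
have [cQ [cQ1 indQ]] := residue.
have [s Hs] := B_ge_finite char_neq2 ffk constants pP pQ QP Quniq cQ1 indQ N.
by exists s => x Bx vx; apply: Hs.
Qed.

Lemma vertex_stab_finite (v : V) : finite_set (ostab aV v).
Proof.
have [s Hs] := stab_finite pQ Qc e0 Bfin v.
apply/finite_seqP; exists [seq g <- pmap (insub : SU L -> option T) s | aV g v == v].
apply/seteqP; split=> g /=; rewrite mem_filter.
  move=> gv; apply/andP; split; first exact/eqP.
  by rewrite mem_pmap_sub; apply: Hs => //; apply: (G_arith Gfi); apply: valP.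
by case/andP=> /eqP.
Qed.

Lemma vertex_fixed_end (v : V) : exists z, forall g : T, g <> 1%g -> aV g v = v ->
  forall z', aB g z' = z' <-> z' = z.
Proof.
have pL : p \in [pchar L].
  by apply: (rmorph_pchar (in_alg L \o iota)); apply: (card_finPcharP cardF p_prime).
have [s Hs] := stab_finite pQ Qc e0 Bfin v.
pose s' := [seq g <- s | `[< g \in G /\ vact g v = v >]].
have s'P g : g \in s' <-> g \in G /\ vact g v = v.
  rewrite mem_filter; split=> [/andP[/asboolP]//|[Gg gv]].
  by apply/andP; split; [apply/asboolP | apply: Hs => //; apply: (G_arith Gfi)].
have [||z Hz] := @common_fixed_end _ _ _ pL s'.
- split=> [|g h /s'P[Gg gv] /s'P[Gh hv]|g /s'P[Gg gv]]; apply/s'P; split.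
  + exact: gpred1.
  + exact: (vact1 pQ Qc e0).
  + exact: gpredM.
  + by rewrite -(vactM pQ Qc e0) hv.
  + exact: gpredVr.
  + by rewrite -{1}gv (vactM pQ Qc e0) mulVg (vact1 pQ Qc e0).
- by move=> g n /s'P[Gg _]; apply: tors.
exists z => g g1 gv z'; apply: Hz; first by apply/s'P; split; [apply: valP | apply: gv].
by apply: contra_not_neq g1 => E; apply: val_inj.
Qed.

Lemma end_ray_unstable z (v : V) : exists n (g : T), [/\ g <> 1%g, aB g z = z &
  aV g (iter n (par z) v) = iter n (par z) v].
Proof.
have [n [h [Gh h1 hz hv]]] := par_unstable pQ Qc e0 B1 BB BM Bc Btr Bfrac Gfi z v.
exists n, (exist _ h Gh : T); split=> // E; apply: h1.
by have := congr1 val E.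
Qed.

Lemma vertex_orbits M : exists l : seq V, forall v : V,
  ~ card_ge (ostab aV v) M.+1 -> exists2 v', v' \in l & same_orbit aV v v'.
Proof.
have [cQ [cQ1 indQ]] := residue.
have [l Hl] := finitely_many_orbits R pQ Qc e0 cQ1 indQ B1 BB BM Bc Bpos Bfin Btr
  (B_riemann char_neq2 ffk constants pP pQ QP Quniq cQ1 indQ)
  (B_mod_finite char_neq2 ffk constants pP pQ QP Quniq cQ1 indQ) Gfi M.
exists l => v few; have [|v' v'l [h Gh hv]] := Hl v.
  move=> -[s [us ss Hs]]; apply: few.
  exists (pmap (insub : SU L -> option T) s); split.
  - exact: pmap_sub_uniq.
  - rewrite size_pmap_sub -ss; apply/eqP; rewrite -all_count; apply/allP => g /Hs[].
    by [].
  by move=> g; rewrite mem_pmap_sub => /Hs[].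
by exists v' => //; exists (exist _ h Gh : T).
Qed.

Local Notation edges := (oriented_edges par ty None).

Lemma oriented_neq (ab : V * V) : edges ab -> ab.1 <> ab.2.
Proof.
case: ab => a b [/= [] /= E ta] Eab; move: (vtype_par pQ Qc e0 None a) (vtype_par pQ Qc e0 None b).
  by rewrite E -Eab; case: (ty a).
by rewrite E -Eab; case: (ty a).
Qed.

Definition edge_set (ab : V * V) : set (set (SU L * R)) :=
  xget set0 [set E | [/\ tree_edges nu E, E (vset ab.1) & E (vset ab.2)]].

Lemma edge_setP ab : edges ab -> [/\ tree_edges nu (edge_set ab), edge_set ab (vset ab.1) & edge_set ab (vset ab.2)].
Proof.
case: ab => a b [[] /= Ep _]; apply: (@xgetPex _ set0 [set E | [/\ tree_edges nu E, E (vset a) & E (vset b)]]).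
  by have [E [HE Ea Eb]] := edge_ex pQ Qc e0 None a; exists E; split=> //; rewrite -Ep.
by have [E [HE Ea Eb]] := edge_ex pQ Qc e0 None b; exists E; split=> //; rewrite -Ep.
Qed.

Lemma edge_set_uniq ab E : edges ab -> tree_edges nu E -> E (vset ab.1) -> E (vset ab.2) -> edge_set ab = E.
Proof.
move=> eab HE E1 E2; have [H1 H2 H3] := edge_setP eab.
exact: (edge_uniq pQ Qc e0 H1 HE (oriented_neq eab)).
Qed.

Lemma oriented_act (g : T) ab : edges ab -> edges (pair_act aV g ab).
Proof.
case=> ee te; split; last by rewrite /= /pair_fun /= (vtype_act pQ Qc e0).
by apply: (edge_act (aB := aB)) => // [h z v|z z' v]; [apply: par_equiv | apply: par_adj].
Qed.

Lemma vertex_sumE : vertex_sum nu G = orbit_sum R aV [set: V].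
Proof.
rewrite /vertex_sum; apply: (inv_stab_sumE R vertex_stab_finite (f := fun v : V => vset v)) => //.
- by move=> v _; apply/asboolP; case: v.
- by move=> v v' _ _; apply: val_inj.
by move=> C /asboolP HC; exists (Vert HC).
Qed.

Lemma edge_sumE : edge_sum nu G = orbit_sum R (pair_act aV) edges.
Proof.
rewrite /edge_sum; apply: (inv_stab_sumE R (fin_stab_edge vertex_stab_finite) (f := edge_set)).
- exact: oriented_act.
- by move=> ab /edge_setP[].
- move=> g ab eab; have [H1 H2 H3] := edge_setP eab.
  apply: edge_set_uniq; first exact: oriented_act.
  + exact: (tree_edge_act pQ Qc e0).
  + by exists (vset ab.1).
  + by exists (vset ab.2).
- move=> ab cd eab ecd Eq; have [H1 H2 H3] := edge_setP eab; have [_ H2' H3'] := edge_setP ecd.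
  rewrite -Eq in H2' H3'.
  have [v [w [_ _ tv tw Hvw]]] := edge_verts pQ Qc e0 H1.
  have pin (xy : V * V) : edges xy -> edge_set ab (vset xy.1) -> edge_set ab (vset xy.2) -> xy = (v, w).
    move=> exy /Hvw Ex /Hvw Ey; have nxy := oriented_neq exy; have tx : ~~ ty xy.1 by case: exy.
    case: xy nxy tx Ex Ey {exy} => x y /= nxy tx [Ex|Ex]; last by rewrite Ex tw in tx.
    by case=> Ey; [case: nxy; rewrite Ex Ey | rewrite Ex Ey].
  by rewrite (pin ab) // (pin cd).
move=> E HE; have [v [w [adj [Ev Ew] tv tw _]]] := edge_verts pQ Qc e0 HE.
by exists (v, w); first by []; apply: edge_set_uniq.
Qed.

Lemma steinberg_stably_free : exists l0 l1
    (psi : {linear 'rV[gring T]_l1 -> (Steinberg G * 'rV[gring T]_l0)%type}) (U : R),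
  [/\ bijective psi, vertex_sum nu G = (l0%:R + U)%:E & edge_sum nu G = (l1%:R + U)%:E].
Proof.
have [cQ [cQ1 indQ]] := residue.
rewrite vertex_sumE edge_sumE.
apply: (@steinberg_presentation R T V (boundary L) aV aB par ty _ _ _ _ _ _
  vertex_fixed_end end_ray_unstable vertex_stab_finite (cQ * cQ)%N _ _ vertex_orbits None).
- by move=> g z v; apply: par_equiv.
- exact: (par_merge pQ Qc e0).
- exact: (par_adj pQ Qc e0).
- exact: (par_nocycle Qc).
- by move=> g v; apply: vtype_act.
- exact: (vtype_par pQ Qc e0).
- exact: (children_ub Qc indQ).
- exact: (two_children pQ Qc e0 (H_value char_neq2 pP pQ QP Quniq)).
- by constructor; exact: (pt R pQ e0 1%g 0).
Qed.

End SteinbergModule.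

Theorem theorem2p1
  (F : finFieldType) (p r : nat) (p_prime : prime p)
  (cardF : #|F| = (p ^ r)%N) (char_neq2 : 2%N \notin [pchar F])
  (k : fieldType) (iota : {rmorphism F -> k})
  (function_field_k : is_function_field iota)
  (constants_k : algebraically_closed_in iota)
  (L : quad_ext k)
  (constants_L : algebraically_closed_in (in_alg L \o iota))
  (P : k -> int) (place_P : is_place iota P)
  (Q : L -> int) (place_Q : is_place (in_alg L \o iota) Q)
  (e : nat) (Q_over_P : lies_over e Q P)
  (Q_unique : forall (e' : nat) (Q' : L -> int),
     is_place (in_alg L \o iota) Q' -> lies_over e' Q' P -> Q' = Q)
  (R : realType)
  (G : groupClosed (SU L))
  (G_finite_index : finite_index_subgroup G
     (arith_group (integral_closure L (regular_outside iota P))))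
  (G_torsion : no_p'_torsion G p) :
  (vertex_sum (nu_ext R e Q) G < +oo)%E /\
  (edge_sum (nu_ext R e Q) G < +oo)%E /\
  fg_module (Steinberg G) /\
  projective_module (Steinberg G) /\
  exists (l0 l1 : nat)
    (f : {linear (Steinberg G * 'rV[gring (subgroup_elt G)]_l0)%type
          -> 'rV[gring (subgroup_elt G)]_l1}),
    bijective f /\
    euler_char (nu_ext R e Q) G = l0%:R - l1%:R.
Proof.
have [l0 [l1 [psi [U [psi_bij EV EE]]]]] := steinberg_stably_free p_prime cardF char_neq2
  function_field_k constants_k place_P place_Q Q_over_P Q_unique R G_finite_index G_torsion.
split; first by rewrite EV ltry.
split; first by rewrite EE ltry.
split; first exact: stably_free_fg psi_bij.
split; first exact: stably_free_projective psi_bij.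
have [f fbij] := stably_free_iso psi_bij; exists l0, l1, f; split=> //.
by rewrite /euler_char EV EE /= opprD addrACA subrr addr0.
Qed.
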